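(* Let $\lambda,\mu,g>0$ and let $A,A',R$ be single bosonic modes. Put $$x=\frac{\lambda+\mu}{\lambda+\mu+\lambda\mu},\qquad k=\frac{\mu\sqrt x}{\lambda+\mu},\qquad \nu=\frac{\lambda+\mu}{g^2},\qquad |\Psi_x\rangle_{AR}=\sqrt{1-x}\sum_{n\ge0}x^{n/2}|n\rangle_A\otimes|n\rangle_R .$$ For every quantum channel $\mathcal C$ from $A$ to $A'$, the average fidelity $$F=\int_{\mathbb C}\frac{d^2\alpha}{\pi}\,\lambda e^{-\lambda|\alpha|^2}\,\langle g\alpha|\,\mathcal C(\rho_{\alpha,\mu})\,|g\alpha\rangle$$ for transforming displaced thermal states $\rho_{\alpha,\mu}$ into coherent states $|g\alpha\rangle$ satisfies $$F=\operatorname{Tr}\big[O\,(\mathcal C\otimes\mathcal I_R)(|\Psi_x\rangle\langle\Psi_x|)\big]=\operatorname{Tr}\big[Z\,(\mathcal N_\nu\mathcal C\otimes\mathcal I_R)(|\Psi_x\rangle\langle\Psi_x|)\big],$$ where $O=(\mathcal N_\nu\otimes\mathcal I_R)(Z)$ and $$Z=\int_{\mathbb C}\frac{d^2\gamma}{\pi}\,|gk\gamma\rangle\langle gk\gamma|\otimes|\overline\gamma\rangle\langle\overline\gamma|$$ is an observable on $A'R$.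
   Context: A bosonic mode has Hilbert space $\ell^2(\mathbb N)$ with Fock basis $\{|n\rangle\}_{n\ge0}$ and annihilation operator $a$. For $\alpha\in\mathbb C$ the coherent state is $|\alpha\rangle=e^{-|\alpha|^2/2}\sum_n\alpha^n|n\rangle/\sqrt{n!}$, $D(\delta)=\exp(\delta a^\dagger-\overline\delta a)$ is the displacement operator, and $d^2\alpha$ is Lebesgue measure on $\mathbb C\cong\mathbb R^2$. The displaced thermal state is $\rho_{\alpha,\mu}=\int\frac{d^2\beta}{\pi}\,\mu e^{-\mu|\beta|^2}|\alpha+\beta\rangle\langle\alpha+\beta|$. The Gaussian additive noise channel is $\mathcal N_\nu(\rho)=\int\frac{d^2\delta}{\pi}\,\nu e^{-\nu|\delta|^2}D(\delta)\rho D(\delta)^\dagger$, applied by the same formula to bounded operators. In tensor products on $A'R$ the first factor is $A'$. Operator-valued integrals are in the weak sense. A quantum channel is a completely positive trace-preserving map. *)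

(* Defs.v *)
From HB Require Import structures.
From mathcomp Require Import all_boot all_order all_algebra.
From mathcomp Require Import all_classical all_reals all_analysis.
From mathcomp Require Import complex.

Set Implicit Arguments.
Unset Strict Implicit.
Unset Printing Implicit Defensive.

Import Order.TTheory GRing.Theory Num.Theory.

Local Open Scope classical_set_scope.
Local Open Scope ring_scope.
Local Open Scope complex_scope.

(* |z|^2, as a real number *)
Definition sqmod (R : realType) (z : R[i]) : R :=
  complex.Re z ^+ 2 + complex.Im z ^+ 2.

(* Unconditional sums: meaningful for absolutely summable families. *)
Definition rsum (R : realType) (I : choiceType) (f : I -> R) : R :=
  fine (\esum_(i in [set: I]) ((EFin \o f)^\+ i)
        - \esum_(i in [set: I]) ((EFin \o f)^\- i))%E.

Definition csum (R : realType) (I : choiceType) (f : I -> R[i]) : R[i] :=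
  rsum (fun i => complex.Re (f i)) +i* rsum (fun i => complex.Im (f i)).

(* The integral of f : C -> C for the Lebesgue measure of C = R^2. *)
Definition cintegrable (R : realType) (f : R[i] -> R[i]) : Prop :=
  let mu := ((@lebesgue_measure R) \x (@lebesgue_measure R))%E in
  mu.-integrable [set: R * R]
    (fun p => (complex.Re (f (p.1 +i* p.2)))%:E) /\
  mu.-integrable [set: R * R]
    (fun p => (complex.Im (f (p.1 +i* p.2)))%:E).

Definition cint (R : realType) (f : R[i] -> R[i]) : R[i] :=
  let mu := ((@lebesgue_measure R) \x (@lebesgue_measure R))%E in
  Rintegral mu [set: R * R] (fun p => complex.Re (f (p.1 +i* p.2))) +i*
  Rintegral mu [set: R * R] (fun p => complex.Im (f (p.1 +i* p.2))).

(* The Hilbert space l^2(I) is {phi : I -> C | l2 phi}; the tensor product of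
   l^2(I) and l^2(J) is l^2(I * J). *)
Definition sqnorm (R : realType) (I : choiceType) (phi : I -> R[i]) : \bar R :=
  \esum_(i in [set: I]) (sqmod (phi i))%:E.

Definition l2 (R : realType) (I : choiceType) (phi : I -> R[i]) : Prop :=
  (sqnorm phi < +oo)%E.

(* antilinear in the first argument *)
Definition dot (R : realType) (I : choiceType) (phi psi : I -> R[i]) : R[i] :=
  csum (fun i => conjc (phi i) * psi i).

Definition tensv (R : realType) (I J : choiceType)
    (phi : I -> R[i]) (psi : J -> R[i]) : I * J -> R[i] :=
  fun p => phi p.1 * psi p.2.

(* An operator X on l^2(I) is given by its matrix X i j = <i| X |j>.  The
   matrix determines the operator when X is bounded; the only unbounded
   operators used are a, its adjoint, and their linear combinations. *)
Definition op (R : realType) (I : choiceType) := I -> I -> R[i].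

Definition opid (R : realType) (I : choiceType) : op R I :=
  fun i j => (i == j)%:R.

Definition opmul (R : realType) (I : choiceType) (X Y : op R I) : op R I :=
  fun i k => csum (fun j => X i j * Y j k).

Definition adjoint (R : realType) (I : choiceType) (X : op R I) : op R I :=
  fun i j => conjc (X j i).

Definition apply (R : realType) (I : choiceType) (X : op R I)
    (phi : I -> R[i]) : I -> R[i] :=
  fun i => csum (fun j => X i j * phi j).

Definition expectation (R : realType) (I : choiceType) (X : op R I)
    (phi : I -> R[i]) : R[i] :=
  dot phi (apply X phi).

Definition ketbra (R : realType) (I : choiceType)
    (phi psi : I -> R[i]) : op R I :=
  fun i j => phi i * conjc (psi j).

Definition tenso (R : realType) (I J : choiceType)
    (X : op R I) (Y : op R J) : op R (I * J)%type :=
  fun p q => X p.1 q.1 * Y p.2 q.2.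

Definition tr (R : realType) (I : choiceType) (X : op R I) : R[i] :=
  csum (fun i => X i i).

(* Finitely supported vectors belong to l2, so a bounded matrix has all its
   rows in l^2 and apply X phi is then an absolutely convergent sum. *)
Definition bounded (R : realType) (I : choiceType) (X : op R I) : Prop :=
  exists M : R, forall phi, l2 phi ->
    (sqnorm (apply X phi) <= M%:E * sqnorm phi)%E.

(* The order of R[i] is partial: 0 <= z means that z is real nonnegative. *)
Definition positive (R : realType) (I : choiceType) (X : op R I) : Prop :=
  bounded X /\ forall phi, l2 phi -> 0 <= expectation X phi.

Definition observable (R : realType) (I : choiceType) (X : op R I) : Prop :=
  bounded X /\ adjoint X = X.

Definition positive_trace_class (R : realType) (I : choiceType)
    (X : op R I) : Prop :=
  positive X /\
  (\esum_(i in [set: I]) (complex.Re (X i i))%:E < +oo)%E.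

(* The trace class as the linear span of the positive operators of finite
   trace. *)
Definition trace_class (R : realType) (I : choiceType) (X : op R I) : Prop :=
  exists P : 'I_4 -> op R I,
    (forall k, positive_trace_class (P k)) /\
    X = (fun i j => \sum_(k < 4) (0 +i* 1) ^+ k * P k i j).

(* C (x) Id on l^2(I) (x) l^2(J): C acts on each block
   (1 (x) <r|) X (1 (x) |s>). *)
Definition ampl (R : realType) (I I' J : choiceType) (C : op R I -> op R I')
    (X : op R (I * J)%type) : op R (I' * J)%type :=
  fun p q => C (fun i j => X (i, p.2) (j, q.2)) p.1 q.1.

Definition completely_positive (R : realType) (I I' : choiceType)
    (C : op R I -> op R I') : Prop :=
  forall (n : nat) (X : op R (I * 'I_n)%type),
    positive_trace_class X -> positive (ampl C X).

(* Only the restriction of C to the trace class is constrained. *)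
Definition channel (R : realType) (I I' : choiceType)
    (C : op R I -> op R I') : Prop :=
  [/\ forall X, trace_class X -> trace_class (C X),
      forall (c : R[i]) X Y, trace_class X -> trace_class Y ->
        C (fun i j => c * X i j + Y i j) = (fun i j => c * C X i j + C Y i j),
      forall X, trace_class X -> tr (C X) = tr X &
      completely_positive C].

(* T is the weak integral of w over C for the Lebesgue measure. *)
Definition is_weak_int (R : realType) (I : choiceType)
    (w : R[i] -> op R I) (T : op R I) : Prop :=
  bounded T /\
  forall phi psi, l2 phi -> l2 psi ->
    cintegrable (fun z => dot phi (apply (w z) psi)) /\
    dot phi (apply T psi) = cint (fun z => dot phi (apply (w z) psi)).

Definition weakly_integrable (R : realType) (I : choiceType)
    (w : R[i] -> op R I) : Prop :=
  exists T, is_weak_int w T.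

(* The weak integral if it exists (it is then unique), and 0 otherwise. *)
Definition weak_int (R : realType) (I : choiceType)
    (w : R[i] -> op R I) : op R I :=
  xget (fun _ _ => 0) [set T | is_weak_int w T].

Definition opscale (R : realType) (I : choiceType) (c : R) (X : op R I) :
    op R I :=
  fun i j => c%:C * X i j.

(* density of the centered Gaussian law of precision t w.r.t. d^2z *)
Definition gauss (R : realType) (t : R) (z : R[i]) : R :=
  t * expR (- t * sqmod z) / pi.

Definition coherent (R : realType) (alpha : R[i]) : nat -> R[i] :=
  fun n => (expR (- sqmod alpha / 2) / Num.sqrt n`!%:R)%:C * alpha ^+ n.

(* a |n> = sqrt n |n - 1> *)
Definition annihilation (R : realType) : op R nat :=
  fun m n => if n == m.+1 then (Num.sqrt n%:R)%:C else 0.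

(* The generator maps finite combinations of Fock vectors to such combinations,
   and Fock vectors are analytic for it, so the unitary D(delta) is given on
   them by the exponential series; here its matrix elements. *)
Definition displacement_generator (R : realType) (delta : R[i]) : op R nat :=
  fun m n => delta * adjoint (@annihilation R) m n
             - conjc delta * @annihilation R m n.

Definition displacement (R : realType) (delta : R[i]) : op R nat :=
  fun m n => csum (fun k : nat =>
    (k`!%:R)^-1 *
    iter k (opmul (displacement_generator delta)) (@opid R nat) m n).

Definition displaced_thermal (R : realType) (mu : R) (alpha : R[i]) :
    op R nat :=
  weak_int (fun beta =>
    opscale (gauss mu beta)
      (ketbra (coherent (alpha + beta)) (coherent (alpha + beta)))).

Definition noise (R : realType) (nu : R) (X : op R nat) : op R nat :=
  weak_int (fun delta =>
    opscale (gauss nu delta)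
      (opmul (opmul (displacement delta) X) (adjoint (displacement delta)))).

Definition two_mode_squeezed (R : realType) (x : R) : nat * nat -> R[i] :=
  fun p => (Num.sqrt (1 - x))%:C *
    (if p.1 == p.2 then (x `^ (p.1%:R / 2))%:C else 0).

Definition average_fidelity (R : realType) (lambda mu g : R)
    (C : op R nat -> op R nat) : R[i] :=
  cint (fun alpha => (gauss lambda alpha)%:C *
    expectation (C (displaced_thermal mu alpha)) (coherent (g%:C * alpha))).

(* integrand of Z with respect to d^2gamma *)
Definition Z_integrand (R : realType) (g k : R) (gamma : R[i]) :
    op R (nat * nat)%type :=
  opscale pi^-1
    (tenso (ketbra (coherent ((g * k)%:C * gamma))
                   (coherent ((g * k)%:C * gamma)))
           (ketbra (coherent (conjc gamma)) (coherent (conjc gamma)))).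

(* Main.v *)
Require Import Defs.
From HB Require Import structures.
From mathcomp Require Import all_boot all_order all_algebra.
From mathcomp Require Import all_classical all_reals all_analysis.
From mathcomp Require Import complex.
From mathcomp Require Import ring lra zify.
From mathcomp Require finmap.
From mathcomp Require Import measurable_realfun.

Set Implicit Arguments.
Unset Strict Implicit.
Unset Printing Implicit Defensive.

Import Order.TTheory GRing.Theory Num.Theory.
Import numFieldNormedType.Exports.

Local Open Scope classical_set_scope.
Local Open Scope ring_scope.
Local Open Scope complex_scope.

(** Write f(a, w) = <g a| C(|w><w|) |g a>, with coherent states.  The fidelity F
   integrates f against the joint law of the Gaussian a and of the displaced
   w = a + b.  Since the partial overlap of |Psi_x> with |conj z>_R is a multiple
   of |sqrt x z>, and since D(d)|b> is a phase times |b + d>, each of the two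
   traces integrates f against the law of g a = g k z + d with w = sqrt x z.
   Completing the square shows that the affine map (d, z) -> (a, w) turns one
   density into the other.

   The traces are read off a Cholesky factorization X = sum_l |L_l><L_l| of the
   positive trace class operator X, so that all interchanges of sums and
   integrals concern nonnegative terms.  The channel is evaluated on an infinite
   superposition by truncation: complete positivity gives a Cauchy-Schwarz bound
   on the off-diagonal part, whose size is governed by the tail of the trace.
   The action of D(d) on coherent states is obtained from the exponential series
   by Taylor's formula along t -> exp(t G)|b>. *)

(** A [channel] is linear on the trace class, trace preserving and completely positive, with finite
    ancillas only. Its continuity, its exchange with weak integrals and the measurability of f in w
    are therefore to be proved. Continuity comes from truncation in the Fock basis, and
    measurability by reading f off the single matrix (C (x) Id)(|Psi_x><Psi_x|). The entries of D(d)
    are series that do not show boundedness, so D(d) is rewritten as pi^-1 times the integral of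
    D(d)|b><b| over b, by means of Gaussian moments.

    The constants are those of a Bayesian estimate of the signal a from w = a + b. The law of w has
    precision lambda mu / (lambda + mu) = (1 - x) / x, so z = w / sqrt x has precision 1 - x, the
    Gaussian factor left by the squeezed state. Given w, the signal a has mean mu w / (lambda + mu)
    = k z and precision lambda + mu, which becomes nu after scaling by g: hence the guess g k z in Z
    and the noise of precision nu. *)

Section Modulus.
Variable R : realType.
Implicit Types z w : R[i].

Definition cabs z : R := Num.sqrt (sqmod z).

Lemma sqmod_ge0 z : 0 <= sqmod z.
Proof. by rewrite addr_ge0 ?sqr_ge0. Qed.

Lemma cabs_ge0 z : 0 <= cabs z. Proof. exact: sqrtr_ge0. Qed.

Lemma cabs_sq z : cabs z ^+ 2 = sqmod z.
Proof. by rewrite sqr_sqrtr ?sqmod_ge0. Qed.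

Lemma cabsE z : `|z| = (cabs z)%:C.
Proof. exact: normc_def. Qed.

Lemma cabs0 : cabs (0 : R[i]) = 0.
Proof. by rewrite /cabs /sqmod /= expr0n addr0 sqrtr0. Qed.

Lemma cabsM z w : cabs (z * w) = cabs z * cabs w.
Proof. by apply: complexI; rewrite -cabsE normrM !cabsE -rmorphM. Qed.

Lemma cabsX z n : cabs (z ^+ n) = cabs z ^+ n.
Proof. by apply: complexI; rewrite -cabsE normrX !cabsE -rmorphXn. Qed.

Lemma cabsD z w : cabs (z + w) <= cabs z + cabs w.
Proof. by rewrite -lecR rmorphD /= -!cabsE ler_normD. Qed.

Lemma cabsN z : cabs (- z) = cabs z.
Proof. by apply: complexI; rewrite -!cabsE normrN. Qed.

Lemma cabsB z w : cabs (z - w) <= cabs z + cabs w.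
Proof. by rewrite -(cabsN w) cabsD. Qed.

Lemma cabsC (a : R) : cabs a%:C = `|a|.
Proof. by rewrite /cabs /sqmod /= expr0n addr0 sqrtr_sqr. Qed.

Lemma cabs_eq0 z : cabs z = 0 -> z = 0.
Proof. by move=> h; apply/eqP; rewrite -normr_eq0 cabsE h. Qed.

Lemma cabs_conj z : cabs (conjc z) = cabs z.
Proof. by case: z => a b; rewrite /cabs /sqmod /= sqrrN. Qed.

Lemma sqmod_conj z : sqmod (conjc z) = sqmod z.
Proof. by case: z => a b; rewrite /sqmod /= sqrrN. Qed.

Lemma sqmodM z w : sqmod (z * w) = sqmod z * sqmod w.
Proof. by rewrite -!cabs_sq cabsM exprMn. Qed.

Lemma sqmodC (a : R) : sqmod a%:C = a ^+ 2.
Proof. by rewrite /sqmod /= expr0n addr0. Qed.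

Lemma mulJc z : conjc z * z = (sqmod z)%:C.
Proof. by case: z => a b; rewrite /sqmod; simpc; rewrite /= [b * a]mulrC addrC subrr -!expr2. Qed.

Lemma Re_cabs z : `|complex.Re z| <= cabs z.
Proof. by rewrite -lecR -cabsE; exact: normc_ge_Re. Qed.

Lemma Im_cabs z : `|complex.Im z| <= cabs z.
Proof.
rewrite -(ler_pXn2r (ltn0Sn 1)) ?nnegrE ?cabs_ge0// cabs_sq real_normK ?num_real//.
by rewrite lerDr sqr_ge0.
Qed.

Lemma cabs_ReIm z : cabs z <= `|complex.Re z| + `|complex.Im z|.
Proof.
rewrite -(ler_pXn2r (ltn0Sn 1)) ?nnegrE ?cabs_ge0 ?addr_ge0// cabs_sq /sqmod.
by rewrite sqrrD !real_normK ?num_real// lerD2r lerDl mulrn_wge0// mulr_ge0.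
Qed.

Lemma ReD z w : complex.Re (z + w) = complex.Re z + complex.Re w.
Proof. by case: z; case: w. Qed.
Lemma ImD z w : complex.Im (z + w) = complex.Im z + complex.Im w.
Proof. by case: z; case: w. Qed.
Lemma ReM z w : complex.Re (z * w) =
  complex.Re z * complex.Re w - complex.Im z * complex.Im w.
Proof. by case: z; case: w. Qed.
Lemma ImM z w : complex.Im (z * w) =
  complex.Re z * complex.Im w + complex.Im z * complex.Re w.
Proof. by case: z; case: w. Qed.
Lemma Re_conj z : complex.Re (conjc z) = complex.Re z.
Proof. by case: z. Qed.
Lemma Im_conj z : complex.Im (conjc z) = - complex.Im z.
Proof. by case: z. Qed.

Lemma conjcM z w : conjc (z * w) = conjc z * conjc w.
Proof. exact: rmorphM. Qed.
Lemma conjcD z w : conjc (z + w) = conjc z + conjc w.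
Proof. exact: rmorphD. Qed.

Lemma conjcN z : conjc (- z) = - conjc z.
Proof. exact: rmorphN. Qed.
Lemma ReN z : complex.Re (- z) = - complex.Re z.
Proof. by case: z. Qed.
Lemma ImN z : complex.Im (- z) = - complex.Im z.
Proof. by case: z. Qed.
Lemma conjc_i : conjc 'i%C = - 'i%C :> R[i].
Proof. by simpc. Qed.

Lemma complexP z w : complex.Re z = complex.Re w ->
  complex.Im z = complex.Im w -> z = w.
Proof. by case: z => ? ?; case: w => ? ? /= -> ->. Qed.

End Modulus.

(* [J] stands both for unconditional sums and for Lebesgue integrals; [M] is
   the corresponding notion of measurability. *)
Section Integration.
Variables (R : realType) (T : Type).
Variables (M : (T -> R) -> Prop) (J : (T -> \bar R) -> \bar R).

(** Additivity, scaling and monotonicity are demanded of nonnegative functions only; signed and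
    complex functions are handled through positive and negative parts. *)
Record integration : Prop := Integration {
  int_meas_cst : forall c, M (fun=> c);
  int_meas_add : forall f g, M f -> M g -> M (fun t => f t + g t);
  int_meas_mul : forall f g, M f -> M g -> M (fun t => f t * g t);
  int_meas_max : forall f g, M f -> M g -> M (fun t => Num.max (f t) (g t));
  int_meas_sqrt : forall f, M f -> M (fun t => Num.sqrt (f t));
  int_add : forall f g, M f -> M g -> (forall t, 0 <= f t) ->
    (forall t, 0 <= g t) ->
    J (fun t => (f t + g t)%:E) = (J (fun t => (f t)%:E) + J (fun t => (g t)%:E))%E;
  int_scale : forall c f, M f -> 0 <= c -> (forall t, 0 <= f t) ->
    J (fun t => (c * f t)%:E) = (c%:E * J (fun t => (f t)%:E))%E;
  int_le : forall f g, M f -> M g -> (forall t, 0 <= f t) ->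
    (forall t, f t <= g t) ->
    (J (fun t => (f t)%:E) <= J (fun t => (g t)%:E))%E;
  int_ge0 : forall f, (forall t, 0 <= f t) -> (0 <= J (fun t => (f t)%:E))%E
}.

Hypothesis HJ : integration.

Definition Jr (f : T -> R) : \bar R := J (fun t => (f t)%:E).

(** The shape copies [rsum], so that [csum] is an instance of [cI] by conversion; [Rintegral] agrees
    with it by [integralE]. *)
Definition rI (f : T -> R) : R :=
  fine (J ((EFin \o f)^\+) - J ((EFin \o f)^\-))%E.
Definition cI (f : T -> R[i]) : R[i] :=
  rI (fun t => complex.Re (f t)) +i* rI (fun t => complex.Im (f t)).

Definition rpos (f : T -> R) t := Num.max (f t) 0.
Definition rneg (f : T -> R) t := Num.max (- f t) 0.
Local Notation pos := rpos.
Local Notation neg := rneg.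

Lemma rposE f : (EFin \o f)^\+%E = (fun t => (pos f t)%:E).
Proof. by apply/funext => t; rewrite funeposE /= /rpos -EFin_max. Qed.
Lemma rnegE f : (EFin \o f)^\-%E = (fun t => (neg f t)%:E).
Proof. by apply/funext => t; rewrite funenegE /= /rneg EFin_max. Qed.

Lemma rpos_ge0 f t : 0 <= pos f t. Proof. by rewrite le_max lexx orbT. Qed.
Lemma rneg_ge0 f t : 0 <= neg f t. Proof. by rewrite le_max lexx orbT. Qed.

#[local] Hint Resolve rpos_ge0 rneg_ge0 : core.

Lemma meas_scale c f : M f -> M (fun t => c * f t).
Proof. by move=> mf; apply: (int_meas_mul HJ) => //; exact: (int_meas_cst HJ). Qed.

Lemma meas_opp f : M f -> M (fun t => - f t).
Proof.
move=> mf; rewrite (_ : (fun _ => _) = (fun t => (-1) * f t)).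
  exact: meas_scale.
by apply/funext => t; rewrite mulN1r.
Qed.

Lemma meas_pos f : M f -> M (pos f).
Proof. by move=> mf; apply: (int_meas_max HJ) => //; exact: (int_meas_cst HJ). Qed.
Lemma meas_neg f : M f -> M (neg f).
Proof.
by move=> mf; apply: (int_meas_max HJ); [exact: meas_opp|exact: (int_meas_cst HJ)].
Qed.

Definition rint (f : T -> R) := M f /\ (Jr (fun t => `|f t|)%R < +oo)%E.

Lemma normr_max (x : R) : `|x| = Num.max x 0 + Num.max (- x) 0.
Proof.
case/orP: (le_total 0 x) => x0.
  by rewrite ger0_norm// (max_idPl x0) (max_idPr _) ?addr0// oppr_le0.
by rewrite ler0_norm// (max_idPr x0) (max_idPl _) ?add0r// oppr_ge0.
Qed.

Lemma sub_max (x : R) : x = Num.max x 0 - Num.max (- x) 0.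
Proof.
case/orP: (le_total 0 x) => x0.
  by rewrite (max_idPl x0) (max_idPr _) ?subr0// oppr_le0.
by rewrite (max_idPr x0) (max_idPl _) ?sub0r ?opprK// oppr_ge0.
Qed.

Lemma meas_norm f : M f -> M (fun t => `|f t|).
Proof.
move=> mf; rewrite (_ : (fun _ => _) = (fun t => pos f t + neg f t)).
  by apply: (int_meas_add HJ); [exact: meas_pos|exact: meas_neg].
by apply/funext => t; rewrite normr_max.
Qed.

Lemma Jr_fin f : (forall t, 0 <= f t) -> (Jr f < +oo)%E -> Jr f \is a fin_num.
Proof. by move=> f0 ffin; rewrite ge0_fin_numE//; exact: (int_ge0 HJ). Qed.

Lemma rint_pos f : rint f -> Jr (pos f) \is a fin_num.
Proof.
move=> [mf ffin]; apply: Jr_fin; first exact: rpos_ge0.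
apply: le_lt_trans ffin; apply: (int_le HJ).
- exact: meas_pos.
- exact: meas_norm.
- exact: rpos_ge0.
- by move=> t; rewrite normr_max lerDl rneg_ge0.
Qed.

Lemma rint_neg f : rint f -> Jr (neg f) \is a fin_num.
Proof.
move=> [mf ffin]; apply: Jr_fin; first exact: rneg_ge0.
apply: le_lt_trans ffin; apply: (int_le HJ).
- exact: meas_neg.
- exact: meas_norm.
- exact: rneg_ge0.
- by move=> t; rewrite normr_max lerDr rpos_ge0.
Qed.

Lemma rIE f : rint f -> rI f = fine (Jr (pos f)) - fine (Jr (neg f)).
Proof.
move=> hf; rewrite /rI rposE rnegE fineB//; [exact: rint_pos|exact: rint_neg].
Qed.

(** From f = a - b follows f^+ + b = a + f^-, an identity between nonnegative functions to which
    additivity applies. Hence any such decomposition computes [rI]. *)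
Lemma rIE_sub f a b : M a -> M b -> (forall t, 0 <= a t) ->
  (forall t, 0 <= b t) -> (Jr a < +oo)%E -> (Jr b < +oo)%E ->
  M f -> (forall t, f t = a t - b t) ->
  rint f /\ rI f = fine (Jr a) - fine (Jr b).
Proof.
move=> ma mb a0 b0 fa fb mf fE.
have hf : rint f.
  split=> //; apply: (@le_lt_trans _ _ (Jr (fun t => a t + b t))).
    apply: (int_le HJ) => //; first exact: meas_norm.
      exact: (int_meas_add HJ).
    by move=> t; rewrite fE (le_trans (ler_normB _ _))// !ger0_norm.
  by rewrite /Jr (int_add HJ)// lte_add_pinfty.
split=> //; rewrite rIE//.
have E : (Jr (pos f) + Jr b = Jr a + Jr (neg f))%E.
  rewrite /Jr -!(int_add HJ)//; [|exact: meas_neg|exact: meas_pos].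
  congr (J _); apply/funext => t; congr (_%:E).
  by have := sub_max (f t); rewrite [X in X = _]fE /rpos /rneg; lra.
move: E => /(congr1 fine); rewrite !fineD//; first last.
- exact: Jr_fin.
- exact: rint_pos.
- exact: rint_neg.
- exact: Jr_fin.
by move=> h; apply/eqP; rewrite subr_eq addrAC -h addrK.
Qed.

Lemma rint_add f g : rint f -> rint g -> rint (fun t => f t + g t) /\
  rI (fun t => f t + g t) = rI f + rI g.
Proof.
move=> hf hg; have [mf _] := hf; have [mg _] := hg.
have := @rIE_sub (fun t => f t + g t) (fun t => pos f t + pos g t)
  (fun t => neg f t + neg g t).
have [mpf mpg] := (meas_pos mf, meas_pos mg); have [mnf mng] := (meas_neg mf, meas_neg mg).
case.
- exact: (int_meas_add HJ).
- exact: (int_meas_add HJ).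
- by move=> t; rewrite addr_ge0.
- by move=> t; rewrite addr_ge0.
- by rewrite /Jr (int_add HJ)// -ge0_fin_numE ?fin_numD ?rint_pos// adde_ge0//; exact: (int_ge0 HJ).
- by rewrite /Jr (int_add HJ)// -ge0_fin_numE ?fin_numD ?rint_neg// adde_ge0//; exact: (int_ge0 HJ).
- exact: (int_meas_add HJ).
- by move=> t; rewrite [in LHS](sub_max (f t)) [in LHS](sub_max (g t)) /rpos /rneg opprD addrACA.
move=> hfg ->; split=> //.
have [fp fn] := (rint_pos hf, rint_neg hf).
have [gp gn] := (rint_pos hg, rint_neg hg).
by rewrite !rIE// /Jr !(int_add HJ)// !fineD// opprD addrACA.
Qed.

Lemma rint_scale c f : rint f -> rint (fun t => c * f t) /\
  rI (fun t => c * f t) = c * rI f.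
Proof.
move=> hf; have [mf _] := hf.
have [mpf mnf] := (meas_pos mf, meas_neg mf).
have [fp fn] := (rint_pos hf, rint_neg hf).
have [c0|c0] := leP 0 c.
  have := @rIE_sub (fun t => c * f t) (fun t => c * pos f t) (fun t => c * neg f t).
  case.
  - exact: meas_scale.
  - exact: meas_scale.
  - by move=> t; rewrite mulr_ge0.
  - by move=> t; rewrite mulr_ge0.
  - by rewrite /Jr (int_scale HJ)// -ge0_fin_numE ?fin_numM// mule_ge0//; exact: (int_ge0 HJ).
  - by rewrite /Jr (int_scale HJ)// -ge0_fin_numE ?fin_numM// mule_ge0//; exact: (int_ge0 HJ).
  - exact: meas_scale.
  - by move=> t; rewrite [in LHS](sub_max (f t)) mulrBr.
  move=> h ->; split=> //.
  by rewrite /Jr !(int_scale HJ)// !fineM// rIE// mulrBr.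
have c0' : 0 <= - c by rewrite oppr_ge0 ltW.
have := @rIE_sub (fun t => c * f t) (fun t => - c * neg f t) (fun t => - c * pos f t).
case.
- exact: meas_scale.
- exact: meas_scale.
- by move=> t; rewrite mulr_ge0.
- by move=> t; rewrite mulr_ge0.
- by rewrite /Jr (int_scale HJ)// -ge0_fin_numE ?fin_numM// mule_ge0//; exact: (int_ge0 HJ).
- by rewrite /Jr (int_scale HJ)// -ge0_fin_numE ?fin_numM// mule_ge0//; exact: (int_ge0 HJ).
- exact: meas_scale.
- by move=> t; rewrite [in LHS](sub_max (f t)) mulrBr !mulNr opprK addrC.
move=> h ->; split=> //.
rewrite /Jr !(int_scale HJ)// !fineM// rIE// mulrBr !mulNr opprK addrC //.
Qed.

Lemma rI_ge0 f : (forall t, 0 <= f t) -> J (fun=> 0%E) = 0%E ->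
  rI f = fine (Jr f).
Proof.
move=> f0 J0; rewrite /rI rposE rnegE (_ : (fun t => (neg f t)%:E) = (fun=> 0%E)).
  rewrite J0 sube0; congr (fine (J _)); apply/funext => t.
  by rewrite /rpos (max_idPl (f0 t)).
by apply/funext => t; rewrite /rneg (max_idPr _)// oppr_le0.
Qed.

Lemma rI_norm f : rint f -> `|rI f| <= fine (Jr (fun t => `|f t|)).
Proof.
move=> hf; have [mf ffin] := hf; rewrite rIE//.
have -> : Jr (fun t => `|f t|) = (Jr (pos f) + Jr (neg f))%E.
  rewrite /Jr -(int_add HJ)//; [|exact: meas_pos|exact: meas_neg].
  by congr (J _); apply/funext => t; rewrite normr_max.
have [fp fn] := (rint_pos hf, rint_neg hf).
rewrite fineD//.
rewrite (le_trans (ler_normB _ _))// !ger0_norm//; apply: fine_ge0.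
  exact: (int_ge0 HJ).
exact: (int_ge0 HJ).
Qed.

Definition cmeas (f : T -> R[i]) :=
  M (fun t => complex.Re (f t)) /\ M (fun t => complex.Im (f t)).

Definition Jabs (f : T -> R[i]) : \bar R := Jr (fun t => cabs (f t)).

Definition cint_able (f : T -> R[i]) := cmeas f /\ (Jabs f < +oo)%E.

Lemma cmeas_cst c : cmeas (fun=> c).
Proof. by split; exact: (int_meas_cst HJ). Qed.

Lemma cmeasD f g : cmeas f -> cmeas g -> cmeas (fun t => f t + g t).
Proof.
move=> [f1 f2] [g1 g2]; split.
  by under eq_fun do rewrite ReD; exact: (int_meas_add HJ).
by under eq_fun do rewrite ImD; exact: (int_meas_add HJ).
Qed.

Lemma cmeasM f g : cmeas f -> cmeas g -> cmeas (fun t => f t * g t).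
Proof.
move=> [f1 f2] [g1 g2]; split.
  under eq_fun do rewrite ReM; apply: (int_meas_add HJ).
    exact: (int_meas_mul HJ).
  by apply: meas_opp; exact: (int_meas_mul HJ).
by under eq_fun do rewrite ImM; apply: (int_meas_add HJ); exact: (int_meas_mul HJ).
Qed.

Lemma cmeas_conj f : cmeas f -> cmeas (fun t => conjc (f t)).
Proof.
move=> [f1 f2]; split; first by under eq_fun do rewrite Re_conj.
by under eq_fun do rewrite Im_conj; exact: meas_opp.
Qed.

Lemma meas_sqmod f : cmeas f -> M (fun t => sqmod (f t)).
Proof.
move=> [f1 f2]; rewrite /sqmod; apply: (int_meas_add HJ).
  by under eq_fun do rewrite expr2; exact: (int_meas_mul HJ).
by under eq_fun do rewrite expr2; exact: (int_meas_mul HJ).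
Qed.

Lemma meas_cabs f : cmeas f -> M (fun t => cabs (f t)).
Proof. by move=> mf; apply: (int_meas_sqrt HJ); exact: meas_sqmod. Qed.

Lemma cmeas_real f : M f -> cmeas (fun t => (f t)%:C).
Proof. by split => //=; exact: (int_meas_cst HJ). Qed.

Lemma cint_able_le f g : cmeas f -> M g ->
  (forall t, cabs (f t) <= g t) -> (Jr g < +oo)%E -> cint_able f.
Proof.
move=> mf mg fg gfin; split=> //; apply: le_lt_trans gfin.
by apply: (int_le HJ) => //; [exact: meas_cabs|move=> t; exact: cabs_ge0].
Qed.

Lemma cint_able_Re f : cint_able f -> rint (fun t => complex.Re (f t)).
Proof.
move=> [mf ffin]; split; first exact: mf.1.
apply: le_lt_trans ffin; apply: (int_le HJ) => //.
- by apply: meas_norm; exact: mf.1.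
- exact: meas_cabs.
- by move=> t; exact: Re_cabs.
Qed.

Lemma cint_able_Im f : cint_able f -> rint (fun t => complex.Im (f t)).
Proof.
move=> [mf ffin]; split; first exact: mf.2.
apply: le_lt_trans ffin; apply: (int_le HJ) => //.
- by apply: meas_norm; exact: mf.2.
- exact: meas_cabs.
- by move=> t; exact: Im_cabs.
Qed.

Lemma cint_able_ReIm f : rint (fun t => complex.Re (f t)) ->
  rint (fun t => complex.Im (f t)) -> cint_able f.
Proof.
move=> h1 h2.
apply: (@cint_able_le _ (fun t => `|complex.Re (f t)| + `|complex.Im (f t)|)).
- by split; [exact: h1.1|exact: h2.1].
- by apply: (int_meas_add HJ); apply: meas_norm; [exact: h1.1|exact: h2.1].
- by move=> t; exact: cabs_ReIm.
rewrite /Jr (int_add HJ)//; first exact: lte_add_pinfty h1.2 h2.2.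
  by apply: meas_norm; exact: h1.1.
by apply: meas_norm; exact: h2.1.
Qed.

Lemma cint_ableD f g : cint_able f -> cint_able g ->
  cint_able (fun t => f t + g t).
Proof.
move=> [mf ff] [mg fg]; apply: (@cint_able_le _ (fun t => cabs (f t) + cabs (g t))).
- exact: cmeasD.
- by apply: (int_meas_add HJ); exact: meas_cabs.
- by move=> t; exact: cabsD.
rewrite /Jr (int_add HJ) ?lte_add_pinfty//; try exact: meas_cabs.
  by move=> t; exact: cabs_ge0.
by move=> t; exact: cabs_ge0.
Qed.

Lemma cint_ableZ c f : cint_able f -> cint_able (fun t => c * f t).
Proof.
move=> [mf ff]; split; first by apply: cmeasM => //; exact: cmeas_cst.
rewrite /Jabs /Jr; under eq_fun do rewrite cabsM.
rewrite (int_scale HJ) ?cabs_ge0//; last 2 first.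
- exact: meas_cabs.
- by move=> t; exact: cabs_ge0.
by rewrite lte_mul_pinfty// lee_fin cabs_ge0.
Qed.

Lemma cID f g : cint_able f -> cint_able g ->
  cI (fun t => f t + g t) = cI f + cI g.
Proof.
move=> hf hg; rewrite /cI; apply: complexP => /=.
  rewrite [LHS](_ : _ = rI (fun t => complex.Re (f t) + complex.Re (g t))).
    by rewrite (rint_add (cint_able_Re hf) (cint_able_Re hg)).2.
  by congr rI; apply/funext => t; rewrite ReD.
rewrite [LHS](_ : _ = rI (fun t => complex.Im (f t) + complex.Im (g t))).
  by rewrite (rint_add (cint_able_Im hf) (cint_able_Im hg)).2.
by congr rI; apply/funext => t; rewrite ImD.
Qed.

Lemma cIZ c f : cint_able f -> cI (fun t => c * f t) = c * cI f.
Proof.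
move=> hf; have [hr hi] := (cint_able_Re hf, cint_able_Im hf).
rewrite /cI; apply: complexP; rewrite ?ReM ?ImM /=.
  rewrite [LHS](_ : _ = rI (fun t => complex.Re c * complex.Re (f t) +
      (- complex.Im c) * complex.Im (f t))); last first.
    by congr rI; apply/funext => t; rewrite ReM mulNr.
  have [h1 e1] := rint_scale (complex.Re c) hr.
  have [h2 e2] := rint_scale (- complex.Im c) hi.
  by rewrite (rint_add h1 h2).2 e1 e2 mulNr.
rewrite [LHS](_ : _ = rI (fun t => complex.Re c * complex.Im (f t) +
    complex.Im c * complex.Re (f t))); last first.
  by congr rI; apply/funext => t; rewrite ImM.
have [h1 e1] := rint_scale (complex.Re c) hi.
have [h2 e2] := rint_scale (complex.Im c) hr.
by rewrite (rint_add h1 h2).2 e1 e2.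
Qed.

Lemma cI_conj f : cint_able f -> cI (fun t => conjc (f t)) = conjc (cI f).
Proof.
move=> hf; rewrite /cI; apply: complexP => /=.
  by congr rI; apply/funext => t; rewrite Re_conj.
rewrite -mulN1r -(rint_scale (-1) (cint_able_Im hf)).2.
by congr rI; apply/funext => t; rewrite Im_conj mulN1r.
Qed.

Lemma cI_real f : (forall t, 0 <= f t) -> J (fun=> 0%E) = 0%E ->
  cI (fun t => (f t)%:C) = (fine (Jr f))%:C.
Proof.
move=> f0 J0; rewrite /cI /= rI_ge0//; congr (_ +i* _).
by rewrite rI_ge0// /Jr J0.
Qed.

(* Rotating [cI f] onto the real axis reduces the bound to the real case. *)
Lemma cI_norm f : cint_able f -> cabs (cI f) <= fine (Jabs f).
Proof.
move=> hf; have [->|z0] := eqVneq (cI f) 0.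
  by rewrite cabs0 fine_ge0//; apply: (int_ge0 HJ) => t; exact: cabs_ge0.
set z := cI f; have az : 0 < cabs z.
  by rewrite lt_neqAle cabs_ge0 andbT eq_sym; apply: contra z0 => /eqP/cabs_eq0 /eqP.
pose u := (cabs z)^-1%:C * conjc z.
have uz : u * z = (cabs z)%:C.
  by rewrite /u -mulrA mulJc -rmorphM /= -cabs_sq expr2 mulrA mulVf ?mul1r// gt_eqF.
have u1 : cabs u = 1.
  by rewrite cabsM cabs_conj cabsC ger0_norm ?invr_ge0 ?cabs_ge0// mulVf ?gt_eqF.
have hu := cint_ableZ u hf.
have : cabs z = rI (fun t => complex.Re (u * f t)).
  by have := cIZ u hf; rewrite -/z uz /cI => -[].
move=> ->; rewrite (le_trans (ler_norm _))// (le_trans (rI_norm (cint_able_Re hu)))//.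
apply: fine_le.
- exact: Jr_fin (cint_able_Re hu).2.
- by apply: Jr_fin hf.2 => t; exact: cabs_ge0.
apply: (int_le HJ) => //.
- by apply: meas_norm; exact: (cint_able_Re hu).1.
- exact: meas_cabs hf.1.
- by move=> t; rewrite (le_trans (Re_cabs _))// cabsM u1 mul1r.
Qed.

Lemma cI0 : J (fun=> 0%E) = 0%E -> cI (fun=> 0) = 0.
Proof. by move=> J0; rewrite (@cI_real (fun=> 0))// /Jr J0. Qed.

Lemma cint_able0 : J (fun=> 0%E) = 0%E -> cint_able (fun=> 0).
Proof.
move=> J0; split; first exact: cmeas_cst.
by rewrite /Jabs /Jr; under eq_fun do rewrite cabs0; rewrite J0.
Qed.

Lemma cint_able_sum (I : Type) (s : seq I) (f : I -> T -> R[i]) :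
  J (fun=> 0%E) = 0%E -> (forall i, cint_able (f i)) ->
  cint_able (fun t => \sum_(i <- s) f i t) /\
  cI (fun t => \sum_(i <- s) f i t) = \sum_(i <- s) cI (f i).
Proof.
move=> J0 hf; elim: s => [|i s [h1 h2]].
  under eq_fun do rewrite big_nil; rewrite big_nil.
  by split; [exact: cint_able0|exact: cI0].
under eq_fun do rewrite big_cons; rewrite big_cons.
by split; [exact: cint_ableD|rewrite cID// h2].
Qed.

Definition N2 (f : T -> R[i]) : \bar R := Jr (fun t => sqmod (f t)).

Lemma N2_ge0 f : (0 <= N2 f)%E.
Proof. by apply: (int_ge0 HJ) => t; exact: sqmod_ge0. Qed.

(* 2 |f g| <= s |f|^2 + |g|^2 / s, with s chosen to balance both terms. *)
Lemma cauchy_schwarz f g : cmeas f -> cmeas g ->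
  (N2 f < +oo)%E -> (N2 g < +oo)%E ->
  (Jr (fun t => cabs (f t) * cabs (g t))%R <=
    (Num.sqrt (fine (N2 f)) * Num.sqrt (fine (N2 g)))%:E)%E.
Proof.
move=> mf mg ff fg.
have [a0 b0] := (N2_ge0 f, N2_ge0 g).
have [Ef Eg] : (fine (N2 f))%:E = N2 f /\ (fine (N2 g))%:E = N2 g.
  by rewrite !fineK ?ge0_fin_numE.
have [Mf Mg] := (meas_cabs mf, meas_cabs mg).
have bnd s : 0 < s -> (Jr (fun t => cabs (f t) * cabs (g t))%R <=
    (s / 2 * fine (N2 f) + (2 * s)^-1 * fine (N2 g))%:E)%E.
  move=> s0; rewrite EFinD !EFinM Ef Eg /N2 /Jr -!(int_scale HJ); first last.
  - by move=> t; exact: sqmod_ge0.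
  - by rewrite divr_ge0 ?ltW.
  - exact: meas_sqmod.
  - by move=> t; exact: sqmod_ge0.
  - by rewrite invr_ge0 mulr_ge0 ?ltW.
  - exact: meas_sqmod.
  rewrite -(int_add HJ); first last.
  - by move=> t; rewrite mulr_ge0 ?sqmod_ge0// invr_ge0 mulr_ge0 ?ltW.
  - by move=> t; rewrite mulr_ge0 ?sqmod_ge0// divr_ge0 ?ltW.
  - by apply: meas_scale; exact: meas_sqmod.
  - by apply: meas_scale; exact: meas_sqmod.
  apply: (int_le HJ).
  - exact: (int_meas_mul HJ).
  - by apply: (int_meas_add HJ); apply: meas_scale; exact: meas_sqmod.
  - by move=> t; rewrite mulr_ge0 ?cabs_ge0.
  move=> t; rewrite -!cabs_sq; set x := cabs (f t); set y := cabs (g t).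
  rewrite -subr_ge0 (_ : _ - _ = (s * x - y) ^+ 2 / (2 * s)).
    by rewrite divr_ge0 ?sqr_ge0 ?mulr_ge0 ?ltW.
  by field; rewrite gt_eqF.
have [A0 B0] : 0 <= fine (N2 f) /\ 0 <= fine (N2 g) by rewrite !fine_ge0.
set a := fine (N2 f) in bnd A0 *; set b := fine (N2 g) in bnd B0 *.
have fin : Jr (fun t => cabs (f t) * cabs (g t)) \is a fin_num.
  apply: Jr_fin; first by move=> t; rewrite mulr_ge0 ?cabs_ge0.
  by apply: le_lt_trans (bnd 1 ltr01) _; rewrite ltry.
rewrite -(fineK fin) lee_fin.
have {}bnd s : 0 < s -> fine (Jr (fun t => cabs (f t) * cabs (g t))) <=
    s / 2 * a + (2 * s)^-1 * b by move=> s0; rewrite -lee_fin fineK// bnd.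
set c := fine _ in bnd *.
apply/ler_addgt0Pr => e e0.
pose u := Num.sqrt a; pose v := Num.sqrt b.
have [u0 v0] : 0 <= u /\ 0 <= v by rewrite !sqrtr_ge0.
have [ua vb] : a = u ^+ 2 /\ b = v ^+ 2 by rewrite !sqr_sqrtr.
rewrite -/u -/v.
(* The optimal s is v / u, which degenerates when u or v vanishes. It is replaced by (v + d) / (u +
   d), at an extra cost d (u + v) / 2 that this d keeps below e. *)
pose d := Num.min 1 (e / (u + v + 1)).
have uv0 : 0 < u + v + 1 by rewrite ltr_wpDl// addr_ge0.
have d0 : 0 < d by rewrite lt_min ltr01 divr_gt0.
have ud : 0 < u + d by rewrite ltr_wpDl.
have vd : 0 < v + d by rewrite ltr_wpDl.
have := bnd ((v + d) / (u + d)) (divr_gt0 vd ud).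
move=> /le_trans; apply.
rewrite ua vb.
have h1 : u ^+ 2 / (u + d) <= u.
  by rewrite ler_pdivrMr// expr2 ler_wpM2l// lerDl ltW.
have h2 : v ^+ 2 / (v + d) <= v.
  by rewrite ler_pdivrMr// expr2 ler_wpM2l// lerDl ltW.
have -> : (v + d) / (u + d) / 2 * u ^+ 2 + (2 * ((v + d) / (u + d)))^-1 * v ^+ 2 =
   (u ^+ 2 / (u + d) * (v + d) + v ^+ 2 / (v + d) * (u + d)) / 2.
  by field; rewrite !gt_eqF.
apply: (@le_trans _ _ ((u * (v + d) + v * (u + d)) / 2)).
  by rewrite ler_pM2r ?invr_gt0// lerD// ler_wpM2r// ltW.
have de : d * (u + v + 1) <= e.
  by rewrite -ler_pdivlMr// ge_min lexx orbT.
have : d * (u + v) <= e.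
  by apply: le_trans de; rewrite ler_wpM2l ?(ltW d0)// lerDl.
have := mulr_ge0 (ltW d0) (addr_ge0 u0 v0).
lra.
Qed.

Lemma cint_able_mul f g : cmeas f -> cmeas g ->
  (N2 f < +oo)%E -> (N2 g < +oo)%E -> cint_able (fun t => f t * g t).
Proof.
move=> mf mg ff fg; split; first exact: cmeasM.
rewrite /Jabs; under eq_fun do rewrite cabsM.
by apply: le_lt_trans (cauchy_schwarz mf mg ff fg) _; rewrite ltry.
Qed.

Lemma cI_mul_le f g : cmeas f -> cmeas g ->
  (N2 f < +oo)%E -> (N2 g < +oo)%E ->
  cabs (cI (fun t => f t * g t)) <=
    Num.sqrt (fine (N2 f)) * Num.sqrt (fine (N2 g)).
Proof.
move=> mf mg ff fg; have h := cint_able_mul mf mg ff fg.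
apply: le_trans (cI_norm h) _; rewrite -lee_fin fineK; last first.
  by apply: Jr_fin h.2 => t; exact: cabs_ge0.
rewrite /Jabs; under eq_fun do rewrite cabsM.
exact: cauchy_schwarz.
Qed.

Lemma N2D f g : cmeas f -> cmeas g ->
  (N2 f < +oo)%E -> (N2 g < +oo)%E -> (N2 (fun t => f t + g t)%R < +oo)%E.
Proof.
move=> mf mg ff fg.
apply: (@le_lt_trans _ _ (Jr (fun t => 2 * sqmod (f t) + 2 * sqmod (g t)))).
  apply: (int_le HJ).
  - by apply: meas_sqmod; exact: cmeasD.
  - by apply: (int_meas_add HJ); apply: meas_scale; exact: meas_sqmod.
  - by move=> t; exact: sqmod_ge0.
  - move=> t; rewrite /sqmod ReD ImD -subr_ge0.
    rewrite (_ : _ - _ = (complex.Re (f t) - complex.Re (g t)) ^+ 2 +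
      (complex.Im (f t) - complex.Im (g t)) ^+ 2); last by ring.
    by rewrite addr_ge0 ?sqr_ge0.
rewrite /Jr (int_add HJ).
- by rewrite !(int_scale HJ) ?lte_add_pinfty ?lte_mul_pinfty//;
    try exact: meas_sqmod; move=> t; exact: sqmod_ge0.
- by apply: meas_scale; exact: meas_sqmod.
- by apply: meas_scale; exact: meas_sqmod.
- by move=> t; rewrite mulr_ge0 ?sqmod_ge0.
- by move=> t; rewrite mulr_ge0 ?sqmod_ge0.
Qed.

Lemma N2Z c f : cmeas f -> N2 (fun t => c * f t) = ((sqmod c)%:E * N2 f)%E.
Proof.
move=> mf; rewrite /N2 /Jr; under eq_fun do rewrite sqmodM.
rewrite (int_scale HJ) ?sqmod_ge0//; first exact: meas_sqmod.
by move=> t; exact: sqmod_ge0.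
Qed.

End Integration.

(** * Square summable families and bounded operators *)

Section EsumSeq.
Variables (R : realType) (I : choiceType).
Implicit Types (f g : I -> R) (s : seq I).

Lemma esum_seq_le f s : uniq s -> (forall i, 0 <= f i) ->
  ((\sum_(i <- s) f i)%:E <= \esum_(i in [set: I]) (f i)%:E)%E.
Proof.
move=> us f0; apply: esum_ge; exists [set` s]; first by split.
by rewrite -sumEFin fsbig_seq.
Qed.

Lemma esum_le_seq f (M : \bar R) :
  (forall s, uniq s -> ((\sum_(i <- s) f i)%:E <= M)%E) ->
  (\esum_(i in [set: I]) (f i)%:E <= M)%E.
Proof.
move=> h; apply: ge_ereal_sup => _ [A [Afin _] <-].
rewrite fsbig_finite// sumEFin; apply: h; exact: finmap.fset_uniq.
Qed.

Lemma esum_gt_seq f (e : R) : 0 < e -> (forall i, 0 <= f i) ->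
  (\esum_(i in [set: I]) (f i)%:E < +oo)%E ->
  exists2 s, uniq s &
    fine (\esum_(i in [set: I]) (f i)%:E) - e < \sum_(i <- s) f i.
Proof.
move=> e0 f0 ffin.
have ff : \esum_(i in [set: I]) (f i)%:E \is a fin_num.
  by rewrite ge0_fin_numE//; apply: esum_ge0 => i _; rewrite lee_fin.
have [_ [A [Afin _] <-]] := ub_ereal_sup_adherent e0 ff.
rewrite -/(esum _ _) fsbig_finite// sumEFin -[X in (X - _)%E]fineK//.
by rewrite -EFinB lte_fin => h; exists (finmap.enum_fset (fset_set A)) => //; exact: finmap.fset_uniq.
Qed.

(** Finite partial sums give one inequality; the same inequality for c^-1 gives the other. *)
Lemma esum_scale c f : 0 <= c -> (forall i, 0 <= f i) ->
  \esum_(i in [set: I]) (c * f i)%:E = (c%:E * \esum_(i in [set: I]) (f i)%:E)%E.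
Proof.
have le1 c' g : 0 <= c' -> (forall i, 0 <= g i) ->
   (\esum_(i in [set: I]) (c' * g i)%:E <= c'%:E * \esum_(i in [set: I]) (g i)%:E)%E.
  move=> c0 g0; apply: esum_le_seq => s us; rewrite -mulr_sumr EFinM.
  by rewrite lee_wpmul2l ?lee_fin// esum_seq_le.
move=> c0 f0; apply/eqP; rewrite eq_le le1//=.
have [->|cn0] := eqVneq c 0.
  by rewrite mul0e esum_ge0// => i _; rewrite lee_fin mulr_ge0.
have cp : 0 < c by rewrite lt_neqAle eq_sym cn0.
rewrite -lee_pdivlMl//; apply: le_trans (le1 c^-1 (fun i => c * f i) _ _).
- by apply: le_esum => i _; rewrite mulrA mulVf// mul1r.
- by rewrite invr_ge0.
- by move=> i; rewrite mulr_ge0.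
Qed.

Definition Jsum (f : I -> \bar R) : \bar R := \esum_(i in [set: I]) f i.

Lemma esum_integration : integration (fun=> True) Jsum.
Proof.
split=> //; rewrite /Jsum.
- by move=> f g _ _ f0 g0; under eq_esum do rewrite EFinD; rewrite esumD// => i _;
    rewrite lee_fin.
- by move=> c f _ c0 f0; rewrite esum_scale.
- by move=> f g _ _ f0 fg; apply: le_esum => i _; rewrite lee_fin.
- by move=> f f0; apply: esum_ge0 => i _; rewrite lee_fin.
Qed.

Lemma Jsum0 : Jsum (fun=> 0%E) = 0%E.
Proof. by rewrite /Jsum esum1. Qed.

End EsumSeq.

(** * Absolutely summable complex families *)

Section Csum.
Variables (R : realType) (I : choiceType).
Implicit Types (f g : I -> R[i]) (s : seq I).

Let HS := esum_integration R I.

Definition asum f : \bar R := \esum_(i in [set: I]) (cabs (f i))%:E.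
Definition csummable f : Prop := (asum f < +oo)%E.

Lemma csumE f : csum f = cI (@Jsum R I) f. Proof. by []. Qed.

Lemma cmeasT f : cmeas (fun=> True) f. Proof. by []. Qed.

Lemma csummableP f : csummable f <-> cint_able (fun=> True) (@Jsum R I) f.
Proof. by split=> [h|[]//]; split. Qed.

Lemma asum_ge0 f : (0 <= asum f)%E.
Proof. by apply: esum_ge0 => i _; rewrite lee_fin cabs_ge0. Qed.

Lemma asum_fineK f : csummable f -> ((fine (asum f))%:E = asum f)%E.
Proof. by move=> h; rewrite fineK// ge0_fin_numE// asum_ge0. Qed.

Lemma csummable_le f (g : I -> R) : (forall i, cabs (f i) <= g i) ->
  (\esum_(i in [set: I]) (g i)%:E < +oo)%E -> csummable f.
Proof. by move=> fg; apply: le_lt_trans; apply: le_esum => i _; rewrite lee_fin. Qed.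

Lemma csummableD f g : csummable f -> csummable g ->
  csummable (fun i => f i + g i).
Proof.
by move=> /csummableP hf /csummableP hg; apply/csummableP; exact: (cint_ableD HS).
Qed.

Lemma csummableZ c f : csummable f -> csummable (fun i => c * f i).
Proof. by move=> /csummableP hf; apply/csummableP; exact: (cint_ableZ HS). Qed.

Lemma csumD f g : csummable f -> csummable g ->
  csum (fun i => f i + g i) = csum f + csum g.
Proof. by move=> /csummableP hf /csummableP hg; exact: (cID HS). Qed.

Lemma csumZ c f : csummable f -> csum (fun i => c * f i) = c * csum f.
Proof. by move=> /csummableP hf; exact: (cIZ HS). Qed.

Lemma csum_conj f : csummable f -> csum (fun i => conjc (f i)) = conjc (csum f).
Proof. by move=> /csummableP hf; exact: (cI_conj HS). Qed.

Lemma csum_norm f : csummable f -> cabs (csum f) <= fine (asum f).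
Proof. by move=> /csummableP hf; exact: (cI_norm HS). Qed.

Lemma csum_real (f : I -> R) : (forall i, 0 <= f i) ->
  csum (fun i => (f i)%:C) = (fine (\esum_(i in [set: I]) (f i)%:E))%:C.
Proof. by move=> f0; rewrite csumE (cI_real f0)//; exact: Jsum0. Qed.

Lemma csum0 : csum (fun _ : I => 0 : R[i]) = 0 :> R[i].
Proof. by rewrite csumE cI0//; exact: Jsum0. Qed.

Lemma csummable_sum (K : Type) (s : seq K) (f : K -> I -> R[i]) :
  (forall k, csummable (f k)) ->
  csummable (fun i => \sum_(k <- s) f k i) /\
  csum (fun i => \sum_(k <- s) f k i) = \sum_(k <- s) csum (f k).
Proof.
move=> hf; have hf' k : cint_able (fun=> True) (@Jsum R I) (f k).
  exact/csummableP.
by have [/csummableP h1 h2] := cint_able_sum HS s (Jsum0 R I) hf'.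
Qed.

Lemma esum_single (a : R) j : 0 <= a ->
  \esum_(i in [set: I]) (if i == j then a else 0)%:E = a%:E.
Proof.
move=> a0; rewrite -[RHS](@esum_set1 R I j (fun=> a%:E)) ?lee_fin//.
rewrite [RHS]esum_mkcond; apply: eq_esum => i _.
have [->|ij] := eqVneq i j; first by rewrite mem_set.
by rewrite memNset// => /= E; rewrite E eqxx in ij.
Qed.

Lemma csum_single (a : R[i]) j :
  csummable (fun i => if i == j then a else 0) /\
  csum (fun i => if i == j then a else 0) = a.
Proof.
have h1 (b : R) : 0 <= b -> csummable (fun i => if i == j then b%:C else 0) /\
    csum (fun i => if i == j then b%:C else 0) = b%:C.
  move=> b0; split.
    apply: (@csummable_le _ (fun i => if i == j then b else 0)).
      by move=> i; case: eqP => _; rewrite ?cabs0// cabsC ger0_norm.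
    by rewrite esum_single ?ltry.
  have -> : (fun i => if i == j then b%:C else 0) =
      (fun i => (if i == j then b else 0)%:C).
    by apply/funext => i; case: eqP.
  by rewrite csum_real ?esum_single// => i; case: eqP.
have h2 (b : R) : csummable (fun i => if i == j then b%:C else 0) /\
    csum (fun i => if i == j then b%:C else 0) = b%:C.
  have [|b0] := leP 0 b; first exact: h1.
  have -> : (fun i => if i == j then b%:C else 0) =
      (fun i => -1 * (if i == j then (- b)%:C else 0)).
    apply/funext => i; case: eqP => _; last by rewrite mulr0.
    by rewrite rmorphN mulN1r opprK.
  have [|h3 h4] := h1 (- b); first by rewrite oppr_ge0 ltW.
  split; first exact: csummableZ.
  by rewrite csumZ// h4 rmorphN mulN1r opprK.
have -> : (fun i => if i == j then a else 0) = (fun i =>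
   (if i == j then (complex.Re a)%:C else 0) +
   'i%C * (if i == j then (complex.Im a)%:C else 0)).
  by apply/funext => i; case: eqP => _; rewrite ?mulr0 ?addr0// -complexE.
have [a1 a2] := h2 (complex.Re a); have [b1 b2] := h2 (complex.Im a).
split; first by apply: csummableD => //; exact: csummableZ.
rewrite csumD//; last exact: csummableZ.
by rewrite csumZ// a2 b2 -complexE.
Qed.

Lemma csum_finite f s : uniq s -> (forall i, i \notin s -> f i = 0) ->
  csummable f /\ csum f = \sum_(i <- s) f i.
Proof.
move=> us fs.
have -> : f = (fun i => \sum_(j <- s) (if i == j then f j else 0)).
  apply/funext => i; have [si|/[dup] nsi /fs ->] := boolP (i \in s).
    rewrite (bigD1_seq i)//= eqxx big1 ?addr0// => j ji.
    by rewrite eq_sym (negbTE ji).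
  rewrite big_seq big1// => j js; case: eqP => // ij.
  by move: nsi; rewrite ij js.
have h j : csummable (fun i => if i == j then f j else 0) by have [] := csum_single (f j) j.
have [h1 ->] := csummable_sum s h; split=> //.
rewrite big_seq [RHS]big_seq; apply: eq_bigr => j js.
rewrite (csum_single (f j) j).2 (bigD1_seq j)//= eqxx big1 ?addr0// => k kj.
by rewrite eq_sym (negbTE kj).
Qed.

Lemma csum_single_support f j : (forall i, i != j -> f i = 0) -> csum f = f j.
Proof.
move=> fj; have [|_ ->] := @csum_finite f [:: j] isT; last by rewrite big_seq1.
by move=> i; rewrite inE => /fj.
Qed.

End Csum.

(** * Double sums and their interchange *)

Section CsumPair.
Variables (R : realType) (I J : choiceType).

Lemma esum_pair (f : I * J -> R) : (forall p, 0 <= f p) ->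
  \esum_(p in [set: I * J]) (f p)%:E =
  \esum_(i in [set: I]) \esum_(j in [set: J]) (f (i, j))%:E.
Proof.
move=> f0; rewrite esum_esum; last by move=> i j _ _; rewrite lee_fin.
have -> : [set: I] `*`` (fun=> [set: J]) = setT by apply/seteqP; split.
by apply: eq_esum => -[].
Qed.

Lemma esum_swap (f : I * J -> R) : (forall p, 0 <= f p) ->
  \esum_(i in [set: I]) \esum_(j in [set: J]) (f (i, j))%:E =
  \esum_(j in [set: J]) \esum_(i in [set: I]) (f (i, j))%:E.
Proof.
move=> f0; rewrite -esum_pair// (esum_esum (a := fun j i => (f (i, j))%:E));
  last by move=> i j _ _; rewrite lee_fin.
rewrite (@reindex_esum R (J * I)%type _ (setT `*`` (fun=> setT)) setT (fun p => (p.2, p.1)))//.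
split.
- by move=> [].
- by move=> [? ?] [? ?] _ _ /= [-> ->].
- by move=> [i j] _; exists (j, i).
Qed.

Let rsum_pair (f : I * J -> R) :
  (\esum_(p in [set: I * J]) `|f p|%:E < +oo)%E ->
  rsum f = rsum (fun i => rsum (fun j => f (i, j))).
Proof.
move=> ffin.
have HI := esum_integration R I; have HJ := esum_integration R J.
have HIJ := esum_integration R (I * J)%type.
have hf : rint (fun=> True) (@Jsum R (I * J)%type) f by [].
have hfi i : rint (fun=> True) (@Jsum R J) (fun j => f (i, j)).
  split=> //; apply: le_lt_trans ffin; rewrite (@esum_pair (fun p => `|f p|))//.
  rewrite (esumID [set i]) => [|k _]; last by apply: esum_ge0 => j _; rewrite lee_fin.
  rewrite setTI esum_set1; last by apply: esum_ge0 => j _; rewrite lee_fin.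
  by rewrite leeDl// esum_ge0// => k _; apply: esum_ge0 => j _; rewrite lee_fin.
have [fpos fneg] := (rint_pos HIJ hf, rint_neg HIJ hf).
have -> : rsum f = rI (@Jsum R (I * J)%type) f by [].
rewrite (rIE HIJ hf).
pose a i := fine (Jr (@Jsum R J) (rpos (fun j => f (i, j)))).
pose b i := fine (Jr (@Jsum R J) (rneg (fun j => f (i, j)))).
have Ea : Jr (@Jsum R I) a = Jr (@Jsum R (I * J)%type) (rpos f).
  rewrite /Jr /Jsum [RHS]esum_pair; last by move=> p; exact: rpos_ge0.
  by apply: eq_esum => i _; rewrite fineK//; exact: (rint_pos HJ (hfi i)).
have Eb : Jr (@Jsum R I) b = Jr (@Jsum R (I * J)%type) (rneg f).
  rewrite /Jr /Jsum [RHS]esum_pair; last by move=> p; exact: rneg_ge0.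
  by apply: eq_esum => i _; rewrite fineK//; exact: (rint_neg HJ (hfi i)).
have [] := @rIE_sub R I _ _ HI (fun i => rsum (fun j => f (i, j))) a b => //.
- by move=> i; rewrite fine_ge0//; apply: (int_ge0 HJ) => j; exact: rpos_ge0.
- by move=> i; rewrite fine_ge0//; apply: (int_ge0 HJ) => j; exact: rneg_ge0.
- by rewrite Ea -ge0_fin_numE//; apply: (int_ge0 HIJ) => j; exact: rpos_ge0.
- by rewrite Eb -ge0_fin_numE//; apply: (int_ge0 HIJ) => j; exact: rneg_ge0.
- by move=> i; exact: (rIE HJ (hfi i)).
by move=> _; rewrite Ea Eb => <-.
Qed.

Lemma csum_pair (f : I * J -> R[i]) : csummable f ->
  [/\ forall i, csummable (fun j => f (i, j)),
     csummable (fun i => csum (fun j => f (i, j))) &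
     csum f = csum (fun i => csum (fun j => f (i, j)))].
Proof.
move=> hf.
have E : asum f = \esum_(i in [set: I]) asum (fun j => f (i, j)).
  by rewrite /asum esum_pair// => p; exact: cabs_ge0.
have hfi i : csummable (fun j => f (i, j)).
  apply: le_lt_trans hf; rewrite E (esumID [set i]); last by move=> k _; exact: asum_ge0.
  rewrite setTI esum_set1 ?asum_ge0// leeDl// esum_ge0// => k _; exact: asum_ge0.
split=> //.
  apply: (@csummable_le _ _ _ (fun i => fine (asum (fun j => f (i, j))))).
    by move=> i; exact: csum_norm.
  by rewrite (_ : esum _ _ = asum f)// E; apply: eq_esum => i _; rewrite asum_fineK.
have hR : (\esum_(p in [set: I * J]) `|complex.Re (f p)|%:E < +oo)%E.
  by apply: le_lt_trans hf; apply: le_esum => p _; rewrite lee_fin Re_cabs.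
have hI : (\esum_(p in [set: I * J]) `|complex.Im (f p)|%:E < +oo)%E.
  by apply: le_lt_trans hf; apply: le_esum => p _; rewrite lee_fin Im_cabs.
by rewrite /csum !rsum_pair.
Qed.

Lemma csummable_pair (f : I * J -> R[i]) (a : I -> R) :
  (forall i, (asum (fun j => f (i, j)) <= (a i)%:E)%E) ->
  (\esum_(i in [set: I]) (a i)%:E < +oo)%E -> csummable f.
Proof.
move=> ha; apply: le_lt_trans; rewrite /asum esum_pair; last by move=> p; exact: cabs_ge0.
by apply: le_esum => i _; exact: ha.
Qed.

End CsumPair.

Lemma csum_reindex (R : realType) (I J : choiceType) (e : J -> I)
    (f : I -> R[i]) : set_bij setT setT e -> csum f = csum (fun j => f (e j)).
Proof.
move=> be; rewrite /csum /rsum; congr (_ +i* _); congr (fine (_ - _)%E);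
  (etransitivity; first exact: (@reindex_esum R J I setT setT e _ be));
  by apply: eq_esum => i _; rewrite ?funeposE ?funenegE.
Qed.

Lemma csum_swap (R : realType) (I J : choiceType) (f : I -> J -> R[i]) :
  csummable (fun p : I * J => f p.1 p.2) ->
  csum (fun i => csum (fun j => f i j)) = csum (fun j => csum (fun i => f i j)).
Proof.
move=> hf; have [_ _ <-] := csum_pair hf.
have hf' : csummable (fun p : J * I => f p.2 p.1).
  rewrite /csummable /asum esum_pair; last by move=> p; exact: cabs_ge0.
  rewrite -(esum_swap (f := fun p => cabs (f p.1 p.2))); last by move=> p; exact: cabs_ge0.
  by rewrite -(esum_pair (f := fun p => cabs (f p.1 p.2)))// => p; exact: cabs_ge0.
have [_ _ <-] := csum_pair hf'.
have bij : set_bij setT setT (fun p : J * I => (p.2, p.1)).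
  split.
  - by move=> [].
  - by move=> [? ?] [? ?] _ _ /= [-> ->].
  - by move=> [i j] _; exists (j, i).
exact: (csum_reindex (fun p : I * J => f p.1 p.2) bij).
Qed.

(** * The Hilbert space of square summable families *)

Section L2.
Variables (R : realType) (I : choiceType).
Implicit Types (phi psi : I -> R[i]) (s : seq I).

Let HS := esum_integration R I.

Definition sqn phi : R := fine (sqnorm phi).
Definition nrm phi : R := Num.sqrt (sqn phi).

Lemma sqnorm_ge0 phi : (0 <= sqnorm phi)%E.
Proof. exact: (N2_ge0 HS). Qed.

Lemma sqn_ge0 phi : 0 <= sqn phi.
Proof. by rewrite fine_ge0// sqnorm_ge0. Qed.

Lemma sqnK phi : l2 phi -> ((sqn phi)%:E = sqnorm phi)%E.
Proof. by move=> h; rewrite fineK// ge0_fin_numE// sqnorm_ge0. Qed.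

Lemma nrm_ge0 phi : 0 <= nrm phi. Proof. exact: sqrtr_ge0. Qed.

Lemma nrm_sq phi : nrm phi ^+ 2 = sqn phi.
Proof. by rewrite sqr_sqrtr ?sqn_ge0. Qed.

Lemma l2D phi psi : l2 phi -> l2 psi -> l2 (fun i => phi i + psi i).
Proof. exact: (N2D HS). Qed.

Lemma sqnormZ c phi : sqnorm (fun i => c * phi i) = ((sqmod c)%:E * sqnorm phi)%E.
Proof. exact: (N2Z HS). Qed.

Lemma l2Z c phi : l2 phi -> l2 (fun i => c * phi i).
Proof. by move=> h; rewrite /l2 sqnormZ lte_mul_pinfty// lee_fin sqmod_ge0. Qed.

Lemma l2_lin c phi psi : l2 phi -> l2 psi -> l2 (fun i => c * phi i + psi i).
Proof. by move=> h1 h2; apply: l2D => //; exact: l2Z. Qed.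

Lemma l2B phi psi : l2 phi -> l2 psi -> l2 (fun i => phi i - psi i).
Proof.
move=> h1 h2; rewrite (_ : (fun _ => _) = (fun i => phi i + (-1) * psi i)).
  by apply: l2D => //; exact: l2Z.
by apply/funext => i; rewrite mulN1r.
Qed.

Lemma sqnorm_conj phi : sqnorm (fun i => conjc (phi i)) = sqnorm phi.
Proof. by rewrite /sqnorm; apply: eq_esum => i _; rewrite sqmod_conj. Qed.

Lemma l2_conj phi : l2 phi -> l2 (fun i => conjc (phi i)).
Proof. by rewrite /l2 sqnorm_conj. Qed.

Lemma l2_mul phi psi : l2 phi -> l2 psi -> csummable (fun i => phi i * psi i).
Proof. by move=> h1 h2; apply/csummableP; exact: (cint_able_mul HS). Qed.

Lemma l2_mul_le phi psi : l2 phi -> l2 psi ->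
  cabs (csum (fun i => phi i * psi i)) <= nrm phi * nrm psi.
Proof. by move=> h1 h2; exact: (cI_mul_le HS). Qed.

Lemma asum_mul phi psi : l2 phi -> l2 psi ->
  (asum (fun i => (phi i * psi i)%R) <= (nrm phi * nrm psi)%:E)%E.
Proof.
move=> h1 h2; rewrite /asum; under eq_esum do rewrite cabsM.
exact: (cauchy_schwarz HS).
Qed.

Lemma dot_summable phi psi : l2 phi -> l2 psi ->
  csummable (fun i => conjc (phi i) * psi i).
Proof. by move=> h1 h2; apply: l2_mul => //; exact: l2_conj. Qed.

Lemma nrm_conj phi : nrm (fun i => conjc (phi i)) = nrm phi.
Proof. by rewrite /nrm /sqn sqnorm_conj. Qed.

Lemma dot_le phi psi : l2 phi -> l2 psi -> cabs (dot phi psi) <= nrm phi * nrm psi.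
Proof.
by move=> h1 h2; rewrite -(nrm_conj phi); apply: l2_mul_le => //; exact: l2_conj.
Qed.

Lemma dot_conj phi psi : l2 phi -> l2 psi -> dot psi phi = conjc (dot phi psi).
Proof.
move=> h1 h2; rewrite -csum_conj; last exact: dot_summable.
by congr csum; apply/funext => i; rewrite conjcM conjcK mulrC.
Qed.

Lemma dot_linr c phi psi psi' : l2 phi -> l2 psi -> l2 psi' ->
  dot phi (fun i => c * psi i + psi' i) = c * dot phi psi + dot phi psi'.
Proof.
move=> h h1 h2; rewrite /dot.
transitivity (csum (fun i => c * (conjc (phi i) * psi i) + conjc (phi i) * psi' i)).
  by congr csum; apply/funext => i; rewrite mulrDr mulrCA.
have s1 := dot_summable h h1.
by rewrite csumD ?csumZ//; [exact: csummableZ|exact: dot_summable].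
Qed.

Lemma dot_linl c phi phi' psi : l2 phi -> l2 phi' -> l2 psi ->
  dot (fun i => c * phi i + phi' i) psi = conjc c * dot phi psi + dot phi' psi.
Proof.
move=> h h1 h2; rewrite dot_conj//; last exact: l2_lin.
by rewrite dot_linr// conjcD conjcM -!dot_conj.
Qed.

Lemma dot_self phi : dot phi phi = (sqn phi)%:C.
Proof.
rewrite /dot -csum_real; last by move=> i; exact: sqmod_ge0.
by congr csum; apply/funext => i; rewrite mulJc.
Qed.

Definition ebase (j : I) : I -> R[i] := fun i => (i == j)%:R.

Lemma sqnorm_ebase j : sqnorm (ebase j) = 1%E.
Proof.
rewrite /sqnorm -(@esum_single R I 1 j ler01); apply: eq_esum => i _.
by rewrite /ebase; case: eqP => _ /=; rewrite /sqmod /= ?expr1n expr0n addr0.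
Qed.

Lemma l2_ebase j : l2 (ebase j).
Proof. by rewrite /l2 sqnorm_ebase ltry. Qed.

Lemma nrm_ebase j : nrm (ebase j) = 1.
Proof. by rewrite /nrm /sqn sqnorm_ebase sqrtr1. Qed.

Lemma dot_ebase j psi : dot (ebase j) psi = psi j.
Proof.
rewrite /dot (csum_single_support (j := j)) /ebase ?eqxx ?conjc1 ?mul1r//.
by move=> i /negbTE ->; rewrite conjc0 mul0r.
Qed.

Definition rst s phi : I -> R[i] := fun i => if i \in s then phi i else 0.

Lemma rst_cons i s phi : i \notin s ->
  rst (i :: s) phi = (fun k => phi i * ebase i k + rst s phi k).
Proof.
move=> si; apply/funext => k; rewrite /rst inE /ebase.
have [->|ki] /= := eqVneq k i; first by rewrite (negbTE si) mulr1 addr0.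
by rewrite mulr0 add0r.
Qed.

Lemma rst_nil phi : rst [::] phi = (fun=> 0). Proof. by []. Qed.

Lemma sqnorm_rst s phi : uniq s ->
  sqnorm (rst s phi) = (\sum_(i <- s) sqmod (phi i))%:E.
Proof.
move=> us; rewrite /sqnorm -sumEFin fsbig_seq// -esum_fset//; last first.
  by move=> i _; rewrite lee_fin sqmod_ge0.
rewrite [RHS]esum_mkcond; apply: eq_esum => i _.
rewrite /rst mem_setE; case: ifP => //.
by rewrite /sqmod /= expr0n addr0.
Qed.

Lemma l2_rst s phi : uniq s -> l2 (rst s phi).
Proof. by move=> us; rewrite /l2 sqnorm_rst// ltry. Qed.

Lemma dot_rst s phi psi : uniq s ->
  dot (rst s phi) psi = \sum_(i <- s) conjc (phi i) * psi i.
Proof.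
move=> us; rewrite /dot (csum_finite us _).2; last first.
  by move=> i si; rewrite /rst (negbTE si) conjc0 mul0r.
by rewrite big_seq [RHS]big_seq; apply: eq_bigr => i si; rewrite /rst si.
Qed.

Lemma l2_tail phi (e : R) : l2 phi -> 0 < e ->
  exists2 s, uniq s & nrm (fun i => phi i - rst s phi i) <= e.
Proof.
move=> h e0; have e20 : 0 < e ^+ 2 by rewrite exprn_gt0.
have [|s us hs] := esum_gt_seq e20 _ h; first by move=> i; exact: sqmod_ge0.
exists s => //; rewrite -(ger0_norm (ltW e0)) -sqrtr_sqr ler_wsqrtr//.
have hr := l2_rst phi us.
have hd : l2 (fun i => phi i - rst s phi i) by exact: l2B.
rewrite -lee_fin sqnK//.
have E : sqnorm phi = (sqnorm (rst s phi) + sqnorm (fun i => phi i - rst s phi i)%R)%E.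
  rewrite /sqnorm -esumD; last 2 first.
  - by move=> i _; rewrite lee_fin sqmod_ge0.
  - by move=> i _; rewrite lee_fin sqmod_ge0.
  apply: eq_esum => i _; rewrite -EFinD /rst; case: ifP => _.
    by rewrite subrr [X in _ + X](_ : _ = 0) ?addr0// /sqmod /= expr0n addr0.
  by rewrite subr0 [X in X + _](_ : _ = 0) ?add0r// /sqmod /= expr0n addr0.
move: hs; rewrite -/(sqnorm phi) -/(sqn phi) => hs.
move: E; rewrite -(sqnK h) -(sqnK hr) -(sqnK hd) -EFinD => -[] E.
have S : sqn (rst s phi) = \sum_(i <- s) sqmod (phi i).
  by rewrite /sqn sqnorm_rst.
rewrite lee_fin; move: hs; rewrite -S E; lra.
Qed.

Lemma nrmD phi psi : l2 phi -> l2 psi ->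
  nrm (fun i => phi i + psi i) <= nrm phi + nrm psi.
Proof.
move=> h1 h2.
rewrite -(ler_pXn2r (ltn0Sn 1)) ?nnegrE ?nrm_ge0 ?addr_ge0 ?nrm_ge0//.
have h12 := l2D h1 h2.
rewrite nrm_sq -lecR -dot_self.
have -> : dot (fun i => phi i + psi i) (fun i => phi i + psi i) =
   (sqn phi)%:C + (sqn psi)%:C + (dot phi psi + conjc (dot phi psi)).
  have E c : (fun i => c i + psi i) = (fun i => 1 * c i + psi i) :> (I -> R[i]).
    by apply/funext => i; rewrite mul1r.
  rewrite {1}E dot_linl// conjc1 mul1r E !dot_linr// !mul1r !dot_self.
  by rewrite (dot_conj h1 h2); ring.
rewrite addcJ -!rmorphD /= -[2]/(2%:R) -(rmorph_nat (real_complex R)) -rmorphM -rmorphD lecR.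
set r := rsum _; have : r <= nrm phi * nrm psi.
  by rewrite (le_trans (ler_norm _))// (le_trans (Re_cabs (dot phi psi)))// dot_le.
rewrite sqrrD !nrm_sq -mulr_natl; lra.
Qed.

End L2.

(** * Bounded sesquilinear forms and their matrices *)

Section Forms.
Variables (R : realType) (I : choiceType).
Implicit Types (phi psi : I -> R[i]) (s : seq I) (A : op R I).

(** Weak integrals, products and adjoints of operators, and sums of rank one operators all appear
    first as such forms; [form_op] then recovers the matrix, which is Riesz representation. *)
Record bounded_form (B : (I -> R[i]) -> (I -> R[i]) -> R[i]) (M : R) : Prop :=
  BoundedForm {
  form_linl : forall c phi phi' psi, l2 phi -> l2 phi' -> l2 psi ->
    B (fun i => c * phi i + phi' i) psi = conjc c * B phi psi + B phi' psi;
  form_linr : forall c phi psi psi', l2 phi -> l2 psi -> l2 psi' ->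
    B phi (fun i => c * psi i + psi' i) = c * B phi psi + B phi psi';
  form_le : forall phi psi, l2 phi -> l2 psi ->
    cabs (B phi psi) <= M * nrm phi * nrm psi
}.

Lemma form_conj B M : bounded_form B M ->
  bounded_form (fun phi psi => conjc (B psi phi)) M.
Proof.
move=> h; split.
- by move=> c phi phi' psi h1 h2 h3; rewrite (form_linr h)// conjcD conjcM.
- by move=> c phi psi psi' h1 h2 h3; rewrite (form_linl h)// conjcD conjcM conjcK.
- by move=> phi psi h1 h2; rewrite cabs_conj (le_trans (form_le h _ _))// mulrAC.
Qed.

Lemma l2_0 : l2 (fun _ : I => 0 : R[i]).
Proof. by rewrite -(rst_nil (fun=> 0)); exact: l2_rst. Qed.

Lemma form_0r B M phi : bounded_form B M -> l2 phi -> B phi (fun=> 0) = 0.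
Proof.
move=> h h1; have := form_linr h (-1) h1 l2_0 l2_0.
rewrite (_ : (fun _ => _) = (fun=> 0)); last by apply/funext => i; rewrite mulr0 addr0.
by rewrite mulN1r addNr.
Qed.

Lemma form_rst B M s phi psi : bounded_form B M -> uniq s -> l2 phi ->
  B phi (rst s psi) = \sum_(i <- s) psi i * B phi (ebase R i).
Proof.
move=> h us h1; elim: s us => [_|i s IH /= /andP[si us]].
  by rewrite big_nil rst_nil (form_0r h).
rewrite rst_cons// (form_linr h)//; first by rewrite IH// big_cons.
  exact: l2_ebase.
exact: l2_rst.
Qed.

Lemma form_rstl B M s phi psi : bounded_form B M -> uniq s -> l2 psi ->
  B (rst s phi) psi = \sum_(i <- s) conjc (phi i) * B (ebase R i) psi.
Proof.
move=> h us h1; have := form_rst phi (form_conj h) us h1.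
move=> /(congr1 conjc); rewrite conjcK => ->; rewrite rmorph_sum.
by apply: eq_bigr => i _; rewrite [LHS]conjcM conjcK.
Qed.

(** Tested against the truncation of y itself, the form equals S, the partial sum of |y_i|^2, while
    the bound is M |psi| sqrt S; dividing by sqrt S bounds S uniformly in the truncation. *)
Lemma form_l2 B M psi : bounded_form B M -> l2 psi ->
  (sqnorm (fun i => B (ebase R i) psi) <= ((M * nrm psi) ^+ 2)%:E)%E.
Proof.
move=> h h1; set y := fun i => _; apply: esum_le_seq => s us; rewrite lee_fin.
have hr := l2_rst y us.
set S := \sum_(i <- s) _.
have S0 : 0 <= S by apply: sumr_ge0 => i _; exact: sqmod_ge0.
have E : B (rst s y) psi = S%:C.
  rewrite (form_rstl _ h)// rmorph_sum; apply: eq_bigr => i _.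
  by rewrite mulJc.
have N : nrm (rst s y) = Num.sqrt S by rewrite /nrm /sqn sqnorm_rst.
have := form_le h hr h1; rewrite E cabsC ger0_norm// N => hS.
have [S00|Sp] := eqVneq S 0; first by rewrite S00 sqr_ge0.
have rS : 0 < Num.sqrt S by rewrite sqrtr_gt0 lt_neqAle eq_sym Sp.
have S2 : S = Num.sqrt S ^+ 2 by rewrite sqr_sqrtr.
have hM : Num.sqrt S <= M * nrm psi.
  by rewrite -(ler_pM2r rS) -expr2 -S2 mulrAC.
rewrite S2 ler_pXn2r ?nnegrE ?sqrtr_ge0//.
exact: le_trans (sqrtr_ge0 _) hM.
Qed.

(** Both sides agree on finitely supported vectors and are continuous in the first argument.
    Replacing phi by a truncation with remainder q costs at most |q| (|y| + |M| |psi|). *)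
Lemma form_vec B M phi psi : bounded_form B M -> l2 phi -> l2 psi ->
  l2 (fun i => B (ebase R i) psi) /\
  dot phi (fun i => B (ebase R i) psi) = B phi psi.
Proof.
move=> h h1 h2; set y := fun i => _.
have hy : l2 y by apply: le_lt_trans (form_l2 h h2) _; rewrite ltry.
split=> //; apply/eqP; rewrite -subr_eq0; apply/eqP; apply: cabs_eq0.
apply/eqP; rewrite eq_le cabs_ge0 andbT.
set K := nrm y + M * nrm psi.
have K0 : 0 <= nrm y + `|M| * nrm psi by rewrite addr_ge0 ?mulr_ge0 ?nrm_ge0.
apply/ler_addgt0Pr => e e0; rewrite add0r.
set K' := nrm y + `|M| * nrm psi + 1; have K'0 : 0 < K' by rewrite ltr_wpDl.
have [s us hs] := l2_tail h1 (divr_gt0 e0 K'0).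
set q := fun i => phi i - rst s phi i in hs.
have hq : l2 q by apply: l2B => //; exact: l2_rst.
have hr := l2_rst phi us.
have E : phi = (fun i => 1 * rst s phi i + q i).
  by apply/funext => i; rewrite mul1r /q addrC subrK.
rewrite E dot_linl// (form_linl h)// conjc1 !mul1r dot_rst// (form_rstl _ h us h2).
rewrite opprD addrACA subrr add0r.
apply: le_trans (cabsB _ _) _.
apply: (@le_trans _ _ (nrm q * K')).
  rewrite /K' mulrDr mulr1 mulrDr -addrA lerD ?dot_le//.
  apply: (@le_trans _ _ (M * nrm q * nrm psi)); first exact: form_le h _ _ hq h2.
  rewrite (mulrC M) -mulrA ler_wpDr ?nrm_ge0// ler_wpM2l ?nrm_ge0//.
  by rewrite ler_wpM2r ?nrm_ge0// ler_norm.
by rewrite -ler_pdivlMr.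
Qed.

Definition form_op (B : (I -> R[i]) -> (I -> R[i]) -> R[i]) : op R I :=
  fun i j => B (ebase R i) (ebase R j).

Lemma form_apply B M psi i : bounded_form B M -> l2 psi ->
  apply (form_op B) psi i = B (ebase R i) psi.
Proof.
move=> h h1; have hc := form_conj h.
have [h2 h3] := form_vec hc h1 (l2_ebase R i).
rewrite -[RHS]conjcK -h3 /dot -csum_conj; last exact: dot_summable.
by congr csum; apply/funext => j; rewrite conjcM !conjcK mulrC.
Qed.

Lemma form_dot B M phi psi : bounded_form B M -> l2 phi -> l2 psi ->
  l2 (apply (form_op B) psi) /\ dot phi (apply (form_op B) psi) = B phi psi.
Proof.
move=> h h1 h2.
have -> : apply (form_op B) psi = (fun i => B (ebase R i) psi).
  by apply/funext => i; rewrite (form_apply _ h).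
exact: form_vec h h1 h2.
Qed.

Lemma form_bounded B M : bounded_form B M -> bounded (form_op B).
Proof.
move=> h; exists (M ^+ 2) => phi h1.
have -> : apply (form_op B) phi = (fun i => B (ebase R i) phi).
  by apply/funext => i; rewrite (form_apply _ h).
by rewrite (le_trans (form_l2 h h1))// exprMn nrm_sq EFinM sqnK.
Qed.

Lemma apply_rst A s psi i : uniq s ->
  apply A (rst s psi) i = \sum_(j <- s) A i j * psi j.
Proof.
move=> us; rewrite /apply (csum_finite us _).2; last first.
  by move=> j js; rewrite /rst (negbTE js) mulr0.
by rewrite big_seq [RHS]big_seq; apply: eq_bigr => j js; rewrite /rst js.
Qed.

Lemma sqmod_le_sqnorm psi i : ((sqmod (psi i))%:E <= sqnorm psi)%E.
Proof.
have := @esum_seq_le R I (fun i => sqmod (psi i)) [:: i] isT (fun i => sqmod_ge0 _).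
by rewrite big_seq1.
Qed.

(* Testing the bound on truncations of the conjugated row. *)
Lemma bounded_row A i : bounded A -> l2 (fun j => A i j).
Proof.
move=> [M hM]; have [M0|M0] := leP 0 M; last first.
  have := hM (ebase R i) (l2_ebase R i); rewrite sqnorm_ebase mule1.
  by move=> /(le_trans (sqnorm_ge0 _)); rewrite lee_fin leNgt M0.
apply: (@le_lt_trans _ _ M%:E); last by rewrite ltry.
apply: esum_le_seq => s us; rewrite lee_fin; set S := \sum_(j <- s) _.
have S0 : 0 <= S by apply: sumr_ge0 => j _; exact: sqmod_ge0.
pose psi j := conjc (A i j).
have := hM (rst s psi) (l2_rst psi us); rewrite sqnorm_rst//.
move=> /(le_trans (sqmod_le_sqnorm _ i)); rewrite apply_rst//.
have -> : \sum_(j <- s) A i j * psi j = S%:C.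
  by rewrite rmorph_sum; apply: eq_bigr => j _; rewrite mulrC mulJc.
have -> : \sum_(j <- s) sqmod (psi j) = S by apply: eq_bigr => j _; rewrite sqmod_conj.
rewrite -EFinM lee_fin sqmodC expr2.
have [->//|Sn] := eqVneq S 0.
by rewrite ler_pM2r// lt_neqAle eq_sym Sn.
Qed.

Lemma apply_linr A c psi psi' : bounded A -> l2 psi -> l2 psi' ->
  apply A (fun i => c * psi i + psi' i) = (fun i => c * apply A psi i + apply A psi' i).
Proof.
move=> hA h1 h2; apply/funext => i; rewrite /apply.
have s1 : csummable (fun j => A i j * psi j) by apply: l2_mul => //; exact: bounded_row.
have s2 : csummable (fun j => A i j * psi' j) by apply: l2_mul => //; exact: bounded_row.
rewrite -csumZ// -csumD//; last exact: csummableZ.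
by congr csum; apply/funext => j; rewrite mulrDr mulrCA.
Qed.

Lemma l2_apply A psi : bounded A -> l2 psi -> l2 (apply A psi).
Proof.
move=> [M hM] h; apply: le_lt_trans (hM _ h) _.
by rewrite -(sqnK h) -EFinM ltry.
Qed.

Lemma bounded_nrm A : bounded A ->
  exists2 K, 0 <= K & forall psi, l2 psi -> nrm (apply A psi) <= K * nrm psi.
Proof.
move=> hA; have [M hM] := hA; exists (Num.sqrt `|M|); first exact: sqrtr_ge0.
move=> psi h; have h' := l2_apply hA h.
rewrite /nrm -sqrtrM// ler_wsqrtr// -lee_fin (sqnK h').
apply: le_trans (hM _ h) _; rewrite EFinM (sqnK h) lee_wpmul2r ?sqnorm_ge0//.
by rewrite lee_fin ler_norm.
Qed.

Lemma bounded_formP A : bounded A ->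
  exists M, bounded_form (fun phi psi => dot phi (apply A psi)) M.
Proof.
move=> hA; have [K K0 hK] := bounded_nrm hA; exists K; split.
- by move=> c phi phi' psi h1 h2 h3; rewrite dot_linl//; exact: l2_apply.
- by move=> c phi psi psi' h1 h2 h3; rewrite apply_linr// dot_linr//; exact: l2_apply.
- move=> phi psi h1 h2; have h3 := l2_apply hA h2.
  by rewrite (le_trans (dot_le h1 h3))// mulrAC mulrC ler_wpM2r ?nrm_ge0 ?hK.
Qed.

Lemma form_opK A : form_op (fun phi psi => dot phi (apply A psi)) = A.
Proof.
apply/funext => i; apply/funext => j; rewrite /form_op dot_ebase /apply.
rewrite (csum_single_support (j := j)) /ebase ?eqxx ?mulr1//.
by move=> k /negbTE ->; rewrite mulr0.
Qed.

Lemma adjoint_form A :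
  adjoint A = form_op (fun phi psi => conjc (dot psi (apply A phi))).
Proof.
by apply/funext => i; apply/funext => j; rewrite /form_op /adjoint -{1}(form_opK A).
Qed.

Lemma bounded_adjoint A : bounded A -> bounded (adjoint A).
Proof.
move=> /bounded_formP[M h]; rewrite adjoint_form.
exact: form_bounded (form_conj h).
Qed.

Lemma dot_adjoint A phi psi : bounded A -> l2 phi -> l2 psi ->
  dot (apply (adjoint A) phi) psi = dot phi (apply A psi).
Proof.
move=> hA h1 h2; have [M h] := bounded_formP hA.
have hA' := bounded_adjoint hA.
rewrite dot_conj//; last exact: l2_apply.
rewrite adjoint_form (form_dot (form_conj h) h2 h1).2.
by rewrite conjcK.
Qed.

Lemma opmul_form A A' :
  opmul A A' = form_op (fun phi psi => dot phi (apply A (apply A' psi))).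
Proof.
apply/funext => i; apply/funext => j; rewrite /form_op dot_ebase /opmul.
rewrite [in RHS]/apply; congr csum; apply/funext => k; congr (_ * _).
by rewrite -[in LHS](form_opK A') /form_op dot_ebase.
Qed.

Lemma opmul_bounded_form A A' : bounded A -> bounded A' ->
  exists M, bounded_form (fun phi psi => dot phi (apply A (apply A' psi))) M.
Proof.
move=> hA hA'; have [K K0 hK] := bounded_nrm hA.
have [K' K'0 hK'] := bounded_nrm hA'; exists (K * K'); split.
- by move=> c phi phi' psi h1 h2 h3; rewrite dot_linl//; do 2 apply: l2_apply => //.
- move=> c phi psi psi' h1 h2 h3.
  rewrite apply_linr// apply_linr//; [|exact: l2_apply..].
  by rewrite dot_linr//; do 2 apply: l2_apply => //.
- move=> phi psi h1 h2; have h3 := l2_apply hA' h2.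
  apply: le_trans (dot_le h1 (l2_apply hA h3)) _.
  rewrite mulrAC mulrC ler_wpM2r ?nrm_ge0// -mulrA.
  by rewrite (le_trans (hK _ h3))// ler_wpM2l// hK'.
Qed.

Lemma bounded_opmul A A' : bounded A -> bounded A' -> bounded (opmul A A').
Proof.
move=> hA hA'; have [M h] := opmul_bounded_form hA hA'.
by rewrite opmul_form; exact: form_bounded h.
Qed.

Lemma apply_opmul A A' psi : bounded A -> bounded A' -> l2 psi ->
  apply (opmul A A') psi = apply A (apply A' psi).
Proof.
move=> hA hA' h1; have [M h] := opmul_bounded_form hA hA'.
by apply/funext => i; rewrite opmul_form (form_apply _ h)// dot_ebase.
Qed.

Lemma apply_ketbra phi psi chi : l2 psi -> l2 chi ->
  apply (ketbra phi psi) chi = (fun i => phi i * dot psi chi).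
Proof.
move=> h1 h2; apply/funext => i; rewrite /apply /dot -csumZ; last exact: dot_summable.
by congr csum; apply/funext => j; rewrite /ketbra mulrA.
Qed.

Lemma dot_Zr phi c psi : l2 phi -> l2 psi ->
  dot phi (fun i => c * psi i) = c * dot phi psi.
Proof.
move=> h1 h2; rewrite /dot -csumZ; last exact: dot_summable.
by congr csum; apply/funext => j; rewrite mulrCA.
Qed.

Lemma dot_ketbra phi psi a b : l2 phi -> l2 psi -> l2 a -> l2 b ->
  dot phi (apply (ketbra a b) psi) = dot phi a * dot b psi.
Proof.
move=> h1 h2 h3 h4; rewrite apply_ketbra// mulrC -dot_Zr//.
by congr dot; apply/funext => i; rewrite mulrC.
Qed.

Lemma bounded_ketbra (a b : I -> R[i]) : l2 a -> l2 b -> bounded (ketbra a b).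
Proof.
move=> ha hb; exists (sqn a * sqn b) => phi h.
rewrite apply_ketbra//.
under [X in sqnorm X]eq_fun do rewrite mulrC.
rewrite sqnormZ -(sqnK h) -(sqnK ha) -!EFinM lee_fin -cabs_sq.
rewrite [X in X <= _]mulrC -mulrA ler_wpM2l ?sqn_ge0//.
rewrite -!nrm_sq -exprMn ler_pXn2r ?nnegrE ?cabs_ge0 ?mulr_ge0 ?nrm_ge0//.
exact: dot_le.
Qed.

Lemma dot_opscale c A phi psi : l2 phi -> l2 psi -> bounded A ->
  dot phi (apply (opscale c A) psi) = c%:C * dot phi (apply A psi).
Proof.
move=> h1 h2 hA; rewrite -dot_Zr//; last exact: l2_apply.
congr dot; apply/funext => i; rewrite /apply -csumZ; last first.
  by apply: l2_mul => //; exact: bounded_row.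
by congr csum; apply/funext => j; rewrite /opscale mulrA.
Qed.

End Forms.

(** * Positive semidefinite matrices of finite trace *)

Section Cholesky.
Variables (R : realType) (I : countType).
Implicit Types (X : op R I) (s : seq I) (c : I -> R[i]).

Definition quad X s c : R[i] :=
  \sum_(i <- s) \sum_(j <- s) conjc (c i) * X i j * c j.

(** Positivity on finitely supported vectors. Unlike [positive] it says nothing of boundedness, so
    it can be established first; together with a finite trace it yields boundedness ([ptcP]). *)
Definition psd X : Prop := forall s c, uniq s -> 0 <= quad X s c.

Lemma eq_quad X s c c' : {in s, c =1 c'} -> quad X s c = quad X s c'.
Proof.
move=> h; rewrite /quad big_seq [RHS]big_seq; apply: eq_bigr => i si.
by rewrite big_seq [RHS]big_seq; apply: eq_bigr => j sj; rewrite !h.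
Qed.

Lemma quad_cons X i s c : quad X (i :: s) c =
  conjc (c i) * X i i * c i + conjc (c i) * (\sum_(j <- s) X i j * c j)
  + (\sum_(j <- s) conjc (c j) * X j i) * c i + quad X s c.
Proof.
rewrite /quad big_cons big_cons -!addrA; congr (_ + _); rewrite mulr_sumr; congr (_ + _).
  by apply: eq_bigr => j _; rewrite mulrA.
under eq_bigr do rewrite big_cons.
by rewrite big_split /= mulr_suml.
Qed.

Lemma psd_diag X i : psd X -> X i i = (complex.Re (X i i))%:C /\
  0 <= complex.Re (X i i).
Proof.
move=> /(_ [:: i] (fun=> 1) isT); rewrite /quad !big_seq1 conjc1 mulr1 mul1r => h.
by move: (h); rewrite lecE /= => /andP[/eqP h1 h2]; split=> //; apply: complexP.
Qed.

(** The values of the form at e_i + e_j and at e_i + i e_j are real; their vanishing imaginary parts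
    are the two equations wanted. *)
Lemma psd_herm X i j : psd X -> X j i = conjc (X i j).
Proof.
move=> h; have [->|ij] := eqVneq i j.
  by have [-> _] := psd_diag j h; rewrite conjc_real.
have us : uniq [:: i; j] by rewrite /= inE ij.
have [ei _] := psd_diag i h; have [ej _] := psd_diag j h.
have := h _ (fun=> 1) us.
have := h _ (fun k => if k == i then 1 else 'i%C) us.
rewrite /quad !big_cons !big_nil /= !eqxx (eq_sym j) (negbTE ij) ei ej.
move: (complex.Re (X i i)) (complex.Re (X j j)) (X i j) (X j i) => d e u v.
rewrite conjc_i !oppr0 !complexr0 !rmorph1 !mulr1 !mul1r !addr0.
have -> : d%:C + u * 'i%C + (- 'i%C * v + - 'i%C * e%:C * 'i%C) =
    d%:C + (e%:C + (u - v) * 'i%C).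
  transitivity (d%:C + u * 'i%C - 'i%C * v - e%:C * ('i%C ^+ 2)); first by ring.
  by rewrite sqr_i; ring.
move=> /ger0_Im; rewrite !ImD ImiRe ReD ReN /= !add0r => /eqP.
rewrite subr_eq0 => /eqP h1 /ger0_Im; rewrite !ImD /= add0r addr0 => h2.
by apply: complexP; rewrite ?Re_conj ?Im_conj //; lra.
Qed.

(** When the diagonal entry at i vanishes, the form at - t X_ij e_i + e_j is affine in t with slope
    - 2 |X_ij|^2, so a nonzero X_ij would make it negative. *)
Lemma psd_zero X i j : psd X -> X i i = 0 -> X i j = 0.
Proof.
move=> h x0; have [<-//|ij] := eqVneq i j.
have us : uniq [:: i; j] by rewrite /= inE ij.
have [ej d0] := psd_diag j h.
set d := complex.Re _ in ej d0.
have bnd (t : R) : 0 <= - 2 * t * sqmod (X i j) + d.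
  have := h _ (fun k => if k == i then (- t)%:C * X i j else 1) us.
  rewrite /quad !big_cons !big_nil /= !eqxx (eq_sym j) (negbTE ij) x0 ej.
  rewrite (psd_herm i j h); move: (X i j) => u.
  rewrite conjcM conjc_real !conjc1 !mulr1 !mul1r !addr0 mulr0 mul0r add0r.
  rewrite (mulrCA (conjc u)) -(mulrA _ (conjc u)) !mulJc -!rmorphM -!rmorphD ler0c /=.
  by rewrite (_ : _ + _ = - 2 * t * sqmod u + d)//; ring.
have [/eqP|n0] := eqVneq (sqmod (X i j)) 0.
  by rewrite -cabs_sq sqrf_eq0 => /eqP/cabs_eq0.
(* The value of t for which the form equals -1. *)
have := bnd ((d + 1) / (2 * sqmod (X i j))).
rewrite (_ : _ * _ + d = - 1); last by field; rewrite n0.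
by rewrite ler0N1.
Qed.

(** Column n divided by the square root of the pivot. For a zero pivot the inverse is 0, the vector
    vanishes, and the elimination step leaves the matrix unchanged. *)
Definition chol_vec X (n : I) : I -> R[i] :=
  fun i => X i n * ((Num.sqrt (complex.Re (X n n)))^-1)%:C.

Definition chol_step X (n : I) : op R I :=
  fun i j => X i j - chol_vec X n i * conjc (chol_vec X n j).

Lemma chol_step0 X n : psd X -> X n n = 0 ->
  chol_step X n = X /\ chol_vec X n = (fun=> 0).
Proof.
move=> h h0; have E : chol_vec X n = (fun=> 0).
  by apply/funext => i; rewrite /chol_vec h0 /= sqrtr0 invr0 mulr0.
split=> //; apply/funext => i; apply/funext => j.
by rewrite /chol_step E mul0r subr0.
Qed.

Lemma chol_stepE X n i j : psd X -> X n n != 0 ->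
  chol_step X n i j = X i j - X i n * X n j * ((complex.Re (X n n))^-1)%:C.
Proof.
move=> h h0; have [e d0] := psd_diag n h.
rewrite /chol_step /chol_vec conjcM conjc_real -(psd_herm j n h) mulrACA.
by rewrite -rmorphM /= -invfM -expr2 sqr_sqrtr.
Qed.

Lemma chol_step_row X n j : psd X -> chol_step X n n j = 0 /\ chol_step X n j n = 0.
Proof.
move=> h; have [h0|h0] := eqVneq (X n n) 0.
  rewrite (chol_step0 h h0).1; have z := psd_zero j h h0.
  by rewrite (psd_herm n j h) z conjc0.
have [e d0] := psd_diag n h.
have V : X n n * ((complex.Re (X n n))^-1)%:C = 1.
  by rewrite {1}e -rmorphM /= mulfV//; apply: contra h0 => /eqP E; rewrite e E.
rewrite !chol_stepE//; split.
  by rewrite mulrAC V mul1r subrr.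
by rewrite -mulrA V mulr1 subrr.
Qed.

Lemma chol_step_zero X n i : psd X -> (forall j, X i j = 0) ->
  forall j, chol_step X n i j = 0.
Proof. by move=> h h0 j; rewrite /chol_step /chol_vec !h0 !mul0r subrr. Qed.

Lemma quad_rem X s c n : (forall j, X n j = 0) -> (forall j, X j n = 0) ->
  uniq s -> quad X s c = quad X [seq i <- s | i != n] c.
Proof.
move=> r0 c0 us.
have E (F : I -> R[i]) : F n = 0 -> \sum_(i <- s) F i = \sum_(i <- [seq i <- s | i != n]) F i.
  move=> F0; rewrite big_filter [RHS]big_mkcond; apply: eq_bigr => i _ /=.
  by case: eqP => // ->.
rewrite /quad E.
  by apply: eq_bigr => i _; rewrite E// c0 mulr0 mul0r.
by rewrite big1// => j _; rewrite r0 mulr0 mul0r.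
Qed.

(** Row and column n of the Schur complement vanish, so index n may be dropped from the test vector.
    The form of the complement is then that of X, minimized over the coordinate n. *)
Lemma psd_chol_step X n : psd X -> psd (chol_step X n).
Proof.
move=> h; have [h0|h0] := eqVneq (X n n) 0; first by rewrite (chol_step0 h h0).1.
have [e d0] := psd_diag n h.
set d := complex.Re _ in e d0.
have dn : d != 0 by apply: contra h0 => /eqP E; rewrite e E.
move=> s c us.
rewrite (@quad_rem _ s c n)//; last 2 first.
- by move=> j; have [] := chol_step_row n j h.
- by move=> j; have [] := chol_step_row n j h.
set s' := [seq i <- s | i != n].
have us' : uniq (n :: s').
  by rewrite /= filter_uniq// mem_filter /= eqxx.
pose a := \sum_(j <- s') X n j * c j.
(* The minimizing coordinate at n, obtained by completing the square with pivot d. *)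
pose c' k := if k == n then - (a * (d^-1)%:C) else c k.
have := h _ c' us'; rewrite quad_cons.
have cE : {in s', c' =1 c}.
  by move=> k; rewrite mem_filter /c' /= => /andP[/negbTE ->].
have -> : \sum_(j <- s') X n j * c' j = a.
  by rewrite /a big_seq [RHS]big_seq; apply: eq_bigr => j js; rewrite cE.
have -> : \sum_(j <- s') conjc (c' j) * X j n = conjc a.
  rewrite rmorph_sum big_seq [RHS]big_seq; apply: eq_bigr => j js.
  by rewrite cE// (psd_herm n j h) -conjcM mulrC.
rewrite (eq_quad X cE) [c' n]/c' eqxx e.
suff -> : quad (chol_step X n) s' c = quad X s' c - a * conjc a * (d^-1)%:C.
  suff -> : conjc (- (a * d^-1%:C)) * d%:C * - (a * d^-1%:C) +
     conjc (- (a * d^-1%:C)) * a + conjc a * - (a * d^-1%:C) = - (a * conjc a * (d^-1)%:C).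
    by rewrite addrC.
  have V : d%:C * (d^-1)%:C = 1 :> R[i] by rewrite -rmorphM /= mulfV.
  rewrite conjcN conjcM conjc_real.
  transitivity (conjc a * a * d^-1%:C * (d%:C * d^-1%:C) - conjc a * a * d^-1%:C
     - conjc a * a * d^-1%:C); first by ring.
  by rewrite V; ring.
transitivity (\sum_(i <- s') \sum_(j <- s') (conjc (c i) * X i j * c j -
   (conjc (X n i * c i)) * (X n j * c j) * (d^-1)%:C)).
  apply: eq_bigr => i _; apply: eq_bigr => j _.
  rewrite chol_stepE// -/d conjcM -(psd_herm n i h); ring.
under eq_bigr do rewrite big_split /= sumrN -mulr_suml -mulr_sumr.
rewrite big_split /= sumrN -!mulr_suml -/a; congr (_ - _ * _).
by rewrite -rmorph_sum mulrC.
Qed.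

(** Pivots are taken in the order of the codes of the countable index type; a code without an
    element is skipped. *)
Fixpoint chol X (k : nat) : op R I :=
  if k is k'.+1 then
    if unpickle k' is Some n then chol_step (chol X k') n else chol X k'
  else X.

Definition chol_fam X (k : nat) : I -> R[i] :=
  if unpickle k is Some n then chol_vec (chol X k) n else fun=> 0.

Lemma psd_chol X k : psd X -> psd (chol X k).
Proof.
by move=> h; elim: k => //= k IH; case: unpickle => // n; exact: psd_chol_step.
Qed.

Lemma chol_row X k n j : psd X -> (pickle n < k)%N -> chol X k n j = 0.
Proof.
move=> h; elim: k j => //= k IH j; rewrite ltnS leq_eqVlt => /orP[/eqP <-|nk].
  by rewrite pickleK; have [] := chol_step_row n j (psd_chol (pickle n) h).
case: unpickle => [m|]; last exact: IH.
by apply: chol_step_zero; [exact: psd_chol|move=> k'; exact: IH].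
Qed.

Lemma cholE X k i j : psd X ->
  X i j = chol X k i j + \sum_(l < k) chol_fam X l i * conjc (chol_fam X l j).
Proof.
move=> h; elim: k => [|k IH]; first by rewrite big_ord0 addr0.
rewrite big_ord_recr /= {1}IH /chol_fam; case: unpickle => [n|].
  by rewrite /chol_step; ring.
by rewrite mul0r addr0.
Qed.

Lemma chol_fam0 X l i : psd X -> (pickle i < l)%N -> chol_fam X l i = 0.
Proof.
move=> h il; rewrite /chol_fam; case: unpickle => // n.
by rewrite /chol_vec chol_row// mul0r.
Qed.

(** Row i is exhausted once its own code has been treated, so the factor is triangular and the sum
    over l is finite for each entry: no convergence question arises. *)
Lemma cholesky X : psd X -> exists2 L : nat -> I -> R[i],
  (forall l i, (pickle i < l)%N -> L l i = 0) &
  forall i j, X i j = csum (fun l => L l i * conjc (L l j)).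
Proof.
move=> h; exists (chol_fam X) => [l i|i j]; first exact: chol_fam0.
have [|_ ->] := @csum_finite R nat (fun l => chol_fam X l i * conjc (chol_fam X l j))
    (iota 0 (pickle i).+1) (iota_uniq _ _).
  by move=> l; rewrite mem_iota add0n /= ltnS -ltnNge => /(chol_fam0 h) ->; rewrite mul0r.
rewrite (@cholE X (pickle i).+1 i j h) chol_row// add0r.
by rewrite -(big_mkord xpredT (fun l => chol_fam X l i * conjc (chol_fam X l j))) /index_iota subn0.
Qed.

End Cholesky.

(** * Operators of the form sum_l |L_l><L_l| with summable square norms *)

Section TraceClass.
Variables (R : realType) (I : choiceType) (X : op R I) (L : nat -> I -> R[i]).
Variable T : R.
Hypothesis XE : forall i j, X i j = csum (fun l => L l i * conjc (L l j)).
Hypothesis LT : (\esum_(l in [set: nat]) sqnorm (L l) <= T%:E)%E.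

Lemma fam_sqnorm_le l : (sqnorm (L l) <= T%:E)%E.
Proof.
apply: le_trans LT; rewrite (esumID [set l]) => [|k _]; last exact: sqnorm_ge0.
rewrite setTI esum_set1 ?sqnorm_ge0// leeDl// esum_ge0// => k _; exact: sqnorm_ge0.
Qed.

Lemma fam_l2 l : l2 (L l).
Proof. by apply: le_lt_trans (fam_sqnorm_le l) _; rewrite ltry. Qed.

Lemma fam_T_ge0 : 0 <= T.
Proof. by rewrite -lee_fin; apply: le_trans LT; apply: esum_ge0 => l _; exact: sqnorm_ge0. Qed.

Lemma fam_sqn : (\esum_(l in [set: nat]) (sqn (L l))%:E <= T%:E)%E.
Proof. by under eq_esum do rewrite (sqnK (fam_l2 _)). Qed.

Lemma fam_dot phi : l2 phi ->
  (sqnorm (fun l => dot (L l) phi) <= (T * sqn phi)%:E)%E.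
Proof.
move=> h; apply: (@le_trans _ _ (\esum_(l in [set: nat]) (sqn phi * sqn (L l))%:E)%E).
  apply: le_esum => l _; rewrite lee_fin -cabs_sq -!nrm_sq -exprMn.
  rewrite ler_pXn2r ?nnegrE ?cabs_ge0 ?mulr_ge0 ?nrm_ge0// mulrC.
  by apply: dot_le => //; exact: fam_l2.
rewrite esum_scale ?sqn_ge0//; last by move=> l; exact: sqn_ge0.
by rewrite muleC EFinM lee_wpmul2r ?lee_fin ?sqn_ge0// fam_sqn.
Qed.

Lemma fam_dot_l2 phi : l2 phi -> l2 (fun l => dot (L l) phi).
Proof. by move=> h; apply: le_lt_trans (fam_dot h) _; rewrite ltry. Qed.

(** With the Hilbert-Schmidt map V phi = (<L_l|phi>)_l this is <V phi|V psi>: the operator X is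
    V^dagger V. *)
Definition fam_form (phi psi : I -> R[i]) : R[i] :=
  dot (fun l => dot (L l) phi) (fun l => dot (L l) psi).

Lemma fam_bounded_form : bounded_form fam_form T.
Proof.
split.
- move=> c phi phi' psi h1 h2 h3; rewrite /fam_form.
  have -> : (fun l => dot (L l) (fun i => c * phi i + phi' i)) =
     (fun l => c * dot (L l) phi + dot (L l) phi').
    by apply/funext => l; rewrite dot_linr//; exact: fam_l2.
  by rewrite dot_linl//; exact: fam_dot_l2.
- move=> c phi psi psi' h1 h2 h3; rewrite /fam_form.
  have -> : (fun l => dot (L l) (fun i => c * psi i + psi' i)) =
     (fun l => c * dot (L l) psi + dot (L l) psi').
    by apply/funext => l; rewrite dot_linr//; exact: fam_l2.
  by rewrite dot_linr//; exact: fam_dot_l2.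
- move=> phi psi h1 h2.
  apply: le_trans (dot_le (fam_dot_l2 h1) (fam_dot_l2 h2)) _.
  have b chi : l2 chi -> nrm (fun l => dot (L l) chi) <= Num.sqrt T * nrm chi.
    move=> h; rewrite /nrm -sqrtrM ?fam_T_ge0// ler_wsqrtr// -lee_fin sqnK.
      exact: fam_dot.
    exact: fam_dot_l2.
  rewrite -[X in X * nrm phi](sqr_sqrtr fam_T_ge0) expr2 -!mulrA.
  rewrite [X in _ <= _ * X]mulrCA [X in _ <= X]mulrA.
  by rewrite ler_pM ?nrm_ge0 ?b.
Qed.

Lemma fam_formE : form_op fam_form = X.
Proof.
apply/funext => i; apply/funext => j; rewrite /form_op XE /fam_form /dot.
congr csum; apply/funext => l.
rewrite -!/(dot _ _) (dot_conj (l2_ebase R i) (fam_l2 l)) conjcK.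
by rewrite (dot_conj (l2_ebase R j) (fam_l2 l)) !dot_ebase.
Qed.

Lemma fam_bounded : bounded X.
Proof. by rewrite -fam_formE; exact: form_bounded fam_bounded_form. Qed.

Lemma fam_dotE phi psi : l2 phi -> l2 psi ->
  dot phi (apply X psi) = fam_form phi psi.
Proof.
by move=> h1 h2; rewrite -{1}fam_formE (form_dot fam_bounded_form h1 h2).2.
Qed.

Lemma fam_expectation phi : l2 phi ->
  Defs.expectation X phi = (sqn (fun l => dot (L l) phi))%:C.
Proof. by move=> h; rewrite /Defs.expectation fam_dotE// /fam_form dot_self. Qed.

Lemma fam_expectation_ge0 phi : l2 phi -> 0 <= Defs.expectation X phi.
Proof. by move=> h; rewrite fam_expectation// ler0c sqn_ge0. Qed.

Lemma fam_expectation_le phi : l2 phi ->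
  complex.Re (Defs.expectation X phi) <= T * sqn phi.
Proof.
move=> h; rewrite fam_expectation//= -lee_fin sqnK; first exact: fam_dot.
exact: fam_dot_l2.
Qed.

(** Two interchanges of sums, both dominated by multiples of sum_l |L_l|^2: over (l, p) through the
    norm of Y, and over (l, q) at fixed p through the norm of row p of Y. *)
Lemma fam_trace (Y : op R I) : bounded Y ->
  [/\ csummable (fun l => dot (L l) (apply Y (L l))) &
      tr (opmul Y X) = csum (fun l => dot (L l) (apply Y (L l)))].
Proof.
move=> hY; have [K K0 hK] := bounded_nrm hY.
have fin (a : R) : 0 <= a -> (\esum_(l in [set: nat]) (a * sqn (L l))%:E < +oo)%E.
  move=> a0; rewrite esum_scale//; last by move=> l; exact: sqn_ge0.
  rewrite lte_mul_pinfty ?lee_fin//.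
  by apply: le_lt_trans fam_sqn _; rewrite ltry.
have sp : csummable (fun p : nat * I => apply Y (L p.1) p.2 * conjc (L p.1 p.2)).
  apply: csummable_pair (fin K K0) => l /=.
  apply: le_trans (asum_mul _ _) _.
  - by apply: l2_apply => //; exact: fam_l2.
  - by apply: l2_conj; exact: fam_l2.
  rewrite lee_fin nrm_conj -nrm_sq expr2 mulrA ler_wpM2r ?nrm_ge0// hK//.
  exact: fam_l2.
have E l : dot (L l) (apply Y (L l)) = csum (fun p => apply Y (L l) p * conjc (L l p)).
  by rewrite /dot; congr csum; apply/funext => p; rewrite mulrC.
split; first by under eq_fun do rewrite E; have [] := csum_pair sp.
under [in RHS]eq_fun do rewrite E.
rewrite (csum_swap (f := fun l p => apply Y (L l) p * conjc (L l p)) sp).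
congr csum; apply/funext => p; rewrite /opmul.
under eq_fun do rewrite XE.
have hr := bounded_row p hY.
have bp l : cabs (L l p) <= nrm (L l).
  rewrite -(dot_ebase p (L l)) -[leRHS]mul1r -(nrm_ebase R p).
  by apply: dot_le; [exact: l2_ebase|exact: fam_l2].
have sq : csummable (fun q : nat * I => Y p q.2 * L q.1 q.2 * conjc (L q.1 p)).
  apply: (@csummable_pair R nat I _ (fun l => nrm (Y p) * sqn (L l))) => [l /=|]; last first.
    by apply: fin; exact: nrm_ge0.
  rewrite /asum; under eq_esum do rewrite cabsM mulrC cabs_conj.
  rewrite esum_scale ?cabs_ge0//; last by move=> q; exact: cabs_ge0.
  apply: (@le_trans _ _ ((nrm (L l))%:E * (nrm (Y p) * nrm (L l))%:E)%E).
    apply: lee_pmul; rewrite ?lee_fin ?cabs_ge0 ?asum_ge0//.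
    exact: asum_mul (fam_l2 l).
  by rewrite -EFinM lee_fin -nrm_sq expr2 mulrCA.
have -> : (fun q => Y p q * csum (fun l => L l q * conjc (L l p))) =
  (fun q => csum (fun l => Y p q * L l q * conjc (L l p))).
  apply/funext => q; rewrite -csumZ; first by congr csum; apply/funext => l; rewrite mulrA.
  apply: (@csummable_le _ _ _ (fun l => 1 * sqn (L l))); last exact: fin.
  move=> l; rewrite cabsM cabs_conj mul1r -nrm_sq expr2 ler_pM ?cabs_ge0//.
  rewrite -(dot_ebase q (L l)) -[leRHS]mul1r -(nrm_ebase R q).
  by apply: dot_le; [exact: l2_ebase|exact: fam_l2].
rewrite -(csum_swap (f := fun l q => Y p q * L l q * conjc (L l p)) sq).
congr csum; apply/funext => l; rewrite [RHS]mulrC /apply -csumZ; last first.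
  by apply: l2_mul => //; exact: fam_l2.
by congr csum; apply/funext => q; rewrite mulrC.
Qed.

End TraceClass.

(* A positive semidefinite matrix of finite trace has a Hilbert-Schmidt
   square root in the form of its Cholesky factor. *)
Lemma psd_trace_fam (R : realType) (I : countType) (X : op R I) (T : R) : psd X ->
  (\esum_(i in [set: I]) (complex.Re (X i i))%:E = T%:E)%E ->
  exists2 L : nat -> I -> R[i],
    forall i j, X i j = csum (fun l => L l i * conjc (L l j)) &
    (\esum_(l in [set: nat]) sqnorm (L l) = T%:E)%E.
Proof.
move=> hX hT; have [L L0 XE] := cholesky hX; exists L => //.
rewrite -hT /sqnorm (esum_swap (f := fun p => sqmod (L p.1 p.2))); last first.
  by move=> p; exact: sqmod_ge0.
apply: eq_esum => i _ /=; rewrite XE.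
have -> : (fun l => L l i * conjc (L l i)) = (fun l => (sqmod (L l i))%:C).
  by apply/funext => l; rewrite mulrC mulJc.
rewrite csum_real /=; last by move=> l; exact: sqmod_ge0.
have [|hs _] := @csum_finite R nat (fun l => (sqmod (L l i))%:C)
    (iota 0 (pickle i).+1) (iota_uniq _ _).
  move=> l; rewrite mem_iota add0n /= ltnS -ltnNge => /L0 ->.
  by rewrite /sqmod /= expr0n addr0.
rewrite fineK// ge0_fin_numE; last by apply: esum_ge0 => l _; rewrite lee_fin sqmod_ge0.
apply: le_lt_trans hs; apply: le_esum => l _.
by rewrite lee_fin cabsC ler_norm.
Qed.

(** * Integration on the complex plane *)

Section LebesgueIntegration.
Context d (T : measurableType d) (R : realType) (m : {measure set T -> \bar R}).

Definition Jint (f : T -> \bar R) : \bar R := (\int[m]_t f t)%E.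

Lemma integral_integration : integration (measurable_fun [set: T]) Jint.
Proof.
split; rewrite /Jint.
- by move=> c; exact: measurable_cst.
- by move=> f g mf mg; exact: measurable_funD.
- by move=> f g mf mg; exact: measurable_funM.
- by move=> f g mf mg; exact: measurable_maxr.
- move=> f mf; apply: (measurableT_comp _ mf).
  by apply: continuous_measurable_fun; exact: sqrt_continuous.
- move=> f g mf mg f0 g0; under eq_integral do rewrite EFinD.
  rewrite ge0_integralD//.
  + by move=> t _; rewrite lee_fin.
  + exact/measurable_EFinP.
  + by move=> t _; rewrite lee_fin.
  + exact/measurable_EFinP.
- move=> c f mf c0 f0; under eq_integral do rewrite EFinM.
  rewrite ge0_integralZl_EFin//; first by move=> t _; rewrite lee_fin.
  exact/measurable_EFinP.
- move=> f g mf mg f0 fg; apply: ge0_le_integral => //.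
  + by move=> t _; rewrite lee_fin.
  + exact/measurable_EFinP.
  + exact/measurable_EFinP.
  + by move=> t _; rewrite lee_fin.
- by move=> f f0; apply: integral_ge0 => t _; rewrite lee_fin.
Qed.

Lemma Jint0 : Jint (fun=> 0%E) = 0%E.
Proof. exact: integral0. Qed.

Lemma rI_Rintegral (f : T -> R) : Rintegral m setT f = rI Jint f.
Proof. by rewrite /Rintegral integralE. Qed.

Lemma rint_integrable (f : T -> R) :
  m.-integrable setT (fun t => (f t)%:E) <-> rint (measurable_fun setT) Jint f.
Proof.
split=> [/integrableP[/measurable_EFinP mf h]|[mf h]]; first by split.
by apply/integrableP; split; first exact/measurable_EFinP.
Qed.

End LebesgueIntegration.

(** A property of the index type, so that the measurability lemmas below serve one mode ([nat]) and
    two modes ([nat * nat]) alike. *)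
Definition esum_measurable (R : realType) (I : choiceType) : Prop :=
  forall d (T : measurableType d) (h : I -> T -> \bar R),
    (forall i, measurable_fun setT (h i)) -> (forall i t, 0 <= h i t)%E ->
    measurable_fun setT (fun t => \esum_(i in [set: I]) h i t).

Lemma esum_measurable_nat (R : realType) : esum_measurable R nat.
Proof.
move=> d T h mh h0.
rewrite (_ : (fun t => _) = (fun t => (\sum_(i <oo) h i t)%E)).
  by apply: ge0_emeasurable_sum => // i t _ _; exact: h0.
by apply/funext => t; rewrite nneseries_esumT.
Qed.

Lemma esum_measurable_pair (R : realType) : esum_measurable R (nat * nat)%type.
Proof.
move=> d T h mh h0.
rewrite (_ : (fun t => _) = (fun t => \esum_(i in [set: nat]) \esum_(j in [set: nat]) h (i, j) t)).
  apply: esum_measurable_nat.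
    by move=> i; exact: (@esum_measurable_nat R _ _ (fun j t => h (i, j) t)).
  by move=> i t; apply: esum_ge0.
apply/funext => t; rewrite esum_esum//.
have -> : [set: nat] `*`` (fun=> [set: nat]) = setT by apply/seteqP; split.
by apply: eq_esum => -[].
Qed.

Section CsumMeasurable.
Context (R : realType) (I : choiceType) (hI : esum_measurable R I).
Context d (T : measurableType d).
Local Notation cmeasT := (cmeas (measurable_fun [set: T])).

Lemma rsum_measurable (f : I -> T -> R) :
  (forall i, measurable_fun setT (f i)) -> measurable_fun setT (fun t => rsum (f^~ t)).
Proof.
move=> mf; apply: measurableT_comp; first exact: fine_measurable.
apply: emeasurable_funB; apply: hI => [i|i t]; rewrite ?rposE ?rnegE ?lee_fin ?rpos_ge0 ?rneg_ge0//.
  rewrite (_ : (fun t => _) = (fun t => (Num.max (f i t) 0)%:E)).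
    by apply/measurable_EFinP; exact: measurable_maxr.
  by apply/funext => t; rewrite rposE.
rewrite (_ : (fun t => _) = (fun t => (Num.max (- f i t) 0)%:E)).
  apply/measurable_EFinP; apply: measurable_maxr => //.
  by apply: measurableT_comp => //; exact: oppr_measurable.
by apply/funext => t; rewrite rnegE.
Qed.

Lemma cmeas_csum (f : I -> T -> R[i]) :
  (forall i, cmeasT (f i)) -> cmeasT (fun t => csum (f^~ t)).
Proof.
move=> mf; split.
  by apply: (@rsum_measurable (fun i t => complex.Re (f i t))) => i; exact: (mf i).1.
by apply: (@rsum_measurable (fun i t => complex.Im (f i t))) => i; exact: (mf i).2.
Qed.

Lemma cmeas_mul (f g : T -> R[i]) : cmeasT f -> cmeasT g -> cmeasT (fun t => f t * g t).
Proof.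
move=> [f1 f2] [g1 g2]; split.
  under eq_fun do rewrite ReM.
  by apply: measurable_funB; exact: measurable_funM.
under eq_fun do rewrite ImM.
by apply: measurable_funD; exact: measurable_funM.
Qed.

Lemma cmeas_dot (phi psi : T -> I -> R[i]) :
  (forall i, cmeasT (phi^~ i)) -> (forall i, cmeasT (psi^~ i)) ->
  cmeasT (fun t => dot (phi t) (psi t)).
Proof.
move=> m1 m2; apply: (cmeas_csum (f := fun i t => conjc (phi t i) * psi t i)) => i.
apply: cmeas_mul => //; split; first by under eq_fun do rewrite Re_conj; exact: (m1 i).1.
under eq_fun do rewrite Im_conj.
by apply: measurableT_comp; last exact: (m1 i).2.
Qed.

Lemma cmeas_apply (A : T -> op R I) (psi : T -> I -> R[i]) i :
  (forall i j, cmeasT (fun t => A t i j)) -> (forall i, cmeasT (psi^~ i)) ->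
  cmeasT (fun t => apply (A t) (psi t) i).
Proof.
by move=> m1 m2; apply: (cmeas_csum (f := fun j t => A t i j * psi t j)) => j;
  exact: cmeas_mul.
Qed.

End CsumMeasurable.

Lemma integral_esum d (T : measurableType d) (R : realType)
    (m : {measure set T -> \bar R}) (h : nat -> T -> \bar R) :
  (forall i, measurable_fun setT (h i)) -> (forall i t, 0 <= h i t)%E ->
  (\int[m]_t (\esum_(i in [set: nat]) h i t) = \esum_(i in [set: nat]) (\int[m]_t h i t))%E.
Proof.
move=> mh h0; rewrite -nneseries_esumT//; last by move=> i; exact: integral_ge0.
rewrite -integral_nneseries//.
by apply: eq_integral => t _; rewrite nneseries_esumT.
Qed.

(** * Affine changes of variable *)

Section Affine1.
Variable R : realType.
Local Notation leb := (@lebesgue_measure R).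

Let aff (a b : R) (x : measurableTypeR R) : measurableTypeR R := a * x + b.

Let maff a b : measurable_fun setT (aff a b).
Proof. by apply: measurable_funD => //; exact: measurable_funM. Qed.

(** The image of Lebesgue measure under x -> a x + b, multiplied by a, agrees with Lebesgue measure
    on half-open intervals, hence on all measurable sets. *)
Let integral_aff_gt0 (a b : R) (f : measurableTypeR R -> \bar R) : 0 < a ->
  measurable_fun setT f -> (forall x, 0 <= f x)%E ->
  (\int[leb]_x f (a * x + b)%R = (a^-1)%:E * \int[leb]_x f x)%E.
Proof.
move=> a0 mf f0.
pose nuf : {measure set (measurableTypeR R) -> \bar R} := pushforward leb (aff a b).
pose nu0 := nuf (maff a b).
pose nu := mscale (NngNum (ltW a0)) nu0.
have E A : measurable A -> leb A = nu A.
  apply: lebesgue_measure_unique => _ [[u v] _ <-].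
  have P : aff a b @^-1` `]u, v] = `](u - b) / a, (v - b) / a]%classic.
    by apply/seteqP; split => x /=; rewrite !in_itv /= /aff
      ltr_pdivrMr// ler_pdivlMr// ltrBlDr lerBrDr mulrC.
  rewrite [RHS](_ : _ = (a%:E * leb (aff a b @^-1` `]u, v]))%E)// P.
  rewrite !lebesgue_measure_itv /= !lte_fin ltr_pM2r ?invr_gt0// ltrD2r.
  case: ifP => _; last by rewrite mule0.
  by rewrite -!EFinB -EFinM -mulrBl opprB addrA subrK mulrCA divff ?mulr1// gt_eqF.
have -> : (\int[leb]_x f x = a%:E * \int[leb]_x f (a * x + b)%R)%E.
  rewrite (eq_measure_integral nu) => [|A mA _]; last exact: E.
  by rewrite ge0_integral_mscale//= ge0_integral_pushforward.
by rewrite muleA -EFinM mulVf ?mul1e// gt_eqF.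
Qed.

Let integral_opp (f : measurableTypeR R -> \bar R) : measurable_fun setT f -> (forall x, 0 <= f x)%E ->
  (\int[leb]_x f (- x)%R = \int[leb]_x f x)%E.
Proof.
move=> mf f0.
pose oppT := (-%R : measurableTypeR R -> measurableTypeR R).
pose nuf : {measure set (measurableTypeR R) -> \bar R} := pushforward leb oppT.
have mo : measurable_fun setT oppT by exact: oppr_measurable.
pose nu0 := nuf mo.
rewrite [RHS](eq_measure_integral nu0) => [|A mA _].
  by rewrite ge0_integral_pushforward//; exact: oppr_measurable.
exact/esym/lebesgue_measureN.
Qed.

Lemma integral_affine (a b : R) (f : measurableTypeR R -> \bar R) : a != 0 ->
  measurable_fun setT f -> (forall x, 0 <= f x)%E ->
  (\int[leb]_x f (a * x + b)%R = (`|a|^-1)%:E * \int[leb]_x f x)%E.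
Proof.
move=> a0 mf f0; have [ap|an] := ltP 0 a.
  by rewrite integral_aff_gt0// gtr0_norm.
have an' : 0 < - a by rewrite oppr_gt0 lt_neqAle a0.
rewrite ltr0_norm -?oppr_gt0// -(integral_aff_gt0 b an' mf f0).
rewrite -[RHS]integral_opp//.
- by apply: eq_integral => x _; rewrite mulrNN.
- by apply: (measurableT_comp mf); exact: maff.
Qed.

End Affine1.

Local Notation plane R := ((@lebesgue_measure R) \x (@lebesgue_measure R))%E.

Section Plane.
Variable R : realType.
Local Notation leb := (@lebesgue_measure R).

Definition toC (p : measurableTypeR R * measurableTypeR R) : R[i] := p.1 +i* p.2.

Definition Lint (f : R[i] -> \bar R) : \bar R := Jint (plane R) (fun p => f (toC p)).

Definition emeasC (f : R[i] -> \bar R) : Prop := measurable_fun [set: measurableTypeR R * measurableTypeR R] (fun p => f (toC p)).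
Definition cmeasC (f : R[i] -> R[i]) : Prop :=
  cmeas (measurable_fun [set: measurableTypeR R * measurableTypeR R]) (fun p => f (toC p)).

Lemma cintE (f : R[i] -> R[i]) : cint f = cI (Jint (plane R)) (fun p => f (toC p)).
Proof. by rewrite /cint /cI !rI_Rintegral. Qed.

Lemma cintegrableP (f : R[i] -> R[i]) :
  cintegrable f <-> cint_able (measurable_fun [set: measurableTypeR R * measurableTypeR R]) (Jint (plane R)) (fun p => f (toC p)).
Proof.
have HP := integral_integration (plane R).
split=> [[/rint_integrable h1 /rint_integrable h2]|h]; first exact: (cint_able_ReIm HP).
by split; apply/rint_integrable; [exact: (cint_able_Re HP h)|exact: (cint_able_Im HP h)].
Qed.

(** The dilation is real, so by Tonelli it acts on the two coordinates separately, each contributing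
    a factor 1 / |a|. *)
Lemma Lint_affine (a : R) (b : R[i]) (f : R[i] -> \bar R) : a != 0 ->
  emeasC f -> (forall z, 0 <= f z)%E ->
  Lint (fun z => f (a%:C * z + b)) = ((a ^+ 2)^-1%:E * Lint f)%E.
Proof.
case: b => b1 b2 a0 mf f0; rewrite /Lint /Jint.
have maff (c : R) : measurable_fun [set: measurableTypeR R] (fun x : measurableTypeR R => (a * x + c : measurableTypeR R)).
  by apply: measurable_funD => //; exact: measurable_funM.
have mg : measurable_fun [set: measurableTypeR R * measurableTypeR R] (fun p => f (a%:C * toC p + b1 +i* b2)).
  rewrite (_ : (fun p => _) = (fun p => f (toC p)) \o (fun p => (a * p.1 + b1, a * p.2 + b2))).
    apply: measurableT_comp => //; apply: measurable_fun_pair.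
      by apply: (measurableT_comp (maff b1)).
    by apply: (measurableT_comp (maff b2)).
  apply/funext => -[x y] /=; congr f; rewrite /toC /=; simpc.
  by rewrite ?mul0r ?subr0 ?addr0.
rewrite (fubini_tonelli1 (fun p => f (a%:C * toC p + b1 +i* b2)))//.
rewrite (fubini_tonelli1 (fun p => f (toC p)))// /fubini_F.
have mfx x : measurable_fun [set: measurableTypeR R] (fun y : measurableTypeR R => f (toC (x, y))).
  by apply: (measurableT_comp mf); exact: measurable_pair1.
transitivity (\int[leb]_x ((`|a|^-1)%:E * \int[leb]_y f (toC ((a * x + b1)%R, y))))%E.
  apply: eq_integral => x _; rewrite -(@integral_affine _ a b2)//.
  apply: eq_integral => y _; congr f; rewrite /toC /=; simpc.
  by rewrite ?mul0r ?subr0 ?addr0.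
have mF := measurable_fun_fubini_tonelli_F (m2 := leb) (fun p => f (toC p)) mf (fun p => f0 (toC p)).
rewrite ge0_integralZl_EFin//; last 2 first.
- by move=> x _; exact: integral_ge0.
- by have := measurableT_comp mF (maff b1).
rewrite (integral_affine b1 a0 mF); last by move=> x; exact: integral_ge0.
by rewrite muleA -EFinM -invfM -normrM -expr2 ger0_norm ?sqr_ge0.
Qed.

Lemma cint_translate (b : R[i]) (f : R[i] -> R[i]) : cmeasC f ->
  cint (fun z => f (z + b)) = cint f.
Proof.
move=> [m1 m2]; rewrite !cintE.
have L1 (g : R[i] -> \bar R) : emeasC g -> (forall z, 0 <= g z)%E ->
    Jint (plane R) (fun p => g (toC p + b)) = Jint (plane R) (fun p => g (toC p)).
  move=> mg g0; have := Lint_affine b (oner_neq0 R) mg g0.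
  rewrite expr1n invr1 mul1e /Lint => <-.
  by congr Jint; apply/funext => p; rewrite mul1r.
have L2 (g : R[i] -> R) : measurable_fun setT (fun p => g (toC p)) ->
   rI (Jint (plane R)) (fun p => g (toC p + b)) = rI (Jint (plane R)) (fun p => g (toC p)).
  move=> mg; rewrite /rI !rposE !rnegE; congr (fine (_ - _)%E).
    apply: (L1 (fun z => (Num.max (g z) 0)%:E)) => [|z]; last by rewrite lee_fin le_max lexx orbT.
    by apply/measurable_EFinP; exact: measurable_maxr.
  apply: (L1 (fun z => (Num.max (- g z) 0)%:E)) => [|z]; last by rewrite lee_fin le_max lexx orbT.
  apply/measurable_EFinP; apply: measurable_maxr => //.
  by apply: measurableT_comp => //; exact: oppr_measurable.
by rewrite /cI (L2 (fun z => complex.Re (f z)))// (L2 (fun z => complex.Im (f z))).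
Qed.

Local Notation RR := (measurableTypeR R * measurableTypeR R)%type.

Lemma plane_sigma_finite : sigma_finite [set: RR] (leb \x leb)%E.
Proof.
have /sigma_finiteP[F [TF ndF Foo]] := sigma_finiteT leb.
exists (fun n => F n `*` F n) => [|k].
  rewrite -setXTT TF predeqE => -[x y]; split.
    move=> [/= [n _ Fnx] [k _ Gky]]; exists (maxn n k) => //; split.
      by move: x Fnx; exact/subsetPset/ndF/leq_maxl.
    by move: y Gky; exact/subsetPset/ndF/leq_maxr.
  by move=> [n _ []/= ? ?]; split; exists n.
have [? ?] := Foo k; split; first exact: measurableX.
by rewrite product_measure1E// lte_mul_pinfty// ge0_fin_numE.
Qed.

(* The library instance for products is not found on [leb \x leb]. *)
Let planeM : {sigma_finite_measure set RR -> \bar R} :=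
  HB.pack_for {sigma_finite_measure set RR -> \bar R} (leb \x leb)%E
    (Measure_isSigmaFinite.Build _ _ _ (leb \x leb)%E plane_sigma_finite).

Lemma Lint_swap (F : R[i] -> R[i] -> \bar R) :
  measurable_fun [set: (measurableTypeR R * measurableTypeR R) * (measurableTypeR R * measurableTypeR R)] (fun q => F (toC q.1) (toC q.2)) ->
  (forall z w, 0 <= F z w)%E ->
  Lint (fun z => Lint (fun w => F z w)) = Lint (fun w => Lint (fun z => F z w)).
Proof.
move=> mF F0; rewrite /Lint /Jint.
have := fubini_tonelli (m1 := planeM) (m2 := planeM) (fun q => F (toC q.1) (toC q.2))
  mF (fun q => F0 (toC q.1) (toC q.2)).
exact.
Qed.

Lemma Lint_ge0 f : (forall z, 0 <= f z)%E -> (0 <= Lint f)%E.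
Proof. by move=> f0; apply: integral_ge0. Qed.

End Plane.

(** * Existence of dominated weak integrals *)

Section WeakIntegral.
Variables (R : realType) (I : choiceType) (w : R[i] -> op R I) (M : R).
Hypothesis wb : forall z, bounded (w z).
Hypothesis wm : forall phi psi, l2 phi -> l2 psi ->
  cmeasC (fun z => dot phi (apply (w z) psi)).
Hypothesis wle : forall phi psi, l2 phi -> l2 psi ->
  (Lint (fun z => (cabs (dot phi (apply (w z) psi)))%:E) <=
     (M * nrm phi * nrm psi)%:E)%E.

Let HP := integral_integration (plane R).

Definition weak_form (phi psi : I -> R[i]) : R[i] :=
  cint (fun z => dot phi (apply (w z) psi)).

Lemma weak_form_able phi psi : l2 phi -> l2 psi ->
  cint_able (measurable_fun [set: measurableTypeR R * measurableTypeR R]) (Jint (plane R))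
    (fun p => dot phi (apply (w (toC p)) psi)).
Proof.
by move=> h1 h2; split; [exact: wm|apply: le_lt_trans (wle h1 h2) _; rewrite ltry].
Qed.

Lemma weak_bounded_form : bounded_form weak_form M.
Proof.
split.
- move=> c phi phi' psi h1 h2 h3; rewrite /weak_form !cintE.
  have e1 := weak_form_able h1 h3; have e2 := weak_form_able h2 h3.
  have := cID HP (cint_ableZ HP (conjc c) e1) e2; rewrite (cIZ HP (conjc c) e1) => <-.
  by congr cI; apply/funext => p; rewrite dot_linl//; exact: l2_apply.
- move=> c phi psi psi' h1 h2 h3; rewrite /weak_form !cintE.
  have e1 := weak_form_able h1 h2; have e2 := weak_form_able h1 h3.
  have := cID HP (cint_ableZ HP c e1) e2; rewrite (cIZ HP c e1) => <-.
  congr cI; apply/funext => p; rewrite apply_linr// dot_linr//; exact: l2_apply.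
- move=> phi psi h1 h2; rewrite /weak_form cintE.
  have e := weak_form_able h1 h2.
  apply: le_trans (cI_norm HP e) _; rewrite -lee_fin fineK; first exact: wle.
  by apply: (Jr_fin HP) e.2 => p; exact: cabs_ge0.
Qed.

Lemma weak_int_exists : is_weak_int w (form_op weak_form).
Proof.
split; first exact: form_bounded weak_bounded_form.
move=> phi psi h1 h2; split; first by apply/cintegrableP; exact: weak_form_able.
exact: (form_dot weak_bounded_form h1 h2).2.
Qed.

(** The choice made in [weak_int] falls on a genuine integral because the bounded form of the
    averaged matrix elements supplies one. *)
Lemma weak_int_is : is_weak_int w (weak_int w).
Proof. by rewrite /weak_int; apply: xgetPex; exists (form_op weak_form); exact: weak_int_exists. Qed.

Lemma weak_intE : weak_int w = form_op weak_form.
Proof.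
have [_ h] := weak_int_is.
apply/funext => i; apply/funext => j; rewrite -(form_opK (weak_int w)) /form_op.
by have [_ ->] := h (ebase R i) (ebase R j) (l2_ebase R i) (l2_ebase R j).
Qed.

Lemma weak_int_dot phi psi : l2 phi -> l2 psi ->
  dot phi (apply (weak_int w) psi) = cint (fun z => dot phi (apply (w z) psi)).
Proof. by move=> h1 h2; have [_ h] := weak_int_is; have [_ ->] := h phi psi h1 h2. Qed.

Lemma weak_int_bounded : bounded (weak_int w).
Proof. by have [] := weak_int_is. Qed.

End WeakIntegral.

(** * Closure properties of measurable complex functions *)

Section MeasClosure.
Context d (T : measurableType d) (R : realType).
Local Notation cm := (cmeas (measurable_fun [set: T])).

(** Measurability does not depend on the measure; the zero measure merely instantiates the general
    closure lemmas. *)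
Let HT := integral_integration (mzero : {measure set T -> \bar R}).

Lemma cm_cst (c : R[i]) : cm (fun=> c). Proof. exact: (cmeas_cst HT). Qed.

Lemma cm_add (f g : T -> R[i]) : cm f -> cm g -> cm (fun t => f t + g t).
Proof. exact: (cmeasD HT). Qed.

Lemma cm_mul (f g : T -> R[i]) : cm f -> cm g -> cm (fun t => f t * g t).
Proof. exact: cmeas_mul. Qed.

Lemma cm_conj (f : T -> R[i]) : cm f -> cm (fun t => conjc (f t)).
Proof. exact: (cmeas_conj HT). Qed.

Lemma cm_real (f : T -> R) : measurable_fun setT f -> cm (fun t => (f t)%:C).
Proof. exact: (cmeas_real HT). Qed.

Lemma cm_pow (f : T -> R[i]) n : cm f -> cm (fun t => f t ^+ n).
Proof.
move=> mf; elim: n => [|n IH]; first by under eq_fun do rewrite expr0; exact: cm_cst.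
by under eq_fun do rewrite exprS; exact: cm_mul.
Qed.

Lemma cm_cabs (f : T -> R[i]) : cm f -> measurable_fun setT (fun t => cabs (f t)).
Proof. exact: (meas_cabs HT). Qed.

Lemma cm_sqmod (f : T -> R[i]) : cm f -> measurable_fun setT (fun t => sqmod (f t)).
Proof. exact: (meas_sqmod HT). Qed.

Lemma meas_exp (f : T -> R) : measurable_fun setT f -> measurable_fun setT (fun t => expR (f t)).
Proof. by move=> mf; apply: (measurableT_comp (@measurable_expR R) mf). Qed.

Lemma meas_gauss (t : R) (f : T -> R[i]) : cm f -> measurable_fun setT (fun x => gauss t (f x)).
Proof.
move=> mf; rewrite /gauss.
apply: measurable_funM => //; apply: measurable_funM => //.
apply: meas_exp; apply: measurable_funM => //; exact: cm_sqmod.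
Qed.

Lemma cm_coherent (f : T -> R[i]) n : cm f -> cm (fun t => coherent (f t) n).
Proof.
move=> mf; apply: cm_mul; last exact: cm_pow.
apply: cm_real; apply: measurable_funM => //; apply: meas_exp.
apply: measurable_funM => //; apply: measurableT_comp; first exact: oppr_measurable.
exact: cm_sqmod.
Qed.

End MeasClosure.

Section PlaneMeas.
Variable R : realType.
Local Notation RR := (measurableTypeR R * measurableTypeR R)%type.

Lemma cm_toC : cmeas (measurable_fun [set: RR]) (@toC R).
Proof. by split => /=; [exact: measurable_fst|exact: measurable_snd]. Qed.

Lemma cm_toC1 : cmeas (measurable_fun [set: (RR * RR)%type]) (fun q => toC q.1).
Proof.
split => /=.
  by apply: (measurableT_comp measurable_fst); exact: measurable_fst.
by apply: (measurableT_comp measurable_snd); exact: measurable_fst.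
Qed.

Lemma cm_toC2 : cmeas (measurable_fun [set: (RR * RR)%type]) (fun q => toC q.2).
Proof.
split => /=.
  by apply: (measurableT_comp measurable_fst); exact: measurable_snd.
by apply: (measurableT_comp measurable_snd); exact: measurable_snd.
Qed.

End PlaneMeas.

(** * Gaussian moments and coherent states *)

Section Derivatives.
Variable R : realType.
Implicit Types (f g : R -> R) (x a b c : R).

Lemma dv_eq f x a b : is_derive x 1 f a -> a = b -> is_derive x 1 f b.
Proof. by move=> h <-. Qed.

Lemma dv_add f g x a b : is_derive x 1 f a -> is_derive x 1 g b ->
  is_derive x 1 (fun t => f t + g t) (a + b).
Proof. by move=> h1 h2; exact: is_deriveD. Qed.

Lemma dv_opp f x a : is_derive x 1 f a -> is_derive x 1 (fun t => - f t) (- a).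
Proof. by move=> h1; exact: is_deriveN. Qed.

Lemma dv_mul f g x a b : is_derive x 1 f a -> is_derive x 1 g b ->
  is_derive x 1 (fun t => f t * g t) (a * g x + f x * b).
Proof.
move=> h1 h2; apply: (dv_eq (is_deriveM h1 h2)).
by rewrite /GRing.scale /= addrC (mulrC a).
Qed.

Lemma dv_cst c x : is_derive x 1 (fun _ : R => c) 0.
Proof. exact: is_derive_cst. Qed.

Lemma dv_id x : is_derive x 1 (fun t : R => t) 1.
Proof. exact: is_derive_id. Qed.

Lemma dv_pow f x a n : is_derive x 1 f a ->
  is_derive x 1 (fun t => f t ^+ n) (n%:R * f x ^+ n.-1 * a).
Proof.
move=> h; elim: n => [|n IH].
  under eq_fun do rewrite expr0.
  by rewrite !mul0r; exact: dv_cst.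
under eq_fun do rewrite exprS.
apply: (dv_eq (dv_mul h IH)).
case: n {IH} => [|n] /=; first by rewrite expr0; ring.
by rewrite [f x ^+ n.+1]exprS [n.+2%:R]mulrS; ring.
Qed.

Lemma dv_comp f g x a b : is_derive x 1 g b -> is_derive (g x) 1 f a ->
  is_derive x 1 (fun t => f (g t)) (b * a).
Proof. by move=> h1 h2; rewrite mulrC; exact: (is_derive1_comp h2 h1). Qed.

Lemma dv_exp g x b : is_derive x 1 g b ->
  is_derive x 1 (fun t => expR (g t)) (b * expR (g x)).
Proof. by move=> h; apply: dv_comp h _. Qed.

Lemma dv_continuous f f' : (forall x, is_derive x 1 f (f' x)) -> continuous f.
Proof.
move=> h x; apply: differentiable_continuous; apply/derivable1_diffP.
by case: (h x).
Qed.

End Derivatives.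

(** * Moments of the real Gaussian *)

Section GaussianMoments.
Variable R : realType.
Local Notation leb := (@lebesgue_measure R).

Lemma poly_le_exp (k : nat) : exists2 C : R, 0 <= C &
  forall s : R, 0 <= s -> (1 + s) ^+ k <= C * expR (s / 2).
Proof.
(* From 1 + s <= a exp(s / a), the k-th power costs exp(k s / a), and k / a <= 1/2 for this a. *)
pose a : R := 2 * k.+1%:R; have a0 : 0 < a by rewrite mulr_gt0 ?ltr0n.
have a1 : 1 <= a by rewrite /a -[leLHS]mulr1 ler_pM ?ler1n.
exists (a ^+ k) => [|s s0]; first by rewrite exprn_ge0 ?ltW.
have h : 1 + s <= a * expR (s / a).
  have := expR_ge1Dx (s / a); rewrite -(ler_pM2l a0) => /(le_trans _); apply.
  by rewrite mulrDr mulr1 mulrCA divff ?gt_eqF// mulr1 lerD2r.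
have : (1 + s) ^+ k <= (a * expR (s / a)) ^+ k.
  by rewrite lerXn2r ?nnegrE ?addr_ge0 ?mulr_ge0 ?expR_ge0 ?(ltW a0).
move=> /le_trans; apply; rewrite exprMn ler_wpM2l ?exprn_ge0 ?(ltW a0)//.
rewrite -expRM_natl ler_expR /a -mulr_natl mulrA.
rewrite mulr1 ler_pdivrMr ?mulr_gt0 ?ltr0n//.
rewrite (_ : s / 2 * (2 * k.+1%:R) = k.+1%:R * s); last by field.
by rewrite ler_wpM2r// ler_nat.
Qed.

Lemma pow_le_poly (x : R) k : `|x| ^+ k <= (1 + x ^+ 2) ^+ k.
Proof.
apply: lerXn2r; rewrite ?nnegrE ?addr_ge0 ?sqr_ge0//.
rewrite -[x ^+ 2]real_normK ?num_real//; set t := `|x|.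
have := sqr_ge0 (t - 1); have t0 : 0 <= t by exact: normr_ge0.
nra.
Qed.

Let gauss_half_integral : (\int[leb]_x (expR (- (x ^+ 2 / 2)))%:E < +oo)%E.
Proof.
have s2 : (Num.sqrt 2)^-1 != 0 :> R by rewrite invr_eq0 sqrtr_eq0 -ltNge.
have m : measurable_fun [set: measurableTypeR R] (fun x : measurableTypeR R => (gauss_fun x)%:E).
  by apply/measurable_EFinP; exact: measurable_gauss_fun.
have := integral_affine 0 s2 m (fun x => gauss_fun_ge0 x).
rewrite integralT_gauss => E.
rewrite (_ : (\int[leb]_x _)%E = (\int[leb]_x (gauss_fun ((Num.sqrt 2)^-1 * x + 0))%:E)%E).
  by rewrite E -EFinM ltry.
apply: eq_integral => x _; rewrite /gauss_fun addr0 exprMn exprVn sqr_sqrtr//.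
by rewrite mulrC.
Qed.

Definition mom_fun (k : nat) (x : R) : R := x ^+ k * expR (- x ^+ 2).

Let mom_meas k : measurable_fun [set: measurableTypeR R] (mom_fun k).
Proof.
apply: measurable_funM; first exact: exprn_measurable.
by apply: meas_exp; apply: measurableT_comp; [exact: oppr_measurable|exact: exprn_measurable].
Qed.

Let mom_bound k : exists2 C : R, 0 <= C &
  forall x, `|mom_fun k x| <= C * expR (- (x ^+ 2 / 2)).
Proof.
have [C C0 hC] := poly_le_exp k; exists C => // x.
rewrite normrM normrX (ger0_norm (expR_ge0 _)).
apply: (@le_trans _ _ (C * expR (x ^+ 2 / 2) * expR (- x ^+ 2))).
  rewrite ler_wpM2r ?expR_ge0// (le_trans (pow_le_poly _ _))// hC//.
  exact: sqr_ge0.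
by rewrite -mulrA -expRD ler_wpM2l// ler_expR; lra.
Qed.

Lemma mom_integrable k : leb.-integrable setT (fun x => (mom_fun k x)%:E).
Proof.
have [C C0 hC] := mom_bound k.
have mexp : measurable_fun [set: measurableTypeR R] (fun x : measurableTypeR R => expR (- (x ^+ 2 / 2))).
  apply: meas_exp; apply: measurableT_comp; first exact: oppr_measurable.
  by apply: measurable_funM => //; exact: exprn_measurable.
apply/integrableP; split; first by apply/measurable_EFinP; exact: mom_meas.
apply: (@le_lt_trans _ _ (\int[leb]_x (C * expR (- (x ^+ 2 / 2)))%:E)%E).
  apply: ge0_le_integral => //.
  - by apply/measurable_EFinP; apply: measurableT_comp => //; exact: mom_meas.
  - by apply/measurable_EFinP; apply: measurable_funM => //; exact: mexp.
  - by move=> x _; rewrite /= lee_fin hC.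
under eq_integral do rewrite EFinM.
rewrite ge0_integralZl_EFin//.
  by apply: lte_mul_pinfty gauss_half_integral; rewrite ?lee_fin.
by apply/measurable_EFinP; exact: mexp.
Qed.

Definition mom k : R := \int[leb]_x (mom_fun k x).

Lemma mom0 : mom 0 = Num.sqrt pi.
Proof.
rewrite /mom /Rintegral (_ : (\int[leb]_x _)%E = (Num.sqrt pi)%:E)//.
rewrite -integralT_gauss; apply: eq_integral => x _.
by rewrite /mom_fun expr0 mul1r.
Qed.

Let mom_deriv k (x : R) :
  is_derive x 1 (mom_fun k) (k%:R * mom_fun k.-1 x - 2 * mom_fun k.+1 x).
Proof.
have h := dv_mul (dv_pow k (dv_id x)) (dv_exp (dv_opp (dv_pow 2 (dv_id x)))).
apply: dv_eq h _; rewrite /mom_fun /= [x ^+ k.+1]exprS; ring.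
Qed.

(** The boundary terms of the integration by parts: x times [mom_fun k] is the next moment function,
    which is bounded, so the decay is at least C / |x|. *)
Let mom_fun_cvg k : (fun n => mom_fun k n.+1%:R - mom_fun k (- n.+1%:R)) @ \oo --> (0 : R).
Proof.
have [C C0 hC] := mom_bound k.+1.
have b (x : R) : 0 < `|x| -> `|mom_fun k x| <= C / `|x|.
  move=> x0; rewrite ler_pdivlMr// -normrM.
  apply: (@le_trans _ _ (C * expR (- (x ^+ 2 / 2)))).
    by rewrite (_ : _ * x = mom_fun k.+1 x)//; rewrite /mom_fun [x ^+ k.+1]exprS; ring.
  rewrite -[leRHS]mulr1 ler_wpM2l// -expR0 ler_expR oppr_le0.
  by rewrite divr_ge0// sqr_ge0.
apply/cvgr0Pnorm_le => e e0.
have [N hN] : exists N : nat, 2 * C / e <= N%:R.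
  by exists (Num.truncn (2 * C / e)).+1; rewrite ltW// truncnS_gt.
exists N => // n /= Nn.
have n0 : (0 : R) < n.+1%:R by rewrite ltr0n.
apply: le_trans (ler_normB _ _) _.
apply: (@le_trans _ _ (C / n.+1%:R + C / n.+1%:R)).
  apply: lerD.
    by have := b n.+1%:R; rewrite gtr0_norm// => /(_ n0).
  by have := b (- n.+1%:R); rewrite normrN gtr0_norm// => /(_ n0).
rewrite -mulrDl ler_pdivrMr// mulrC -ler_pdivrMr// (_ : C + C = 2 * C); last by ring.
by apply: le_trans hN _; rewrite ler_nat (leq_trans Nn).
Qed.

(** The derivative of x^k exp(- x^2) has integral zero over the line: the fundamental theorem of
    calculus on [-(n+1), n+1], then dominated convergence. *)
Lemma mom_rec k : 2 * mom k.+1 = k%:R * mom k.-1.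
Proof.
pose D (x : R) := k%:R * mom_fun k.-1 x - 2 * mom_fun k.+1 x.
have contm j : continuous (mom_fun j) by apply: dv_continuous => x; exact: mom_deriv.
have contD : continuous D.
  move=> x; apply: cvgB; apply: cvgM; [exact: cvg_cst|exact: contm|exact: cvg_cst|exact: contm].
have i1 : leb.-integrable setT (fun x => (k%:R * mom_fun k.-1 x)%:E).
  by have := integrableZl measurableT k%:R (mom_integrable k.-1).
have i2 : leb.-integrable setT (fun x => (2 * mom_fun k.+1 x)%:E).
  by have := integrableZl measurableT 2 (mom_integrable k.+1).
have iD : leb.-integrable setT (fun x => (D x)%:E).
  by have := integrableB measurableT i1 i2.
suff E : (\int[leb]_x (D x)%:E = 0)%E.
  have : \int[leb]_x (D x) = 0 by rewrite /Rintegral E.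
  rewrite /D RintegralB// !RintegralZl//; try exact: mom_integrable.
  by rewrite -/(mom _) -/(mom _) => /eqP; rewrite subr_eq0 => /eqP ->.
pose A n : set (measurableTypeR R) := `[- n.+1%:R, n.+1%:R]%classic.
have mA n : measurable (A n) by exact: measurable_itv.
have dc := @dominated_convergence _ (measurableTypeR R) R leb setT measurableT
  (fun n x => ((D \_ (A n)) x)%:E) (fun x => (D x)%:E) (fun x => (`|D x|)%:E).
case: dc => [n|||||_ _ cv].
- apply/measurable_EFinP; apply/(measurable_restrictT _ (mA n)).
  by apply: measurable_funTS; exact: continuous_measurable_fun.
- by apply/measurable_EFinP; exact: continuous_measurable_fun.
- apply: aeW => x _; apply: cvg_near_cst.
  have [N hN] : exists N : nat, `|x| <= N%:R.
    by exists (Num.truncn `|x|).+1; rewrite ltW// truncnS_gt.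
  exists N => // n /= Nn; rewrite patchE ifT//; apply/mem_set; rewrite /A /= in_itv /= -ler_norml.
  by rewrite (le_trans hN)// ler_nat (leq_trans Nn).
- exact: (integrable_norm iD).
- apply: aeW => x n _; rewrite lee_fin patchE; case: ifP => // _.
  by rewrite normr0.
have FE n : (\int[leb]_x ((D \_ (A n)) x)%:E =
    (mom_fun k n.+1%:R - mom_fun k (- n.+1%:R))%:E)%E.
  rewrite (_ : (\int[leb]_x _)%E = (\int[leb]_(x in A n) (D x)%:E)%E); last first.
    by rewrite [RHS]integral_mkcond; apply: eq_integral => x _; rewrite restrict_EFin.
  rewrite (@continuous_FTC2 _ D (mom_fun k))//.
  - by rewrite -subr_gt0 opprK addr_gt0 ?ltr0n.
  - exact: continuous_subspaceT.
  - split.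
    + by move=> x _; case: (mom_deriv k x).
    + by apply: cvg_at_right_filter; exact: contm.
    + by apply: cvg_at_left_filter; exact: contm.
  - move=> x _; rewrite derive1E; have hd := mom_deriv k x.
    by rewrite derive_val.
have cv2 : (fun n => (mom_fun k n.+1%:R - mom_fun k (- n.+1%:R))%:E) @ \oo --> (0 : \bar R)%E.
  by apply: cvg_EFin; [exact: nearW|exact: mom_fun_cvg].
move: cv; rewrite (_ : [sequence _]_n = (fun n => (mom_fun k n.+1%:R - mom_fun k (- n.+1%:R))%:E)).
  by move=> cv; apply: (cvg_unique _ cv cv2).
by apply/funext => n; rewrite -FE.
Qed.

End GaussianMoments.

(** * Complex Gaussian moments and the Bessel inequality for coherent states *)

Section CoherentStates.
Variable R : realType.
Local Notation leb := (@lebesgue_measure R).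
Local Notation RR := (measurableTypeR R * measurableTypeR R)%type.
Local Notation able := (cint_able (measurable_fun [set: RR]) (Jint (plane R))).
Implicit Types (z : R[i]) (f : R[i] -> R[i]).

Let HP := integral_integration (plane R).

Lemma Lint_gauss_pi : Lint (fun z : R[i] => (expR (- sqmod z))%:E) = pi%:E.
Proof.
rewrite /Lint /Jint.
have m : measurable_fun [set: RR] (fun p => (expR (- sqmod (toC p)))%:E).
  apply/measurable_EFinP; apply: meas_exp; apply: measurableT_comp.
    exact: oppr_measurable.
  by apply: cm_sqmod; exact: cm_toC.
rewrite (fubini_tonelli1 _ m)// /fubini_F /=.
transitivity (\int[leb]_x ((Num.sqrt pi)%:E * (gauss_fun x)%:E))%E.
  apply: eq_integral => x _; rewrite muleC -(@integralT_gauss R) -ge0_integralZl_EFin//.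
  - by apply: eq_integral => y _; rewrite -EFinM /gauss_fun -expRD -opprD.
  - by move=> y _; rewrite lee_fin gauss_fun_ge0.
  - by apply/measurable_EFinP; exact: measurable_gauss_fun.
  - exact: gauss_fun_ge0.
rewrite ge0_integralZl_EFin//.
- by rewrite integralT_gauss -EFinM -expr2 sqr_sqrtr// pi_ge0.
- by move=> x _; rewrite lee_fin gauss_fun_ge0.
- by apply/measurable_EFinP; exact: measurable_gauss_fun.
Qed.

Lemma Lint_gauss_scaled (t : R) : 0 < t ->
  Lint (fun z : R[i] => (expR (- t * sqmod z))%:E) = (pi / t)%:E.
Proof.
move=> t0; have s0 : Num.sqrt t != 0 by rewrite gt_eqF// sqrtr_gt0.
have m : emeasC (fun z : R[i] => (expR (- sqmod z))%:E).
  apply/measurable_EFinP; apply: meas_exp; apply: measurableT_comp.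
    exact: oppr_measurable.
  by apply: cm_sqmod; exact: cm_toC.
have := Lint_affine 0 s0 m (fun z => expR_ge0 _).
rewrite Lint_gauss_pi sqr_sqrtr ?ltW// -EFinM mulrC => <-.
congr Lint; apply/funext => z; rewrite addr0 sqmodM sqmodC sqr_sqrtr ?ltW//.
by rewrite mulNr.
Qed.

Lemma Lint_gauss (t : R) : 0 < t -> Lint (fun z : R[i] => (gauss t z)%:E) = 1%E.
Proof.
move=> t0; rewrite /gauss /Lint /Jint.
have m : measurable_fun [set: RR] (fun p => (expR (- t * sqmod (toC p)))%:E).
  apply/measurable_EFinP; apply: meas_exp; apply: measurable_funM => //.
  by apply: cm_sqmod; exact: cm_toC.
transitivity (\int[plane R]_p ((t / pi)%:E * (expR (- t * sqmod (toC p)))%:E))%E.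
  by apply: eq_integral => p _; rewrite -EFinM mulrAC.
rewrite ge0_integralZl_EFin ?divr_ge0 ?pi_ge0 ?ltW//.
have := Lint_gauss_scaled t0; rewrite /Lint /Jint => ->.
by rewrite -EFinM mulrA divfK ?divff ?gt_eqF ?pi_gt0.
Qed.

Definition wfun z : R := expR (- sqmod z).

(** At most polynomial growth: a class stable under products and conjugation, all of whose members
    are integrable against exp(- |z|^2). *)
Definition growth f : Prop := cmeasC f /\
  exists C k, 0 <= C /\ forall z, cabs (f z) <= C * (1 + sqmod z) ^+ k.

Lemma growth_able f : growth f -> able (fun p => (wfun (toC p))%:C * f (toC p)).
Proof.
move=> [mf [C [k [C0 hf]]]]; have [K K0 hK] := @poly_le_exp R k.
have mw : measurable_fun [set: RR] (fun p => wfun (toC p)).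
  apply: meas_exp; apply: measurableT_comp; first exact: oppr_measurable.
  by apply: cm_sqmod; exact: cm_toC.
have me : measurable_fun [set: RR] (fun p => expR (- 2^-1 * sqmod (toC p))).
  by apply: meas_exp; apply: measurable_funM => //; apply: cm_sqmod; exact: cm_toC.
apply: (@cint_able_le _ _ _ _ HP _ (fun p => (C * K) * expR (- 2^-1 * sqmod (toC p)))).
- by apply: cm_mul => //; exact: cm_real.
- exact: measurable_funM.
- move=> p; rewrite cabsM cabsC ger0_norm ?expR_ge0// /wfun.
  set s := sqmod _; have s0 : 0 <= s by exact: sqmod_ge0.
  apply: (@le_trans _ _ (expR (- s) * (C * (K * expR (s / 2))))).
    rewrite ler_wpM2l ?expR_ge0// (le_trans (hf _))// ler_wpM2l// hK//.
  rewrite (_ : expR _ * _ = C * K * (expR (- s) * expR (s / 2))); last by ring.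
  by rewrite -expRD ler_wpM2l ?mulr_ge0// ler_expR; lra.
rewrite /Jr (int_scale HP) ?mulr_ge0//.
have := @Lint_gauss_scaled 2^-1; rewrite /Lint => ->; last by rewrite invr_gt0.
by rewrite -EFinM ltry.
Qed.

(** The Gaussian integral without normalization: its total mass is pi. *)
Definition Lg f : R[i] := cint (fun z => (wfun z)%:C * f z).

Lemma growth_lin c f g : growth f -> growth g -> growth (fun z => c * f z + g z).
Proof.
move=> [mf [C [k [C0 hf]]]] [mg [D [l [D0 hg]]]]; split.
  by apply: cm_add => //; apply: cm_mul => //; exact: cm_cst.
exists (cabs c * C + D), (maxn k l); split.
  by rewrite addr_ge0 ?mulr_ge0 ?cabs_ge0.
move=> z; apply: le_trans (cabsD _ _) _; rewrite cabsM mulrDl.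
have s1 : 1 <= 1 + sqmod z by rewrite lerDl sqmod_ge0.
apply: lerD.
  rewrite -mulrA ler_wpM2l ?cabs_ge0// (le_trans (hf z))// ler_wpM2l//.
  by rewrite ler_weXn2l// leq_maxl.
by rewrite (le_trans (hg z))// ler_wpM2l// ler_weXn2l// leq_maxr.
Qed.

Lemma growth_mul f g : growth f -> growth g -> growth (fun z => f z * g z).
Proof.
move=> [mf [C [k [C0 hf]]]] [mg [D [l [D0 hg]]]]; split; first exact: cm_mul.
exists (C * D), (k + l)%N; split; first exact: mulr_ge0.
by move=> z; rewrite cabsM exprD mulrACA ler_pM ?cabs_ge0.
Qed.

Lemma growth_cst c : growth (fun=> c).
Proof.
split; first exact: cm_cst.
by exists (cabs c), 0; split; [exact: cabs_ge0|move=> z; rewrite expr0 mulr1].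
Qed.

Lemma growth_id : growth id.
Proof.
split; first exact: cm_toC.
exists 1, 1; split => // z; rewrite mul1r expr1 -cabs_sq.
by have := sqr_ge0 (cabs z - 1); have := cabs_ge0 z; nra.
Qed.

Lemma growth_conj f : growth f -> growth (fun z => conjc (f z)).
Proof.
move=> [mf [C [k [C0 hf]]]]; split; first exact: cm_conj.
by exists C, k; split=> // z; rewrite cabs_conj.
Qed.

Lemma growth_Re : growth (fun z => (complex.Re z)%:C).
Proof.
split; first by split; [exact: (cm_toC R).1|exact: measurable_cst].
exists 1, 1; split => // z; rewrite mul1r expr1 cabsC (le_trans (Re_cabs z))//.
by rewrite -cabs_sq; have := sqr_ge0 (cabs z - 1); have := cabs_ge0 z; nra.
Qed.

Lemma growth_Im : growth (fun z => (complex.Im z)%:C).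
Proof.
split; first by split; [exact: (cm_toC R).2|exact: measurable_cst].
exists 1, 1; split => // z; rewrite mul1r expr1 cabsC (le_trans (Im_cabs z))//.
by rewrite -cabs_sq; have := sqr_ge0 (cabs z - 1); have := cabs_ge0 z; nra.
Qed.

Lemma growth_pow f n : growth f -> growth (fun z => f z ^+ n).
Proof.
move=> h; elim: n => [|n IH]; first by under eq_fun do rewrite expr0; exact: growth_cst.
by under eq_fun do rewrite exprS; exact: growth_mul.
Qed.

Lemma Lg_lin c f g : growth f -> growth g ->
  Lg (fun z => c * f z + g z) = c * Lg f + Lg g.
Proof.
move=> hf hg; rewrite /Lg !cintE.
have [a1 a2] := (growth_able hf, growth_able hg).
have := cID HP (cint_ableZ HP c a1) a2; rewrite (cIZ HP c a1) => <-.
by congr cI; apply/funext => p; rewrite mulrDr mulrCA.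
Qed.

Lemma Lg_conj f : growth f -> Lg (fun z => conjc (f z)) = conjc (Lg f).
Proof.
move=> hf; rewrite /Lg !cintE; have := cI_conj HP (growth_able hf) => <-.
by congr cI; apply/funext => p; rewrite conjcM conjc_real.
Qed.

Lemma LgZ c f : growth f -> Lg (fun z => c * f z) = c * Lg f.
Proof.
move=> hf; rewrite /Lg !cintE -(cIZ HP c (growth_able hf)).
by congr cI; apply/funext => p; rewrite mulrCA.
Qed.

Definition mono (a b : nat) z : R[i] := (complex.Re z ^+ a * complex.Im z ^+ b)%:C.

Lemma growth_mono a b : growth (mono a b).
Proof.
rewrite (_ : mono a b = (fun z => (complex.Re z)%:C ^+ a * (complex.Im z)%:C ^+ b)).
  by apply: growth_mul; apply: growth_pow; [exact: growth_Re|exact: growth_Im].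
by apply/funext => z; rewrite /mono rmorphM !rmorphXn.
Qed.

Lemma Lg_mono a b : Lg (mono a b) = (mom R a * mom R b)%:C.
Proof.
have ha := growth_able (growth_mono a b).
rewrite /Lg cintE /cI; apply: complexP => /=; last first.
  rewrite -rI_Rintegral /Rintegral (_ : (\int[_]_x _)%E = 0%E)//.
  by apply: integral0_eq => p _; rewrite /= mul0r mulr0 addr0.
have := cint_able_Re HP ha => /rint_integrable.
rewrite (_ : (fun t => _) = (fun p : RR => (mom_fun a p.1 * mom_fun b p.2)%:E)); last first.
  apply/funext => p; congr (_%:E).
  rewrite ReM /= mul0r subr0 /mom_fun /wfun /sqmod /toC /= opprD expRD; ring.
move=> hi; rewrite -rI_Rintegral /Rintegral.
rewrite (_ : (\int[_]_x _)%E = (mom R a * mom R b)%:E)//.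
transitivity (\int[plane R]_p (mom_fun a p.1 * mom_fun b p.2)%:E)%E.
  apply: eq_integral => p _; congr (_%:E).
  rewrite mul0r subr0 /mom_fun /wfun /sqmod /toC /= opprD expRD; ring.
rewrite -integral12_prod_meas1// /fubini_F /=.
transitivity (\int[leb]_x ((mom R b)%:E * (mom_fun a x)%:E))%E.
  apply: eq_integral => x _; rewrite -EFinM mulrC.
  under eq_integral do rewrite EFinM.
  rewrite integralZl//; last exact: mom_integrable.
  rewrite [RHS]EFinM; congr (_ * _)%E; rewrite /mom /Rintegral fineK//.
  by apply: integrable_fin_num => //; exact: mom_integrable.
rewrite integralZl//; last exact: mom_integrable.
rewrite mulrC [RHS]EFinM; congr (_ * _)%E; rewrite /mom /Rintegral fineK//.
by apply: integrable_fin_num => //; exact: mom_integrable.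
Qed.

(* [polyd f fx fy]: f is a polynomial in Re z and Im z with partial
   derivatives fx and fy. *)
Inductive polyd : (R[i] -> R[i]) -> (R[i] -> R[i]) -> (R[i] -> R[i]) -> Prop :=
| polyd_mono a b : polyd (mono a b)
    (fun z => a%:R * mono a.-1 b z) (fun z => b%:R * mono a b.-1 z)
| polyd_lin c f fx fy g gx gy : polyd f fx fy -> polyd g gx gy ->
    polyd (fun z => c * f z + g z) (fun z => c * fx z + gx z) (fun z => c * fy z + gy z).

Lemma polyd_eq f fx fy f' fx' fy' : f =1 f' -> fx =1 fx' -> fy =1 fy' ->
  polyd f fx fy -> polyd f' fx' fy'.
Proof. by move=> /funext <- /funext <- /funext <-. Qed.

Lemma polyd_growth f fx fy : polyd f fx fy -> [/\ growth f, growth fx & growth fy].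
Proof.
elim=> [a b|c f' fx' fy' g gx gy _ [h1 h2 h3] _ [k1 k2 k3]].
  by split; [exact: growth_mono|apply: growth_mul; [exact: growth_cst|exact: growth_mono]..].
by split; exact: growth_lin.
Qed.

Lemma polyd_Re f fx fy : polyd f fx fy ->
  polyd (fun z => (complex.Re z)%:C * f z) (fun z => f z + (complex.Re z)%:C * fx z)
    (fun z => (complex.Re z)%:C * fy z).
Proof.
elim=> [a b|c f' fx' fy' g gx gy _ h1 _ h2].
  apply: polyd_eq (polyd_mono a.+1 b) => z.
  - by rewrite /mono exprS -rmorphM mulrA.
  - case: a => [|a] /=; first by rewrite mul1r mul0r mulr0 addr0.
    rewrite mulrCA -[(complex.Re z)%:C * mono _ _ _]rmorphM mulrA -exprS.
    by rewrite /mono -[in LHS]addn1 natrD mulrDl mul1r addrC.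
  - by rewrite mulrCA /mono -rmorphM exprS mulrA.
by apply: polyd_eq (polyd_lin c h1 h2) => z; ring.
Qed.

Lemma polyd_Im f fx fy : polyd f fx fy ->
  polyd (fun z => (complex.Im z)%:C * f z) (fun z => (complex.Im z)%:C * fx z)
    (fun z => f z + (complex.Im z)%:C * fy z).
Proof.
elim=> [a b|c f' fx' fy' g gx gy _ h1 _ h2].
  apply: polyd_eq (polyd_mono a b.+1) => z.
  - by rewrite /mono exprS -rmorphM mulrCA.
  - by rewrite mulrCA /mono -rmorphM exprS [X in _ = _ * X%:C]mulrCA.
  - case: b => [|b] /=; first by rewrite mul1r mul0r mulr0 addr0.
    rewrite mulrCA -[(complex.Im z)%:C * mono _ _ _]rmorphM mulrCA -exprS.
    by rewrite /mono -[in LHS]addn1 natrD mulrDl mul1r addrC.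
by apply: polyd_eq (polyd_lin c h1 h2) => z; ring.
Qed.

(** Gaussian integration by parts in each real variable: on monomials it is the recurrence
    [mom_rec], and both sides are linear. *)
Lemma polyd_ibp f fx fy : polyd f fx fy ->
  Lg fx = 2 * Lg (fun z => (complex.Re z)%:C * f z) /\
  Lg fy = 2 * Lg (fun z => (complex.Im z)%:C * f z).
Proof.
elim=> [a b|c f' fx' fy' g gx gy p1 [h1 h2] p2 [k1 k2]].
  rewrite !LgZ; [|exact: growth_mono..]; rewrite !Lg_mono.
  have -> : (fun z => (complex.Re z)%:C * mono a b z) = mono a.+1 b.
    by apply/funext => z; rewrite /mono exprS -rmorphM mulrA.
  have -> : (fun z => (complex.Im z)%:C * mono a b z) = mono a b.+1.
    by apply/funext => z; rewrite /mono exprS -rmorphM mulrCA.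
  rewrite !Lg_mono -!(rmorph_nat (real_complex R)) -!rmorphM !mulrA.
  split; first by rewrite mom_rec.
  by congr (_%:C); rewrite mulrAC -mom_rec; ring.
have [f1 f2 f3] := polyd_growth p1; have [g1 g2 g3] := polyd_growth p2.
have e (u : R[i] -> R[i]) : growth u ->
    Lg (fun z => u z * (c * f' z + g z)) = c * Lg (fun z => u z * f' z) + Lg (fun z => u z * g z).
  move=> hu; rewrite -Lg_lin; [|exact: growth_mul..].
  by congr Lg; apply/funext => z; rewrite mulrDr mulrCA.
rewrite !Lg_lin// !e; [|exact: growth_Im|exact: growth_Re].
by rewrite h1 h2 k1 k2; split; ring.
Qed.

Lemma polyd_zn m n : polyd (fun z => z ^+ m * conjc z ^+ n)
  (fun z => m%:R * (z ^+ m.-1 * conjc z ^+ n) + n%:R * (z ^+ m * conjc z ^+ n.-1))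
  (fun z => 'i%C * (m%:R * (z ^+ m.-1 * conjc z ^+ n)) -
            'i%C * (n%:R * (z ^+ m * conjc z ^+ n.-1))).
Proof.
(* The product rule for the factor Re z + e Im z, which is z for e = i and conj z for e = - i. *)
have step (f fx fy : R[i] -> R[i]) (e : R[i]) : polyd f fx fy ->
    polyd (fun z => ((complex.Re z)%:C + e * (complex.Im z)%:C) * f z)
     (fun z => f z + ((complex.Re z)%:C + e * (complex.Im z)%:C) * fx z)
     (fun z => e * f z + ((complex.Re z)%:C + e * (complex.Im z)%:C) * fy z).
  move=> h; apply: polyd_eq (polyd_lin e (polyd_Im h) (polyd_Re h)) => z; ring.
have zE z : z = (complex.Re z)%:C + 'i%C * (complex.Im z)%:C by exact: complexE.
have zbE z : conjc z = (complex.Re z)%:C + (- 'i%C) * (complex.Im z)%:C.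
  by rewrite [in LHS](zE z) conjcD conjcM !conjc_real conjc_i.
elim: m => [|m IHm].
  elim: n => [|n IHn].
    apply: polyd_eq (polyd_mono 0 0) => z.
    - by rewrite /mono !expr0 !mulr1.
    - by rewrite !mul0r addr0.
    - by rewrite !mul0r !mulr0 subr0.
  apply: polyd_eq (step _ _ _ (- 'i%C) IHn) => z; rewrite -zbE.
  - by rewrite !expr0 !mul1r exprS.
  - by rewrite !expr0 !mul1r !mul0r !add0r; case: n {IHn} => [|n];
      rewrite ?mul0r ?mulr0 ?addr0 ?mul1r// [conjc z ^+ n.+1]exprS [n.+2%:R]mulrS; ring.
  - by rewrite !expr0 !mul1r !mul0r !mulr0 !sub0r; case: n {IHn} => [|n];
      rewrite ?mul0r ?mulr0 ?oppr0 ?mulr0 ?addr0 ?mul1r ?mulNr// [conjc z ^+ n.+1]exprS [n.+2%:R]mulrS; ring.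
apply: polyd_eq (step _ _ _ 'i%C IHm) => z; rewrite -zE.
- by rewrite exprS mulrA.
- by case: m {IHm} => [|m];
      rewrite ?mul0r ?add0r ?mul1r ?exprS ?expr0 ?[m.+2%:R]mulrS //=; ring.
- by case: m {IHm} => [|m];
      rewrite ?mul0r ?add0r ?mul1r ?exprS ?expr0 ?[m.+2%:R]mulrS //=; ring.
Qed.

Definition mom2 m n : R[i] := Lg (fun z => z ^+ m * conjc z ^+ n).

Lemma growth_zn m n : growth (fun z => z ^+ m * conjc z ^+ n).
Proof.
by apply: growth_mul; apply: growth_pow; [exact: growth_id|apply: growth_conj; exact: growth_id].
Qed.

(** The combination f_x + i f_y is twice the derivative in conj z, which sees only the powers of
    conj z; integration by parts turns it into multiplication by 2 z. *)
Lemma mom2_rec m n : mom2 m.+1 n = n%:R * mom2 m n.-1.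
Proof.
have [h1 h2] := polyd_ibp (polyd_zn m n).
have [_ gx gy] := polyd_growth (polyd_zn m n).
have E : Lg (fun z => 'i%C * ('i%C * (m%:R * (z ^+ m.-1 * conjc z ^+ n)) -
            'i%C * (n%:R * (z ^+ m * conjc z ^+ n.-1))) +
   (m%:R * (z ^+ m.-1 * conjc z ^+ n) + n%:R * (z ^+ m * conjc z ^+ n.-1))) =
   2 * (n%:R * mom2 m n.-1).
  rewrite mulrA -LgZ; last exact: growth_zn.
  congr Lg; apply/funext => z; rewrite mulrBr !mulrA -expr2 sqr_i; ring.
rewrite Lg_lin// h1 h2 in E.
have gR : growth (fun z => (complex.Re z)%:C * (z ^+ m * conjc z ^+ n)).
  by apply: growth_mul; [exact: growth_Re|exact: growth_zn].
have gI : growth (fun z => (complex.Im z)%:C * (z ^+ m * conjc z ^+ n)).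
  by apply: growth_mul; [exact: growth_Im|exact: growth_zn].
have two : (2 : R[i]) != 0 by rewrite pnatr_eq0.
apply: (mulfI two); rewrite -E mulrCA -mulrDr; congr (_ * _).
rewrite -Lg_lin// /mom2; congr Lg; apply/funext => z.
by rewrite {1}exprS {1}(complexE z); ring.
Qed.

Lemma conjcX z n : conjc (z ^+ n) = conjc z ^+ n.
Proof. by elim: n => [|n IH]; rewrite ?expr0 ?conjc1// !exprS conjcM IH. Qed.

Lemma mom2_conj m n : mom2 m n = conjc (mom2 n m).
Proof.
rewrite /mom2 -Lg_conj; last exact: growth_zn.
by congr Lg; apply/funext => z; rewrite conjcM !conjcX conjcK mulrC.
Qed.

Lemma mom2E m n : mom2 m n = if m == n then (n`!%:R * pi)%:C else 0.
Proof.
elim: m n => [|m IH] [|n].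
- rewrite eqxx fact0 mul1r /mom2.
  have -> : (fun z => z ^+ 0 * conjc z ^+ 0) = mono 0 0.
    by apply/funext => z; rewrite /mono !expr0 !mulr1.
  by rewrite Lg_mono mom0 -expr2 sqr_sqrtr// pi_ge0.
- by rewrite mom2_conj mom2_rec mul0r conjc0.
- by rewrite mom2_rec mul0r.
- rewrite mom2_rec /= IH eqSS; case: eqP => _; last by rewrite mulr0.
  by rewrite factS natrM -(rmorph_nat (real_complex R)) -rmorphM mulrA.
Qed.

Lemma coh_mul z m n : coherent z m * conjc (coherent z n) =
  (Num.sqrt (m`!%:R) * Num.sqrt (n`!%:R))^-1%:C *
    ((wfun z)%:C * (z ^+ m * conjc z ^+ n)).
Proof.
rewrite /coherent conjcM conjc_real conjcX mulrACA -rmorphM [RHS]mulrA -rmorphM.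
congr (_%:C * _); rewrite mulrACA -expRD mulrC invfM; congr (_ * expR _).
by field.
Qed.

Lemma coh_able m n : able (fun p => coherent (toC p) m * conjc (coherent (toC p) n)).
Proof.
under eq_fun do rewrite coh_mul; apply: (cint_ableZ HP).
exact: growth_able (growth_zn m n).
Qed.

Lemma coh_orth m n :
  cint (fun z => coherent z m * conjc (coherent z n)) = if m == n then pi%:C else 0.
Proof.
rewrite cintE; under eq_fun do rewrite coh_mul.
rewrite (cIZ HP _ (growth_able (growth_zn m n))).
have := mom2E m n; rewrite /mom2 /Lg cintE => ->.
case: eqP => [->|_]; last by rewrite mulr0.
rewrite -expr2 sqr_sqrtr// -rmorphM mulrA mulVf ?mul1r//.
Qed.

Lemma nneseries_exp (s : R) : 0 <= s ->
  \esum_(n in [set: nat]) (s ^+ n / n`!%:R)%:E = (expR s)%:E.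
Proof.
move=> s0; rewrite -nneseries_esumT; last first.
  by move=> n; rewrite lee_fin divr_ge0// exprn_ge0.
rewrite /expR -EFin_lim; last exact: is_cvg_series_exp_coeff.
by congr (limn _); apply/funext => n; rewrite /= sumEFin.
Qed.

Lemma sqmodX z n : sqmod (z ^+ n) = sqmod z ^+ n.
Proof. by rewrite -!cabs_sq cabsX -!exprM mulnC. Qed.

Lemma sqmod_coherent z n :
  sqmod (coherent z n) = expR (- sqmod z) * (sqmod z ^+ n / n`!%:R).
Proof.
rewrite sqmodM sqmodC exprMn exprVn sqr_sqrtr// -expRM_natl.
have -> : 2 * (- sqmod z / 2) = - sqmod z by field.
by rewrite sqmodX; ring.
Qed.

Lemma sqnorm_coherent z : sqnorm (coherent z) = 1%E.
Proof.
rewrite /sqnorm; under eq_esum do rewrite sqmod_coherent.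
rewrite esum_scale ?expR_ge0//; last first.
  by move=> n; rewrite divr_ge0// exprn_ge0// sqmod_ge0.
by rewrite nneseries_exp ?sqmod_ge0// -EFinM -expRD addNr expR0.
Qed.

Lemma l2_coherent z : l2 (coherent z).
Proof. by rewrite /l2 sqnorm_coherent ltry. Qed.

Lemma nrm_coherent z : nrm (coherent z) = 1.
Proof. by rewrite /nrm /sqn sqnorm_coherent sqrtr1. Qed.

Lemma cmC_dot_coherent (phi : nat -> R[i]) : cmeasC (fun z => dot phi (coherent z)).
Proof.
apply: (cmeas_dot (@esum_measurable_nat R)) => n; first exact: cm_cst.
by apply: cm_coherent; exact: cm_toC.
Qed.

(** Expanding the square leaves the integrals of [coh_orth], of which only the diagonal ones
    survive. *)
Lemma bessel_finite (phi : nat -> R[i]) s : uniq s ->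
  Lint (fun z => (sqmod (dot (rst s phi) (coherent z)))%:E) =
    (pi * sqn (rst s phi))%:E.
Proof.
move=> us; have hr := l2_rst phi us.
pose F i j p := conjc (phi i) * phi j * (coherent (toC p) i * conjc (coherent (toC p) j)).
have FE p : (sqmod (dot (rst s phi) (coherent (toC p))))%:C =
    \sum_(i <- s) \sum_(j <- s) F i j p.
  rewrite -mulJc dot_rst// mulrC rmorph_sum mulr_suml; apply: eq_bigr => i _.
  rewrite mulr_sumr; apply: eq_bigr => j _.
  by rewrite /F [X in _ * X]conjcM conjcK mulrACA.
have ai i j : able (F i j) by apply: (cint_ableZ HP); exact: coh_able.
have as_ i : able (fun p => \sum_(j <- s) F i j p).
  exact: (cint_able_sum HP s (Jint0 _) (ai i)).1.
have [ab E] := cint_able_sum HP s (Jint0 (plane R)) as_.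
have fin : Jr (Jint (plane R)) (fun p => sqmod (dot (rst s phi) (coherent (toC p)))) \is a fin_num.
  apply: (Jr_fin HP) => [p|]; first exact: sqmod_ge0.
  have := ab.2; rewrite /Jabs; under eq_fun do rewrite -FE cabsC ger0_norm ?sqmod_ge0//.
  exact.
rewrite /Lint -[LHS]/(Jr _ _) -(fineK fin); congr (_%:E); apply: complexI.
rewrite -cI_real; [|by move=> p; exact: sqmod_ge0|exact: Jint0].
under eq_fun do rewrite FE.
rewrite E /sqn sqnorm_rst//= mulr_sumr rmorph_sum.
rewrite big_seq [RHS]big_seq; apply: eq_bigr => i si.
rewrite (cint_able_sum HP s (Jint0 (plane R)) (ai i)).2 (bigD1_seq i)//= big1 ?addr0.
  rewrite (cIZ HP _ (coh_able i i)); have := coh_orth i i; rewrite cintE eqxx => ->.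
  by rewrite mulJc -rmorphM mulrC.
move=> j ji; rewrite (cIZ HP _ (coh_able i j)); have := coh_orth i j.
by rewrite cintE eq_sym (negbTE ji) => ->; rewrite mulr0.
Qed.

Lemma conjc_opp1 : conjc (-1) = -1 :> R[i].
Proof. by apply: complexP; rewrite /= ?oppr0 ?opprK. Qed.

Lemma dot_subl (I : choiceType) (a b psi : I -> R[i]) : l2 a -> l2 b -> l2 psi ->
  dot (fun i => a i - b i) psi = dot a psi - dot b psi.
Proof.
move=> ha hb hpsi.
have -> : (fun i => a i - b i) = (fun i => -1 * b i + a i).
  by apply/funext => i; move: (a i) (b i) => u v; ring.
rewrite (dot_linl (-1) hb ha hpsi) conjc_opp1.
by move: (dot b psi) (dot a psi) => u v; ring.
Qed.

(** Any initial segment containing the finite list of [l2_tail] leaves a smaller remainder. *)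
Lemma l2_tail_iota (phi : nat -> R[i]) (d : R) : l2 phi -> 0 < d ->
  exists N0, forall n, (N0 <= n)%N -> nrm (fun i => phi i - rst (iota 0 n) phi i) <= d.
Proof.
move=> hphi d0; have [s us hs] := l2_tail hphi d0.
exists (\max_(i <- s) i).+1 => n sn; apply: le_trans hs.
have hd t : uniq t -> l2 (fun i => phi i - rst t phi i) by move=> ut; apply: l2B => //; exact: l2_rst.
rewrite -(ler_pXn2r (ltn0Sn 1)) ?nnegrE ?nrm_ge0// !nrm_sq -lee_fin !sqnK; [|exact: hd|exact: hd (iota_uniq _ _)].
apply: le_esum => i _; rewrite lee_fin /rst.
have [_|ni] := boolP (i \in iota 0 n); first by rewrite subrr sqmodC expr0n /= sqmod_ge0.
case: ifP => // si; move: ni; rewrite mem_iota /= add0n => /negP; case.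
by apply: leq_ltn_trans sn; rewrite (big_rem i si) /= leq_max leqnn.
Qed.

Lemma dot_rst_cvg (phi psi : nat -> R[i]) : l2 phi -> l2 psi ->
  (fun n => sqmod (dot (rst (iota 0 n) phi) psi)) @ \oo --> sqmod (dot phi psi).
Proof.
move=> hphi hpsi.
have hr n := l2_rst phi (iota_uniq 0 n).
pose e n := nrm (fun i => phi i - rst (iota 0 n) phi i).
have he : e @ \oo --> (0 : R).
  apply/cvgr0Pnorm_le => d d0.
  have [N0 h] := l2_tail_iota hphi d0.
  by exists N0 => // n /= /h; rewrite ger0_norm ?nrm_ge0.
have b n : cabs (dot phi psi - dot (rst (iota 0 n) phi) psi) <= e n * nrm psi.
  rewrite -dot_subl//.
  by apply: dot_le => //; apply: l2B.
have c : (fun n => cabs (dot (rst (iota 0 n) phi) psi)) @ \oo --> cabs (dot phi psi).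
  apply/cvgrPdist_le => d d0.
  have : (fun n => e n * nrm psi) @ \oo --> (0 : R).
    by rewrite -(mul0r (nrm psi)); apply: cvgM => //; exact: cvg_cst.
  move=> /cvgrPdist_le /(_ d d0); apply: filterS => n.
  rewrite sub0r normrN ger0_norm ?mulr_ge0 ?nrm_ge0// => /(le_trans (b n)); apply: le_trans.
  rewrite ler_norml lerBrDr lerBlDr.
  have h (u v : R[i]) : cabs u <= cabs (u - v) + cabs v by rewrite -{1}(subrK v u) cabsD.
  rewrite h andbT addrC lerBlDr addrC (le_trans (h _ (dot phi psi)))// lerD2r.
  by rewrite -cabsN opprB.
rewrite -cabs_sq; under eq_fun do rewrite -cabs_sq.
by rewrite expr2; under eq_fun do rewrite expr2; exact: cvgM.
Qed.

(** Fatou's lemma along the truncations of phi, for which the identity is exact. This bound is the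
    domination behind every weak integral over coherent states without a Gaussian weight. *)
Lemma bessel (phi : nat -> R[i]) : l2 phi ->
  (Lint (fun z => (sqmod (dot phi (coherent z)))%:E) <= (pi * sqn phi)%:E)%E.
Proof.
move=> hphi.
pose f n (p : RR) : \bar R := (sqmod (dot (rst (iota 0 n) phi) (coherent (toC p))))%:E.
have mf n : measurable_fun setT (f n).
  by apply/measurable_EFinP; apply: cm_sqmod; exact: cmC_dot_coherent.
have f0 n p : setT p -> (0 <= f n p)%E by rewrite lee_fin sqmod_ge0.
have := fatou (plane R) measurableT mf f0.
rewrite (_ : (\int[plane R]_(x in _) _)%E = Lint (fun z => (sqmod (dot phi (coherent z)))%:E)); last first.
  apply: eq_integral => p _.
  have cf : f ^~ p @ \oo --> (sqmod (dot phi (coherent (toC p))))%:E.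
    apply: cvg_EFin; first exact: nearW.
    exact: dot_rst_cvg hphi (l2_coherent _).
  by rewrite is_cvg_limn_einfE ?(cvg_lim _ cf)//; apply/cvg_ex; eexists; exact: cf.
move=> /le_trans; apply.
have b n : (\int[plane R]_x f n x <= (pi * sqn phi)%:E)%E.
  have := bessel_finite phi (iota_uniq 0 n); rewrite /Lint /Jint /f => ->.
  rewrite lee_fin ler_wpM2l ?pi_ge0// -lee_fin sqnK ?sqnK//; last exact: l2_rst (iota_uniq _ _).
  apply: le_esum => i _; rewrite lee_fin /rst; case: ifP => // _.
  by rewrite sqmodC expr0n /= sqmod_ge0.
rewrite limn_einf_lim; apply: lime_le.
  exact: is_cvg_einfs.
by apply: nearW => n; apply: le_trans (b n); apply: ereal_inf_lbound; exists n => /=.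
Qed.

End CoherentStates.

(** * The displacement operator *)

Section SeriesTail.
Variable R : realType.
Implicit Types (f : nat -> R[i]) (a : nat -> R).

Definition tail (V : nmodType) (K : nat) (f : nat -> V) (n : nat) : V :=
  if (n < K)%N then 0 else f n.

Lemma tail_real a K : (forall n, 0 <= a n) -> forall n, 0 <= tail K a n.
Proof. by move=> a0 n; rewrite /tail; case: ifP. Qed.

Lemma cabs_tail f K n : cabs (tail K f n) = tail K (fun n => cabs (f n)) n.
Proof. by rewrite /tail; case: ifP => // _; rewrite cabs0. Qed.

Lemma esum_tail a (e : R) : (forall n, 0 <= a n) ->
  (\esum_(n in [set: nat]) (a n)%:E < +oo)%E -> 0 < e ->
  exists K0, forall K, (K0 <= K)%N -> (\esum_(n in [set: nat]) (tail K a n)%:E <= e%:E)%E.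
Proof.
move=> a0 ha e0.
have [s us hs] := esum_gt_seq e0 a0 ha.
exists (\max_(i <- s) i).+1 => K sK; apply: esum_le_seq => t ut; rewrite lee_fin.
have E : \sum_(i <- t) tail K a i = \sum_(i <- [seq i <- t | (K <= i)%N]) a i.
  rewrite big_filter [RHS]big_mkcond; apply: eq_bigr => i _.
  by rewrite /tail ltnNge; case: (K <= i)%N.
have ust : uniq (s ++ [seq i <- t | (K <= i)%N]).
  rewrite cat_uniq us filter_uniq//= andbT; apply/hasPn => i.
  rewrite mem_filter => /andP[Ki _]; apply/negP => si.
  have := leq_trans sK Ki; rewrite ltnNge => /negP; apply.
  by rewrite (big_rem i si) /= leq_max leqnn.
have := esum_seq_le ust a0; rewrite big_cat /= -E.
have h0 : (0 <= \esum_(n in [set: nat]) (a n)%:E)%E.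
  by apply: esum_ge0 => i _; rewrite lee_fin.
rewrite -(fineK (x := \esum_(n in [set: nat]) (a n)%:E)) ?ge0_fin_numE// lee_fin.
lra.
Qed.

Lemma csum_tailE f K : csummable f -> csummable (tail K f) /\
  csum f = \sum_(k < K) f k + csum (tail K f).
Proof.
move=> hf; have ht : csummable (tail K f).
  by apply: csummable_le hf => i; rewrite /tail; case: ifP => // _; rewrite cabs0 cabs_ge0.
split=> //.
have [|h1 h2] := @csum_finite _ _ (fun i => if (i < K)%N then f i else 0) (iota 0 K) (iota_uniq _ _).
  by move=> i; rewrite mem_iota /= add0n => /negbTE ->.
rewrite -(big_mkord xpredT f) /index_iota subn0.
rewrite (_ : \sum_(i <- iota 0 K) f i = \sum_(i <- iota 0 K) (if (i < K)%N then f i else 0)); last first.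
  rewrite big_seq [RHS]big_seq; apply: eq_bigr => i.
  by rewrite mem_iota /= add0n => ->.
rewrite -h2 -csumD//; congr csum; apply/funext => i.
by rewrite /tail; case: ifP => _; rewrite ?addr0 ?add0r.
Qed.

Lemma csum_cvg f (e : R) : csummable f -> 0 < e ->
  exists K0, forall K, (K0 <= K)%N -> cabs (csum f - \sum_(k < K) f k) <= e.
Proof.
move=> hf e0; have [K0 hK] := esum_tail (fun n => cabs_ge0 (f n)) hf e0.
exists K0 => K /hK; have [ht ->] := csum_tailE K hf.
rewrite addrC addKr => h; apply: le_trans (csum_norm ht) _.
rewrite -lee_fin asum_fineK//; apply: le_trans h.
by rewrite /asum; under eq_esum do rewrite cabs_tail.
Qed.

Lemma eq_cabs_eps (z w : R[i]) : (forall e : R, 0 < e -> cabs (z - w) <= e) -> z = w.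
Proof.
move=> h; apply/eqP; rewrite -subr_eq0; apply/eqP; apply: cabs_eq0.
apply/eqP; rewrite eq_le cabs_ge0 andbT; apply/ler_addgt0Pr => e e0.
by rewrite add0r h.
Qed.

End SeriesTail.

Section IntegralSeries.
Context d (T : measurableType d) (R : realType) (m : {measure set T -> \bar R}).
Local Notation cm := (cmeas (measurable_fun [set: T])).
Let HT := integral_integration m.

(** After K terms the integral of the remainder is at most the tail of the convergent series of L^1
    norms. *)
Lemma cI_csum (f : nat -> T -> R[i]) : (forall n, cm (f n)) ->
  (forall t, csummable (f^~ t)) ->
  (\esum_(n in [set: nat]) Jabs (Jint m) (f n) < +oo)%E ->
  cint_able (measurable_fun [set: T]) (Jint m) (fun t => csum (f^~ t)) /\
  cI (Jint m) (fun t => csum (f^~ t)) = csum (fun n => cI (Jint m) (f n)).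
Proof.
move=> mf sf ff.
have af n : cint_able (measurable_fun [set: T]) (Jint m) (f n).
  split => //; apply: le_lt_trans ff.
  have := @esum_ge _ _ [set: nat] (fun n => Jabs (Jint m) (f n)) (Jabs (Jint m) (f n)).
  apply; exists [set n] => //=; last by rewrite fsbig_set1.
have J0 n : (0 <= Jabs (Jint m) (f n))%E by apply: (int_ge0 HT) => t; exact: cabs_ge0.
have Jfin n : Jabs (Jint m) (f n) \is a fin_num by rewrite ge0_fin_numE//; exact: (af n).2.
have st K : Jr (Jint m) (fun t => fine (asum (tail K (f^~ t)))) =
    \esum_(n in [set: nat]) (tail K (fun n => fine (Jabs (Jint m) (f n))) n)%:E.
  rewrite /Jr /Jint.
  transitivity (\int[m]_t \esum_(n in [set: nat]) (cabs (tail K (f^~ t) n))%:E)%E.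
    apply: eq_integral => t _; rewrite asum_fineK//.
    by case: (csum_tailE K (sf t)).
  rewrite integral_esum.
  - apply: eq_esum => n _; rewrite /tail; case: ifP => _; last by rewrite fineK.
    by apply: integral0_eq => t _; rewrite cabs0.
  - move=> n; apply/measurable_EFinP; rewrite /tail.
    by case: (n < K)%N; [exact: measurable_cst|exact: (meas_cabs HT)].
  - by move=> n t; rewrite lee_fin cabs_ge0.
have mt K : cm (fun t => csum (tail K (f^~ t))).
  apply: (cmeas_csum (@esum_measurable_nat R)) => n; rewrite /tail.
  by case: (n < K)%N => //; exact: (cmeas_cst HT).
have mat K : measurable_fun setT (fun t => fine (asum (tail K (f^~ t)))).
  apply: measurableT_comp; first exact: fine_measurable.
  apply: (@esum_measurable_nat R) => [n|n t]; last by rewrite lee_fin cabs_ge0.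
  apply/measurable_EFinP; rewrite /tail.
  by case: (n < K)%N; [exact: measurable_cst|exact: (meas_cabs HT)].
have a0 n : 0 <= fine (Jabs (Jint m) (f n)) by exact: fine_ge0.
have fa : (\esum_(n in [set: nat]) (fine (Jabs (Jint m) (f n)))%:E < +oo)%E.
  by under eq_esum do rewrite fineK//.
have ft K : (Jr (Jint m) (fun t => fine (asum (tail K (f^~ t)))) < +oo)%E.
  rewrite st; apply: le_lt_trans fa; apply: le_esum => n _.
  by rewrite lee_fin /tail; case: ifP.
have at_ K : cint_able (measurable_fun [set: T]) (Jint m) (fun t => csum (tail K (f^~ t))).
  apply: (cint_able_le HT (mt K) (mat K)) => [t|//].
  by apply: csum_norm; case: (csum_tailE K (sf t)).
have E K : cint_able (measurable_fun [set: T]) (Jint m) (fun t => csum (f^~ t)) /\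
  cI (Jint m) (fun t => csum (f^~ t)) =
    \sum_(k < K) cI (Jint m) (f k) + cI (Jint m) (fun t => csum (tail K (f^~ t))).
  have [b1 b2] := cint_able_sum HT (index_enum 'I_K) (Jint0 m) (fun i : 'I_K => af i).
  have e : (fun t => csum (f^~ t)) = (fun t => \sum_(k < K) f k t + csum (tail K (f^~ t))).
    by apply/funext => t; case: (csum_tailE K (sf t)).
  by rewrite e; split; [exact: (cint_ableD HT)|rewrite (cID HT b1 (at_ K)) b2].
split; first exact: (E 0).1.
have sA : csummable (fun n => cI (Jint m) (f n)).
  by apply: csummable_le fa => n; exact: (cI_norm HT).
apply: eq_cabs_eps => e e0; have e20 : 0 < e / 2 by rewrite divr_gt0.
have [K1 h1] := csum_cvg sA e20.
have [K2 h2] := esum_tail a0 fa e20.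
pose K := maxn K1 K2.
have k1 := h1 K (leq_maxl _ _); have k2 := h2 K (leq_maxr _ _).
rewrite (E K).2; set s := \sum_(k < K) _ in k1 *; set u := cI _ _; set v := csum _ in k1 *.
have k3 : cabs u <= e / 2.
  apply: le_trans (cI_norm HT (at_ K)) _.
  have hfin : (Jabs (Jint m) (fun t => csum (tail K (f^~ t))) <= (e / 2)%:E)%E.
    apply: le_trans k2; rewrite -st; apply: (int_le HT) => //.
    - exact: (meas_cabs HT).
    - by move=> t; exact: cabs_ge0.
    - by move=> t; apply: csum_norm; case: (csum_tailE K (sf t)).
  rewrite -lee_fin fineK// ge0_fin_numE ?(le_lt_trans hfin) ?ltry//.
  by apply: (int_ge0 HT) => t; exact: cabs_ge0.
have -> : s + u - v = u - (v - s) by ring.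
by apply: le_trans (cabsB _ _) _; lra.
Qed.

End IntegralSeries.

(** * The exponential series of the displacement generator *)

Section Generator.
Variable R : realType.
Implicit Types (d : R[i]) (u : nat -> R[i]).

(** The action of d a^dagger - conj d a on coordinates. At m = 0 the meaningless predecessor is
    multiplied by sqrt 0. *)
Definition gen d u : nat -> R[i] := fun m =>
  d * (Num.sqrt m%:R)%:C * u m.-1 - conjc d * (Num.sqrt m.+1%:R)%:C * u m.+1.

Lemma opmul_gen d (X : op R nat) n :
  (fun m => opmul (displacement_generator d) X m n) = gen d (fun j => X j n).
Proof.
apply/funext => m; rewrite /opmul /displacement_generator /adjoint /annihilation /gen.
case: m => [|m].
  rewrite (csum_single_support (j := 1)) => [|j j1].
    by rewrite (_ : (0 == 2)%N = false)// eqxx conjc0 sqrtr0 (rmorph0 (real_complex R)) !mulr0 mul0r !sub0r mulNr.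
  by rewrite (_ : (0 == j.+1)%N = false)// (negbTE j1) conjc0 !mulr0 subr0 mul0r.
have [||_ ->] := @csum_finite R _ (fun j => (d * conjc (if m.+1 == j.+1 then (Num.sqrt m.+1%:R)%:C else 0) -
   conjc d * (if j == m.+2 then (Num.sqrt j%:R)%:C else 0)) * X j n) [:: m; m.+2].
- by rewrite /= inE andbT neq_ltn ltnS leqnSn.
- move=> j; rewrite !inE negb_or => /andP[jm jm2].
  by rewrite eqSS eq_sym (negbTE jm) (negbTE jm2) conjc0 !mulr0 subr0 mul0r.
rewrite big_cons big_seq1 !eqxx conjc_real.
rewrite (_ : (m == m.+2) = false); last by apply/negP => /eqP; lia.
rewrite (_ : (m.+1 == m.+3) = false); last by apply/negP => /eqP; lia.
by rewrite conjc0 !mulr0 subr0 sub0r mulNr.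
Qed.

Lemma iter_opmul_gen d k m n :
  iter k (opmul (displacement_generator d)) (@opid R nat) m n =
  iter k (gen d) (ebase R n) m.
Proof.
elim: k m => [//|k IH] m; rewrite !iterS.
have := congr1 (fun f => f m) (opmul_gen d (iter k (opmul (displacement_generator d)) (@opid R nat)) n).
by rewrite /= => ->; congr gen; apply/funext => j.
Qed.

Lemma gen_le d u m (N : nat) : (m < N)%N ->
  cabs (gen d u m) <= cabs d * Num.sqrt N%:R * (cabs (u m.-1) + cabs (u m.+1)).
Proof.
move=> mN; apply: le_trans (cabsB _ _) _.
rewrite !cabsM !cabsC cabs_conj !ger0_norm ?sqrtr_ge0// mulrDr.
apply: lerD; rewrite ler_wpM2r ?cabs_ge0// ler_wpM2l ?cabs_ge0// ler_wsqrtr// ler_nat//.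
exact: ltnW.
Qed.

(** Each application moves the index by one, so k applications at m meet no square root weight
    larger than sqrt N; each doubles the number of terms. *)
Lemma iter_gen_le d u (U : R) k m N : (forall n, cabs (u n) <= U) -> (m + k <= N)%N ->
  cabs (iter k (gen d) u m) <= (2 * cabs d * Num.sqrt N%:R) ^+ k * U.
Proof.
move=> uU; elim: k m => [|k IH] m mk; first by rewrite expr0 mul1r.
rewrite iterS; apply: le_trans (gen_le _ _ (N := N) _) _; first by lia.
have h1 : cabs (iter k (gen d) u m.-1) <= (2 * cabs d * Num.sqrt N%:R) ^+ k * U.
  by apply: IH; lia.
have h2 : cabs (iter k (gen d) u m.+1) <= (2 * cabs d * Num.sqrt N%:R) ^+ k * U.
  by apply: IH; lia.
rewrite exprS; set q := _ ^+ k in h1 h2 *.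
have -> : 2 * cabs d * Num.sqrt N%:R * q * U = cabs d * Num.sqrt N%:R * (q * U + q * U) by ring.
by rewrite ler_wpM2l ?mulr_ge0 ?cabs_ge0 ?sqrtr_ge0// lerD.
Qed.

Let HS := esum_integration R nat.

(** The summands are the entries of row m of the k-th power of the generator, whose l^1 norm obeys
    the same recursion. *)
Lemma asum_iter_gen d k m N : (m + k <= N)%N ->
  (asum (fun n => iter k (gen d) (ebase R n) m) <= ((2 * cabs d * Num.sqrt N%:R) ^+ k)%:E)%E.
Proof.
elim: k m => [|k IH] m mk.
  rewrite expr0 /asum /=.
  rewrite -(esum_single m (@ler01 R)); apply: le_esum => n _.
  rewrite lee_fin /ebase eq_sym; case: eqP => _; last by rewrite cabs0.
  by rewrite (cabsC (1 : R)) normr1.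
pose c := cabs d * Num.sqrt N%:R; have c0 : 0 <= c by rewrite mulr_ge0 ?cabs_ge0 ?sqrtr_ge0.
apply: (@le_trans _ _ (\esum_(n in [set: nat]) (c * (cabs (iter k (gen d) (ebase R n) m.-1)
   + cabs (iter k (gen d) (ebase R n) m.+1)))%:E)).
  by apply: le_esum => n _; rewrite lee_fin iterS gen_le//; lia.
rewrite esum_scale//; last by move=> n; rewrite addr_ge0 ?cabs_ge0.
have := int_add HS (f := fun n => cabs (iter k (gen d) (ebase R n) m.-1))
  (g := fun n => cabs (iter k (gen d) (ebase R n) m.+1)) I I.
rewrite /Jsum => ->; [|by move=> n; exact: cabs_ge0..].
have h1 := IH m.-1 ltac:(lia); have h2 := IH m.+1 ltac:(lia).
rewrite exprS; set q := _ ^+ k in h1 h2 *.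
rewrite (_ : 2 * cabs d * Num.sqrt N%:R * q = c * (q + q)); last by rewrite /c; ring.
by rewrite [X in (_ <= X)%E]EFinM lee_wpmul2l ?lee_fin// EFinD leeD.
Qed.

Lemma gen_iter_apply d u (U : R) k m : (forall n, cabs (u n) <= U) ->
  csummable (fun n => iter k (gen d) (ebase R n) m * u n) /\
  csum (fun n => iter k (gen d) (ebase R n) m * u n) = iter k (gen d) u m.
Proof.
move=> uU; elim: k m => [|k IH] m.
  rewrite /= (csum_single_support (j := m)) => [|i im]; last first.
    by rewrite /ebase eq_sym (negbTE im) mul0r.
  rewrite {2}/ebase eqxx mul1r; split=> //.
  have [] := @csum_finite _ _ (fun n => ebase R n m * u n) [:: m]; rewrite // => i.
  by rewrite inE eq_sym /ebase => /negbTE ->; rewrite mul0r.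
rewrite (_ : (fun n => _) = (fun n => d * (Num.sqrt m%:R)%:C * (iter k (gen d) (ebase R n) m.-1 * u n)
  + (- (conjc d * (Num.sqrt m.+1%:R)%:C)) * (iter k (gen d) (ebase R n) m.+1 * u n))); last first.
  by apply/funext => n; rewrite iterS /gen; ring.
have [s1 e1] := IH m.-1; have [s2 e2] := IH m.+1.
split; first by apply: csummableD; exact: csummableZ.
rewrite csumD ?csumZ//; [|exact: csummableZ..].
by rewrite e1 e2 iterS /gen mulNr.
Qed.

(** Bound, for c = 2 |d|, on term k of the exponential series in row m. It is summable in k because
    k! outgrows k^(k/2). *)
Definition gbound (c : R) m k : R := (c * Num.sqrt (m + k)%:R) ^+ k / k`!%:R.

Lemma gbound_ge0 c m k : 0 <= c -> 0 <= gbound c m k.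
Proof. by move=> c0; rewrite divr_ge0// exprn_ge0// mulr_ge0// sqrtr_ge0. Qed.

Lemma pow_fact_le (x : R) k : 0 <= x -> x ^+ k / k`!%:R <= expR x.
Proof.
move=> x0; rewrite -lee_fin -nneseries_exp//.
have := @esum_seq_le R nat (fun n => x ^+ n / n`!%:R) [:: k] isT; rewrite big_seq1; apply.
by move=> n; rewrite divr_ge0// exprn_ge0.
Qed.

Lemma esum_geometric : (\esum_(k in [set: nat]) ((2^-1 : R) ^+ k)%:E <= 2%:E)%E.
Proof.
rewrite -nneseries_esumT => [|k]; last by rewrite lee_fin exprn_ge0.
apply: lime_le; first by apply: is_cvg_nneseries => k _ _; rewrite lee_fin exprn_ge0.
apply: nearW => n; rewrite sumEFin lee_fin big_mkord.
have -> : \sum_(i < n) (2^-1 : R) ^+ i = 2 - 2 * 2^-1 ^+ n.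
  elim: n => [|n IH]; first by rewrite big_ord0 expr0 mulr1 subrr.
  by rewrite big_ord_recr /= IH exprS; field.
by rewrite lerBlDr lerDl mulr_ge0// exprn_ge0.
Qed.

Lemma gbound_le c m k : 0 <= c ->
  gbound c m k <= expR m%:R * ((2 * c ^+ 2 * expR 1) ^+ k / k`!%:R) + 2^-1 ^+ k.
Proof.
move=> c0; set x := gbound c m k; have x0 : 0 <= x by exact: gbound_ge0.
(* Squaring removes the square root, through x <= P x^2 + 1 / P; with P = 2^k the second term stays
   summable, and the first one is controlled by (m + k)^k / k! <= exp(m + k). *)
pose P : R := 2 ^+ k; have P0 : 0 < P by rewrite exprn_gt0.
have f0 : (0 : R) < k`!%:R by rewrite ltr0n fact_gt0.
have h1 : x <= P * x ^+ 2 + P^-1.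
  rewrite -(ler_pM2l P0) mulrDr divff ?gt_eqF//.
  have := sqr_ge0 (P * x - 1); have : 0 <= P * x by rewrite mulr_ge0// ltW.
  rewrite (_ : P * (P * x ^+ 2) = (P * x) ^+ 2); last by ring.
  by set y := P * x; nra.
apply: le_trans h1 _; rewrite exprVn lerD2r.
have -> : P * x ^+ 2 = (2 * c ^+ 2) ^+ k / k`!%:R * ((m + k)%:R ^+ k / k`!%:R).
  have a2 : ((c * Num.sqrt (m + k)%:R) ^+ k) ^+ 2 = (c ^+ 2) ^+ k * (m + k)%:R ^+ k.
    by rewrite exprAC [(c * _) ^+ 2]exprMn sqr_sqrtr// exprMn.
  rewrite /x /gbound expr_div_n a2 /P [(2 * c ^+ 2) ^+ k]exprMn.
  by field; rewrite gt_eqF.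
apply: (@le_trans _ _ ((2 * c ^+ 2) ^+ k / k`!%:R * expR (m + k)%:R)).
  rewrite ler_wpM2l ?pow_fact_le// divr_ge0 ?exprn_ge0 ?mulr_ge0 ?sqr_ge0//.
rewrite natrD expRD -(mulr1 k%:R) expRM_natl [(_ * expR 1) ^+ k]exprMn.
by rewrite le_eqVlt; apply/orP; left; apply/eqP; field; rewrite gt_eqF.
Qed.

Lemma gbound_summable c m : 0 <= c ->
  (\esum_(k in [set: nat]) (gbound c m k)%:E < +oo)%E.
Proof.
move=> c0; have b0 : 0 <= 2 * c ^+ 2 * expR 1 :> R.
  by rewrite !mulr_ge0 ?expR_ge0// sqr_ge0.
apply: (@le_lt_trans _ _ (\esum_(k in [set: nat])
  (expR m%:R * ((2 * c ^+ 2 * expR 1) ^+ k / k`!%:R) + 2^-1 ^+ k)%:E)).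
  by apply: le_esum => k _; rewrite lee_fin gbound_le.
have := int_add HS (f := fun k => expR m%:R * ((2 * c ^+ 2 * expR 1) ^+ k / k`!%:R))
  (g := fun k => 2^-1 ^+ k) I I.
have h k : 0 <= (2 * c ^+ 2 * expR 1) ^+ k / k`!%:R :> R by rewrite divr_ge0// exprn_ge0.
rewrite /Jsum => ->; [|by move=> k; rewrite ?mulr_ge0 ?expR_ge0 ?exprn_ge0..].
rewrite esum_scale ?expR_ge0// nneseries_exp// -EFinM lte_add_pinfty ?ltry//.
exact: le_lt_trans esum_geometric (ltry _).
Qed.

Lemma iter_gen_gbound d u (U : R) k m : (forall n, cabs (u n) <= U) ->
  cabs ((k`!%:R)^-1 * iter k (gen d) u m) <= gbound (2 * cabs d) m k * U.
Proof.
move=> uU; rewrite -(rmorph_nat (real_complex R)) -fmorphV cabsM cabsC.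
rewrite ger0_norm ?invr_ge0// /gbound mulrC mulrAC ler_wpM2r ?invr_ge0//.
exact: iter_gen_le.
Qed.

(** Stated for bounded sequences, so that it covers coherent states as well as the constant 1, which
    yields the summability of the rows. The double series over k and n is dominated by [gbound]. *)
Lemma apply_displacement d u (U : R) m : 0 <= U -> (forall n, cabs (u n) <= U) ->
  [/\ csummable (fun n => displacement d m n * u n),
      csummable (fun k => (k`!%:R)^-1 * iter k (gen d) u m) &
  apply (displacement d) u m = csum (fun k => (k`!%:R)^-1 * iter k (gen d) u m)].
Proof.
move=> U0 uU.
have c0 : 0 <= 2 * cabs d by rewrite mulr_ge0 ?cabs_ge0.
pose f (k n : nat) : R[i] := (k`!%:R)^-1 * iter k (gen d) (ebase R n) m * u n.
have gs : (\esum_(k in [set: nat]) (gbound (2 * cabs d) m k * U)%:E < +oo)%E.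
  under eq_esum do rewrite mulrC.
  rewrite esum_scale//; last by move=> k; exact: gbound_ge0.
  have := gbound_summable m c0.
  have : (0 <= \esum_(k in [set: nat]) (gbound (2 * cabs d) m k)%:E)%E.
    by apply: esum_ge0 => k _; rewrite lee_fin gbound_ge0.
  by move=> h0 h1; rewrite lte_mul_pinfty// lee_fin.
have fl k : (asum (f k) <= (gbound (2 * cabs d) m k * U)%:E)%E.
  have h1 : 0 <= (k`!%:R)^-1 * U :> R by rewrite mulr_ge0// invr_ge0.
  apply: (@le_trans _ _ (\esum_(n in [set: nat]) ((k`!%:R)^-1 * U * cabs (iter k (gen d) (ebase R n) m))%:E)).
    apply: le_esum => n _; rewrite lee_fin /f !cabsM -(rmorph_nat (real_complex R)) -fmorphV cabsC.
    rewrite ger0_norm ?invr_ge0// [leLHS]mulrAC ler_wpM2r ?cabs_ge0// ler_wpM2l ?invr_ge0//.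
  rewrite esum_scale//; last by move=> n; exact: cabs_ge0.
  have := @asum_iter_gen d k m (m + k) (leqnn _).
  rewrite /gbound (_ : _ / _ * U = (k`!%:R)^-1 * U * (2 * cabs d * Num.sqrt (m + k)%:R) ^+ k); last by ring.
  by rewrite [X in _ -> (_ <= X)%E]EFinM => h; rewrite lee_wpmul2l ?lee_fin.
have sf : csummable (fun p : nat * nat => f p.1 p.2) by exact: csummable_pair fl gs.
have sf' : csummable (fun p : nat * nat => f p.2 p.1).
  move: sf; rewrite /csummable /asum !esum_pair /=; [|by move=> p; exact: cabs_ge0..].
  by rewrite (@esum_swap _ _ _ (fun p : nat * nat => cabs (f p.1 p.2))) // => p; exact: cabs_ge0.
have [h1 h2 _] := csum_pair sf'; have [_ h3 _] := csum_pair sf.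
have E n : displacement d m n * u n = csum (fun k => f k n).
  rewrite /displacement mulrC -csumZ.
    by congr csum; apply/funext => k; rewrite iter_opmul_gen /f mulrC.
  apply: csummable_le (gbound_summable m c0) => k; rewrite iter_opmul_gen.
  rewrite -[leRHS]mulr1; apply: iter_gen_gbound => i; rewrite /ebase.
  by case: eqP => _; rewrite ?cabs0// (cabsC (1 : R)) normr1.
have E2 k : csum (f k) = (k`!%:R)^-1 * iter k (gen d) u m.
  have [g1 <-] := gen_iter_apply d k m uU; rewrite -csumZ//.
  by congr csum; apply/funext => n; rewrite /f mulrA.
split.
- by under eq_fun do rewrite E.
- by under eq_fun do rewrite -E2.
- rewrite /apply; under eq_fun do rewrite E; rewrite -(csum_swap sf).
  by congr csum; apply/funext => k; rewrite E2.
Qed.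

Lemma displacement_row d m : csummable (displacement d m).
Proof.
have [] := @apply_displacement d (fun=> 1) 1 m ler01.
  by move=> n; rewrite (cabsC (1 : R)) normr1.
by under eq_fun do rewrite mulr1.
Qed.

End Generator.

(** * Derivatives of complex functions of a real variable *)

Section ComplexDerivative.
Variable R : realType.
Implicit Types (f g : R -> R[i]) (t : R) (a b : R[i]).

Definition cdv t f a : Prop :=
  is_derive t 1 (fun s => complex.Re (f s)) (complex.Re a) /\
  is_derive t 1 (fun s => complex.Im (f s)) (complex.Im a).

Lemma cdv_eq t f a b : cdv t f a -> a = b -> cdv t f b.
Proof. by move=> h <-. Qed.

Lemma cdv_add t f g a b : cdv t f a -> cdv t g b -> cdv t (fun s => f s + g s) (a + b).
Proof.
move=> [h1 h2] [k1 k2]; split; rewrite ?ReD ?ImD.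
  by under eq_fun do rewrite ReD; exact: dv_add.
by under eq_fun do rewrite ImD; exact: dv_add.
Qed.

Lemma cdv_mul t f g a b : cdv t f a -> cdv t g b ->
  cdv t (fun s => f s * g s) (a * g t + f t * b).
Proof.
move=> [h1 h2] [k1 k2]; split; rewrite ?ReD ?ImD ?ReM ?ImM.
  under eq_fun do rewrite ReM.
  by apply: dv_eq (dv_add (dv_mul h1 k1) (dv_opp (dv_mul h2 k2))) _; ring.
under eq_fun do rewrite ImM.
by apply: dv_eq (dv_add (dv_mul h1 k2) (dv_mul h2 k1)) _; ring.
Qed.

Lemma cdv_cst t c : cdv t (fun=> c) 0.
Proof. by split; exact: dv_cst. Qed.

Lemma cdv_real t (f : R -> R) (a : R) : is_derive t 1 f a -> cdv t (fun s => (f s)%:C) a%:C.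
Proof. by split => //=; exact: dv_cst. Qed.

Lemma cdv_pow t f a n : cdv t f a -> cdv t (fun s => f s ^+ n) (n%:R * f t ^+ n.-1 * a).
Proof.
move=> h; elim: n => [|n IH].
  under eq_fun do rewrite expr0.
  by rewrite !mul0r; exact: cdv_cst.
under eq_fun do rewrite exprS.
apply: (cdv_eq (cdv_mul h IH)).
case: n {IH} => [|n] /=; first by rewrite expr0; ring.
by rewrite [f t ^+ n.+1]exprS [n.+2%:R]mulrS; ring.
Qed.

Lemma mean_value_le (f df : R -> R) (B : R) : (forall t, is_derive t 1 f (df t)) ->
  (forall t, 0 <= t <= 1 -> `|df t| <= B) -> `|f 1 - f 0| <= B.
Proof.
move=> h hB; have [|t] := @MVT R f df 0 1 ltr01 (fun t _ => h t).
  by apply: continuous_subspaceT; exact: dv_continuous h.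
rewrite in_itv /= => /andP[/ltW t0 /ltW t1] ->; rewrite subr0 mulr1 hB//.
by rewrite t0 t1.
Qed.

(** The mean value theorem is applied to the real and imaginary parts separately, at possibly
    different points; hence the factor 2. *)
Lemma cmean_value_le (f df : R -> R[i]) (B : R) : (forall t, cdv t f (df t)) ->
  (forall t, 0 <= t <= 1 -> cabs (df t) <= B) -> cabs (f 1 - f 0) <= 2 * B.
Proof.
move=> h hB; apply: le_trans (cabs_ReIm _) _.
rewrite ReD ReN ImD ImN mulr2n mulrDl mul1r; apply: lerD.
  apply: (mean_value_le (fun t => (h t).1)) => t /hB; exact: le_trans (Re_cabs _).
apply: (mean_value_le (fun t => (h t).2)) => t /hB; exact: le_trans (Im_cabs _).
Qed.

Definition cis (x : R) : R[i] := cos x +i* sin x.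

Lemma sqmod_cis x : sqmod (cis x) = 1.
Proof. exact: cos2Dsin2. Qed.

Lemma cis0 : cis 0 = 1.
Proof. by rewrite /cis cos0 sin0. Qed.

Lemma conj_cis x : conjc (cis x) = cis (- x).
Proof. by rewrite /cis cosN sinN. Qed.

Lemma cdv_cis t (f : R -> R) (a : R) : is_derive t 1 f a ->
  cdv t (fun s => cis (f s)) (a%:C * 'i%C * cis (f t)).
Proof.
move=> h; split; rewrite /cis !(ReM, ImM) /=.
  by apply: dv_eq (dv_comp h (is_derive_cos _)) _; ring.
by apply: dv_eq (dv_comp h (is_derive_sin _)) _; ring.
Qed.

End ComplexDerivative.

(** * The action of D(d) on coherent states *)

Section DisplacedCoherent.
Variable R : realType.
Implicit Types (d b z : R[i]).

Lemma cdv_gen d (V : R -> nat -> R[i]) (V' : nat -> R[i]) t m :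
  (forall n, cdv t (fun s => V s n) (V' n)) ->
  cdv t (fun s => gen d (V s) m) (gen d V' m).
Proof.
move=> h.
have := cdv_add (cdv_mul (cdv_cst t (d * (Num.sqrt m%:R)%:C)) (h m.-1))
  (cdv_mul (cdv_cst t (- (conjc d * (Num.sqrt m.+1%:R)%:C))) (h m.+1)).
rewrite (_ : (fun s => _) = (fun s => gen d (V s) m)); last first.
  by apply/funext => s; rewrite /gen mulNr.
by move=> /cdv_eq; apply; rewrite /gen !mul0r !add0r mulNr.
Qed.

Lemma cabs_coherent z n : cabs (coherent z n) <= 1.
Proof.
have := sqmod_le_sqnorm (coherent z) n; rewrite sqnorm_coherent lee_fin => h.
by rewrite /cabs -sqrtr1 ler_wsqrtr.
Qed.

Let mono_n z n : R[i] := (Num.sqrt n`!%:R)^-1%:C * z ^+ n.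

Let sqrt_fact n : Num.sqrt n.+1`!%:R = Num.sqrt n.+1%:R * Num.sqrt n`!%:R :> R.
Proof. by rewrite factS natrM sqrtrM. Qed.

Let sqrt_nat0 n : Num.sqrt n.+1%:R != 0 :> R.
Proof. by rewrite gt_eqF// sqrtr_gt0 ltr0n. Qed.

Let sqrt_fact0 n : Num.sqrt n`!%:R != 0 :> R.
Proof. by rewrite gt_eqF// sqrtr_gt0 ltr0n fact_gt0. Qed.

Let mono_succ z n : (Num.sqrt n.+1%:R)%:C * mono_n z n.+1 = z * mono_n z n.
Proof.
rewrite /mono_n sqrt_fact invfM (rmorphM (real_complex R)) exprS.
have e : (Num.sqrt n.+1%:R)%:C * ((Num.sqrt n.+1%:R)^-1)%:C = 1 :> R[i].
  by rewrite -rmorphM divff.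
by rewrite !mulrA e mul1r mulrAC mulrC mulrA.
Qed.

Let mono_dv z n : ((Num.sqrt n`!%:R)^-1)%:C * (n%:R * z ^+ n.-1) =
  (Num.sqrt n%:R)%:C * mono_n z n.-1.
Proof.
case: n => [|n]; first by rewrite mul0r mulr0 sqrtr0 mul0r.
rewrite /mono_n /= [LHS]mulrA [RHS]mulrA -(rmorph_nat (real_complex R)) -!rmorphM.
congr (_%:C * _); rewrite sqrt_fact invfM -{2}(sqr_sqrtr (ler0n R n.+1)).
by field; rewrite sqrt_fact0 sqrt_nat0.
Qed.

Let coh_mono z n : coherent z n = (expR (- sqmod z / 2))%:C * mono_n z n.
Proof. by rewrite /coherent /mono_n mulrA -rmorphM. Qed.

(** The phase exp((d conj b - conj d b) / 2) of the Weyl relation between D(d) D(b) and D(b + d). *)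
Definition theta d b : R[i] := cis (- complex.Im (conjc d * b)).

Lemma sqmod_theta d b : sqmod (theta d b) = 1.
Proof. exact: sqmod_cis. Qed.

(* the curve exp(tG)|b> *)
Definition coh_curve d b (t : R) : nat -> R[i] := fun n =>
  cis (- t * complex.Im (conjc d * b)) * coherent (b + t%:C * d) n.

(** The curve solves u' = G u in each coordinate. Differentiating z^n gives the raising term; the
    Gaussian factor and the phase contribute the real and imaginary parts of - conj d z, which is
    the lowering term since a |z> = z |z>. *)
Lemma cdv_coh_curve d b t n :
  cdv t (fun s => coh_curve d b s n) (gen d (coh_curve d b t) n).
Proof.
set th := complex.Im (conjc d * b).
have hz : cdv t (fun s => b + s%:C * d) d.
  have := cdv_add (cdv_cst t b) (cdv_mul (cdv_real (dv_id t)) (cdv_cst t d)).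
  by move=> /cdv_eq; apply; rewrite mulr0 addr0 add0r mul1r.
set z := b + t%:C * d.
have hs : is_derive t 1 (fun s => expR (- sqmod (b + s%:C * d) / 2))
    (- complex.Re (conjc d * z) * expR (- sqmod z / 2)).
  have h := dv_exp (dv_mul (dv_opp (dv_add (dv_pow 2 hz.1) (dv_pow 2 hz.2))) (dv_cst 2^-1 t)).
  apply: dv_eq h _; rewrite -/z /= ReM Re_conj Im_conj /sqmod.
  by congr (_ * _); field.
have hc := cdv_cis (dv_mul (dv_opp (dv_id t)) (dv_cst th t)).
have hm : cdv t (fun s => mono_n (b + s%:C * d) n) ((Num.sqrt n%:R)%:C * mono_n z n.-1 * d).
  apply: cdv_eq (cdv_mul (cdv_cst t _) (cdv_pow n hz)) _.
  by rewrite mul0r add0r mulrA mono_dv.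
have := cdv_mul hc (cdv_mul (cdv_real hs) hm).
rewrite (_ : (fun s => _) = (fun s => coh_curve d b s n)); last first.
  by apply/funext => s; rewrite /coh_curve coh_mono.
move=> /cdv_eq; apply; rewrite -/z /gen /coh_curve !coh_mono -/th -/z.
set E := (expR _)%:C; set W := cis _.
(* The imaginary part of conj d z is constant along the curve, because conj d d is real; a phase
   linear in t therefore suffices. *)
have hcz : conjc d * z = (complex.Re (conjc d * z))%:C + 'i%C * th%:C.
  rewrite [LHS]complexE; congr (_ + 'i%C * _%:C).
  rewrite /z mulrDr ImD -/th mulrCA mulJc -rmorphM /=.
  by rewrite addr0.
set rr := complex.Re (conjc d * z) in hcz *.
have e1 : (-1 * th + - t * 0)%:C = - th%:C by rewrite mulr0 addr0 mulN1r (rmorphN (real_complex R)).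
have e2 : (- rr * expR (- sqmod z / 2))%:C = - rr%:C * E.
  by rewrite (rmorphM (real_complex R)) (rmorphN (real_complex R)).
rewrite e1 e2.
transitivity (d * (Num.sqrt n%:R)%:C * (W * (E * mono_n z n.-1)) -
   conjc d * z * (W * (E * mono_n z n))).
  by rewrite hcz; ring.
congr (_ - _); rewrite [RHS](_ : _ = conjc d * (W * (E * ((Num.sqrt n.+1%:R)%:C * mono_n z n.+1)))).
  by rewrite mono_succ; ring.
by ring.
Qed.

Lemma cabs_coh_curve d b t n : cabs (coh_curve d b t n) <= 1.
Proof.
rewrite /coh_curve cabsM -[leRHS]mulr1 ler_pM ?cabs_ge0 ?cabs_coherent//.
by rewrite /cabs sqmod_cis sqrtr1.
Qed.

Lemma cdv_iter_gen d b t k m :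
  cdv t (fun s => iter k (gen d) (coh_curve d b s) m) (iter k.+1 (gen d) (coh_curve d b t) m).
Proof.
elim: k m => [|k IH] m; first exact: cdv_coh_curve.
rewrite [iter k.+2 _ _]iterS; apply: cdv_gen => n; exact: IH.
Qed.

(** The Taylor sum for u(1) expanded at time t. It interpolates between u(1) at t = 1 and the
    partial sum of the exponential series on |b> at t = 0. *)
Let taylor d b m K (t : R) : R[i] :=
  \sum_(k < K) ((1 - t) ^+ k / k`!%:R)%:C * iter k (gen d) (coh_curve d b t) m.

(* the derivative of the Taylor sum telescopes *)
Let cdv_taylor d b m K t : cdv t (taylor d b m K.+1)
  (((1 - t) ^+ K / K`!%:R)%:C * iter K.+1 (gen d) (coh_curve d b t) m).
Proof.
elim: K => [|K IH].
  rewrite /taylor; under eq_fun do rewrite big_ord1 expr0 fact0 divr1 mul1r.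
  by rewrite expr0 fact0 divr1 mul1r; exact: (cdv_iter_gen d b t 0 m).
rewrite /taylor; under eq_fun do rewrite big_ord_recr.
have hr : is_derive t 1 (fun s : R => (1 - s) ^+ K.+1 / K.+1`!%:R) (- ((1 - t) ^+ K / K`!%:R)).
  have := dv_mul (dv_pow K.+1 (dv_add (dv_cst 1 t) (dv_opp (dv_id t)))) (dv_cst (K.+1`!%:R)^-1 t).
  move=> /dv_eq; apply; rewrite /= factS natrM; field.
  by rewrite addrC natr1 !pnatr_eq0 -lt0n fact_gt0.
apply: cdv_eq (cdv_add IH (cdv_mul (cdv_real hr) (cdv_iter_gen d b t K.+1 m))) _.
by rewrite (rmorphN (real_complex R)) mulNr addrA subrr add0r.
Qed.

Lemma displacement_coherent d b m :
  apply (displacement d) (coherent b) m = theta d b * coherent (b + d) m.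
Proof.
have c0 : 0 <= 2 * cabs d by rewrite mulr_ge0 ?cabs_ge0.
have [_ hs ->] := apply_displacement d m (@ler01 R) (cabs_coherent b).
have -> : theta d b * coherent (b + d) m = coh_curve d b 1 m.
  by rewrite /theta /coh_curve mulN1r mul1r.
have v0 : coh_curve d b 0 = coherent b.
  by apply/funext => n; rewrite /coh_curve oppr0 mul0r cis0 mul1r mul0r addr0.
(* The derivative of the Taylor sum carries 1 / K! rather than 1 / (K+1)!. Doubling the constant of
   [gbound] absorbs the missing factor, as K + 1 <= 2^(K+1); the outer 2 is that of
   [cmean_value_le]. *)
have mv K : cabs (coh_curve d b 1 m - \sum_(k < K.+1) (k`!%:R)^-1 * iter k (gen d) (coherent b) m)
    <= 2 * gbound (2 * (2 * cabs d)) m K.+1.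
  have := @cmean_value_le R _ _ (gbound (2 * (2 * cabs d)) m K.+1) (fun t => cdv_taylor d b m K t).
  rewrite (_ : taylor d b m K.+1 1 = coh_curve d b 1 m); last first.
    rewrite /taylor big_ord_recl big1 => [|k _]; last by rewrite subrr expr0n mul0r mul0r.
    by rewrite expr0 fact0 divr1 mul1r addr0.
  rewrite (_ : taylor d b m K.+1 0 = \sum_(k < K.+1) (k`!%:R)^-1 * iter k (gen d) (coherent b) m); last first.
    rewrite /taylor; apply: eq_bigr => k _; rewrite subr0 expr1n mul1r v0.
    by rewrite fmorphV rmorph_nat.
  apply=> t /andP[t0 t1]; rewrite cabsM cabsC.
  have h1 := iter_gen_le d (U := 1) (k := K.+1) (m := m) (cabs_coh_curve d b t) (leqnn _).
  have r0 : 0 <= (1 - t) ^+ K / K`!%:R by rewrite divr_ge0// exprn_ge0// subr_ge0.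
  have r1 : (1 - t) ^+ K / K`!%:R <= (K`!%:R)^-1.
    by rewrite -[leRHS]mul1r ler_wpM2r ?invr_ge0// exprn_ile1// ?subr_ge0// lerBlDr lerDl.
  rewrite ger0_norm//; apply: (@le_trans _ _ ((K`!%:R)^-1 * ((2 * cabs d * Num.sqrt (m + K.+1)%:R) ^+ K.+1 * 1))).
    by rewrite ler_pM ?cabs_ge0.
  rewrite mulr1 /gbound -(mulrA 2 (2 * cabs d)) [X in _ <= X / _]exprMn.
  set q := (2 * cabs d * _) ^+ K.+1.
  have q0 : 0 <= q by rewrite exprn_ge0// !mulr_ge0 ?cabs_ge0 ?sqrtr_ge0.
  have f0 : (0 : R) < K`!%:R by rewrite ltr0n fact_gt0.
  have -> : 2 ^+ K.+1 * q / K.+1`!%:R = (K`!%:R)^-1 * q * (2 ^+ K.+1 / K.+1%:R).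
    have p1 : 1 + K%:R != 0 :> R by rewrite addrC natr1 pnatr_eq0.
    have p2 : K`!%:R != 0 :> R by rewrite gt_eqF.
    by rewrite factS natrM; field; rewrite ?p1 ?p2.
  rewrite -[leLHS]mulr1 ler_wpM2l ?mulr_ge0 ?invr_ge0//.
  rewrite ler_pdivlMr ?ltr0n// mul1r -natrX ler_nat.
  exact: ltnW (ltn_expl _ _).
apply: eq_cabs_eps => e e0; have e30 : 0 < e / 3 by rewrite divr_gt0.
have [K1 h1] := csum_cvg hs e30.
have c20 : 0 <= 2 * (2 * cabs d) by rewrite mulr_ge0.
have [K2 h2] := esum_tail (fun k => gbound_ge0 m k c20) (gbound_summable m c20) e30.
pose K := maxn K1 K2.
have k1 := h1 K.+1 (leqW (leq_maxl _ _)).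
have k2 : gbound (2 * (2 * cabs d)) m K.+1 <= e / 3.
  have := h2 K (leq_maxr _ _); rewrite -lee_fin; apply: le_trans.
  have := @esum_seq_le R nat _ [:: K.+1] isT (tail_real K (fun k => gbound_ge0 m k c20)).
  by rewrite big_seq1 /tail ltnNge leqnSn.
have k3 := mv K.
set s := \sum_(k < K.+1) _ in k1 k3 *; set u := csum _ in k1 *; set v := coh_curve _ _ _ _ in k3 *.
have -> : u - v = (u - s) - (v - s) by ring.
by apply: le_trans (cabsB _ _) _; lra.
Qed.

End DisplacedCoherent.

Lemma cm_cis d (T : measurableType d) (R : realType) (f : T -> R) :
  measurable_fun setT f -> cmeas (measurable_fun [set: T]) (fun t => cis (f t)).
Proof.
move=> mf; split.
  exact: (measurableT_comp (continuous_measurable_fun (@continuous_cos R)) mf).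
exact: (measurableT_comp (continuous_measurable_fun (@continuous_sin R)) mf).
Qed.

Section Scaling.
Variables (R : realType) (I : choiceType).
Implicit Types (A : op R I) (phi psi : I -> R[i]).

Lemma apply_opscale c A phi : bounded A -> l2 phi ->
  apply (opscale c A) phi = (fun i => c%:C * apply A phi i).
Proof.
move=> bA hp; apply/funext => i; rewrite /apply -csumZ.
  by congr csum; apply/funext => j; rewrite /opscale mulrA.
by apply: l2_mul => //; exact: bounded_row.
Qed.

Lemma bounded_opscale c A : bounded A -> bounded (opscale c A).
Proof.
move=> bA; have [M hM] := bA; exists (c ^+ 2 * M) => phi hp.
rewrite apply_opscale// sqnormZ sqmodC [(_ * M)%:E]EFinM -muleA lee_wpmul2l ?lee_fin ?sqr_ge0//.
exact: hM.
Qed.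

Lemma dot_coef_ebase m (psi : I -> R[i]) : dot psi (ebase R m) = conjc (psi m).
Proof. by rewrite /dot (csum_single_support (j := m)) => [|i im]; rewrite /ebase ?eqxx ?mulr1// (negbTE im) mulr0. Qed.

(** The bound on the form at phi = A psi, divided by |A psi|. *)
Lemma contraction_form A (M : R) : 0 <= M ->
  (forall phi psi, l2 phi -> l2 psi -> cabs (dot phi (apply A psi)) <= M * nrm phi * nrm psi) ->
  bounded A ->
  forall psi, l2 psi -> nrm (apply A psi) <= M * nrm psi.
Proof.
move=> M0 h bA psi hp; have ha := l2_apply bA hp.
have := h _ _ ha hp; rewrite dot_self cabsC ger0_norm ?sqn_ge0// -nrm_sq expr2 mulrAC -mulrA.
have [->|n0] := eqVneq (nrm (apply A psi)) 0; first by rewrite mulr_ge0 ?nrm_ge0.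
have npos : 0 < nrm (apply A psi) by rewrite lt_neqAle eq_sym n0 nrm_ge0.
by rewrite mulrA ler_pM2r.
Qed.

Lemma nrm_le_sqnorm (u v : I -> R[i]) (M : R) : 0 <= M -> l2 u -> l2 v -> nrm u <= M * nrm v ->
  (sqnorm u <= (M ^+ 2)%:E * sqnorm v)%E.
Proof.
move=> M0 hu hv h; rewrite -!sqnK// -EFinM lee_fin -!nrm_sq -exprMn.
by rewrite lerXn2r ?nnegrE ?nrm_ge0 ?mulr_ge0 ?nrm_ge0.
Qed.

End Scaling.

(** * D(d) as a bounded operator *)

Section DisplacementOperator.
Variable R : realType.
Local Notation RR := (measurableTypeR R * measurableTypeR R)%type.
Implicit Types (d b z : R[i]) (phi psi : nat -> R[i]).
Let HP := integral_integration (plane R).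

Lemma cauchy_le (f g : R[i] -> R[i]) (A B : R) : 0 <= A -> 0 <= B -> cmeasC f -> cmeasC g ->
  (Lint (fun z => (sqmod (f z))%:E) <= A%:E)%E ->
  (Lint (fun z => (sqmod (g z))%:E) <= B%:E)%E ->
  (Lint (fun z => (cabs (f z) * cabs (g z))%:E) <= (Num.sqrt A * Num.sqrt B)%:E)%E.
Proof.
move=> A0 B0 mf mg hf hg.
have := cauchy_schwarz HP mf mg (le_lt_trans hf (ltry _)) (le_lt_trans hg (ltry _)).
move=> /le_trans; apply; rewrite lee_fin.
have h (u : R[i] -> R[i]) (D : R) : (Lint (fun z => (sqmod (u z))%:E) <= D%:E)%E ->
    Num.sqrt (fine (N2 (Jint (plane R)) (fun p => u (toC p)))) <= Num.sqrt D.
  move=> hu; rewrite ler_wsqrtr// -lee_fin fineK//.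
  by rewrite ge0_fin_numE ?(le_lt_trans hu (ltry _))//; exact: (N2_ge0 HP).
by rewrite ler_pM ?sqrtr_ge0//; exact: h.
Qed.

Lemma cmC_theta d : cmeasC (theta d).
Proof.
apply: cm_cis; apply: measurableT_comp; first exact: oppr_measurable.
exact: (cm_mul (cm_cst _ _) (cm_toC R)).2.
Qed.

Lemma cmC_dot_shift phi d : cmeasC (fun b => dot phi (coherent (b + d))).
Proof.
apply: (cmeas_dot (@esum_measurable_nat R)) => n; first exact: cm_cst.
by apply: cm_coherent; apply: cm_add; [exact: cm_toC|exact: cm_cst].
Qed.

Lemma Lint_translate d (f : R[i] -> \bar R) : emeasC f -> (forall z, 0 <= f z)%E ->
  Lint (fun z => f (z + d)) = Lint f.
Proof.
move=> mf f0; have E := Lint_affine d (oner_neq0 R) mf f0.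
have -> : Lint (fun z => f (z + d)) = Lint (fun z => f (1%:C * z + d)).
  by congr Lint; apply/funext => z; rewrite mul1r.
by rewrite E (_ : (1 ^+ 2)^-1 = 1) ?mul1e// expr1n invr1.
Qed.

Lemma bessel_shift phi d : l2 phi ->
  (Lint (fun b => (sqmod (dot phi (coherent (b + d))))%:E) <= (pi * sqn phi)%:E)%E.
Proof.
move=> hp.
have h (f : R[i] -> \bar R) B : emeasC f -> (forall z, 0 <= f z)%E ->
    (Lint f <= B)%E -> (Lint (fun z => f (z + d)%R) <= B)%E.
  by move=> mf f0; rewrite Lint_translate.
apply: (h (fun z => (sqmod (dot phi (coherent z)))%:E)) (bessel hp).
  by apply/measurable_EFinP; apply: cm_sqmod; exact: cmC_dot_coherent.
by move=> z; rewrite lee_fin sqmod_ge0.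
Qed.

(** This is pi^-1 D(d)|b><b|, written with the explicit value of D(d)|b>; its weak integral over b
    exists by the Bessel inequality. *)
Definition res_coh d b : op R nat :=
  opscale pi^-1 (ketbra (fun m => theta d b * coherent (b + d) m) (coherent b)).

Lemma bounded_res_coh d b : bounded (res_coh d b).
Proof. by apply: bounded_opscale; apply: bounded_ketbra; [apply: l2Z|]; exact: l2_coherent. Qed.

Lemma res_coh_form d b phi psi : l2 phi -> l2 psi ->
  dot phi (apply (res_coh d b) psi) =
  (pi^-1)%:C * (theta d b * (dot phi (coherent (b + d)) * dot (coherent b) psi)).
Proof.
move=> hp hq; have hc z := @l2_coherent R z; have ht := l2Z (theta d b) (hc (b + d)).
rewrite dot_opscale//; last exact: bounded_ketbra.
rewrite (dot_ketbra hp hq ht (hc b)) (dot_Zr _ hp (hc (b + d))).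
by rewrite !mulrA.
Qed.

Lemma cm_res_coh d phi psi : l2 phi -> l2 psi ->
  cmeasC (fun b => dot phi (apply (res_coh d b) psi)).
Proof.
move=> hp hq; rewrite /cmeasC; under eq_fun do rewrite res_coh_form//.
apply: cm_mul; first exact: cm_cst.
apply: cm_mul; first exact: cmC_theta.
apply: cm_mul; first exact: cmC_dot_shift.
under eq_fun do rewrite (dot_conj hq (l2_coherent _)); apply: cm_conj.
exact: cmC_dot_coherent.
Qed.

Lemma res_coh_le d phi psi : l2 phi -> l2 psi ->
  (Lint (fun b => (cabs (dot phi (apply (res_coh d b) psi)))%:E) <=
    (1 * nrm phi * nrm psi)%:E)%E.
Proof.
move=> hp hq.
have h1 := bessel_shift d hp; have h2 := bessel hq.
have := cauchy_le (mulr_ge0 (@pi_ge0 R) (sqn_ge0 phi)) (mulr_ge0 (@pi_ge0 R) (sqn_ge0 psi))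
  (cmC_dot_shift phi d) (cmC_dot_coherent psi) h1 h2.
rewrite !sqrtrM ?pi_ge0// mulrACA -expr2 sqr_sqrtr ?pi_ge0// => h.
rewrite (_ : (fun b => _) = (fun b => (pi^-1 *
   (cabs (dot phi (coherent (b + d))) * cabs (dot psi (coherent b))))%:E)); last first.
  apply/funext => b; rewrite res_coh_form// !cabsM cabsC ger0_norm ?invr_ge0 ?pi_ge0//.
  rewrite {1}/cabs sqmod_theta sqrtr1 mul1r.
  by rewrite (dot_conj hq (l2_coherent b)) cabs_conj.
rewrite /Lint (int_scale HP) ?invr_ge0 ?pi_ge0//; last first.
- by move=> p; rewrite mulr_ge0 ?cabs_ge0.
- by apply: measurable_funM; apply: cm_cabs; [exact: cmC_dot_shift|exact: cmC_dot_coherent].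
apply: (@le_trans _ _ ((pi^-1)%:E * (pi * (nrm phi * nrm psi))%:E)%E).
  by rewrite lee_wpmul2l ?lee_fin ?invr_ge0 ?pi_ge0.
by rewrite -EFinM lee_fin mulKf ?gt_eqF ?pi_gt0// mul1r.
Qed.

Let wis d := weak_int_is (bounded_res_coh d) (cm_res_coh d) (res_coh_le d).

Lemma Lint_sqmod_coh n : (Lint (fun z : R[i] => (sqmod (coherent z n))%:E) <= pi%:E)%E.
Proof.
have := bessel (@l2_ebase R nat n); rewrite -nrm_sq nrm_ebase expr1n mulr1.
by under eq_fun do rewrite dot_ebase.
Qed.

(** Coordinate m of D(d)|b> is the series of row m applied to |b>; integrated term by term against
    <b|n>, it collapses by [coh_orth]. Boundedness, contractivity and the adjoint of D(d) are all
    read off this integral rather than off the exponential series. *)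
Lemma displacement_weak d : displacement d = weak_int (res_coh d).
Proof.
rewrite (weak_intE (bounded_res_coh d) (cm_res_coh d) (res_coh_le d)).
apply/funext => m; apply/funext => n; rewrite /form_op /weak_form cintE.
pose f j (p : RR) : R[i] := (pi^-1)%:C * displacement d m j *
  (coherent (toC p) j * conjc (coherent (toC p) n)).
have cle (z : R[i]) j : cabs (coherent z j * conjc (coherent z n)) <= 1.
  by rewrite cabsM cabs_conj -[leRHS]mulr1 ler_pM ?cabs_ge0 ?cabs_coherent.
have fE p : dot (ebase R m) (apply (res_coh d (toC p)) (ebase R n)) = csum (f^~ p).
  rewrite (res_coh_form d _ (@l2_ebase R nat m) (@l2_ebase R nat n)) dot_ebase dot_coef_ebase mulrA mulrA -[_ * theta _ _ * _]mulrA.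
  rewrite -displacement_coherent mulrAC /apply -csumZ.
    by congr csum; apply/funext => j; rewrite /f; ring.
  by have [] := apply_displacement d m (@ler01 R) (cabs_coherent (toC p)).
have mf j : cmeas (measurable_fun [set: RR]) (f j).
  apply: cm_mul; first exact: cm_cst.
  apply: cm_mul; first by apply: cm_coherent; exact: cm_toC.
  by apply: cm_conj; apply: cm_coherent; exact: cm_toC.
have sD := csummableZ (pi^-1)%:C (displacement_row d m).
have sf p : csummable (f^~ p).
  apply: csummable_le sD => j; rewrite /f cabsM -[leRHS]mulr1.
  by rewrite ler_wpM2l ?cabs_ge0.
have Jf j : (Jabs (Jint (plane R)) (f j) <= (cabs (displacement d m j))%:E)%E.
  have := cauchy_le (@pi_ge0 R) (@pi_ge0 R)
    (cm_coherent j (cm_toC R)) (cm_coherent n (cm_toC R)) (Lint_sqmod_coh j) (Lint_sqmod_coh n).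
  rewrite -expr2 sqr_sqrtr ?pi_ge0// => h.
  rewrite /Jabs /Jr (_ : (fun t => _) = (fun t => ((pi^-1 * cabs (displacement d m j)) *
     (cabs (coherent (toC t) j) * cabs (coherent (toC t) n)))%:E)); last first.
    apply/funext => p; rewrite /f; move: (coherent (toC p) j) (coherent (toC p) n) => u v.
    rewrite !cabsM cabs_conj [cabs (pi^-1)%:C]cabsC ger0_norm//.
    by rewrite invr_ge0 pi_ge0.
  rewrite (int_scale HP) ?mulr_ge0 ?cabs_ge0 ?invr_ge0 ?pi_ge0//; last first.
  - by move=> p; rewrite mulr_ge0 ?cabs_ge0.
  - by apply: measurable_funM; apply: cm_cabs; apply: cm_coherent; exact: cm_toC.
  apply: (@le_trans _ _ ((pi^-1 * cabs (displacement d m j))%:E * pi%:E)%E).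
    by rewrite lee_wpmul2l ?lee_fin ?mulr_ge0 ?cabs_ge0 ?invr_ge0 ?pi_ge0.
  by rewrite -EFinM lee_fin mulrAC mulVf ?mul1r ?gt_eqF ?pi_gt0.
have sJ : (\esum_(j in [set: nat]) Jabs (Jint (plane R)) (f j) < +oo)%E.
  apply: le_lt_trans (displacement_row d m); apply: le_esum => j _; exact: Jf.
have [_] := cI_csum mf sf sJ.
under eq_fun do rewrite -fE; move=> ->.
have ab j := @coh_able R j n; have ort j : cI (Jint (plane R)) (f j) =
    (pi^-1)%:C * displacement d m j * (if j == n then pi%:C else 0).
  by rewrite -coh_orth cintE -(cIZ HP _ (ab j)).
rewrite (csum_single_support (j := n)) => [|j jn]; rewrite ort ?eqxx.
  by rewrite mulrAC -rmorphM mulVf ?mul1r ?gt_eqF ?pi_gt0.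
by rewrite (negbTE jn) mulr0.
Qed.

Lemma bounded_displacement d : bounded (displacement d).
Proof. by rewrite displacement_weak; case: (wis d). Qed.

Lemma displacement_dot d phi psi : l2 phi -> l2 psi ->
  dot phi (apply (displacement d) psi) = cint (fun b =>
  (pi^-1)%:C * (theta d b * (dot phi (coherent (b + d)) * dot (coherent b) psi))).
Proof.
move=> hp hq; rewrite displacement_weak ((wis d).2 _ _ hp hq).2.
by congr cint; apply/funext => b; rewrite res_coh_form.
Qed.

Lemma nrm_displacement d psi : l2 psi -> nrm (apply (displacement d) psi) <= nrm psi.
Proof.
move=> hq; rewrite -[leRHS]mul1r; apply: contraction_form => //; last exact: bounded_displacement.
move=> phi psi' hp hq'; rewrite displacement_weak ((wis d).2 _ _ hp hq').2 cintE.
have ab := (cintegrableP _).1 ((wis d).2 _ _ hp hq').1.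
apply: le_trans (cI_norm HP ab) _; rewrite -lee_fin fineK; first exact: res_coh_le.
by rewrite ge0_fin_numE ?ab.2//; apply: (int_ge0 HP) => p; exact: cabs_ge0.
Qed.

(** Conjugating the integral exchanges |b + d> and |b>; the translation b -> b - d restores the
    form, and the phases agree because conj d d is real. *)
Lemma adjoint_displacement d : adjoint (displacement d) = displacement (- d).
Proof.
apply/funext => m; apply/funext => n.
have e d' i j : displacement d' i j = cint (fun b => (pi^-1)%:C *
    (theta d' b * (coherent (b + d') i * conjc (coherent b j)))).
  rewrite -[LHS](dot_ebase i (fun i => displacement d' i j)).
  have -> : (fun i => displacement d' i j) = apply (displacement d') (ebase R j).
    apply/funext => k; rewrite /apply (csum_single_support (j := j)) => [|l lj].
      by rewrite /ebase eqxx mulr1.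
    by rewrite /ebase (negbTE lj) mulr0.
  rewrite (displacement_dot d' (@l2_ebase R nat i) (@l2_ebase R nat j)); congr cint; apply/funext => b.
  by rewrite dot_ebase dot_coef_ebase.
have ab d' i j : cint_able (measurable_fun [set: RR]) (Jint (plane R)) (fun p => (pi^-1)%:C *
    (theta d' (toC p) * (coherent (toC p + d') i * conjc (coherent (toC p) j)))).
  have := (cintegrableP _).1 ((wis d').2 _ _ (@l2_ebase R nat i) (@l2_ebase R nat j)).1.
  by under eq_fun do rewrite (res_coh_form d' _ (@l2_ebase R nat i) (@l2_ebase R nat j)) dot_ebase dot_coef_ebase.
rewrite /adjoint !e cintE -(cI_conj HP (ab _ _ _)).
pose h b := (pi^-1)%:C * (conjc (theta d (b - d)) * (coherent (b - d) m * conjc (coherent b n))).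
have mh : cmeasC h.
  apply: cm_mul; first exact: cm_cst.
  have mbd : cmeas (measurable_fun [set: RR]) (fun p => toC p - d).
    by apply: cm_add; [exact: cm_toC|exact: cm_cst].
  apply: cm_mul.
    apply: cm_conj; apply: cm_cis; apply: measurableT_comp; first exact: oppr_measurable.
    exact: (cm_mul (cm_cst _ _) mbd).2.
  by apply: cm_mul; [exact: cm_coherent|apply: cm_conj; apply: cm_coherent; exact: cm_toC].
have := cint_translate d mh; rewrite cintE => E.
transitivity (cint h).
  rewrite -E; congr cI; apply/funext => p; rewrite /h addrK.
  rewrite conjcM conjc_real conjcM conjcM conjcK; congr (_ * (_ * _)).
  by rewrite mulrC.
congr cint; apply/funext => b; rewrite /h; congr (_ * (_ * _)).
rewrite /theta conj_cis opprK; congr cis.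
by rewrite conjcN mulNr ImN opprK mulrBr mulJc ImD ImN /= subr0.
Qed.

Lemma cmC_displacement m n : cmeasC (fun d => displacement d m n).
Proof.
apply: (cmeas_csum (@esum_measurable_nat R)) => k.
apply: cm_mul; first exact: cm_cst.
under eq_fun do rewrite iter_opmul_gen.
elim: k m => [|k IH] m; first exact: cm_cst.
rewrite /=; under eq_fun do rewrite /gen.
apply: cm_add.
  by apply: cm_mul => //; apply: cm_mul; [exact: cm_toC|exact: cm_cst].
under eq_fun do rewrite -mulNr -mulNr.
apply: cm_mul => //; apply: cm_mul; last exact: cm_cst.
by under eq_fun do rewrite -conjcN -mulN1r; apply: cm_conj; apply: cm_mul; [exact: cm_cst|exact: cm_toC].
Qed.

End DisplacementOperator.

(** * Resolutions of the identity and additive noise *)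

Section Tensor.
Variables (R : realType) (I J : choiceType).
Implicit Types (phi : I * J -> R[i]) (A : op R I) (Y : op R (I * J)%type).

Lemma esum_term_le (K : choiceType) (a : K -> \bar R) k : (forall i, 0 <= a i)%E ->
  (a k <= \esum_(i in [set: K]) a i)%E.
Proof.
by move=> a0; apply: esum_ge; exists [set k] => //=; rewrite fsbig_set1.
Qed.

Lemma esum_fiber (g : I * J -> R) r : (forall p, 0 <= g p) ->
  (forall i j, j != r -> g (i, j) = 0) ->
  \esum_(p in [set: I * J]) (g p)%:E = \esum_(i in [set: I]) (g (i, r))%:E.
Proof.
move=> g0 gr; rewrite esum_pair//; apply: eq_esum => i _.
rewrite -[RHS](esum_single r (g0 (i, r))); apply: eq_esum => j _.
by case: eqP => [->//|/eqP jr]; rewrite gr.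
Qed.

Lemma csum_fiber (f : I * J -> R[i]) r : (forall i j, j != r -> f (i, j) = 0) ->
  csum f = csum (fun i => f (i, r)).
Proof.
move=> fr; rewrite !csumE /cI /rI !rposE !rnegE.
have h (a : R[i] -> R) : a 0 = 0 ->
    Jsum (fun p => (rpos (fun p => a (f p)) p)%:E) =
    Jsum (fun i => (rpos (fun i => a (f (i, r))) i)%:E) /\
    Jsum (fun p => (rneg (fun p => a (f p)) p)%:E) =
    Jsum (fun i => (rneg (fun i => a (f (i, r))) i)%:E).
  move=> a0; split; rewrite /Jsum (esum_fiber (r := r)) //.
  - by move=> p; exact: rpos_ge0.
  - by move=> i j jr; rewrite /rpos fr// a0 maxxx.
  - by move=> p; exact: rneg_ge0.
  - by move=> i j jr; rewrite /rneg fr// a0 oppr0 maxxx.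
by have [-> ->] := h (@complex.Re R) erefl; have [-> ->] := h (@complex.Im R) erefl.
Qed.

Definition slice phi (r : J) : I -> R[i] := fun i => phi (i, r).

(** The block (1 (x) <r|) Y (1 (x) |s>) on which [ampl] acts. *)
Definition blk Y (r s : J) : op R I := fun i j => Y (i, r) (j, s).

Lemma sqnorm_slice phi : sqnorm phi = \esum_(r in [set: J]) sqnorm (slice phi r).
Proof.
rewrite /sqnorm esum_pair; last by move=> p; exact: sqmod_ge0.
by rewrite (esum_swap (f := fun p => sqmod (phi p)))// => p; exact: sqmod_ge0.
Qed.

Lemma l2_slice phi r : l2 phi -> l2 (slice phi r).
Proof.
rewrite /l2 sqnorm_slice; apply: le_lt_trans.
by apply: esum_term_le => s; exact: sqnorm_ge0.
Qed.

Lemma sqnorm_tensv (u : I -> R[i]) (v : J -> R[i]) : l2 u -> l2 v ->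
  sqnorm (tensv u v) = (sqn u * sqn v)%:E.
Proof.
move=> hu hv; rewrite /sqnorm esum_pair; last by move=> p; exact: sqmod_ge0.
transitivity (\esum_(i in [set: I]) (sqn v * sqmod (u i))%:E).
  apply: eq_esum => i _; under eq_esum do rewrite /tensv /= sqmodM.
  rewrite esum_scale ?sqmod_ge0//; last by move=> j; exact: sqmod_ge0.
  by rewrite -/(sqnorm v) -sqnK// -EFinM mulrC.
rewrite esum_scale ?sqn_ge0//; last by move=> i; exact: sqmod_ge0.
by rewrite -/(sqnorm u) -sqnK// -EFinM mulrC.
Qed.

Lemma l2_tensv (u : I -> R[i]) (v : J -> R[i]) : l2 u -> l2 v -> l2 (tensv u v).
Proof. by move=> hu hv; rewrite /l2 sqnorm_tensv// ltry. Qed.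

Lemma apply_blk Y r s (phi : I -> R[i]) :
  apply (blk Y r s) phi = slice (apply Y (tensv phi (ebase R s))) r.
Proof.
apply/funext => i; rewrite /apply /slice (csum_fiber (r := s)) => [|j t ts].
  by congr csum; apply/funext => j; rewrite /tensv /ebase /= eqxx mulr1.
by rewrite /tensv /ebase /= (negbTE ts) !mulr0.
Qed.

Lemma bounded_blk Y r s : bounded Y -> bounded (blk Y r s).
Proof.
move=> [M hM]; exists M => phi hp; have ht := l2_tensv hp (@l2_ebase R J s).
rewrite apply_blk; apply: le_trans (_ : _ <= sqnorm (apply Y (tensv phi (ebase R s))))%E _.
  rewrite [leRHS]sqnorm_slice.
  by apply: (@esum_term_le _ (fun r => sqnorm (slice (apply Y (tensv phi (ebase R s))) r))) => t; exact: sqnorm_ge0.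
apply: le_trans (hM _ ht) _.
by rewrite (sqnorm_tensv hp (@l2_ebase R J s)) -(nrm_sq (ebase R s)) nrm_ebase expr1n mulr1 sqnK.
Qed.

Lemma apply_tenso_id A phi i r :
  apply (tenso A (@opid R J)) phi (i, r) = apply A (slice phi r) i.
Proof.
rewrite /apply (csum_fiber (r := r)) => [|j t tr].
  by congr csum; apply/funext => j; rewrite /tenso /opid /= eqxx mulr1.
by rewrite /tenso /opid /= eq_sym (negbTE tr) mulr0 mul0r.
Qed.

(** A (x) 1 acts on each slice separately, and the square norms of the slices add up. *)
Lemma sqnorm_tenso_id A (M : R) : 0 <= M ->
  (forall psi, l2 psi -> (sqnorm (apply A psi) <= M%:E * sqnorm psi)%E) ->
  forall phi, l2 phi -> (sqnorm (apply (tenso A (@opid R J)) phi) <= M%:E * sqnorm phi)%E.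
Proof.
move=> M0 h phi hp; have hs r := l2_slice r hp.
have E : \esum_(r in [set: J]) sqnorm (slice phi r) = \esum_(r in [set: J]) (sqn (slice phi r))%:E.
  by apply: eq_esum => r _; rewrite sqnK.
rewrite [X in (_ <= _ * X)%E]sqnorm_slice E -esum_scale//; last by move=> r; exact: sqn_ge0.
rewrite sqnorm_slice; apply: le_esum => r _.
rewrite (_ : slice _ r = apply A (slice phi r)); last first.
  by apply/funext => i; rewrite /slice apply_tenso_id.
by rewrite EFinM sqnK// h.
Qed.

Lemma bounded_tenso_id A : bounded A -> bounded (tenso A (@opid R J)).
Proof.
move=> bA; have [K K0 hK] := bounded_nrm bA.
exists (K ^+ 2); apply: sqnorm_tenso_id; first exact: sqr_ge0.
by move=> psi hp; apply: nrm_le_sqnorm => //; [exact: l2_apply|exact: hK].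
Qed.

Lemma conj_opid (r s : J) : conjc (@opid R J r s) = @opid R J s r.
Proof.
rewrite /opid eq_sym; case: (s == r); last exact: conjc0.
by apply: complexP; rewrite /= ?oppr0.
Qed.

Lemma adjoint_tenso_id A : adjoint (tenso A (@opid R J)) = tenso (adjoint A) (@opid R J).
Proof.
apply/funext => p; apply/funext => q.
by rewrite /adjoint /tenso conjcM conj_opid.
Qed.

Lemma opmul_tenso_l A Y p q :
  opmul (tenso A (@opid R J)) Y p q = opmul A (blk Y p.2 q.2) p.1 q.1.
Proof.
rewrite /opmul (csum_fiber (r := p.2)) => [|j t tp].
  by congr csum; apply/funext => j; rewrite /tenso /opid /= eqxx mulr1; case: q.
by rewrite /tenso /opid /= eq_sym (negbTE tp) mulr0 mul0r.
Qed.

Lemma opmul_tenso_r A Y p q :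
  opmul Y (adjoint (tenso A (@opid R J))) p q = opmul (blk Y p.2 q.2) (adjoint A) p.1 q.1.
Proof.
rewrite adjoint_tenso_id /opmul (csum_fiber (r := q.2)) => [|j t tq].
  by congr csum; apply/funext => j; rewrite /tenso /opid /= eqxx mulr1; case: p.
by rewrite /tenso /opid /= (negbTE tq) mulr0 mulr0.
Qed.

Lemma tenso_ketbra (a b : I -> R[i]) (c e : J -> R[i]) :
  tenso (ketbra a b) (ketbra c e) = ketbra (tensv a c) (tensv b e).
Proof.
apply/funext => p; apply/funext => q.
by rewrite /tenso /ketbra /tensv conjcM mulrACA.
Qed.

Lemma apply_tenso_tensv A (u : I -> R[i]) (v : J -> R[i]) : bounded A -> l2 u ->
  apply (tenso A (@opid R J)) (tensv u v) = tensv (apply A u) v.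
Proof.
move=> bA hu; apply/funext => -[i r]; rewrite apply_tenso_id /tensv /= mulrC /apply -csumZ.
  by congr csum; apply/funext => j; rewrite /slice /=; ring.
by apply: l2_mul => //; exact: bounded_row.
Qed.

End Tensor.

(** * Weak integrals of projectors onto families with a Bessel inequality *)

Section Resolution.
Variables (R : realType) (I : choiceType) (v : R[i] -> I -> R[i]).
Local Notation RR := (measurableTypeR R * measurableTypeR R)%type.
Hypothesis vl2 : forall z, l2 (v z).
Hypothesis vm : forall phi, l2 phi -> cmeasC (fun z => dot phi (v z)).
Hypothesis vbessel : forall phi, l2 phi ->
  (Lint (fun z => (sqmod (dot phi (v z)))%:E) <= (pi * sqn phi)%:E)%E.
Let HP := integral_integration (plane R).

Definition res_integrand z : op R I := opscale pi^-1 (ketbra (v z) (v z)).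

Let rb z : bounded (res_integrand z).
Proof. by apply: bounded_opscale; apply: bounded_ketbra. Qed.

Lemma res_integrand_dot z phi psi : l2 phi -> l2 psi ->
  dot phi (apply (res_integrand z) psi) =
  (pi^-1)%:C * (dot phi (v z) * conjc (dot psi (v z))).
Proof.
move=> hp hq; rewrite dot_opscale//; last exact: bounded_ketbra.
by rewrite (dot_ketbra hp hq (vl2 z) (vl2 z)) (dot_conj hq (vl2 z)).
Qed.

Let rm phi psi : l2 phi -> l2 psi -> cmeasC (fun z => dot phi (apply (res_integrand z) psi)).
Proof.
move=> hp hq; rewrite /cmeasC; under eq_fun do rewrite res_integrand_dot//.
apply: cm_mul; first exact: cm_cst.
by apply: cm_mul; [exact: vm|apply: cm_conj; exact: vm].
Qed.

Let rle phi psi : l2 phi -> l2 psi ->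
  (Lint (fun z => (cabs (dot phi (apply (res_integrand z) psi)))%:E) <=
    (1 * nrm phi * nrm psi)%:E)%E.
Proof.
move=> hp hq.
have := cauchy_le (mulr_ge0 (@pi_ge0 R) (sqn_ge0 phi)) (mulr_ge0 (@pi_ge0 R) (sqn_ge0 psi))
  (vm hp) (vm hq) (vbessel hp) (vbessel hq).
rewrite !sqrtrM ?pi_ge0// mulrACA -expr2 sqr_sqrtr ?pi_ge0// => h.
rewrite (_ : (fun b => _) = (fun b => (pi^-1 *
   (cabs (dot phi (v b)) * cabs (dot psi (v b))))%:E)); last first.
  apply/funext => b; rewrite res_integrand_dot// !cabsM cabsC ger0_norm ?invr_ge0 ?pi_ge0//.
  by rewrite cabs_conj.
rewrite /Lint (int_scale HP) ?invr_ge0 ?pi_ge0//; last first.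
- by move=> p; rewrite mulr_ge0 ?cabs_ge0.
- by apply: measurable_funM; apply: cm_cabs; exact: vm.
apply: (@le_trans _ _ ((pi^-1)%:E * (pi * (nrm phi * nrm psi))%:E)%E).
  by rewrite lee_wpmul2l ?lee_fin ?invr_ge0 ?pi_ge0.
by rewrite -EFinM lee_fin mulKf ?gt_eqF ?pi_gt0// mul1r.
Qed.

Lemma res_weakly_integrable : weakly_integrable res_integrand.
Proof. by exists (form_op (weak_form res_integrand)); exact: weak_int_exists rb rm rle. Qed.

Lemma res_dot phi psi : l2 phi -> l2 psi ->
  dot phi (apply (weak_int res_integrand) psi) =
  cint (fun z => (pi^-1)%:C * (dot phi (v z) * conjc (dot psi (v z)))).
Proof.
move=> hp hq; rewrite (weak_int_dot rb rm rle)//; congr cint; apply/funext => z.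
exact: res_integrand_dot.
Qed.

Lemma bounded_res : bounded (weak_int res_integrand).
Proof. exact: weak_int_bounded rb rm rle. Qed.

Lemma res_able phi psi : l2 phi -> l2 psi ->
  cint_able (measurable_fun [set: RR]) (Jint (plane R))
    (fun p => (pi^-1)%:C * (dot phi (v (toC p)) * conjc (dot psi (v (toC p))))).
Proof.
move=> hp hq; have := weak_form_able rm rle hp hq.
by under eq_fun do rewrite res_integrand_dot//.
Qed.

Lemma res_observable : observable (weak_int res_integrand).
Proof.
split; first exact: bounded_res.
rewrite (weak_intE rb rm rle); apply/funext => i; apply/funext => j.
have hi := @l2_ebase R I i; have hj := @l2_ebase R I j.
rewrite /adjoint /form_op /weak_form.
transitivity (conjc (cint (fun z => (pi^-1)%:C * (dot (ebase R j) (v z) * conjc (dot (ebase R i) (v z)))))).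
  by congr (conjc (cint _)); apply/funext => z; exact: res_integrand_dot.
rewrite cintE -(cI_conj HP (res_able hj hi)) cintE; congr cI; apply/funext => p.
rewrite res_integrand_dot// conjcM conjc_real conjcM conjcK; congr (_ * _).
by rewrite mulrC.
Qed.

Lemma Lint_esum (h : nat -> R[i] -> \bar R) : (forall n, emeasC (h n)) ->
  (forall n z, 0 <= h n z)%E ->
  Lint (fun z => \esum_(n in [set: nat]) h n z) = \esum_(n in [set: nat]) Lint (h n).
Proof. by move=> mh h0; rewrite /Lint /Jint integral_esum// => n p; exact: h0. Qed.

Lemma res_expectation phi : l2 phi ->
  Lint (fun z => (pi^-1 * sqmod (dot phi (v z)))%:E) \is a fin_num /\
  dot phi (apply (weak_int res_integrand) phi) =
  (fine (Lint (fun z => (pi^-1 * sqmod (dot phi (v z)))%:E)))%:C.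
Proof.
move=> hp; have p0 z : 0 <= pi^-1 * sqmod (dot phi (v z)).
  by rewrite mulr_ge0 ?sqmod_ge0// invr_ge0 pi_ge0.
split.
  rewrite ge0_fin_numE; last by apply: Lint_ge0 => z; rewrite lee_fin.
  rewrite /Lint (int_scale HP) ?invr_ge0 ?pi_ge0//; last first.
  - by move=> p; exact: sqmod_ge0.
  - by apply: cm_sqmod; exact: vm.
  apply: (@le_lt_trans _ _ ((pi^-1)%:E * (pi * sqn phi)%:E)%E).
    by rewrite lee_wpmul2l ?lee_fin ?invr_ge0 ?pi_ge0//; exact: vbessel.
  by rewrite -EFinM ltry.
rewrite res_dot// cintE.
rewrite (_ : (fun p => _) = (fun p : RR => (pi^-1 * sqmod (dot phi (v (toC p))))%:C)).
  by rewrite cI_real//; exact: Jint0.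
by apply/funext => p; rewrite [X in _ * X]mulrC mulJc -rmorphM.
Qed.

Section Trace.
Variables (X : op R I) (L : nat -> I -> R[i]) (T : R).
Hypothesis XE : forall i j, X i j = csum (fun l => L l i * conjc (L l j)).
Hypothesis LT : (\esum_(l in [set: nat]) sqnorm (L l) <= T%:E)%E.

(** Along X = sum_l |L_l><L_l| every term is nonnegative, so Tonelli exchanges the sum over l with
    the integral. *)
Lemma res_trace : tr (opmul (weak_int res_integrand) X) =
  (fine (Lint (fun z => (pi^-1 * complex.Re (Defs.expectation X (v z)))%:E)))%:C.
Proof.
have hL l : l2 (L l) := fam_l2 LT l.
have [_ ->] := fam_trace XE LT bounded_res.
pose c l := fine (Lint (fun z => (pi^-1 * sqmod (dot (L l) (v z)))%:E)).
have p0 (a : R) : 0 <= a -> 0 <= pi^-1 * a by move=> a0; rewrite mulr_ge0// invr_ge0 pi_ge0.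
have -> : (fun l => dot (L l) (apply (weak_int res_integrand) (L l))) = (fun l => (c l)%:C).
  by apply/funext => l; exact: (res_expectation (hL l)).2.
rewrite csum_real; last by move=> l; apply: fine_ge0; apply: Lint_ge0 => z; rewrite lee_fin p0 ?sqmod_ge0.
congr ((fine _)%:C).
transitivity (\esum_(l in [set: nat]) Lint (fun z => (pi^-1 * sqmod (dot (L l) (v z)))%:E)).
  by apply: eq_esum => l _; rewrite fineK//; exact: (res_expectation (hL l)).1.
rewrite -Lint_esum.
- congr Lint; apply/funext => z; rewrite esum_scale ?invr_ge0 ?pi_ge0//.
    rewrite (fam_expectation XE LT (vl2 z)) /= EFinM; congr (_ * _)%E.
    by rewrite sqnK//; apply: (fam_dot_l2 LT).
  by move=> l; exact: sqmod_ge0.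
- move=> l; apply/measurable_EFinP; apply: measurable_funM => //.
  by apply: cm_sqmod; exact: vm.
- by move=> l z; rewrite lee_fin p0 ?sqmod_ge0.
Qed.

End Trace.

End Resolution.

(** * Gaussian averages of D(d) Y D(d)^dagger for an abstract family of contractions D(d) *)

Section NoiseIntegral.
Variables (R : realType) (I : choiceType) (hI : esum_measurable R I).
Variables (D : R[i] -> op R I) (nu : R).
Local Notation RR := (measurableTypeR R * measurableTypeR R)%type.
Hypothesis nu0 : 0 < nu.
Hypothesis bD : forall d, bounded (D d).
Hypothesis aD : forall d, adjoint (D d) = D (- d).
Hypothesis cD : forall d phi, l2 phi -> nrm (apply (D d) phi) <= nrm phi.
Hypothesis mD : forall i j, cmeasC (fun d => D d i j).
Variable Y : op R I.
Hypothesis bY : bounded Y.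
Let HP := integral_integration (plane R).

Definition noise_integrand d : op R I :=
  opscale (gauss nu d) (opmul (opmul (D d) Y) (adjoint (D d))).

Lemma gauss_ge0 (t : R) (z : R[i]) : 0 <= t -> 0 <= gauss t z.
Proof. by move=> t0; rewrite /gauss divr_ge0 ?pi_ge0// mulr_ge0 ?expR_ge0. Qed.

Let bop d : bounded (opmul (opmul (D d) Y) (adjoint (D d))).
Proof. by apply: bounded_opmul; [exact: bounded_opmul|exact: bounded_adjoint]. Qed.

Lemma noise_integrand_dot d phi psi : l2 phi -> l2 psi ->
  dot phi (apply (noise_integrand d) psi) = (gauss nu d)%:C *
  dot (apply (D (- d)) phi) (apply Y (apply (D (- d)) psi)).
Proof.
move=> hp hq; rewrite (dot_opscale _ hp hq (bop d)); congr (_ * _).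
have ba := bounded_adjoint (bD d); have ha := l2_apply ba hq.
rewrite (apply_opmul (bounded_opmul (bD d) bY) ba hq) (apply_opmul (bD d) bY ha).
have hy := l2_apply bY ha.
by have := dot_adjoint (bD d) hp hy => <-; rewrite aD.
Qed.

Let nb d : bounded (noise_integrand d).
Proof. exact: bounded_opscale. Qed.

Let nm phi psi : l2 phi -> l2 psi -> cmeasC (fun d => dot phi (apply (noise_integrand d) psi)).
Proof.
move=> hp hq; rewrite /cmeasC; under eq_fun do rewrite noise_integrand_dot//.
have ma chi i : cmeas (measurable_fun [set: RR]) (fun p => apply (D (- toC p)) chi i).
  apply: (cmeas_apply hI) => [k l|k]; last exact: cm_cst.
  by under eq_fun do rewrite -aD; apply: cm_conj; exact: mD.
apply: cm_mul; first by apply: cm_real; apply: meas_gauss; exact: cm_toC.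
apply: (cmeas_dot hI) => i; first exact: ma.
by apply: (cmeas_apply hI) => [k l|k]; [exact: cm_cst|exact: ma].
Qed.

Let K : R := s2val (cid2 (bounded_nrm bY)).
Let K0 : 0 <= K := s2valP (cid2 (bounded_nrm bY)).
Let hK psi : l2 psi -> nrm (apply Y psi) <= K * nrm psi := s2valP' (cid2 (bounded_nrm bY)) psi.

Let nle phi psi : l2 phi -> l2 psi ->
  (Lint (fun d => (cabs (dot phi (apply (noise_integrand d) psi)))%:E) <=
    (K * nrm phi * nrm psi)%:E)%E.
Proof.
move=> hp hq.
have mg : measurable_fun [set: RR] (fun p => gauss nu (toC p)).
  by apply: meas_gauss; exact: cm_toC.
apply: (@le_trans _ _ (Lint (fun d => (K * nrm phi * nrm psi * gauss nu d)%:E))).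
  apply: (int_le HP).
  - by apply: cm_cabs; exact: nm.
  - exact: measurable_funM.
  - by move=> p; exact: cabs_ge0.
  move=> p; rewrite noise_integrand_dot// cabsM cabsC ger0_norm; last exact: gauss_ge0 (ltW nu0).
  rewrite [leRHS]mulrC ler_wpM2l//; first exact: gauss_ge0 (ltW nu0).
  have ba := bD (- toC p).
  have h1 := l2_apply ba hp; have h2 := l2_apply ba hq.
  apply: le_trans (dot_le h1 (l2_apply bY h2)) _.
  rewrite (mulrC K) -mulrA; apply: ler_pM; rewrite ?nrm_ge0//; first exact: cD.
  by apply: le_trans (hK h2) _; rewrite ler_wpM2l//; exact: cD.
rewrite /Lint (int_scale HP) ?mulr_ge0 ?nrm_ge0//.
  by have := Lint_gauss nu0; rewrite /Lint => ->; rewrite mule1.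
by move=> p; exact: gauss_ge0 (ltW nu0).
Qed.

Lemma noise_weakE i j : weak_int noise_integrand i j = cint (fun d => noise_integrand d i j).
Proof.
rewrite (weak_intE nb nm nle) /form_op /weak_form; congr cint; apply/funext => d.
exact: (congr1 (fun A => A i j) (form_opK (noise_integrand d))).
Qed.

Lemma noise_dot phi psi : l2 phi -> l2 psi ->
  dot phi (apply (weak_int noise_integrand) psi) = cint (fun d => (gauss nu d)%:C *
  dot (apply (D (- d)) phi) (apply Y (apply (D (- d)) psi))).
Proof.
move=> hp hq; rewrite (weak_int_dot nb nm nle)//; congr cint; apply/funext => d.
exact: noise_integrand_dot.
Qed.

Lemma bounded_noise : bounded (weak_int noise_integrand).
Proof. exact: weak_int_bounded nb nm nle. Qed.

Lemma noise_able phi psi : l2 phi -> l2 psi ->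
  cint_able (measurable_fun [set: RR]) (Jint (plane R)) (fun p => (gauss nu (toC p))%:C *
  dot (apply (D (- toC p)) phi) (apply Y (apply (D (- toC p)) psi))).
Proof.
move=> hp hq; have := weak_form_able nm nle hp hq.
by under eq_fun do rewrite noise_integrand_dot//.
Qed.

End NoiseIntegral.

Section ModeNoise.
Variables (R : realType) (nu : R).
Hypothesis nu0 : 0 < nu.
Implicit Types (d : R[i]) (Y : op R (nat * nat)%type).
Local Notation RR := (measurableTypeR R * measurableTypeR R)%type.
Let HP := integral_integration (plane R).

Definition displacement_l d : op R (nat * nat)%type := tenso (displacement d) (@opid R nat).

Lemma adjoint_displacement_l d : adjoint (displacement_l d) = displacement_l (- d).
Proof. by rewrite /displacement_l adjoint_tenso_id adjoint_displacement. Qed.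

Lemma bounded_displacement_l d : bounded (displacement_l d).
Proof. by apply: bounded_tenso_id; exact: bounded_displacement. Qed.

Lemma nrm_displacement_l d phi : l2 phi -> nrm (apply (displacement_l d) phi) <= nrm phi.
Proof.
move=> hp; have ha := l2_apply (bounded_displacement_l d) hp.
rewrite ler_wsqrtr// -lee_fin !sqnK// -[leRHS]mul1e.
apply: sqnorm_tenso_id => // psi hq; rewrite mul1e -!sqnK//; last first.
  by apply: l2_apply => //; exact: bounded_displacement.
rewrite lee_fin -!nrm_sq lerXn2r ?nnegrE ?nrm_ge0//.
exact: nrm_displacement.
Qed.

Let mD2 p q : cmeasC (fun d => displacement_l d p q).
Proof. by apply: cm_mul; [exact: cmC_displacement|exact: cm_cst]. Qed.

(** [ampl] integrates each block on its own, whereas the right side is a single weak integral on two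
    modes. Entry by entry the integrands coincide, since conjugation by D(d) (x) 1 acts
    blockwise. *)
Lemma ampl_noiseE Y : bounded Y ->
  ampl (noise nu) Y = weak_int (noise_integrand displacement_l nu Y).
Proof.
move=> bY; apply/funext => p; apply/funext => q.
rewrite (noise_weakE (@esum_measurable_pair R) nu0 bounded_displacement_l adjoint_displacement_l nrm_displacement_l mD2 bY).
rewrite (_ : ampl (noise nu) Y p q = weak_int (noise_integrand (@displacement R) nu (blk Y p.2 q.2)) p.1 q.1)//.
rewrite (noise_weakE (@esum_measurable_nat R) nu0 (@bounded_displacement R) (@adjoint_displacement R) (@nrm_displacement R) (@cmC_displacement R) (bounded_blk p.2 q.2 bY)).
congr cint; apply/funext => d; rewrite /noise_integrand /opscale; congr (_ * _).
have E : opmul (opmul (displacement_l d) Y) (adjoint (displacement_l d)) p q =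
  opmul (blk (opmul (displacement_l d) Y) p.2 q.2) (adjoint (displacement d)) p.1 q.1.
  exact: opmul_tenso_r.
have E2 : blk (opmul (displacement_l d) Y) p.2 q.2 = opmul (displacement d) (blk Y p.2 q.2).
  by apply/funext => i; apply/funext => j; exact: opmul_tenso_l.
by rewrite E E2.
Qed.

Lemma bounded_ampl_noise Y : bounded Y -> bounded (ampl (noise nu) Y).
Proof.
by move=> bY; rewrite ampl_noiseE//; apply: (bounded_noise (@esum_measurable_pair R) nu0 bounded_displacement_l adjoint_displacement_l nrm_displacement_l mD2 bY).
Qed.

Lemma ampl_noise_dot Y phi psi : bounded Y -> l2 phi -> l2 psi ->
  dot phi (apply (ampl (noise nu) Y) psi) = cint (fun d => (gauss nu d)%:C *
   dot (apply (displacement_l (- d)) phi) (apply Y (apply (displacement_l (- d)) psi))).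
Proof.
move=> bY hp hq; rewrite (ampl_noiseE bY).
exact: (noise_dot (@esum_measurable_pair R) nu0 bounded_displacement_l adjoint_displacement_l nrm_displacement_l mD2 bY hp hq).
Qed.

Lemma ampl_noise_able Y phi psi : bounded Y -> l2 phi -> l2 psi ->
  cint_able (measurable_fun [set: RR]) (Jint (plane R)) (fun p => (gauss nu (toC p))%:C *
   dot (apply (displacement_l (- toC p)) phi) (apply Y (apply (displacement_l (- toC p)) psi))).
Proof.
move=> bY hp hq.
exact: (noise_able (@esum_measurable_pair R) nu0 bounded_displacement_l adjoint_displacement_l nrm_displacement_l mD2 bY hp hq).
Qed.

Lemma ampl_noise_expectation Y phi (e : R[i] -> R) : bounded Y -> l2 phi -> (forall d, 0 <= e d) ->
  (forall d, Defs.expectation Y (apply (displacement_l (- d)) phi) = (e d)%:C) ->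
  Lint (fun d => (gauss nu d * e d)%:E) \is a fin_num /\
  Defs.expectation (ampl (noise nu) Y) phi = (fine (Lint (fun d => (gauss nu d * e d)%:E)))%:C.
Proof.
move=> bY hp e0 eE.
have ge0 (p : RR) : 0 <= gauss nu (toC p) * e (toC p).
  by rewrite mulr_ge0//; exact: gauss_ge0 (ltW nu0).
have fE : (fun p : RR => (gauss nu (toC p))%:C *
   dot (apply (displacement_l (- toC p)) phi) (apply Y (apply (displacement_l (- toC p)) phi))) =
  (fun p => (gauss nu (toC p) * e (toC p))%:C).
  apply/funext => p; rewrite -[dot _ _]/(Defs.expectation Y (apply (displacement_l (- toC p)) phi)).
  by rewrite eE -rmorphM.
have ab := ampl_noise_able bY hp hp; rewrite fE in ab.
split.
  apply: (Jr_fin HP) => //; have := ab.2; rewrite /Jabs.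
  by under eq_fun do rewrite cabsC ger0_norm//.
rewrite /Defs.expectation ampl_noise_dot// cintE fE cI_real//; exact: Jint0.
Qed.

End ModeNoise.

(** * The product vectors of Z and their displacements *)

Section TensorCoherent.
Variables (R : realType) (c : R).
Implicit Types (d z : R[i]) (phi : nat * nat -> R[i]).
Local Notation RR := (measurableTypeR R * measurableTypeR R)%type.
Let HP := integral_integration (plane R).

(** For d = 0 and c = g k these are the vectors of Z; D(d) (x) 1 carries them to the general ones up
    to a phase. *)
Definition tcoh d z : nat * nat -> R[i] :=
  tensv (coherent (c%:C * z + d)) (coherent (conjc z)).

Lemma l2_tcoh d z : l2 (tcoh d z).
Proof. by apply: l2_tensv; exact: l2_coherent. Qed.

Lemma coherent_conj z n : coherent (conjc z) n = conjc (coherent z n).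
Proof. by rewrite /coherent conjcM conjc_real conjcX sqmod_conj. Qed.

Lemma cmC_dot_tcoh d phi : cmeasC (fun z => dot phi (tcoh d z)).
Proof.
apply: (cmeas_dot (@esum_measurable_pair R)) => p; first exact: cm_cst.
apply: cm_mul; apply: cm_coherent.
  by apply: cm_add; [apply: cm_mul; [exact: cm_cst|exact: cm_toC]|exact: cm_cst].
by apply: cm_conj; exact: cm_toC.
Qed.

Let row phi (i : nat) : nat -> R[i] := fun r => phi (i, r).

Let sqnorm_row phi : sqnorm phi = \esum_(i in [set: nat]) sqnorm (row phi i).
Proof. by rewrite /sqnorm esum_pair// => p; exact: sqmod_ge0. Qed.

Let l2_row phi i : l2 phi -> l2 (row phi i).
Proof.
rewrite /l2 sqnorm_row; apply: le_lt_trans.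
by apply: (esum_term_le (a := fun i => sqnorm (row phi i))) => j; exact: sqnorm_ge0.
Qed.

Let dot_row phi d z : l2 phi ->
  ((sqmod (dot phi (tcoh d z)))%:E <=
    \esum_(i in [set: nat]) (sqmod (dot (row phi i) (coherent (conjc z))))%:E)%E.
Proof.
move=> hp; set u := coherent (c%:C * z + d); set v := coherent (conjc z).
have hv : l2 v := l2_coherent _; have hu : l2 u := l2_coherent _.
pose e i := dot (row phi i) v.
have E : dot phi (tcoh d z) = csum (fun i => u i * e i).
  have [_ _] := csum_pair (dot_summable hp (l2_tcoh d z)).
  rewrite -/(dot phi (tcoh d z)) => ->; congr csum; apply/funext => i.
  rewrite /e /dot -csumZ; last exact: dot_summable (l2_row _ hp) hv.
  by congr csum; apply/funext => r; exact: mulrCA.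
have he : l2 e.
  rewrite /l2; apply: (@le_lt_trans _ _ (sqnorm phi)) => //.
  rewrite [leRHS]sqnorm_row; apply: le_esum => i _; have hr := l2_row i hp.
  rewrite -sqnK// lee_fin -cabs_sq -nrm_sq lerXn2r ?nnegrE ?nrm_ge0 ?cabs_ge0//.
  by apply: le_trans (dot_le hr hv) _; rewrite nrm_coherent mulr1.
rewrite -[leRHS]/(sqnorm e) -sqnK// lee_fin E -cabs_sq -nrm_sq lerXn2r ?nnegrE ?nrm_ge0 ?cabs_ge0//.
by apply: le_trans (l2_mul_le hu he) _; rewrite nrm_coherent mul1r.
Qed.

(** By Cauchy-Schwarz the unit vector on the first mode can be discarded at the price of a sum over
    the rows of phi; each row obeys the one-mode inequality, conj z becoming z when the row is
    conjugated. *)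
Lemma bessel_tcoh d phi : l2 phi ->
  (Lint (fun z => (sqmod (dot phi (tcoh d z)))%:E) <= (pi * sqn phi)%:E)%E.
Proof.
move=> hp.
have rE i z : sqmod (dot (row phi i) (coherent (conjc z))) =
    sqmod (dot (fun r => conjc (row phi i r)) (coherent z)).
  have hr := l2_row i hp.
  rewrite -[LHS]sqmod_conj; congr sqmod; rewrite -csum_conj; last exact: dot_summable hr (l2_coherent _).
  rewrite /dot; congr csum; apply/funext => r; rewrite [LHS]conjcM coherent_conj.
  by congr (_ * _); exact: conjcK.
have mr i : emeasC (fun z => (sqmod (dot (fun r => conjc (row phi i r)) (coherent z)))%:E).
  by apply/measurable_EFinP; apply: cm_sqmod; exact: cmC_dot_coherent.
apply: (@le_trans _ _ (Lint (fun z => \esum_(i in [set: nat])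
   (sqmod (dot (fun r => conjc (row phi i r)) (coherent z)))%:E))).
  apply: ge0_le_integral => //.
  - by move=> p _; rewrite lee_fin sqmod_ge0.
  - by apply/measurable_EFinP; apply: cm_sqmod; exact: cmC_dot_tcoh.
  - by apply: esum_measurable_nat => [i|i p]; [exact: mr|rewrite lee_fin sqmod_ge0].
  - move=> p _; apply: le_trans (dot_row d (toC p) hp) _.
    apply: le_esum => i _; rewrite lee_fin le_eqVlt; apply/orP; left; apply/eqP.
    exact: (rE i (toC p)).
rewrite Lint_esum//; last by move=> i z; rewrite lee_fin sqmod_ge0.
apply: (@le_trans _ _ (\esum_(i in [set: nat]) (pi * sqn (row phi i))%:E)).
  apply: le_esum => i _; apply: le_trans (bessel (l2_conj (l2_row i hp))) _.
  by rewrite -nrm_sq nrm_conj nrm_sq.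
rewrite esum_scale ?pi_ge0//; last by move=> i; exact: sqn_ge0.
rewrite EFinM lee_wpmul2l ?lee_fin ?pi_ge0// sqnK// sqnorm_row.
by apply: le_esum => i _; rewrite sqnK//; exact: l2_row.
Qed.

Lemma displacement_tcoh e z :
  apply (displacement_l e) (tcoh 0 z) = (fun p => theta e (c%:C * z) * tcoh e z p).
Proof.
rewrite apply_tenso_tensv; [|exact: bounded_displacement|exact: l2_coherent].
apply/funext => p; rewrite /tensv displacement_coherent /tcoh /tensv addr0.
by rewrite mulrA.
Qed.

End TensorCoherent.

(** * Trace class operators and channels *)

Section PositiveTraceClass.
Variables (R : realType) (I : countType).
Implicit Types (X Y : op R I) (s : seq I) (c : I -> R[i]).

Lemma quad_expectation X s c : uniq s -> quad X s c = Defs.expectation X (rst s c).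
Proof.
move=> us; rewrite /Defs.expectation dot_rst//; apply: eq_bigr => i _.
rewrite apply_rst// mulr_sumr; apply: eq_bigr => j _; by rewrite mulrA.
Qed.

Lemma positive_psd X : positive X -> psd X.
Proof. by move=> [_ h] s c us; rewrite quad_expectation//; apply: h; exact: l2_rst. Qed.

Lemma psd_diag_ge0 X i : psd X -> 0 <= complex.Re (X i i).
Proof. by move=> h; case: (psd_diag i h). Qed.

Definition trace_sum X : \bar R := \esum_(i in [set: I]) (complex.Re (X i i))%:E.

Lemma psd_trace_fin X : psd X -> (trace_sum X < +oo)%E ->
  trace_sum X = (fine (trace_sum X))%:E.
Proof.
move=> hX fX; rewrite fineK// ge0_fin_numE//; apply: esum_ge0 => i _.
by rewrite lee_fin psd_diag_ge0.
Qed.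

(** The Cholesky family bounds the form of X by its trace, so that positivity on finite vectors and
    a finite trace already give a bounded positive operator. *)
Lemma ptcP X : positive_trace_class X <-> psd X /\ (trace_sum X < +oo)%E.
Proof.
split => [[hX fX]|[hX fX]]; first by split => //; exact: positive_psd.
split => //; have [L XE LT] := psd_trace_fam hX (psd_trace_fin hX fX).
have LT' : (\esum_(l in [set: nat]) sqnorm (L l) <= (fine (trace_sum X))%:E)%E by rewrite LT.
split; first exact: fam_bounded XE LT'.
by move=> phi; exact: fam_expectation_ge0 XE LT' phi.
Qed.

Lemma ptc_expectation X phi : psd X -> (trace_sum X < +oo)%E -> l2 phi ->
  [/\ bounded X, Defs.expectation X phi = (complex.Re (Defs.expectation X phi))%:C,
      0 <= complex.Re (Defs.expectation X phi) &
      complex.Re (Defs.expectation X phi) <= fine (trace_sum X) * sqn phi].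
Proof.
move=> hX fX hp; have [L XE LT] := psd_trace_fam hX (psd_trace_fin hX fX).
have LT' : (\esum_(l in [set: nat]) sqnorm (L l) <= (fine (trace_sum X))%:E)%E by rewrite LT.
split; first exact: fam_bounded XE LT'.
- by rewrite (fam_expectation XE LT' hp).
- by rewrite (fam_expectation XE LT' hp) /= sqn_ge0.
- by apply: le_trans (fam_expectation_le XE LT' hp) _; exact: lexx.
Qed.

Lemma quad_lin (a : R[i]) X Y s c :
  quad (fun i j => a * X i j + Y i j) s c = a * quad X s c + quad Y s c.
Proof.
rewrite /quad mulr_sumr -big_split; apply: eq_bigr => i _ /=.
rewrite mulr_sumr -big_split; apply: eq_bigr => j _ /=; ring.
Qed.

Lemma ptc_lin (a : R) X Y : 0 <= a -> positive_trace_class X -> positive_trace_class Y ->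
  positive_trace_class (fun i j => a%:C * X i j + Y i j).
Proof.
move=> a0 /ptcP[hX fX] /ptcP[hY fY]; apply/ptcP; split.
  by move=> s c us; rewrite quad_lin addr_ge0 ?mulr_ge0 ?hX ?hY// lecR.
have := int_add (esum_integration R I) (f := fun i => a * complex.Re (X i i))
  (g := fun i => complex.Re (Y i i)) Logic.I Logic.I.
rewrite /Jsum /trace_sum => h; under eq_esum do rewrite ReD ReM /= mul0r subr0.
rewrite h; [|by move=> i; rewrite ?mulr_ge0 ?psd_diag_ge0..].
rewrite esum_scale//; last by move=> i; exact: psd_diag_ge0.
rewrite lte_add_pinfty//; move: fX; rewrite -/(trace_sum X) => fX.
by rewrite (psd_trace_fin hX fX) -EFinM ltry.
Qed.

Lemma ptc0 : positive_trace_class (fun _ _ : I => 0 : R[i]).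
Proof.
apply/ptcP; split.
  move=> s c us; rewrite /quad big1// => i _; rewrite big1// => j _.
  by rewrite mulr0 mul0r.
by rewrite /trace_sum esum1 ?ltry.
Qed.

Lemma ptc_scale (a : R) X : 0 <= a -> positive_trace_class X ->
  positive_trace_class (fun i j => a%:C * X i j).
Proof.
move=> a0 hX; have := ptc_lin a0 hX ptc0.
by congr positive_trace_class; apply/funext => i; apply/funext => j; rewrite addr0.
Qed.

Lemma ptc_ketbra (v : I -> R[i]) : l2 v -> positive_trace_class (ketbra v v) /\
  trace_sum (ketbra v v) = sqnorm v.
Proof.
move=> hv; have E : trace_sum (ketbra v v) = sqnorm v.
  by apply: eq_esum => i _; rewrite /ketbra mulrC mulJc.
split => //; apply/ptcP; rewrite E; split => // s c us.
have -> : quad (ketbra v v) s c = (sqmod (\sum_(i <- s) conjc (c i) * v i))%:C.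
  rewrite -mulJc mulrC (rmorph_sum (@conjc R)) mulr_suml; apply: eq_bigr => i _.
  rewrite mulr_sumr; apply: eq_bigr => j _.
  by rewrite /ketbra [X in _ = _ * X]conjcM conjcK; ring.
by rewrite lecR sqmod_ge0.
Qed.

Lemma tcP X : trace_class X <-> exists P0 P1 P2 P3 : op R I,
  [/\ positive_trace_class P0, positive_trace_class P1, positive_trace_class P2,
      positive_trace_class P3 &
      X = (fun i j => P0 i j + 'i%C * P1 i j - P2 i j - 'i%C * P3 i j)].
Proof.
have i2 : 'i%C * 'i%C = -1 :> R[i] by rewrite -expr2 sqr_i.
have iE : 0 +i* 1 = 'i%C :> R[i] by [].
pose q1 : 'I_4 := lift ord0 ord0; pose q2 : 'I_4 := lift ord0 (lift ord0 ord0).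
pose q3 : 'I_4 := lift ord0 (lift ord0 (lift ord0 ord0)).
have E (P : 'I_4 -> op R I) i j : \sum_(k < 4) (0 +i* 1) ^+ k * P k i j =
    P ord0 i j + 'i%C * P q1 i j - P q2 i j - 'i%C * P q3 i j.
  rewrite iE !big_ord_recl big_ord0 addr0.
  transitivity (1 * P ord0 i j + ('i%C * P q1 i j + ('i%C ^+ 2 * P q2 i j + 'i%C ^+ 3 * P q3 i j))).
    by [].
  have p2 : 'i%C ^+ 2 = -1 :> R[i] by rewrite expr2.
  have p3 : 'i%C ^+ 3 = - 'i%C :> R[i] by rewrite exprS p2 mulrN1.
  by rewrite p2 p3; ring.
split=> [[P [hP ->]]|[P0 [P1 [P2 [P3 [h0 h1 h2 h3 ->]]]]]].
  exists (P ord0), (P q1), (P q2), (P q3); split => //.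
  by apply/funext => i; apply/funext => j; exact: E.
exists (fun k => nth P0 [:: P0; P1; P2; P3] k); split.
  by case; do 4! [case => //].
apply/funext => i; apply/funext => j.
exact: esym (E (fun k => nth P0 [:: P0; P1; P2; P3] k) i j).
Qed.

Lemma ptc_tc X : positive_trace_class X -> trace_class X.
Proof.
move=> hX; apply/tcP; exists X, (fun _ _ => 0), (fun _ _ => 0), (fun _ _ => 0).
split => //; try exact: ptc0.
by apply/funext => i; apply/funext => j; rewrite mulr0 addr0 !subr0.
Qed.

Lemma tc0 : trace_class (fun _ _ : I => 0 : R[i]).
Proof. exact: ptc_tc ptc0. Qed.

Lemma tc_lin (c : R[i]) X Y : trace_class X -> trace_class Y ->
  trace_class (fun i j => c * X i j + Y i j).
Proof.
move=> /tcP[P0 [P1 [P2 [P3 [p0 p1 p2 p3 ->]]]]] /tcP[Q0 [Q1 [Q2 [Q3 [q0 q1 q2 q3 ->]]]]].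
have m0 (a : R) : 0 <= Num.max a 0 by rewrite le_max lexx orbT.
have mE (a : R) : a%:C = (Num.max a 0)%:C - (Num.max (- a) 0)%:C.
  by rewrite -rmorphB -sub_max.
pose c0 := Num.max (complex.Re c) 0; pose c2 := Num.max (- complex.Re c) 0.
pose c1 := Num.max (complex.Im c) 0; pose c3 := Num.max (- complex.Im c) 0.
have cE : c = c0%:C - c2%:C + 'i%C * (c1%:C - c3%:C).
  by rewrite [LHS]complexE /c0 /c1 /c2 /c3 -!mE.
have i2 : 'i%C * 'i%C = -1 :> R[i] by rewrite -expr2 sqr_i.
have comb (A B D E F : op R I) : positive_trace_class A -> positive_trace_class B ->
    positive_trace_class D -> positive_trace_class E -> positive_trace_class F ->
    positive_trace_class (fun i j => c0%:C * A i j + (c1%:C * B i j + (c2%:C * D i j + (c3%:C * E i j + F i j)))).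
  move=> hA hB hD hE hF; apply: (ptc_lin (m0 _) hA); apply: (ptc_lin (m0 _) hB).
  by apply: (ptc_lin (m0 _) hD); apply: (ptc_lin (m0 _) hE).
(* The product of i^k c_k with i^l P_l belongs to the slot k + l modulo 4, whence the four
   permutations. *)
apply/tcP; do 4!eexists; split; [exact: comb p0 p3 p2 p1 q0|exact: comb p1 p0 p3 p2 q1|
  exact: comb p2 p1 p0 p3 q2|exact: comb p3 p2 p1 p0 q3|].
apply/funext => i; apply/funext => j; rewrite cE.
move: (P0 i j) (P1 i j) (P2 i j) (P3 i j) (Q0 i j) (Q1 i j) (Q2 i j) (Q3 i j) => a0 a1 a2 a3 b0 b1 b2 b3.
by move: (c0%:C) (c1%:C) (c2%:C) (c3%:C) ('i%C) i2 => d0 d1 d2 d3 u u2; ring: u2.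
Qed.

Lemma tc_sum (K : Type) (s : seq K) (c : K -> R[i]) (F : K -> op R I) :
  (forall k, trace_class (F k)) -> trace_class (fun i j => \sum_(k <- s) c k * F k i j).
Proof.
move=> hF; elim: s => [|k s IH].
  by under eq_fun => i do under eq_fun => j do rewrite big_nil; exact: tc0.
under eq_fun => i do under eq_fun => j do rewrite big_cons.
exact: tc_lin.
Qed.

(** Polarization over the vectors u + i^k v, k < 4, each with weight i^k / 4. *)
Lemma tc_ketbra (u v : I -> R[i]) : l2 u -> l2 v -> trace_class (ketbra u v).
Proof.
move=> hu hv; pose w (c : R[i]) i := c * v i + u i.
have q0 : 0 <= 4^-1 :> R by rewrite invr_ge0.
have hw (c : R[i]) : positive_trace_class (fun i j => (4^-1)%:C * ketbra (w c) (w c) i j).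
  by apply: ptc_scale => //; apply: (ptc_ketbra _).1; exact: l2_lin.
apply/tcP; exists (fun i j => (4^-1)%:C * ketbra (w 1) (w 1) i j), (fun i j => (4^-1)%:C * ketbra (w 'i%C) (w 'i%C) i j),
  (fun i j => (4^-1)%:C * ketbra (w (-1)) (w (-1)) i j), (fun i j => (4^-1)%:C * ketbra (w (- 'i%C)) (w (- 'i%C)) i j).
split => //; apply/funext => i; apply/funext => j; rewrite /ketbra /w.
have i2 : 'i%C * 'i%C = -1 :> R[i] by rewrite -expr2 sqr_i.
have c1 : conjc 1 = 1 :> R[i] by apply: complexP; rewrite /= ?oppr0.
have e4 : (4^-1)%:C * 4 = 1 :> R[i] by rewrite -(rmorph_nat (real_complex R)) -rmorphM mulVf.
rewrite !conjcD !conjcM conjc_opp1 [conjc (- 'i%C)]conjcN !conjc_i c1.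
move: (u i) (v i) (conjc (u j)) (conjc (v j)) ('i%C) i2 => a b d e k k2.
by move: ((4^-1)%:C) e4 => q q4; ring: k2 q4.
Qed.

Lemma expectation_lin (a : R[i]) X Y phi : bounded X -> bounded Y -> l2 phi ->
  Defs.expectation (fun i j => a * X i j + Y i j) phi =
  a * Defs.expectation X phi + Defs.expectation Y phi.
Proof.
move=> bX bY hp; rewrite /Defs.expectation.
have := dot_linr a hp (l2_apply bX hp) (l2_apply bY hp) => <-; congr dot.
apply/funext => i; rewrite /apply -csumZ; last by apply: l2_mul => //; exact: bounded_row.
rewrite -csumD; [|apply: csummableZ|]; [|by apply: l2_mul => //; exact: bounded_row..].
by congr csum; apply/funext => j; ring.
Qed.

(** The congruence diag(w) X diag(w): a compression for 0-1 weights, and still positive for weights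
    of mixed sign, which is how the off-diagonal blocks are controlled. *)
Definition weighted (w : I -> R) X : op R I := fun i j => (w i)%:C * X i j * (w j)%:C.

Lemma ptc_weighted (w : I -> R) (M : R) X : (forall i, w i ^+ 2 <= M) ->
  positive_trace_class X -> positive_trace_class (weighted w X).
Proof.
move=> wM /ptcP[hX fX]; apply/ptcP; split.
  move=> s c us; have -> : quad (weighted w X) s c = quad X s (fun i => (w i)%:C * c i).
    apply: eq_bigr => i _; apply: eq_bigr => j _; rewrite /weighted conjcM conjc_real; ring.
  exact: hX.
apply: (@le_lt_trans _ _ (\esum_(i in [set: I]) (M * complex.Re (X i i))%:E)).
  apply: le_esum => i _; rewrite lee_fin /weighted !ReM /= !mul0r !mulr0 !subr0.
  by rewrite mulrAC -expr2 ler_wpM2r ?psd_diag_ge0.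
have [i|noI] := pselect (exists i : I, True); last first.
  rewrite esum1 ?ltry// => i; by case: noI; exists i.
have M0 : 0 <= M by case: i => i _; exact: le_trans (sqr_ge0 _) (wM i).
rewrite esum_scale//; last by move=> j; exact: psd_diag_ge0.
by rewrite -/(trace_sum X) (psd_trace_fin hX fX) -EFinM ltry.
Qed.

End PositiveTraceClass.

Section PsdPull.
Variables (R : realType) (I J : countType).

Lemma psd_pull (X : op R I) (f : J -> I) (g : I -> J) (s : seq J) (c : J -> R[i]) :
  uniq s -> {in s, cancel f g} -> psd X ->
  0 <= \sum_(j <- s) \sum_(k <- s) conjc (c j) * X (f j) (f k) * c k.
Proof.
move=> us fg hX.
have um : uniq (map f s) by rewrite map_inj_in_uniq//; exact: can_in_inj fg.
have := hX (map f s) (c \o g) um; rewrite /quad big_map.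
rewrite big_seq [X in _ -> 0 <= X]big_seq.
rewrite (eq_bigr (fun j => \sum_(k <- s) conjc (c j) * X (f j) (f k) * c k))// => j js.
rewrite big_map big_seq [RHS]big_seq; apply: eq_bigr => k ks /=.
by rewrite !fg.
Qed.

End PsdPull.

Section TraceClassMore.
Variables (R : realType) (I : countType).
Implicit Types (X Y : op R I).

Lemma ptc_bounded X : positive_trace_class X -> bounded X.
Proof. by case=> -[]. Qed.

Lemma apply_lin (a : R[i]) X Y phi : bounded X -> bounded Y -> l2 phi ->
  apply (fun i j => a * X i j + Y i j) phi = (fun i => a * apply X phi i + apply Y phi i).
Proof.
move=> bX bY hp; apply/funext => i; rewrite /apply -csumZ; last by apply: l2_mul => //; exact: bounded_row.
rewrite -csumD; [|apply: csummableZ|]; [|by apply: l2_mul => //; exact: bounded_row..].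
by congr csum; apply/funext => j; ring.
Qed.

Lemma nrmZ (a : R[i]) (phi : I -> R[i]) : l2 phi -> nrm (fun i => a * phi i) = cabs a * nrm phi.
Proof. by move=> hp; rewrite /nrm /sqn sqnormZ -sqnK// -EFinM /= sqrtrM ?sqmod_ge0. Qed.

Lemma bounded_lin (a : R[i]) X Y : bounded X -> bounded Y ->
  bounded (fun i j => a * X i j + Y i j).
Proof.
move=> bX bY; have [K K0 hK] := bounded_nrm bX; have [K' K'0 hK'] := bounded_nrm bY.
have q0 : 0 <= cabs a * K + K' by rewrite addr_ge0// mulr_ge0 ?cabs_ge0.
exists ((cabs a * K + K') ^+ 2) => phi hp.
rewrite apply_lin//; have h1 := l2Z a (l2_apply bX hp); have h2 := l2_apply bY hp.
apply: nrm_le_sqnorm => //; first exact: l2D.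
apply: le_trans (nrmD h1 h2) _; rewrite (nrmZ a (l2_apply bX hp)) mulrDl; apply: lerD; last exact: hK'.
by rewrite -mulrA ler_wpM2l ?cabs_ge0//; exact: hK.
Qed.

Lemma tc_bounded X : trace_class X -> bounded X.
Proof.
move=> /tcP[P0 [P1 [P2 [P3 [/ptc_bounded p0 /ptc_bounded p1 /ptc_bounded p2 /ptc_bounded p3 ->]]]]].
have := bounded_lin 'i%C p1 (bounded_lin (-1) p2 (bounded_lin (- 'i%C) p3 p0)).
by congr bounded; apply/funext => i; apply/funext => j; ring.
Qed.

Lemma bounded0 : bounded (fun _ _ : I => 0 : R[i]).
Proof. exact: ptc_bounded (ptc0 R I). Qed.

Lemma expectation0 (phi : I -> R[i]) : Defs.expectation (fun _ _ : I => 0 : R[i]) phi = 0.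
Proof.
rewrite /Defs.expectation (_ : apply _ _ = (fun=> 0)).
  by rewrite /dot; under eq_fun do rewrite mulr0; exact: csum0.
by apply/funext => i; rewrite /apply; under eq_fun do rewrite mul0r; exact: csum0.
Qed.

Lemma expectation_sum (K : Type) (s : seq K) (c : K -> R[i]) (F : K -> op R I) phi :
  (forall k, bounded (F k)) -> l2 phi ->
  bounded (fun i j => \sum_(k <- s) c k * F k i j) /\
  Defs.expectation (fun i j => \sum_(k <- s) c k * F k i j) phi =
  \sum_(k <- s) c k * Defs.expectation (F k) phi.
Proof.
move=> bF hp; elim: s => [|k s [IH1 IH2]].
  rewrite big_nil (_ : (fun i j => _) = (fun _ _ => 0)); last first.
    by apply/funext => i; apply/funext => j; rewrite big_nil.
  by split; [exact: bounded0|exact: expectation0].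
rewrite big_cons (_ : (fun i j => _) = (fun i j => c k * F k i j + \sum_(k <- s) c k * F k i j)); last first.
  by apply/funext => i; apply/funext => j; rewrite big_cons.
by split; [exact: bounded_lin|rewrite expectation_lin// IH2].
Qed.

Lemma tr_psd X : psd X -> tr X = (fine (trace_sum X))%:C.
Proof.
move=> hX; rewrite -csum_real; last by move=> i; exact: psd_diag_ge0.
by congr csum; apply/funext => i; case: (psd_diag i hX).
Qed.

Lemma psd_trace_ge0 X : psd X -> (0 <= trace_sum X)%E.
Proof. by move=> hX; apply: esum_ge0 => i _; rewrite lee_fin psd_diag_ge0. Qed.

Lemma tc_trace_fin X : trace_class X -> (trace_sum X < +oo)%E.
Proof.
move=> /tcP[P0 [P1 [P2 [P3 [/ptcP[p0 f0] /ptcP[p1 _] /ptcP[p2 _] /ptcP[p3 _] ->]]]]].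
apply: le_lt_trans f0; apply: le_esum => i _; rewrite lee_fin.
have im (P : op R I) : psd P -> complex.Im (P i i) = 0 by move=> hP; case: (psd_diag i hP) => ->.
rewrite !(ReD, ReN, ReM) /= !im//; have := psd_diag_ge0 i p2; lra.
Qed.

Lemma weighted_trace (w : I -> R) X : trace_sum (weighted w X) =
  \esum_(i in [set: I]) (w i ^+ 2 * complex.Re (X i i))%:E.
Proof.
apply: eq_esum => i _; rewrite /weighted !ReM /= !mul0r !mulr0 !subr0.
by rewrite mulrAC -expr2.
Qed.

End TraceClassMore.

(** * Channels: positivity, and continuity under truncation *)

Section Channel.
Variables (R : realType) (C : op R nat -> op R nat).
Hypothesis hC : channel C.
Implicit Types (rho X Y : op R nat) (phi u : nat -> R[i]).

Let Ctc X : trace_class X -> trace_class (C X).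
Proof. by case: hC => h _ _ _; exact: h. Qed.

Let Clin c X Y : trace_class X -> trace_class Y ->
  C (fun i j => c * X i j + Y i j) = (fun i j => c * C X i j + C Y i j).
Proof. by case: hC => _ h _ _; exact: h. Qed.

Let Ctr X : trace_class X -> tr (C X) = tr X.
Proof. by case: hC => _ _ h _; exact: h. Qed.

Let Ccp : completely_positive C.
Proof. by case: hC. Qed.

Lemma channel0 : C (fun _ _ => 0) = (fun _ _ => 0).
Proof.
have := Clin 1 (tc0 R nat) (tc0 R nat).
rewrite (_ : (fun i j => 1 * 0 + 0) = (fun _ _ : nat => 0 : R[i])); last first.
  by apply/funext => i; apply/funext => j; rewrite mulr0 addr0.
move=> E; apply/funext => i; apply/funext => j.
have := congr1 (fun f => f i j) E; rewrite /= mul1r => /eqP.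
by rewrite -[X in X == _ -> _]addr0 (inj_eq (addrI _)) => /eqP.
Qed.

Lemma channel_scale c X : trace_class X -> C (fun i j => c * X i j) = (fun i j => c * C X i j).
Proof.
move=> hX; have := Clin c hX (tc0 R nat); rewrite channel0.
rewrite (_ : (fun i j => c * X i j + 0) = (fun i j => c * X i j)); last first.
  by apply/funext => i; apply/funext => j; rewrite addr0.
by move=> ->; apply/funext => i; apply/funext => j; rewrite addr0.
Qed.

Lemma channel_sum (K : Type) (s : seq K) (c : K -> R[i]) (F : K -> op R nat) :
  (forall k, trace_class (F k)) ->
  C (fun i j => \sum_(k <- s) c k * F k i j) = (fun i j => \sum_(k <- s) c k * C (F k) i j).
Proof.
move=> hF; elim: s => [|k s IH].
  rewrite (_ : (fun i j => _) = (fun _ _ => 0)); last first.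
    by apply/funext => i; apply/funext => j; rewrite big_nil.
  by rewrite channel0; apply/funext => i; apply/funext => j; rewrite big_nil.
rewrite (_ : (fun i j => _) = (fun i j => c k * F k i j + \sum_(k <- s) c k * F k i j)); last first.
  by apply/funext => i; apply/funext => j; rewrite big_cons.
rewrite Clin//; last exact: tc_sum.
by rewrite IH; apply/funext => i; apply/funext => j; rewrite big_cons.
Qed.

(** Positivity is complete positivity with an ancilla of dimension one. *)
Lemma channel_psd rho : positive_trace_class rho ->
  psd (C rho) /\ trace_sum (C rho) = trace_sum rho.
Proof.
move=> hr; have [psr fr] := (ptcP rho).1 hr.
pose X : op R (nat * 'I_1)%type := fun p q => rho p.1 q.1.
have pX : psd X.
  move=> s c us; apply: (psd_pull (f := fst) (g := fun i => (i, ord0))) => //.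
  by move=> [i o] _ /=; rewrite (ord1 o).
have hX : positive_trace_class X.
  apply/ptcP; split=> //.
  rewrite /trace_sum esum_pair; last by move=> p; exact: psd_diag_ge0 pX.
  apply: le_lt_trans fr; apply: le_esum => i _.
  rewrite -[leRHS](esum_single (ord0 : 'I_1) (psd_diag_ge0 i psr)); apply: le_esum => o _.
  by rewrite (ord1 o).
have h := positive_psd (Ccp hX).
have ps : psd (C rho).
  move=> s c us.
  by apply: (psd_pull (f := fun i => (i, ord0 : 'I_1)) (g := fst) (X := ampl C X)).
split => //.
have := Ctr (ptc_tc hr); rewrite !tr_psd// => /complexI E.
have f1 := tc_trace_fin (Ctc (ptc_tc hr)).
by rewrite (psd_trace_fin ps f1) (psd_trace_fin psr fr) E.
Qed.

Lemma channel_expectation rho phi : positive_trace_class rho -> l2 phi ->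
  [/\ bounded (C rho),
     Defs.expectation (C rho) phi = (complex.Re (Defs.expectation (C rho) phi))%:C,
     0 <= complex.Re (Defs.expectation (C rho) phi) &
     complex.Re (Defs.expectation (C rho) phi) <= fine (trace_sum rho) * sqn phi].
Proof.
move=> hr hp; have [ps E] := channel_psd hr; have [_ fr] := (ptcP rho).1 hr.
by rewrite -E; apply: ptc_expectation => //; rewrite E.
Qed.

Definition matunit (r s : nat) : op R nat := ketbra (ebase R r) (ebase R s).

Lemma tc_matunit r s : trace_class (matunit r s).
Proof. by apply: tc_ketbra; exact: l2_ebase. Qed.

Lemma matunitE r s i j : matunit r s i j = ((i == r) && (j == s))%:R.
Proof.
rewrite /matunit /ketbra /ebase; case: (i == r); rewrite ?mul0r// mul1r.
by case: (j == s); [apply: complexP; rewrite /= ?oppr0|exact: conjc0].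
Qed.

Definition lo (N i : nat) : R := (i < N)%:R.
Definition hi (N i : nat) : R := (N <= i)%:R.

(** The expectation of the image of the compression of rho to the first N levels, expanded over
    matrix units: a finite sum, linear in the entries of rho, that commutes with integrals. *)
Definition trunc_val rho (N : nat) phi : R[i] :=
  \sum_(p : 'I_N * 'I_N) rho p.1 p.2 * Defs.expectation (C (matunit p.1 p.2)) phi.

Lemma weighted_lo rho N : weighted (lo N) rho =
  (fun i j => \sum_(p : 'I_N * 'I_N) rho p.1 p.2 * matunit p.1 p.2 i j).
Proof.
apply/funext => i; apply/funext => j; rewrite /weighted /lo.
have [iN|iN] := ltnP i N; last first.
  rewrite mul0r mul0r big1// => -[r s] _ /=; rewrite matunitE.
  case: eqP => [ir|_]; last by rewrite mulr0.
  by move: (ltn_ord r); rewrite -ir ltnNge iN.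
have [jN|jN] := ltnP j N; last first.
  rewrite mulr0 big1// => -[r s] _ /=; rewrite matunitE.
  case: (j =P s :> nat) => [js|_]; last by rewrite andbF mulr0.
  by move: (ltn_ord s); rewrite -js ltnNge jN.
rewrite (bigD1 (Ordinal iN, Ordinal jN))//= matunitE !eqxx mulr1 mul1r mulr1.
rewrite big1 ?addr0// => -[r s] /=; rewrite xpair_eqE -!val_eqE /= matunitE => rs.
by rewrite (eq_sym i) (eq_sym j) (negbTE rs) mulr0.
Qed.

Lemma trunc_valE rho N phi : l2 phi ->
  Defs.expectation (C (weighted (lo N) rho)) phi = trunc_val rho N phi.
Proof.
move=> hp; rewrite weighted_lo channel_sum; last by move=> p; exact: tc_matunit.
by apply: (expectation_sum _ _ _ hp).2 => p; apply: tc_bounded; apply: Ctc; exact: tc_matunit.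
Qed.

Lemma lo_sq N i : lo N i ^+ 2 <= 1.
Proof. by rewrite /lo; case: (_ < _)%N; rewrite ?expr1n ?expr0n. Qed.

Lemma hi_sq N i : hi N i ^+ 2 <= 1.
Proof. by rewrite /hi; case: (_ <= _)%N; rewrite ?expr1n ?expr0n. Qed.

Lemma ptc_tail rho (N : nat) : psd rho ->
  trace_sum (weighted (hi N) rho) = \esum_(i in [set: nat]) (tail N (fun i => complex.Re (rho i i)) i)%:E.
Proof.
move=> hr; rewrite weighted_trace; apply: eq_esum => i _.
by rewrite /hi /tail leqNgt; case: (i < N)%N; rewrite ?expr0n ?mul0r ?expr1n ?mul1r.
Qed.

(** Let P and Q project onto the levels below N and from N on, A = P rho P and D = Q rho Q. The
    operators (P + s Q) rho (P + s Q) and (P - s Q) rho (P - s Q) are positive, hence so are the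
    expectations of their images, and this bounds the off-diagonal part of rho from both sides by A
    / s and multiples of D. It is the Cauchy-Schwarz inequality with a free parameter s. *)
Lemma channel_trunc_le rho phi (s : R) N : positive_trace_class rho -> l2 phi -> 0 < s ->
  `|complex.Re (Defs.expectation (C rho) phi) - complex.Re (trunc_val rho N phi)| <=
  sqn phi * (fine (trace_sum rho) / s + (s + 1) * fine (trace_sum (weighted (hi N) rho))).
Proof.
move=> hr hp s0.
have [e eE] : exists e : op R nat -> R, forall Y, e Y = complex.Re (Defs.expectation (C Y) phi).
  by exists (fun Y => complex.Re (Defs.expectation (C Y) phi)).
pose A := weighted (lo N) rho; pose D := weighted (hi N) rho.
pose wp i := lo N i + s * hi N i; pose wm i := lo N i - s * hi N i.
have wb (t : R) i : (lo N i + t * hi N i) ^+ 2 <= 1 + t ^+ 2.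
  rewrite /lo /hi (leqNgt N i); have := sqr_ge0 t.
  by case: (i < N)%N => /= t2; rewrite ?mulr0 ?addr0 ?expr1n ?add0r ?mulr1; lra.
have hA : positive_trace_class A := ptc_weighted (lo_sq N) hr.
have hD : positive_trace_class D := ptc_weighted (hi_sq N) hr.
have hWp : positive_trace_class (weighted wp rho) := ptc_weighted (wb s) hr.
have hWm : positive_trace_class (weighted wm rho).
  by apply: (@ptc_weighted _ _ wm (1 + (- s) ^+ 2)) => // i; rewrite /wm -mulNr wb.
have elin (a : R) X Y : positive_trace_class X -> positive_trace_class Y ->
    e (fun i j => a%:C * X i j + Y i j) = a * e X + e Y.
  move=> hX hY; have [bX _ _ _] := channel_expectation hX hp.
  have [bY _ _ _] := channel_expectation hY hp.
  rewrite !eE Clin ?expectation_lin//; [|exact: ptc_tc..].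
  by rewrite ReD ReM /= mul0r subr0.
have esc (a : R) X : positive_trace_class X -> e (fun i j => a%:C * X i j) = a * e X.
  move=> hX; have := elin a X _ hX (ptc0 R nat); rewrite [e (fun _ _ => 0)]eE channel0 expectation0 addr0 => <-.
  by congr e; apply/funext => i; apply/funext => j; rewrite addr0.
have ss0 : 0 <= s + s ^+ 2 by rewrite addr_ge0 ?sqr_ge0 ?ltW.
(* Here and in [I2] the terms are arranged so that every coefficient is nonnegative, which keeps
   each combination in the positive trace class. *)
have I1 : s * e rho + e (weighted wm rho) = (1 + s) * e A + (s + s ^+ 2) * e D.
  have e1 := esc (s + s ^+ 2) _ hD; have e2 := elin s _ _ hr hWm.
  have e3 := elin (1 + s) _ _ hA (ptc_scale ss0 hD).
  rewrite -e1 -e2 -e3; congr e; apply/funext => i; apply/funext => j; rewrite /A /D /weighted /wm /lo /hi !(leqNgt N).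
  move: (rho i j) => r; case: (i < N)%N; case: (j < N)%N => /=;
    rewrite ?(rmorphB, rmorphD, rmorphM, rmorph1, rmorph0, rmorphXn) /=; ring.
have I2 : s * e A + (s * e D + e (weighted wp rho)) = s * e rho + (s ^+ 2 * e D + e A).
  have h1 := ptc_lin (ltW s0) hD hWp; have h2 := ptc_lin (sqr_ge0 s) hD hA.
  have e1 := elin s _ _ hD hWp; have e2 := elin (s ^+ 2) _ _ hD hA.
  have e3 := elin s _ _ hA h1; have e4 := elin s _ _ hr h2.
  rewrite -e1 -e2 -e3 -e4; congr e; apply/funext => i; apply/funext => j; rewrite /A /D /weighted /wp /lo /hi !(leqNgt N).
  move: (rho i j) => r; case: (i < N)%N; case: (j < N)%N => /=;
    rewrite ?(rmorphB, rmorphD, rmorphM, rmorph1, rmorph0, rmorphXn) /=; ring.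
have eB X : positive_trace_class X -> 0 <= e X /\ e X <= fine (trace_sum X) * sqn phi.
  by move=> hX; rewrite eE; case: (channel_expectation hX hp).
have [p0 _] := eB _ hWp; have [m0 _] := eB _ hWm.
have [a0 a1] := eB _ hA; have [d0 d1] := eB _ hD.
have TA : fine (trace_sum A) <= fine (trace_sum rho).
  have [psr fr] := (ptcP rho).1 hr; have [psA fA] := (ptcP A).1 hA.
  rewrite -lee_fin -(psd_trace_fin psA fA) -(psd_trace_fin psr fr) weighted_trace.
  by apply: le_esum => i _; rewrite lee_fin ler_piMl ?psd_diag_ge0// lo_sq.
rewrite -trunc_valE// -(eE rho) -(eE (weighted (lo N) rho)) -/A -/D.
set T := fine (trace_sum rho) in TA *; set tau := fine (trace_sum D) in d1 *.
have q0 := sqn_ge0 phi; set q := sqn phi in q0 a1 d1 *.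
have a2 : e A <= T * q by apply: le_trans a1 _; rewrite ler_wpM2r.
rewrite -(ler_pM2l s0) -{1}(gtr0_norm s0) -normrM.
have -> : s * (q * (T / s + (s + 1) * tau)) = T * q + (s ^+ 2 + s) * (tau * q).
  by field; rewrite gt_eqF.
have h3 : (s ^+ 2 + s) * e D <= (s ^+ 2 + s) * (tau * q).
  by rewrite ler_wpM2l// addrC.
have sd : 0 <= s * e D by rewrite mulr_ge0// ltW.
rewrite ler_norml mulrBr; apply/andP; split; lra.
Qed.

Lemma channel_trunc_cvg rho phi (eps : R) : positive_trace_class rho -> l2 phi -> 0 < eps ->
  exists N0, forall N, (N0 <= N)%N ->
  `|complex.Re (Defs.expectation (C rho) phi) - complex.Re (trunc_val rho N phi)| <= eps.
Proof.
move=> hr hp e0; have [psr fr] := (ptcP rho).1 hr.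
have q0 := sqn_ge0 phi; set q := sqn phi in q0.
have T0 : 0 <= fine (trace_sum rho) by apply: fine_ge0; exact: psd_trace_ge0.
set T := fine (trace_sum rho) in T0.
(* The parameter s is fixed first, so that q T / s <= eps / 2; only then is N taken large enough to
   beat the factor s + 1. *)
pose s := 2 * (q * T + 1) / eps.
have s0 : 0 < s by rewrite divr_gt0// mulr_gt0// ltr_wpDl// mulr_ge0.
have e1 : 0 < eps / 2 / ((q + 1) * (s + 1)).
  by rewrite divr_gt0 ?divr_gt0// mulr_gt0 ?ltr_wpDl ?ltr_wpDr// ltW.
have [N0 hN] := esum_tail (fun i => psd_diag_ge0 i psr) fr e1.
exists N0 => N /hN h; apply: le_trans (channel_trunc_le N hr hp s0) _.
rewrite -(ptc_tail N psr) in h.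
have psD := ((ptcP _).1 (ptc_weighted (hi_sq N) hr)).1.
have fD := ((ptcP _).1 (ptc_weighted (hi_sq N) hr)).2.
rewrite (psd_trace_fin psD fD) lee_fin in h.
set tau := fine _ in h *; have tau0 : 0 <= tau by apply: fine_ge0; exact: psd_trace_ge0.
have q1 : 0 < q + 1 by rewrite ltr_wpDl.
have s1 : 0 < s + 1 by rewrite ltr_wpDr// ltW.
rewrite -/q -/T mulrDr.
have h1 : q * (T / s) <= eps / 2.
  rewrite mulrA ler_pdivrMr//.
  have -> : eps / 2 * s = q * T + 1 by rewrite /s; field; rewrite gt_eqF.
  by rewrite lerDl.
have h2 : q * ((s + 1) * tau) <= eps / 2.
  rewrite ler_pdivlMr ?mulr_gt0// in h; apply: le_trans h.
  rewrite [leRHS](_ : _ = (q + 1) * ((s + 1) * tau)); last by ring.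
  by rewrite ler_wpM2r ?lerDl// mulr_ge0// ltW.
lra.
Qed.

End Channel.

(** * The squeezed state *)

Section FormContinuity.
Variable R : realType.

Lemma form_rst_cvg (B : (nat -> R[i]) -> (nat -> R[i]) -> R[i]) (M : R) (w : nat -> R[i]) (eps : R) :
  bounded_form B M -> l2 w -> 0 < eps ->
  exists N0, forall N, (N0 <= N)%N ->
    cabs (B w w - B (rst (iota 0 N) w) (rst (iota 0 N) w)) <= eps.
Proof.
move=> hB hw e0; set n := nrm w; have n0 : 0 <= n by exact: nrm_ge0.
have K0 : 0 < 2 * `|M| * n + 1 by rewrite ltr_wpDl// !mulr_ge0.
have [N0 h] := l2_tail_iota hw (divr_gt0 e0 K0).
exists N0 => N /h; set wN := rst (iota 0 N) w; set dl := (fun i => _) => hd.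
have hN : l2 wN by apply: l2_rst; exact: iota_uniq.
have hdl : l2 dl by exact: l2B.
have wE : w = (fun i => 1 * dl i + wN i).
  by apply/funext => i; rewrite mul1r subrK.
have c1 : conjc 1 = 1 :> R[i] by apply: complexP; rewrite /= ?oppr0.
have E1 : B w w = B w dl + B w wN.
  by rewrite {2}wE (form_linr hB)// mul1r.
have E2 : B w wN = B dl wN + B wN wN.
  by rewrite {1}wE (form_linl hB)// c1 mul1r.
have nN : nrm wN <= n.
  rewrite ler_wsqrtr// -lee_fin !sqnK//; apply: le_esum => i _; rewrite lee_fin /wN /rst.
  by case: ifP => // _; rewrite sqmodC expr0n /= sqmod_ge0.
rewrite E1 E2 addrA addrK; apply: le_trans (cabsD _ _) _.
have b1 := form_le hB hw hdl; have b2 := form_le hB hdl hN.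
have d0 : 0 <= nrm dl by exact: nrm_ge0.
have lM (a b : R) : 0 <= a -> 0 <= b -> M * a * b <= `|M| * a * b.
  by move=> a0 b0; rewrite -!mulrA ler_wpM2r ?mulr_ge0// ler_norm.
have b1' : cabs (B w dl) <= `|M| * n * nrm dl by apply: le_trans b1 _; exact: lM.
have b2' : cabs (B dl wN) <= `|M| * n * nrm dl.
  apply: le_trans b2 _; apply: le_trans (lM _ _ d0 (nrm_ge0 _)) _.
  by rewrite mulrAC ler_wpM2r// ler_wpM2l.
apply: (@le_trans _ _ ((2 * `|M| * n + 1) * nrm dl)).
  apply: le_trans (lerD b1' b2') _; rewrite mulrDl mul1r -subr_ge0.
  by rewrite (_ : _ - _ = nrm dl)//; ring.
by rewrite mulrC -ler_pdivlMr.
Qed.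

End FormContinuity.

Section Squeezed.
Variables (R : realType) (x : R) (C : op R nat -> op R nat).
Hypothesis x0 : 0 < x.
Hypothesis x1 : x < 1.
Hypothesis hC : channel C.

Definition sqz (r : nat) : R := Num.sqrt (1 - x) * Num.sqrt x ^+ r.

Let Psi := ketbra (two_mode_squeezed x) (two_mode_squeezed x).

Lemma two_mode_squeezedE i r : two_mode_squeezed x (i, r) = if i == r then (sqz r)%:C else 0.
Proof.
rewrite /two_mode_squeezed /=; case: eqP => [->|_]; last by rewrite mulr0.
rewrite -rmorphM /sqz; congr ((_ * _)%:C).
by rewrite mulrC powRrM powR12_sqrt ?ltW// powR_mulrn// sqrtr_ge0.
Qed.

(** Each block is a multiple of a single matrix unit, so the output state only involves the images
    of the matrix units under the channel. *)
Lemma squeezed_block r s : blk Psi r s = (fun i j => (sqz r * sqz s)%:C * matunit R r s i j).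
Proof.
apply/funext => i; apply/funext => j.
rewrite /blk /Psi /ketbra !two_mode_squeezedE matunitE.
case: (i == r); rewrite ?mul0r ?mulr0//; case: (j == s); rewrite ?conjc0 ?mulr0//.
by rewrite conjc_real -rmorphM mulr1.
Qed.

Definition squeezed_out : op R (nat * nat)%type := ampl C Psi.

Let bC r s : bounded (C (matunit R r s)).
Proof. by apply: tc_bounded; case: hC => h _ _ _; apply: h; exact: tc_matunit. Qed.

Lemma squeezed_outE m r n s :
  squeezed_out (m, r) (n, s) = (sqz r * sqz s)%:C * C (matunit R r s) m n.
Proof.
rewrite /squeezed_out /ampl /= -[(fun i j => _)]/(blk Psi r s) squeezed_block.
by rewrite (channel_scale hC)//; exact: tc_matunit.
Qed.

(** Complete positivity speaks of finite ancillas, but a finite test vector only sees reference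
    levels up to some N. There the output is the Choi matrix of an unnormalized maximally entangled
    vector, the amplitudes [sqz] being absorbed into the test vector. *)
Lemma psd_squeezed_out : psd squeezed_out.
Proof.
move=> s c us; pose N := \max_(p <- s) p.2.
pose om : nat * 'I_N.+1 -> R[i] := fun p => (p.1 == p.2 :> nat)%:R.
have hom : l2 om.
  pose t := [seq (val r, r) | r <- enum 'I_N.+1].
  have ut : uniq t by rewrite map_inj_uniq ?enum_uniq// => a b [_].
  have -> : om = rst t om.
    apply/funext => -[i r]; rewrite /rst; case: ifPn => // ir; rewrite /om /=.
    case: eqP => // e; case/negP: ir; apply/mapP; exists r; rewrite ?mem_enum//.
    by rewrite e.
  exact: l2_rst.
have [hO _] := ptc_ketbra hom.
have hcp : completely_positive C by case: hC.
have := positive_psd (hcp _ _ hO).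
move=> /(@psd_pull R _ _ _ (fun p : nat * nat => (p.1, inord p.2 : 'I_N.+1))
  (fun q => (q.1, val q.2)) s (fun p => (sqz p.2)%:C * c p) us) h.
have sN p : p \in s -> (p.2 < N.+1)%N.
  by move=> ps; rewrite ltnS /N (big_rem p ps) /= leq_maxl.
have /h : {in s, cancel (fun p : nat * nat => (p.1, inord p.2 : 'I_N.+1)) (fun q => (q.1, val q.2))}.
  by move=> [i r] /sN /= rN; rewrite inordK.
congr (0 <= _); rewrite /quad big_seq [RHS]big_seq; apply: eq_bigr => -[m r] ps.
rewrite big_seq [RHS]big_seq; apply: eq_bigr => -[n s'] ps'.
have E : ampl C (ketbra om om) (m, inord r) (n, inord s') = C (matunit R r s') m n.
  rewrite /ampl /=; congr (C _ m n); apply/funext => i; apply/funext => j.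
  by rewrite /ketbra /om /= !inordK ?(sN _ ps) ?(sN _ ps').
rewrite E squeezed_outE /=.
move: (sqz r) (sqz s') (C (matunit R r s') m n) (c (m, r)) (c (n, s')) => a b w e f.
rewrite conjcM conjc_real (rmorphM (real_complex R)) /=; ring.
Qed.

Lemma esum_geometric_le : (\esum_(k in [set: nat]) (x ^+ k)%:E <= ((1 - x)^-1)%:E)%E.
Proof.
have x1' : 0 < 1 - x by rewrite subr_gt0.
rewrite -nneseries_esumT => [|k]; last by rewrite lee_fin exprn_ge0// ltW.
apply: lime_le; first by apply: is_cvg_nneseries => k _ _; rewrite lee_fin exprn_ge0// ltW.
apply: nearW => n; rewrite sumEFin lee_fin big_mkord.
have -> : \sum_(i < n) x ^+ i = (1 - x ^+ n) / (1 - x).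
  elim: n => [|n IH]; first by rewrite big_ord0 expr0 subrr mul0r.
  by rewrite big_ord_recr /= IH exprS; field; rewrite gt_eqF.
apply: ler_piMl; first by rewrite invr_ge0 ltW.
by rewrite gerBl exprn_ge0// ltW.
Qed.

Lemma sqz_sq r : sqz r ^+ 2 = (1 - x) * x ^+ r.
Proof.
by rewrite /sqz exprMn exprAC !sqr_sqrtr// ?subr_ge0 ltW.
Qed.

Lemma squeezed_out_trace : (trace_sum squeezed_out < +oo)%E.
Proof.
have dg m r : complex.Re (squeezed_out (m, r) (m, r)) = sqz r ^+ 2 * complex.Re (C (matunit R r r) m m).
  by rewrite squeezed_outE ReM /= mul0r subr0 expr2.
have pu r := ptc_ketbra (@l2_ebase R nat r).
have pC r := channel_psd hC (pu r).1.
rewrite /trace_sum esum_pair; last by move=> p; exact: psd_diag_ge0 psd_squeezed_out.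
rewrite (esum_swap (f := fun p => complex.Re (squeezed_out p p))); last by move=> p; exact: psd_diag_ge0 psd_squeezed_out.
apply: (@le_lt_trans _ _ (\esum_(r in [set: nat]) ((1 - x) * x ^+ r)%:E)).
  apply: le_esum => r _; under eq_esum do rewrite dg.
  rewrite esum_scale ?sqr_ge0//; last by move=> m; exact: psd_diag_ge0 (pC r).1.
  by rewrite -/(trace_sum (C (matunit R r r))) (pC r).2 (pu r).2 sqnorm_ebase mule1 sqz_sq.
rewrite esum_scale ?subr_ge0 ?ltW//; last by move=> r; rewrite exprn_ge0// ltW.
apply: (@le_lt_trans _ _ ((1 - x)%:E * ((1 - x)^-1)%:E)%E).
  by rewrite lee_wpmul2l ?lee_fin ?subr_ge0 ?(ltW x1)//; exact: esum_geometric_le.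
by rewrite -EFinM ltry.
Qed.

Lemma ptc_squeezed_out : positive_trace_class squeezed_out.
Proof. by apply/ptcP; split; [exact: psd_squeezed_out|exact: squeezed_out_trace]. Qed.

(** The function f of the overview, with a general vector u in place of |g a>. *)
Definition coh_fid (u : nat -> R[i]) (om : R[i]) : R :=
  complex.Re (Defs.expectation (C (ketbra (coherent om) (coherent om))) u).

(** The coordinates of the partial overlap of the squeezed state with |conj z>: the amplitudes
    x^(r/2) turn z^r into (sqrt x z)^r, and the Gaussian factor is the mismatch of the
    normalizations of |z> and |sqrt x z>. *)
Lemma coherent_sqz z r : coherent z r * (sqz r)%:C =
  (Num.sqrt (1 - x) * expR (- (1 - x) * sqmod z / 2))%:C * coherent ((Num.sqrt x)%:C * z) r.
Proof.
rewrite /coherent /sqz sqmodM sqmodC sqr_sqrtr ?ltW// exprMn.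
rewrite !rmorphM rmorphXn /= mulrACA.
have -> : - sqmod z / 2 = - (1 - x) * sqmod z / 2 + - (x * sqmod z) / 2 by field.
rewrite expRD rmorphM /=.
set a := (expR _)%:C; set b := (expR _)%:C; set d := (_^-1)%:C; set e := (Num.sqrt (1 - x))%:C.
set f := (Num.sqrt x)%:C ^+ r; move: (z ^+ r) => zr; ring.
Qed.

Let form2 u (a b : nat -> R[i]) : R[i] := dot (tensv u a) (apply squeezed_out (tensv u b)).

Let tensv_lin (u : nat -> R[i]) c (a b : nat -> R[i]) :
  tensv u (fun i => c * a i + b i) = (fun p => c * tensv u a p + tensv u b p).
Proof. by apply/funext => p; rewrite /tensv; ring. Qed.

Let nrm_tensv (u a : nat -> R[i]) : l2 u -> l2 a -> nrm (tensv u a) = nrm u * nrm a.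
Proof.
by move=> hu ha; rewrite {1}/nrm /sqn sqnorm_tensv//= sqrtrM// sqn_ge0.
Qed.

Let form2_bounded u : l2 u -> exists M, bounded_form (form2 u) M.
Proof.
move=> hu; have [M hM] := bounded_formP (ptc_bounded ptc_squeezed_out).
exists (M * nrm u * nrm u); split => [c a a' b ha ha' hb|c a b b' ha hb hb'|a b ha hb].
- rewrite /form2 tensv_lin; have := form_linl hM c (l2_tensv hu ha) (l2_tensv hu ha') (l2_tensv hu hb).
  exact.
- rewrite /form2 tensv_lin; have := form_linr hM c (l2_tensv hu ha) (l2_tensv hu hb) (l2_tensv hu hb').
  exact.
- have := form_le hM (l2_tensv hu ha) (l2_tensv hu hb); rewrite !nrm_tensv//.
  by move/le_trans; apply; rewrite le_eqVlt; apply/orP; left; apply/eqP; ring.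
Qed.

Let form2_ebase u r s : l2 u -> form2 u (ebase R r) (ebase R s) =
  (sqz r * sqz s)%:C * Defs.expectation (C (matunit R r s)) u.
Proof.
move=> hu.
transitivity (dot u (apply (blk squeezed_out r s) u)).
  rewrite apply_blk /form2 /dot (csum_fiber (r := r)) => [|i j jr].
    by congr csum; apply/funext => i; rewrite /tensv /ebase /= eqxx mulr1.
  by rewrite /tensv /ebase /= (negbTE jr) mulr0 conjc0 mul0r.
rewrite (_ : blk squeezed_out r s = opscale (sqz r * sqz s) (C (matunit R r s))).
  by rewrite dot_opscale.
by apply/funext => i; apply/funext => j; rewrite /blk squeezed_outE.
Qed.

(** When the reference vector is truncated at N, both sides are the same finite sum over matrix
    units. The left side converges because the output is bounded, the right side by
    [channel_trunc_cvg]. *)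
Lemma squeezed_expectation u z : l2 u ->
  Defs.expectation squeezed_out (tensv u (coherent (conjc z))) =
  ((1 - x) * expR (- (1 - x) * sqmod z) * coh_fid u ((Num.sqrt x)%:C * z))%:C.
Proof.
move=> hu; set w := coherent (conjc z); set om := (Num.sqrt x)%:C * z.
have hw : l2 w by exact: l2_coherent.
have [_ -> _ _] := ptc_expectation psd_squeezed_out squeezed_out_trace (l2_tensv hu hw).
congr (_%:C).
pose K := Num.sqrt (1 - x) * expR (- (1 - x) * sqmod z / 2).
have K2 : (1 - x) * expR (- (1 - x) * sqmod z) = K ^+ 2.
  rewrite /K exprMn sqr_sqrtr ?subr_ge0 ?ltW// -expRM_natl; congr (_ * expR _).
  by field.
have [rho hrho] : exists rho, rho = ketbra (coherent om) (coherent om) by eexists.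
have pr : positive_trace_class rho by rewrite hrho; case: (ptc_ketbra (l2_coherent om)).
have truncE N : form2 u (rst (iota 0 N) w) (rst (iota 0 N) w) = (K ^+ 2)%:C * trunc_val C rho N u.
  have [M hM] := form2_bounded hu.
  have us := iota_uniq 0 N.
  rewrite (form_rstl w hM us (l2_rst w us)).
  rewrite /trunc_val -(pair_bigA _ (fun r s : 'I_N => rho r s * Defs.expectation (C (matunit R r s)) u)) /=.
  rewrite mulr_sumr -(big_mkord xpredT (fun r => (K ^+ 2)%:C * \sum_(j < N) rho r j * Defs.expectation (C (matunit R r j)) u)).
  rewrite /index_iota subn0; apply: eq_bigr => r _.
  rewrite (form_rst w hM us (@l2_ebase R nat r)) mulr_sumr.
  rewrite mulr_sumr -(big_mkord xpredT (fun j => (K ^+ 2)%:C * (rho r j * Defs.expectation (C (matunit R r j)) u))).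
  rewrite /index_iota subn0; apply: eq_bigr => s _.
  rewrite form2_ebase// hrho /ketbra.
  have e1 : conjc (w r) * (sqz r)%:C = K%:C * coherent om r.
    by rewrite /w coherent_conj conjcK coherent_sqz.
  have e2 : w s * (sqz s)%:C = K%:C * conjc (coherent om s).
    have := congr1 (@conjc R) (coherent_sqz z s); rewrite /w coherent_conj !conjcM !conjc_real.
    by move=> ->.
  rewrite (rmorphM (real_complex R)) (rmorphXn (real_complex R)) /=.
  transitivity (conjc (w r) * (sqz r)%:C * (w s * (sqz s)%:C) * Defs.expectation (C (matunit R r s)) u).
    by ring.
  by rewrite e1 e2; ring.
rewrite K2; apply: (@complexI R); apply: eq_cabs_eps => eps e0.
have e20 : 0 < eps / 2 by rewrite divr_gt0.
have [M hM] := form2_bounded hu.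
have [N1 h1] := form_rst_cvg hM hw e20.
have k0 : 0 < eps / 2 / (K ^+ 2 + 1) by rewrite divr_gt0// ltr_wpDl// sqr_ge0.
have [N2 h2] := channel_trunc_cvg hC pr hu k0.
have := h1 (maxn N1 N2) (leq_maxl _ _); have := h2 (maxn N1 N2) (leq_maxr _ _).
rewrite truncE; set tv := trunc_val _ _ _ _ => b2 b1.
rewrite -[form2 u w w]/(Defs.expectation squeezed_out (tensv u w)) in b1.
rewrite -rmorphB cabsC.
set X := complex.Re _; have b1' : `|X - K ^+ 2 * complex.Re tv| <= eps / 2.
  apply: le_trans b1; apply: le_trans (Re_cabs _).
  by rewrite ReD ReN ReM /= mul0r subr0.
rewrite /coh_fid -hrho; set Y := complex.Re _ in b2 *.
have -> : X - K ^+ 2 * Y = (X - K ^+ 2 * complex.Re tv) - K ^+ 2 * (Y - complex.Re tv) by ring.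
apply: le_trans (ler_normB _ _) _; rewrite (_ : eps = eps / 2 + eps / 2); last by field.
apply: lerD => //; rewrite normrM ger0_norm ?sqr_ge0//.
have q1 : 0 < K ^+ 2 + 1 by rewrite ltr_wpDl// sqr_ge0.
rewrite ler_pdivlMr// in b2; apply: le_trans b2; rewrite [leRHS]mulrC.
by rewrite ler_wpM2r// lerDl.
Qed.

End Squeezed.

(** * Displaced thermal states *)

Section PlaneMore.
Variable R : realType.
Local Notation RR := (measurableTypeR R * measurableTypeR R)%type.
Let HP := integral_integration (plane R).

Let planeM' : {sigma_finite_measure set RR -> \bar R} :=
  HB.pack_for {sigma_finite_measure set RR -> \bar R} (plane R)
    (Measure_isSigmaFinite.Build _ _ _ (plane R) (plane_sigma_finite R)).

Lemma Lint_meas (F : R[i] -> R[i] -> \bar R) :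
  measurable_fun [set: (RR * RR)%type] (fun q => F (toC q.1) (toC q.2)) ->
  (forall z w, 0 <= F z w)%E -> emeasC (fun z => Lint (fun w => F z w)).
Proof.
move=> mF F0; have := measurable_fun_fubini_tonelli_F (m2 := planeM')
  (fun q => F (toC q.1) (toC q.2)) mF (fun q => F0 (toC q.1) (toC q.2)).
exact.
Qed.

Lemma Lint_scale (c : R) (f : R[i] -> R) : 0 <= c -> (forall z, 0 <= f z) ->
  measurable_fun [set: RR] (fun p => f (toC p)) ->
  Lint (fun z => (c * f z)%:E) = (c%:E * Lint (fun z => (f z)%:E))%E.
Proof. by move=> c0 f0 mf; rewrite /Lint (int_scale HP). Qed.

Lemma Lint_add (f g : R[i] -> R) : (forall z, 0 <= f z) -> (forall z, 0 <= g z) ->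
  measurable_fun [set: RR] (fun p => f (toC p)) -> measurable_fun [set: RR] (fun p => g (toC p)) ->
  Lint (fun z => (f z + g z)%:E) = (Lint (fun z => (f z)%:E) + Lint (fun z => (g z)%:E))%E.
Proof. by move=> f0 g0 mf mg; rewrite /Lint (int_add HP). Qed.

Lemma Lint_le (f g : R[i] -> R) : (forall z, 0 <= f z) -> (forall z, f z <= g z) ->
  measurable_fun [set: RR] (fun p => f (toC p)) -> measurable_fun [set: RR] (fun p => g (toC p)) ->
  (Lint (fun z => (f z)%:E) <= Lint (fun z => (g z)%:E))%E.
Proof. by move=> f0 fg mf mg; apply: (int_le HP). Qed.

Lemma Lint_sum (K : Type) (s : seq K) (f : K -> R[i] -> R) : (forall k z, 0 <= f k z) ->
  (forall k, measurable_fun [set: RR] (fun p => f k (toC p))) ->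
  Lint (fun z => (\sum_(k <- s) f k z)%:E) = (\sum_(k <- s) Lint (fun z => (f k z)%:E))%E.
Proof.
move=> f0 mf; elim: s => [|k s IH].
  rewrite big_nil; under eq_fun do rewrite big_nil.
  exact: Jint0.
rewrite big_cons -IH; under eq_fun do rewrite big_cons.
rewrite Lint_add// => [z|]; first by apply: sumr_ge0 => i _.
exact: measurable_sum.
Qed.

Lemma Lint_gauss_bound (t : R) (f : R[i] -> R) (B : R) : 0 < t -> 0 <= B ->
  (forall z, 0 <= f z <= B) -> measurable_fun [set: RR] (fun p => f (toC p)) ->
  (Lint (fun z => (gauss t z * f z)%:E) <= B%:E)%E.
Proof.
move=> t0 B0 hf mf; have g0 z : 0 <= gauss t z by exact: gauss_ge0 (ltW t0).
have mg : measurable_fun [set: RR] (fun p => gauss t (toC p)) by apply: meas_gauss; exact: cm_toC.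
apply: (@le_trans _ _ (Lint (fun z => (B * gauss t z)%:E))).
  apply: Lint_le => [z|z||]; [by rewrite mulr_ge0//; case/andP: (hf z)| |exact: measurable_funM|exact: measurable_funM].
  by rewrite mulrC ler_wpM2r//; case/andP: (hf z).
by rewrite Lint_scale// Lint_gauss// mule1.
Qed.

(** First s is chosen to make q T / s small, then N to make the second term small for that s. *)
Lemma trade_off (q T dl : R) (tau : nat -> R) : 0 <= q -> 0 <= T -> (forall N, 0 <= tau N) ->
  (forall e : R, 0 < e -> exists N, tau N <= e) ->
  (forall (s : R) N, 0 < s -> dl <= q * (T / s + (s + 1) * tau N)) -> dl <= 0.
Proof.
move=> q0 T0 tau0 htau h; apply/ler_addgt0Pr => eps e0; rewrite add0r.
pose s := 2 * (q * T + 1) / eps.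
have s0 : 0 < s by rewrite divr_gt0// mulr_gt0// ltr_wpDl// mulr_ge0.
have q1 : 0 < q + 1 by rewrite ltr_wpDl.
have s1 : 0 < s + 1 by rewrite ltr_wpDr// ltW.
have [|N hN] := htau (eps / 2 / ((q + 1) * (s + 1))).
  by rewrite divr_gt0 ?divr_gt0// mulr_gt0.
apply: le_trans (h s N s0) _; rewrite mulrDr.
have h1 : q * (T / s) <= eps / 2.
  rewrite mulrA ler_pdivrMr//.
  have -> : eps / 2 * s = q * T + 1 by rewrite /s; field; rewrite gt_eqF.
  by rewrite lerDl.
have h2 : q * ((s + 1) * tau N) <= eps / 2.
  rewrite ler_pdivlMr ?mulr_gt0// in hN; apply: le_trans hN.
  rewrite [leRHS](_ : _ = (q + 1) * ((s + 1) * tau N)); last by ring.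
  by rewrite ler_wpM2r ?lerDl// mulr_ge0// ltW.
lra.
Qed.

End PlaneMore.

(** * Bounds and measurability of the fidelity of coherent inputs *)

Section CoherentFidelity.
Variables (R : realType) (C : op R nat -> op R nat).
Hypothesis hC : channel C.

Let pc (om : R[i]) := ptc_ketbra (l2_coherent om).

Lemma coh_fid_ge0 u om : l2 u -> 0 <= coh_fid C u om.
Proof. by move=> hu; case: (channel_expectation hC (pc om).1 hu). Qed.

Lemma coh_fid_le u om : l2 u -> coh_fid C u om <= sqn u.
Proof.
move=> hu; have [_ _ _] := channel_expectation hC (pc om).1 hu.
by rewrite (pc om).2 sqnorm_coherent mul1r.
Qed.

(** The channel is arbitrary, so measurability in the input state is not evident. Solving
    [squeezed_expectation] for the fidelity, with the arbitrary choice x = 1/2, expresses it through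
    one fixed matrix tested on vectors that depend measurably on the parameters. *)
Lemma meas_coh_fid d (T : measurableType d) (u : T -> nat -> R[i]) (om : T -> R[i]) :
  (forall n, cmeas (measurable_fun [set: T]) (fun t => u t n)) -> (forall t, l2 (u t)) ->
  cmeas (measurable_fun [set: T]) om ->
  measurable_fun [set: T] (fun t => coh_fid C (u t) (om t)).
Proof.
move=> mu lu mo; pose x : R := 2^-1.
have x0 : 0 < x by rewrite invr_gt0.
have x1 : x < 1 by rewrite invf_lt1// ltr1n.
have sx : Num.sqrt x != 0 by rewrite gt_eqF// sqrtr_gt0.
pose z t := ((Num.sqrt x)^-1)%:C * om t.
have mz : cmeas (measurable_fun [set: T]) z by apply: cm_mul => //; exact: cm_cst.
pose V t := tensv (u t) (coherent (conjc (z t))).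
have E t : coh_fid C (u t) (om t) = (1 - x)^-1 * (expR ((1 - x) * sqmod (z t)) *
    complex.Re (Defs.expectation (squeezed_out x C) (V t))).
  rewrite squeezed_expectation//= /z mulrA -rmorphM divff// mul1r -/(z t).
  set y := sqmod (z t); set cf := coh_fid _ _ _.
  have e : expR ((1 - x) * y) * expR (- (1 - x) * y) = 1 by rewrite -expRD mulNr addrN expR0.
  have x10 : 1 - x != 0 by rewrite subr_eq0 gt_eqF.
  transitivity ((1 - x)^-1 * (1 - x) * (expR ((1 - x) * y) * expR (- (1 - x) * y)) * cf).
    by rewrite e mulVf// !mul1r.
  by ring.
under eq_fun do rewrite E.
apply: measurable_funM => //; apply: measurable_funM.
  by apply: meas_exp; apply: measurable_funM => //; exact: cm_sqmod.
have mV p : cmeas (measurable_fun [set: T]) (fun t => V t p).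
  by apply: cm_mul => //; apply: cm_coherent; exact: cm_conj.
apply: (cmeas_dot (@esum_measurable_pair R) mV _).1 => p.
by apply: (cmeas_apply (@esum_measurable_pair R)) => [k l|k]; [exact: cm_cst|exact: mV].
Qed.

End CoherentFidelity.

(** * Displaced thermal states and their images under a channel *)

Section Thermal.
Variables (R : realType) (mu : R) (al : R[i]).
Hypothesis mu0 : 0 < mu.
Local Notation RR := (measurableTypeR R * measurableTypeR R)%type.
Implicit Types (be : R[i]) (phi psi : nat -> R[i]).
Let HP := integral_integration (plane R).

Let v be : nat -> R[i] := coherent (al + be).
Let hv be : l2 (v be) := l2_coherent _.
Let w be : op R nat := opscale (gauss mu be) (ketbra (v be) (v be)).

Let g0 be : 0 <= gauss mu be. Proof. exact: gauss_ge0 (ltW mu0). Qed.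

Let mg : measurable_fun [set: RR] (fun p => gauss mu (toC p)).
Proof. by apply: meas_gauss; exact: cm_toC. Qed.

Let mv n : cmeas (measurable_fun [set: RR]) (fun p => v (toC p) n).
Proof. by apply: cm_coherent; apply: cm_add; [exact: cm_cst|exact: cm_toC]. Qed.

Let wdot be phi psi : l2 phi -> l2 psi -> dot phi (apply (w be) psi) =
  (gauss mu be)%:C * (dot phi (v be) * conjc (dot psi (v be))).
Proof.
move=> hp hq; rewrite dot_opscale//; last exact: bounded_ketbra.
by rewrite (dot_ketbra hp hq (hv be) (hv be)) (dot_conj hq (hv be)).
Qed.

Let wb be : bounded (w be).
Proof. by apply: bounded_opscale; exact: bounded_ketbra. Qed.

Let mdot phi : cmeasC (fun be => dot phi (v be)).
Proof. by apply: (cmeas_dot (@esum_measurable_nat R)) => n; [exact: cm_cst|exact: mv]. Qed.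

Let wm phi psi : l2 phi -> l2 psi -> cmeasC (fun be => dot phi (apply (w be) psi)).
Proof.
move=> hp hq; rewrite /cmeasC; under eq_fun do rewrite wdot//.
apply: cm_mul; first exact: cm_real.
by apply: cm_mul; [exact: mdot|apply: cm_conj; exact: mdot].
Qed.

Let wle phi psi : l2 phi -> l2 psi ->
  (Lint (fun be => (cabs (dot phi (apply (w be) psi)))%:E) <= (1 * nrm phi * nrm psi)%:E)%E.
Proof.
move=> hp hq.
have E : (fun be => (cabs (dot phi (apply (w be) psi)))%:E) =
    (fun be => (gauss mu be * (cabs (dot phi (v be)) * cabs (dot psi (v be))))%:E).
  by apply/funext => be; rewrite wdot// !cabsM cabsC cabs_conj ger0_norm.
rewrite E mul1r; apply: Lint_gauss_bound => //.
- by rewrite mulr_ge0 ?nrm_ge0.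
- move=> be; rewrite mulr_ge0 ?cabs_ge0//=; apply: ler_pM; rewrite ?cabs_ge0//.
    by have := dot_le hp (hv be); rewrite nrm_coherent mulr1.
  by have := dot_le hq (hv be); rewrite nrm_coherent mulr1.
- by apply: measurable_funM; apply: cm_cabs; exact: mdot.
Qed.

Let rho := displaced_thermal mu al.

Let able phi psi : l2 phi -> l2 psi -> cint_able (measurable_fun [set: RR]) (Jint (plane R))
  (fun p => (gauss mu (toC p))%:C * (dot phi (v (toC p)) * conjc (dot psi (v (toC p))))).
Proof.
move=> hp hq; have := weak_form_able wm wle hp hq.
by under eq_fun do rewrite wdot//.
Qed.

Lemma thermal_dot phi psi : l2 phi -> l2 psi -> dot phi (apply rho psi) =
  cint (fun be => (gauss mu be)%:C * (dot phi (v be) * conjc (dot psi (v be)))).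
Proof.
move=> hp hq; rewrite /rho (weak_int_dot wb wm wle)//; congr cint; apply/funext => be.
exact: wdot.
Qed.

Lemma thermal_entry r s : cint_able (measurable_fun [set: RR]) (Jint (plane R))
    (fun p => (gauss mu (toC p))%:C * (v (toC p) r * conjc (v (toC p) s))) /\
  rho r s = cI (Jint (plane R)) (fun p => (gauss mu (toC p))%:C * (v (toC p) r * conjc (v (toC p) s))).
Proof.
have hr := @l2_ebase R nat r; have hs := @l2_ebase R nat s; split.
  by have := able hr hs; under eq_fun do rewrite !dot_ebase.
rewrite -(form_opK rho) /form_op thermal_dot// cintE; congr cI; apply/funext => p.
by rewrite !dot_ebase.
Qed.

Lemma thermal_expectation phi : l2 phi ->
  Lint (fun be => (gauss mu be * sqmod (dot phi (v be)))%:E) \is a fin_num /\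
  Defs.expectation rho phi = (fine (Lint (fun be => (gauss mu be * sqmod (dot phi (v be)))%:E)))%:C.
Proof.
move=> hp; have p0 (p : RR) : 0 <= gauss mu (toC p) * sqmod (dot phi (v (toC p))).
  by rewrite mulr_ge0 ?sqmod_ge0.
have E : (fun p : RR => (gauss mu (toC p))%:C * (dot phi (v (toC p)) * conjc (dot phi (v (toC p))))) =
    (fun p : RR => (gauss mu (toC p) * sqmod (dot phi (v (toC p))))%:C).
  by apply/funext => p; rewrite [X in _ * X]mulrC mulJc -rmorphM.
have ab := able hp hp; rewrite E in ab; split.
  apply: (Jr_fin HP) => //; have := ab.2; rewrite /Jabs.
  by under eq_fun do rewrite cabsC ger0_norm//.
by rewrite /Defs.expectation thermal_dot// cintE E cI_real//; exact: Jint0.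
Qed.

Lemma thermal_psd : psd rho.
Proof.
move=> s c us; rewrite quad_expectation// (thermal_expectation (l2_rst c us)).2 lecR.
by apply: fine_ge0; apply: Lint_ge0 => be; rewrite lee_fin mulr_ge0 ?sqmod_ge0.
Qed.

Lemma thermal_diag i : (complex.Re (rho i i))%:E = Lint (fun be => (gauss mu be * sqmod (v be i))%:E).
Proof.
have hi := @l2_ebase R nat i; have [f1 e1] := thermal_expectation hi.
rewrite -(form_opK rho) -[form_op _ i i]/(Defs.expectation rho (ebase R i)) e1 /= fineK//.
by congr Lint; apply/funext => be; rewrite dot_ebase.
Qed.

(** With unit weights this is the trace; with the weights [hi] it says that the tail of the thermal
    state is the average of the tails of its coherent components. *)
Lemma thermal_trace_weighted (wt : nat -> R) : (forall i, wt i ^+ 2 <= 1) ->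
  trace_sum (weighted wt rho) =
  Lint (fun be => (gauss mu be * fine (trace_sum (weighted wt (ketbra (v be) (v be)))))%:E).
Proof.
move=> w1; have m0 i be : 0 <= gauss mu be * (wt i ^+ 2 * sqmod (v be i)).
  by rewrite mulr_ge0// mulr_ge0 ?sqmod_ge0 ?sqr_ge0.
rewrite weighted_trace.
transitivity (\esum_(i in [set: nat]) Lint (fun be => (gauss mu be * (wt i ^+ 2 * sqmod (v be i)))%:E)).
  apply: eq_esum => i _; rewrite EFinM thermal_diag -Lint_scale ?sqr_ge0//.
  - by congr Lint; apply/funext => be; rewrite mulrCA.
  - by move=> be; rewrite mulr_ge0 ?sqmod_ge0.
  - by apply: measurable_funM => //; apply: cm_sqmod; exact: mv.
rewrite -Lint_esum.
- congr Lint; apply/funext => be; rewrite esum_scale//; last by move=> i; rewrite mulr_ge0 ?sqmod_ge0 ?sqr_ge0.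
  rewrite [RHS]EFinM; congr (_ * _)%E.
  have [ps fi] := (ptcP _).1 (ptc_weighted w1 (ptc_ketbra (hv be)).1).
  rewrite -(psd_trace_fin ps fi) weighted_trace; apply: eq_esum => i _.
  by rewrite /ketbra [X in complex.Re X]mulrC mulJc.
- move=> i; apply/measurable_EFinP; apply: measurable_funM => //.
  by apply: measurable_funM => //; apply: cm_sqmod; exact: mv.
- by move=> i be; rewrite lee_fin.
Qed.

Lemma thermal_trace : trace_sum rho = 1%E.
Proof.
have E (X : op R nat) : weighted (fun=> 1) X = X.
  by apply/funext => i; apply/funext => j; rewrite /weighted mul1r mulr1.
rewrite -(E rho) thermal_trace_weighted; last by move=> i; rewrite expr1n.
rewrite -(Lint_gauss mu0); congr Lint; apply/funext => be.
by rewrite E (ptc_ketbra (hv be)).2 sqnorm_coherent mulr1.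
Qed.

Lemma ptc_thermal : positive_trace_class rho.
Proof. by apply/ptcP; split; [exact: thermal_psd|rewrite thermal_trace ltry]. Qed.

Variable C : op R nat -> op R nat.
Hypothesis hC : channel C.

Let trunc_real r N u : positive_trace_class r -> l2 u ->
  trunc_val C r N u = (complex.Re (trunc_val C r N u))%:C.
Proof.
move=> hr hu; rewrite -(trunc_valE hC)//.
by have [_ -> _ _] := channel_expectation hC (ptc_weighted (lo_sq R N) hr) hu.
Qed.

(** The channel has to be exchanged with the weak integral defining rho. The truncated values do
    commute with the integral. The truncation error of the average and the average of the truncation
    errors obey the same bound, because the tails average as well. *)
Lemma thermal_fidelity u : l2 u ->
  Lint (fun be => (gauss mu be * coh_fid C u (al + be))%:E) \is a fin_num /\
  Defs.expectation (C rho) u = (fine (Lint (fun be => (gauss mu be * coh_fid C u (al + be))%:E)))%:C.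
Proof.
move=> hu; pose h be := coh_fid C u (al + be).
have h0 be : 0 <= h be by exact: coh_fid_ge0.
have mh : measurable_fun [set: RR] (fun p => h (toC p)).
  apply: (meas_coh_fid hC) => //.
  by apply: cm_add; [exact: cm_cst|exact: cm_toC].
have gh0 (p : RR) : 0 <= gauss mu (toC p) * h (toC p) by rewrite mulr_ge0.
have fh : (Lint (fun be => (gauss mu be * h be)%:E) < +oo)%E.
  apply: le_lt_trans (ltry (sqn u)); apply: Lint_gauss_bound => //; first exact: sqn_ge0.
  by move=> be; rewrite h0 coh_fid_le.
have abh : cint_able (measurable_fun [set: RR]) (Jint (plane R)) (fun p => (gauss mu (toC p) * h (toC p))%:C).
  split; first by apply: cm_real; exact: measurable_funM.
  by rewrite /Jabs; under eq_fun do rewrite cabsC ger0_norm//.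
split; first by apply: (Jr_fin HP).
rewrite -[Lint _]/(Jr (Jint (plane R)) (fun p => gauss mu (toC p) * h (toC p))).
rewrite -(cI_real gh0 (Jint0 _)).
have hr := ptc_thermal.
have [bC er _ _] := channel_expectation hC hr hu.
pose tau N := fine (trace_sum (weighted (hi R N) rho)).
pose tb N be := fine (trace_sum (weighted (hi R N) (ketbra (v be) (v be)))).
have ph N := ptc_weighted (hi_sq R N) hr.
have pk N be := ptc_weighted (hi_sq R N) (ptc_ketbra (hv be)).1.
have tau0 N : 0 <= tau N by apply: fine_ge0; exact: psd_trace_ge0 ((ptcP _).1 (ph N)).1.
have tb0 N be : 0 <= tb N be by apply: fine_ge0; exact: psd_trace_ge0 ((ptcP _).1 (pk N be)).1.
have tauE N : Lint (fun be => (gauss mu be * tb N be)%:E) = (tau N)%:E.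
  rewrite -(thermal_trace_weighted (hi_sq R N)).
  by rewrite (psd_trace_fin ((ptcP _).1 (ph N)).1 ((ptcP _).1 (ph N)).2).
have mtb N : measurable_fun [set: RR] (fun p => tb N (toC p)).
  apply: measurableT_comp; first exact: fine_measurable.
  under eq_fun do rewrite weighted_trace.
  apply: (@esum_measurable_nat R) => [i|i p].
    apply/measurable_EFinP; apply: measurable_funM => //.
    by apply: (cm_mul (mv i) (cm_conj (mv i))).1.
  by rewrite lee_fin mulr_ge0 ?sqr_ge0//; exact: psd_diag_ge0 (positive_psd (ptc_ketbra (hv (toC p))).1.1).
pose F N (p : RR) : R[i] := (gauss mu (toC p))%:C * trunc_val C (ketbra (v (toC p)) (v (toC p))) N u.
have FE N : cint_able (measurable_fun [set: RR]) (Jint (plane R)) (F N) /\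
    trunc_val C rho N u = cI (Jint (plane R)) (F N).
  pose f (k : 'I_N * 'I_N) (p : RR) := Defs.expectation (C (matunit R k.1 k.2)) u *
    ((gauss mu (toC p))%:C * (v (toC p) k.1 * conjc (v (toC p) k.2))).
  have fa k : cint_able (measurable_fun [set: RR]) (Jint (plane R)) (f k).
    by apply: (cint_ableZ HP); exact: (thermal_entry k.1 k.2).1.
  have fE : F N = (fun p => \sum_(k : 'I_N * 'I_N) f k p).
    apply/funext => p; rewrite /F /trunc_val mulr_sumr; apply: eq_bigr => k _.
    by rewrite /f /ketbra; ring.
  have [a1 a2] := cint_able_sum HP (index_enum ('I_N * 'I_N)%type) (Jint0 _) fa.
  rewrite fE; split => //; rewrite a2 /trunc_val; apply: eq_bigr => k _.
  rewrite (cIZ HP _ (thermal_entry k.1 k.2).1) mulrC; congr (_ * _).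
  exact: (thermal_entry k.1 k.2).2.
pose G (p : RR) : R[i] := (gauss mu (toC p) * h (toC p))%:C.
(* One copy of the bound for truncating rho, one for truncating the coherent states under the
   integral; hence the factor 2. *)
have main (s : R) N : 0 < s -> cabs (Defs.expectation (C rho) u - cI (Jint (plane R)) G) <=
    2 * sqn u * (1 / s + (s + 1) * tau N).
  move=> s0; have := channel_trunc_le hC N hr hu s0; rewrite -/(tau N) thermal_trace /= => b1.
  have b1' : cabs (Defs.expectation (C rho) u - trunc_val C rho N u) <= sqn u * (1 / s + (s + 1) * tau N).
    by rewrite er trunc_real// -rmorphB cabsC.
  have [aF EF] := FE N.
  have b2 : cabs (trunc_val C rho N u - cI (Jint (plane R)) G) <= sqn u * (1 / s + (s + 1) * tau N).
    have aG := cint_ableZ HP (-1) abh.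
    have -> : trunc_val C rho N u - cI (Jint (plane R)) G = cI (Jint (plane R)) (fun p => F N p + -1 * G p).
      by rewrite (cID HP aF aG) (cIZ HP (-1) abh) mulN1r EF.
    have aFG := cint_ableD HP aF aG.
    apply: le_trans (cI_norm HP aFG) _; rewrite -lee_fin fineK; last first.
      by rewrite ge0_fin_numE ?aFG.2//; apply: (int_ge0 HP) => p; exact: cabs_ge0.
    have s10 : 0 <= s + 1 by rewrite addr_ge0// ltW.
    have i0 : 0 <= 1 / s by rewrite divr_ge0// ltW.
    apply: (@le_trans _ _ (Lint (fun be => (sqn u * (1 / s * gauss mu be + (s + 1) * (gauss mu be * tb N be)))%:E))).
      apply: (Lint_le (f := fun be => cabs ((gauss mu be)%:C *
        trunc_val C (ketbra (v be) (v be)) N u + -1 * (gauss mu be * h be)%:C))).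
      - by move=> be; exact: cabs_ge0.
      - move=> be; have pb := (ptc_ketbra (hv be)).1.
        rewrite (trunc_real _ pb hu) mulN1r -rmorphM -rmorphN -rmorphD /= cabsC.
        have := channel_trunc_le hC N pb hu s0; rewrite -/(tb N be) (ptc_ketbra (hv be)).2 sqnorm_coherent /= => b3.
        rewrite -mulrBr normrM ger0_norm// distrC.
        rewrite [leRHS](_ : _ = gauss mu be * (sqn u * (1 / s + (s + 1) * tb N be))); last by ring.
        by rewrite ler_wpM2l.
      - by apply: cm_cabs; exact: aFG.1.
      - apply: measurable_funM => //; apply: measurable_funD; apply: measurable_funM => //.
        exact: measurable_funM.
    rewrite Lint_scale ?sqn_ge0//; last 2 first.
    - by move=> be; rewrite addr_ge0// mulr_ge0// mulr_ge0.
    - by apply: measurable_funD; apply: measurable_funM => //; exact: measurable_funM.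
    rewrite Lint_add; last 4 first.
    - by move=> be; rewrite mulr_ge0.
    - by move=> be; rewrite mulr_ge0// mulr_ge0.
    - exact: measurable_funM.
    - by apply: measurable_funM => //; exact: measurable_funM.
    rewrite !Lint_scale//; last 2 first.
    - by move=> be; rewrite mulr_ge0.
    - exact: measurable_funM.
    by rewrite Lint_gauss// tauE mule1 -[((s + 1)%:E * _)%E]EFinM -EFinD -EFinM.
  rewrite -[X in cabs X](subrKA (trunc_val C rho N u)).
  apply: le_trans (cabsD _ _) _; lra.
have /eqP : cabs (Defs.expectation (C rho) u - cI (Jint (plane R)) G) = 0.
  apply/eqP; rewrite eq_le cabs_ge0 andbT.
  apply: (@trade_off R (2 * sqn u) 1 _ tau) => //; first by rewrite mulr_ge0 ?sqn_ge0.
  move=> e e0; have fr : (\esum_(i in [set: nat]) (complex.Re (rho i i))%:E < +oo)%E.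
    by rewrite -/(trace_sum rho) thermal_trace ltry.
  have [N0 hN] := esum_tail (fun i => psd_diag_ge0 i thermal_psd) fr e0.
  exists N0; have := hN N0 (leqnn _); rewrite -(ptc_tail N0 thermal_psd).
  by rewrite (psd_trace_fin ((ptcP _).1 (ph N0)).1 ((ptcP _).1 (ph N0)).2) lee_fin.
by move=> /eqP /cabs_eq0 /eqP; rewrite subr_eq0 => /eqP.
Qed.

End Thermal.

(** * The two traces and the fidelity *)

Section NoiseState.
Variables (R : realType) (nu : R) (X : op R (nat * nat)%type).
Hypothesis nu0 : 0 < nu.
Hypothesis hX : positive_trace_class X.
Local Notation RR := (measurableTypeR R * measurableTypeR R)%type.
Implicit Types (phi : nat * nat -> R[i]) (d : R[i]).

Let bX : bounded X := ptc_bounded hX.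

Definition noise_exp phi d : R :=
  complex.Re (Defs.expectation X (apply (displacement_l (- d)) phi)).

Let lD d phi : l2 phi -> l2 (apply (displacement_l d) phi).
Proof. by move=> hp; apply: l2_apply => //; exact: bounded_displacement_l. Qed.

Lemma noise_expE phi d : l2 phi ->
  Defs.expectation X (apply (displacement_l (- d)) phi) = (noise_exp phi d)%:C.
Proof.
move=> hp; have [psX fX] := (ptcP X).1 hX.
by have [_ -> _ _] := ptc_expectation psX fX (lD (- d) hp).
Qed.

Lemma noise_exp_ge0 phi d : l2 phi -> 0 <= noise_exp phi d.
Proof.
move=> hp; have [psX fX] := (ptcP X).1 hX.
by have [_ _ h _] := ptc_expectation psX fX (lD (- d) hp).
Qed.

Lemma meas_noise_exp phi : l2 phi ->
  measurable_fun [set: RR] (fun p => gauss nu (toC p) * noise_exp phi (toC p)).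
Proof.
move=> hp; have [[h _] _] := ampl_noise_able nu0 bX hp hp.
rewrite (_ : (fun p => _) = (fun p : RR => complex.Re ((gauss nu (toC p))%:C *
   dot (apply (displacement_l (- toC p)) phi) (apply X (apply (displacement_l (- toC p)) phi)))))//.
by apply/funext => p; rewrite ReM /= mul0r subr0.
Qed.

Lemma noise_state_expectation phi : l2 phi ->
  Lint (fun d => (gauss nu d * noise_exp phi d)%:E) \is a fin_num /\
  Defs.expectation (ampl (noise nu) X) phi =
  (fine (Lint (fun d => (gauss nu d * noise_exp phi d)%:E)))%:C.
Proof.
move=> hp; apply: ampl_noise_expectation => // d; first exact: noise_exp_ge0.
exact: noise_expE.
Qed.

(** Along X = sum_l |L_l><L_l| the diagonal of the displaced operator sums to sum_l |D(d) L_l|^2, at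
    most the trace of X since D(d) (x) 1 is a contraction; averaging over d keeps this bound. *)
Lemma ptc_ampl_noise : positive_trace_class (ampl (noise nu) X).
Proof.
have [psX fX] := (ptcP X).1 hX.
have g0 d : 0 <= gauss nu d by exact: gauss_ge0 (ltW nu0).
have ge0 phi d : l2 phi -> 0 <= gauss nu d * noise_exp phi d.
  by move=> hp; rewrite mulr_ge0// noise_exp_ge0.
apply/ptcP; split.
  move=> s c us; rewrite quad_expectation// (noise_state_expectation (l2_rst c us)).2 lecR.
  by apply: fine_ge0; apply: Lint_ge0 => d; rewrite lee_fin ge0//; exact: l2_rst.
have [L XE LT] := psd_trace_fam psX (psd_trace_fin psX fX).
set T := fine (trace_sum X) in LT.
have LT' : (\esum_(l in [set: nat]) sqnorm (L l) <= T%:E)%E by rewrite LT.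
have hL l : l2 (L l) := fam_l2 LT' l.
have le p := @l2_ebase R (nat * nat)%type p.
apply: le_lt_trans (ltry T); apply: esum_le_seq => s us.
have dg p : (complex.Re (ampl (noise nu) X p p))%:E =
    Lint (fun d => (gauss nu d * noise_exp (ebase R p) d)%:E).
  have [f1 e1] := noise_state_expectation (le p).
  rewrite -[ampl _ _ p p](congr1 (fun A => A p p) (form_opK (ampl (noise nu) X))).
  by rewrite -[form_op _ p p]/(Defs.expectation _ (ebase R p)) e1 /= fineK.
rewrite -sumEFin; under eq_bigr do rewrite dg.
rewrite -Lint_sum; last 2 first.
- by move=> p d; apply: ge0; exact: le.
- by move=> p; apply: meas_noise_exp; exact: le.
under eq_fun do rewrite -mulr_sumr.
apply: (@le_trans _ _ (Lint (fun d => (T * gauss nu d)%:E))).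
  apply: Lint_le.
  - by move=> d; rewrite mulr_ge0// sumr_ge0// => p _; apply: noise_exp_ge0; exact: le.
  - move=> d; rewrite mulrC ler_wpM2r//.
    have e0 p : 0 <= noise_exp (ebase R p) d by apply: noise_exp_ge0; exact: le.
    rewrite -lee_fin; apply: le_trans (esum_seq_le us e0) _.
    have eq1 p : (noise_exp (ebase R p) d)%:E =
        \esum_(l in [set: nat]) (sqmod (apply (displacement_l d) (L l) p))%:E.
      rewrite /noise_exp (fam_expectation XE LT' (lD (- d) (le p))) /=.
      rewrite sqnK; last exact: (fam_dot_l2 LT' (lD (- d) (le p))).
      apply: eq_esum => l _; congr (_%:E).
      have := dot_adjoint (bounded_displacement_l (- d)) (hL l) (le p).
      by rewrite adjoint_displacement_l opprK => <-; rewrite dot_coef_ebase sqmod_conj.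
    under eq_esum do rewrite eq1.
    rewrite (esum_swap (f := fun q => sqmod (apply (displacement_l d) (L q.2) q.1))); last first.
      by move=> q; exact: sqmod_ge0.
    apply: le_trans LT'; apply: le_esum => l _.
    rewrite -/(sqnorm (apply (displacement_l d) (L l))) -!sqnK//; last exact: lD.
    by rewrite lee_fin -!nrm_sq lerXn2r ?nnegrE ?nrm_ge0//; exact: nrm_displacement_l.
  - under eq_fun do rewrite mulr_sumr.
    by apply: measurable_sum => p; apply: meas_noise_exp; exact: le.
  - by apply: measurable_funM => //; apply: meas_gauss; exact: cm_toC.
have T0 : 0 <= T by apply: fine_ge0; exact: psd_trace_ge0.
rewrite Lint_scale//; last by apply: meas_gauss; exact: cm_toC.
by rewrite Lint_gauss// mule1.
Qed.

End NoiseState.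

Lemma sqmodN (R : realType) (z : R[i]) : sqmod (- z) = sqmod z.
Proof. by rewrite /sqmod ReN ImN !sqrrN. Qed.

Lemma Lint_opp (R : realType) (f : R[i] -> \bar R) : emeasC f -> (forall z, 0 <= f z)%E ->
  Lint (fun z => f (- z)) = Lint f.
Proof.
move=> mf f0; have m1 : (-1 : R) != 0 by rewrite oppr_eq0 oner_eq0.
have := Lint_affine 0 m1 mf f0; rewrite (_ : ((-1) ^+ 2)^-1 = 1); last by rewrite sqrrN expr1n invr1.
rewrite mul1e => <-; congr Lint; apply/funext => z; congr f.
by rewrite addr0 (rmorphN (real_complex R)) mulN1r.
Qed.

Lemma Lint_affine_real (R : realType) (a : R) (b : R[i]) (f : R[i] -> R) : a != 0 ->
  (forall z, 0 <= f z) ->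
  measurable_fun [set: measurableTypeR R * measurableTypeR R] (fun p => f (toC p)) ->
  measurable_fun [set: measurableTypeR R * measurableTypeR R] (fun p => f (a%:C * toC p + b)) ->
  Lint (fun z => (f z)%:E) = Lint (fun z => (a ^+ 2 * f (a%:C * z + b))%:E).
Proof.
move=> a0 f0 mf mfa.
have m : emeasC (fun z => (f z)%:E) by apply/measurable_EFinP.
have f0' z : (0 <= (f z)%:E)%E by rewrite lee_fin.
rewrite Lint_scale ?sqr_ge0// (Lint_affine b a0 m f0') muleA -EFinM.
by rewrite divff ?expf_neq0// mul1e.
Qed.

Lemma expectation_phase (R : realType) (I : choiceType) (X : op R I) (v : I -> R[i]) (t : R[i]) :
  bounded X -> l2 v -> sqmod t = 1 ->
  Defs.expectation X (fun q => t * v q) = Defs.expectation X v.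
Proof.
move=> bX hv ht; rewrite /Defs.expectation.
have -> : apply X (fun q => t * v q) = (fun q => t * apply X v q).
  apply/funext => q; rewrite /apply -csumZ; last by apply: l2_mul => //; exact: bounded_row.
  by congr csum; apply/funext => j; rewrite mulrCA.
by congr csum; apply/funext => q; rewrite conjcM mulrACA mulJc ht mul1r.
Qed.

(** * The two traces as one double integral *)

Section SqueezedTrace.
Variables (R : realType) (x nu g k : R) (C : op R nat -> op R nat).
Hypothesis x0 : 0 < x.
Hypothesis x1 : x < 1.
Hypothesis nu0 : 0 < nu.
Hypothesis hC : channel C.
Local Notation RR := (measurableTypeR R * measurableTypeR R)%type.
Local Notation c := (g * k).
Local Notation X := (squeezed_out x C).
Local Notation Z := (weak_int (Z_integrand g k)).

Lemma sq_ptc : positive_trace_class X.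
Proof. exact: ptc_squeezed_out. Qed.

Lemma sq_gauss_ge0 t : 0 <= gauss nu t.
Proof. exact: gauss_ge0 (ltW nu0). Qed.

Lemma invpi_ge0 : 0 <= pi^-1 :> R.
Proof. by rewrite invr_ge0 pi_ge0. Qed.

Lemma tcoh_l2 z : l2 (tcoh c 0 z). Proof. exact: l2_tcoh. Qed.
Lemma tcoh_meas phi : l2 phi -> cmeasC (fun z => dot phi (tcoh c 0 z)).
Proof. by move=> _; exact: cmC_dot_tcoh. Qed.
Lemma tcoh_bessel phi : l2 phi -> (Lint (fun z => (sqmod (dot phi (tcoh c 0 z)))%:E) <= (pi * sqn phi)%:E)%E.
Proof. exact: bessel_tcoh. Qed.

Lemma Z_integrandE : Z_integrand g k = res_integrand (tcoh c 0).
Proof.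
apply/funext => z; rewrite /Z_integrand /res_integrand tenso_ketbra; congr opscale.
by rewrite /tcoh addr0.
Qed.

Lemma Z_res : Z = weak_int (res_integrand (tcoh c 0)).
Proof. by rewrite Z_integrandE. Qed.

Lemma Z_weakly_integrable : weakly_integrable (Z_integrand g k).
Proof. by rewrite Z_integrandE; exact: (res_weakly_integrable tcoh_l2 tcoh_meas tcoh_bessel). Qed.

Lemma Z_observable : observable Z.
Proof. by rewrite Z_res; exact: (res_observable tcoh_l2 tcoh_meas tcoh_bessel). Qed.

(* <v|X|v> for v = |b> (x) |conj z> *)
Definition sq_exp (b z : R[i]) : R := (1 - x) * expR (- (1 - x) * sqmod z) *
  coh_fid C (coherent b) ((Num.sqrt x)%:C * z).

Lemma sq_exp_ge0 b z : 0 <= sq_exp b z.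
Proof.
rewrite /sq_exp mulr_ge0//; last by apply: coh_fid_ge0 => //; exact: l2_coherent.
by rewrite mulr_ge0 ?expR_ge0// subr_ge0 ltW.
Qed.

Lemma sq_expE d z : Defs.expectation X (tcoh c d z) = (sq_exp (c%:C * z + d) z)%:C.
Proof. by rewrite /tcoh squeezed_expectation//; exact: l2_coherent. Qed.

Lemma meas_sq_exp d (T : measurableType d) (b z : T -> R[i]) :
  cmeas (measurable_fun [set: T]) b -> cmeas (measurable_fun [set: T]) z ->
  measurable_fun [set: T] (fun t => sq_exp (b t) (z t)).
Proof.
move=> mb mz; apply: measurable_funM.
  apply: measurable_funM => //; apply: meas_exp; apply: measurable_funM => //.
  exact: cm_sqmod.
apply: (meas_coh_fid hC) => [n|t|]; [exact: cm_coherent|exact: l2_coherent|].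
by apply: cm_mul => //; exact: cm_cst.
Qed.

(** The common integrand of the two traces: d is the noise and z the label of the product vectors of
    Z. *)
Definition sq_int (d z : R[i]) : R := gauss nu d * (pi^-1 * sq_exp (c%:C * z + d) z).

Lemma sq_int_ge0 d z : 0 <= sq_int d z.
Proof. by rewrite mulr_ge0 ?sq_gauss_ge0// mulr_ge0 ?invpi_ge0 ?sq_exp_ge0. Qed.

Definition sq_total : \bar R := Lint (fun z => Lint (fun d => (sq_int d z)%:E)).

Lemma meas_sq_int : measurable_fun [set: (RR * RR)%type] (fun t => (sq_int (toC t.1) (toC t.2))%:E).
Proof.
apply/measurable_EFinP; apply: measurable_funM; first by apply: meas_gauss; exact: cm_toC1.
apply: measurable_funM => //; apply: meas_sq_exp; last exact: cm_toC2.
by apply: cm_add; [apply: cm_mul; [exact: cm_cst|exact: cm_toC2]|exact: cm_toC1].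
Qed.

Lemma meas_sq_int1 z : measurable_fun [set: RR] (fun t => sq_int (toC t) z).
Proof.
apply: measurable_funM; first by apply: meas_gauss; exact: cm_toC.
apply: measurable_funM => //; apply: meas_sq_exp; last exact: cm_cst.
by apply: cm_add; [exact: cm_cst|exact: cm_toC].
Qed.

(** Noise on the state displaces the vectors of Z by D(d)^dagger = D(-d), giving g k z - d in place
    of g k z + d; the Gaussian is even, so d may be replaced by - d. *)
Lemma trace_Z_noise : tr (opmul Z (ampl (noise nu \o C)
  (ketbra (two_mode_squeezed x) (two_mode_squeezed x)))) = (fine sq_total)%:C.
Proof.
rewrite (_ : ampl (noise nu \o C) _ = ampl (noise nu) X)//.
have sq_ptc' := ptc_ampl_noise nu0 sq_ptc; have [ps f] := (ptcP _).1 sq_ptc'.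
have [L XE LT] := psd_trace_fam ps (psd_trace_fin ps f).
have LT' : (\esum_(l in [set: nat]) sqnorm (L l) <= (fine (trace_sum (ampl (noise nu) X)))%:E)%E by rewrite LT.
rewrite Z_res (res_trace tcoh_l2 tcoh_meas tcoh_bessel XE LT'); congr ((fine _)%:C).
congr Lint; apply/funext => z.
have [f1 ->] := noise_state_expectation nu0 sq_ptc (tcoh_l2 z); rewrite /= EFinM fineK//.
have eE d : noise_exp X (tcoh c 0 z) d = sq_exp (c%:C * z - d) z.
  rewrite /noise_exp displacement_tcoh expectation_phase; [by rewrite sq_expE|exact: ptc_bounded sq_ptc|exact: l2_tcoh|exact: sqmod_theta].
under eq_fun do rewrite eE.
have m1 : measurable_fun [set: RR] (fun t => gauss nu (toC t) * sq_exp (c%:C * z - toC t) z).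
  apply: measurable_funM; first by apply: meas_gauss; exact: cm_toC.
  apply: meas_sq_exp; last exact: cm_cst.
  apply: cm_add; first exact: cm_cst.
  by under eq_fun do rewrite -mulN1r; apply: cm_mul; [exact: cm_cst|exact: cm_toC].
have h0 d : 0 <= gauss nu d * sq_exp (c%:C * z - d) z by rewrite mulr_ge0 ?sq_gauss_ge0 ?sq_exp_ge0.
have := Lint_scale (f := fun d => gauss nu d * sq_exp (c%:C * z - d) z) invpi_ge0 h0 m1.
move=> <-.
have mq : emeasC (fun d => (sq_int d z)%:E).
  by apply/measurable_EFinP; exact: meas_sq_int1.
have hq d : (0 <= (sq_int d z)%:E)%E by rewrite lee_fin sq_int_ge0.
apply: etrans _ (Lint_opp mq hq).
congr Lint; apply/funext => d; rewrite /sq_int mulrCA; congr ((_ * _)%:E).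
by rewrite /gauss sqmodN.
Qed.

(** Here the noise sits on Z and puts D(-d) on the vectors L_l; moved to the other side of the
    scalar product it becomes D(d) on the vectors of Z, whose phase drops out of the square modulus.
    The sum over l and the integrals over d and z have nonnegative terms and commute. *)
Lemma trace_O : tr (opmul (ampl (noise nu) Z) X) = (fine sq_total)%:C.
Proof.
have [ps f] := (ptcP _).1 sq_ptc; have [L XE LT] := psd_trace_fam ps (psd_trace_fin ps f).
have LT' : (\esum_(l in [set: nat]) sqnorm (L l) <= (fine (trace_sum X))%:E)%E by rewrite LT.
have hL l : l2 (L l) := fam_l2 LT' l.
have bZ : bounded Z by case: Z_observable.
have [_ ->] := fam_trace XE LT' (bounded_ampl_noise nu0 bZ).
pose r l d z : R := pi^-1 * sqmod (dot (L l) (tcoh c d z)).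
have r0 l d z : 0 <= r l d z by rewrite mulr_ge0 ?invpi_ge0 ?sqmod_ge0.
have gn0 := sq_gauss_ge0.
pose e l d := fine (Lint (fun z => (r l d z)%:E)).
have e0 l d : 0 <= e l d by apply: fine_ge0; apply: Lint_ge0 => z; rewrite lee_fin.
have eP l d : Lint (fun z => (r l d z)%:E) \is a fin_num /\
    Defs.expectation Z (apply (displacement_l (- d)) (L l)) = (e l d)%:C.
  have hD : l2 (apply (displacement_l (- d)) (L l)).
    by apply: l2_apply => //; exact: bounded_displacement_l.
  have [f1 e1] := res_expectation tcoh_l2 tcoh_meas tcoh_bessel hD.
  have E : (fun z => (pi^-1 * sqmod (dot (apply (displacement_l (- d)) (L l)) (tcoh c 0 z)))%:E) =
      (fun z => (r l d z)%:E).
    apply/funext => z; have := dot_adjoint (bounded_displacement_l d) (hL l) (tcoh_l2 z).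
    rewrite adjoint_displacement_l => ->.
    by rewrite displacement_tcoh (dot_Zr _ (hL l) (l2_tcoh c d z)) sqmodM sqmod_theta mul1r.
  split; first by rewrite -E.
  rewrite Z_res; apply: etrans e1 _; rewrite /e.
  exact: (congr1 (fun u => (fine (Lint u))%:C) E).
have nE l := ampl_noise_expectation nu0 bZ (hL l) (e0 l) (fun d => (eP l d).2).
have mr l : measurable_fun [set: (RR * RR)%type] (fun t => r l (toC t.1) (toC t.2)).
  apply: measurable_funM => //; apply: cm_sqmod.
  apply: (cmeas_dot (@esum_measurable_pair R)) => n; first exact: cm_cst.
  apply: cm_mul; apply: cm_coherent; last by apply: cm_conj; exact: cm_toC2.
  by apply: cm_add; [apply: cm_mul; [exact: cm_cst|exact: cm_toC2]|exact: cm_toC1].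
have mr1 l d : measurable_fun [set: RR] (fun t => r l d (toC t)).
  by apply: measurable_funM => //; apply: cm_sqmod; exact: cmC_dot_tcoh.
have mgr l : measurable_fun [set: (RR * RR)%type] (fun t => (gauss nu (toC t.1) * r l (toC t.1) (toC t.2))%:E).
  by apply/measurable_EFinP; apply: measurable_funM => //; apply: meas_gauss; exact: cm_toC1.
have gr0 l d z : (0 <= (gauss nu d * r l d z)%:E)%E by rewrite lee_fin mulr_ge0.
have IE l : Lint (fun d => (gauss nu d * e l d)%:E) =
    Lint (fun d => Lint (fun z => (gauss nu d * r l d z)%:E)).
  congr Lint; apply/funext => d.
  have := Lint_scale (f := r l d) (gn0 d) (r0 l d) (mr1 l d) => ->.
  by rewrite EFinM /e fineK//; exact: (eP l d).1.
transitivity (csum (fun l => (fine (Lint (fun d => (gauss nu d * e l d)%:E)))%:C)).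
  by congr csum; apply/funext => l; exact: (nE l).2.
rewrite csum_real; last first.
  by move=> l; apply: fine_ge0; apply: Lint_ge0 => d; rewrite lee_fin mulr_ge0.
congr ((fine _)%:C).
transitivity (\esum_(l in [set: nat]) Lint (fun d => Lint (fun z => (gauss nu d * r l d z)%:E))).
  by apply: eq_esum => l _; rewrite (fineK (nE l).1); exact: IE.
rewrite -Lint_esum; last 2 first.
- by move=> l; exact: Lint_meas (mgr l) (gr0 l).
- by move=> l d; exact: Lint_ge0 (gr0 l d).
transitivity (Lint (fun d => Lint (fun z => (sq_int d z)%:E))); last first.
  have hsq d z : (0 <= (sq_int d z)%:E)%E by rewrite lee_fin; exact: sq_int_ge0.
  exact: (Lint_swap (F := fun d z => (sq_int d z)%:E) meas_sq_int hsq).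
congr Lint; apply/funext => d; rewrite -Lint_esum; last 2 first.
- by move=> l; apply/measurable_EFinP; apply: measurable_funM => //; exact: mr1.
- by move=> l z; exact: gr0.
congr Lint; apply/funext => z; rewrite (esum_scale (gn0 d) (fun l => r0 l d z)).
rewrite /sq_int [RHS]EFinM; congr (_ * _)%E.
rewrite /r esum_scale ?invpi_ge0//; last by move=> l; exact: sqmod_ge0.
rewrite [RHS]EFinM; congr (_ * _)%E.
have := fam_expectation XE LT' (l2_tcoh c d z); rewrite sq_expE => /complexI ->.
by rewrite sqnK//; exact: (fam_dot_l2 LT' (l2_tcoh c d z)).
Qed.

End SqueezedTrace.

Lemma Lint_rescale (R : realType) (x : R) (f : R[i] -> R) : 0 < x -> (forall z, 0 <= f z) ->
  measurable_fun [set: measurableTypeR R * measurableTypeR R]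
    (fun p => f ((Num.sqrt x)^-1%:C * toC p)) ->
  Lint (fun z => (f z)%:E) = Lint (fun z => (x^-1 * f ((Num.sqrt x)^-1%:C * z))%:E).
Proof.
move=> x0 f0 mf; have s0 : Num.sqrt x != 0 by rewrite gt_eqF// sqrtr_gt0.
have m : emeasC (fun z => (f ((Num.sqrt x)^-1%:C * z))%:E) by apply/measurable_EFinP.
have h z : (0 <= (f ((Num.sqrt x)^-1%:C * z))%:E)%E by rewrite lee_fin.
rewrite (Lint_scale (f := fun z => f _)) ?invr_ge0 ?(ltW x0)//.
have := Lint_affine 0 s0 m h; rewrite sqr_sqrtr ?(ltW x0)// => <-.
by congr Lint; apply/funext => z; rewrite addr0 mulrA -rmorphM mulVf// mul1r.
Qed.

Lemma density_translate (R : realType) (al : R[i]) (u h : R[i] -> R) :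
  emeasC (fun om => (u (om - al) * h om)%:E) ->
  (forall om, 0 <= (u (om - al) * h om)%:E)%E ->
  Lint (fun be => (u be * h (al + be))%:E) = Lint (fun om => (u (om - al) * h om)%:E).
Proof.
move=> mf f0; rewrite -(Lint_translate al mf f0).
by apply: (congr1 (@Lint R)); apply/funext => be; rewrite addrK addrC.
Qed.

(** * The average fidelity and the comparison of densities *)

Section Fidelity.
Variables (R : realType) (lambda mu g : R).
Hypothesis lambda0 : 0 < lambda.
Hypothesis mu0 : 0 < mu.
Variable C : op R nat -> op R nat.
Hypothesis hC : channel C.
Local Notation RR := (measurableTypeR R * measurableTypeR R)%type.

(* the joint density of alpha and omega = alpha + beta, times the fidelity *)
Definition fid_int (al om : R[i]) : R :=
  gauss lambda al * (gauss mu (om - al) * coh_fid C (coherent (g%:C * al)) om).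

Lemma cm_sub d (T : measurableType d) (a b : T -> R[i]) :
  cmeas (measurable_fun [set: T]) a -> cmeas (measurable_fun [set: T]) b ->
  cmeas (measurable_fun [set: T]) (fun t => a t - b t).
Proof.
move=> ma mb; apply: cm_add => //; under eq_fun do rewrite -mulN1r.
by apply: cm_mul => //; exact: cm_cst.
Qed.

Lemma meas_fid_tail d (T : measurableType d) (a w : T -> R[i]) :
  cmeas (measurable_fun [set: T]) a -> cmeas (measurable_fun [set: T]) w ->
  measurable_fun [set: T] (fun t => gauss mu (w t - a t) * coh_fid C (coherent (g%:C * a t)) (w t)).
Proof.
move=> ma mw; apply: measurable_funM; first by apply: meas_gauss; exact: cm_sub.
apply: (meas_coh_fid hC) => [n|t|//]; last exact: l2_coherent.
by apply: cm_coherent; apply: cm_mul => //; exact: cm_cst.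
Qed.

(** The thermal average over beta is translated by alpha, so that the coherent input omega = alpha +
    beta becomes the variable of integration. *)
Lemma average_fidelityE : average_fidelity lambda mu g C =
  (fine (Lint (fun al => Lint (fun om => (fid_int al om)%:E))))%:C.
Proof.
pose J al := Lint (fun om => (gauss mu (om - al) * coh_fid C (coherent (g%:C * al)) om)%:E).
have t0 al om : 0 <= gauss mu (om - al) * coh_fid C (coherent (g%:C * al)) om.
  by rewrite mulr_ge0 ?gauss_ge0 ?(ltW mu0) ?coh_fid_ge0//; exact: l2_coherent.
have mt al : measurable_fun [set: RR] (fun p => gauss mu (toC p - al) * coh_fid C (coherent (g%:C * al)) (toC p)).
  by apply: meas_fid_tail; [exact: cm_cst|exact: cm_toC].
have JP al : J al \is a fin_num /\
    Defs.expectation (C (displaced_thermal mu al)) (coherent (g%:C * al)) = (fine (J al))%:C.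
  have [f1 e1] := thermal_fidelity al mu0 hC (l2_coherent (g%:C * al)).
  have E : Lint (fun be => (gauss mu be * coh_fid C (coherent (g%:C * al)) (al + be))%:E) = J al.
    have mq : emeasC (fun om => (gauss mu (om - al) * coh_fid C (coherent (g%:C * al)) om)%:E).
      by apply/measurable_EFinP; exact: mt.
    have hq om : (0 <= (gauss mu (om - al) * coh_fid C (coherent (g%:C * al)) om)%:E)%E.
      by rewrite lee_fin.
    exact: (@density_translate R al (gauss mu) (fun om => coh_fid C (coherent (g%:C * al)) om) mq hq).
  by move: f1 e1; move: (Lint _) E => L ->.
have F0 al : 0 <= gauss lambda al * fine (J al).
  rewrite mulr_ge0 ?gauss_ge0 ?(ltW lambda0)//; apply: fine_ge0.
  by apply: Lint_ge0 => om; rewrite lee_fin.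
rewrite /average_fidelity.
have -> : (fun al => (gauss lambda al)%:C * Defs.expectation (C (displaced_thermal mu al)) (coherent (g%:C * al))) =
    (fun al => (gauss lambda al * fine (J al))%:C).
  by apply/funext => al; rewrite (JP al).2 -rmorphM.
have G0 (p : RR) : 0 <= gauss lambda (toC p) * fine (J (toC p)) by exact: F0.
rewrite cintE (cI_real G0 (Jint0 _)); congr ((fine _)%:C).
rewrite -[LHS]/(Lint (fun al => (gauss lambda al * fine (J al))%:E)).
congr Lint; apply/funext => al; rewrite EFinM fineK; last exact: (JP al).1.
by rewrite /J -Lint_scale ?gauss_ge0 ?(ltW lambda0).
Qed.

Hypothesis g0 : 0 < g.

Let p : R := lambda + mu.
Let x : R := p / (p + lambda * mu).
Let k : R := mu * Num.sqrt x / p.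
Let nu : R := p / g ^+ 2.

Lemma squeezing_params : [/\ 0 < x, x < 1 & 0 < nu].
Proof.
have p0 : 0 < p by rewrite addr_gt0.
have pl0 : 0 < p + lambda * mu by rewrite addr_gt0// mulr_gt0.
split; [by rewrite divr_gt0| |by rewrite divr_gt0// exprn_gt0].
by rewrite ltr_pdivrMr// mul1r ltrDl mulr_gt0.
Qed.

Let ReZ (a : R) (z : R[i]) : complex.Re (a%:C * z) = a * complex.Re z.
Proof. by rewrite ReM /= mul0r subr0. Qed.

Let ImZ (a : R) (z : R[i]) : complex.Im (a%:C * z) = a * complex.Im z.
Proof. by rewrite ImM /= mul0r addr0. Qed.

(* completing the square in alpha *)
Lemma density_match (al om : R[i]) (h : R) :
  x^-1 * (g ^+ 2 * (gauss nu (g%:C * al - (g * k)%:C * ((Num.sqrt x)^-1%:C * om)) *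
    (pi^-1 * ((1 - x) * expR (- (1 - x) * sqmod ((Num.sqrt x)^-1%:C * om)) * h)))) =
  gauss lambda al * (gauss mu (om - al) * h).
Proof.
have [x0 x1 nu0] := squeezing_params.
have s0 : Num.sqrt x != 0 by rewrite gt_eqF// sqrtr_gt0.
have p0 : lambda + mu != 0 by rewrite gt_eqF// addr_gt0.
have pl0 : lambda + mu + lambda * mu != 0 by rewrite gt_eqF// addr_gt0 ?mulr_gt0 ?addr_gt0.
have gn0 : g != 0 by rewrite gt_eqF.
have pi0 : pi != 0 :> R by rewrite gt_eqF// pi_gt0.
have S2 : sqmod ((Num.sqrt x)^-1%:C * om) = sqmod om / x.
  by rewrite sqmodM sqmodC exprVn sqr_sqrtr 1?mulrC// ltW.
have S1 : sqmod (g%:C * al - (g * k)%:C * ((Num.sqrt x)^-1%:C * om)) =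
    g ^+ 2 * ((complex.Re al - mu / p * complex.Re om) ^+ 2 + (complex.Im al - mu / p * complex.Im om) ^+ 2).
  rewrite mulrA -rmorphM /sqmod !(ReD, ReN, ImD, ImN) !(ReZ, ImZ).
  have -> : g * k / Num.sqrt x = g * (mu / p) by rewrite /k; field; rewrite s0 p0.
  by ring.
rewrite /gauss S1 S2.
have E : expR (- nu * (g ^+ 2 * ((complex.Re al - mu / p * complex.Re om) ^+ 2 + (complex.Im al - mu / p * complex.Im om) ^+ 2))) *
    expR (- (1 - x) * (sqmod om / x)) = expR (- lambda * sqmod al) * expR (- mu * sqmod (om - al)).
  rewrite -!expRD; congr expR; rewrite /sqmod !(ReD, ReN, ImD, ImN) /nu /x /p.
  move: (complex.Re al) (complex.Im al) (complex.Re om) (complex.Im om) => a b d e.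
  by field; rewrite ?gn0 ?p0 ?pl0.
set e1 := expR (- nu * _) in E *; set e2 := expR (- (1 - x) * _) in E *.
set e3 := expR (- lambda * _) in E *; set e4 := expR (- mu * _) in E *.
(* The normalizations: the Jacobians g^2 and 1 / x turn nu (1 - x) into lambda mu. *)
have N : x^-1 * g ^+ 2 * nu * (1 - x) = lambda * mu.
  by rewrite /nu /x /p; field; rewrite ?gn0 ?p0 ?pl0.
transitivity (x^-1 * g ^+ 2 * nu * (1 - x) * (e1 * e2) * h / pi / pi); first by ring.
by rewrite N E; ring.
Qed.

Lemma sq_total_match : sq_total x nu g k C =
  Lint (fun al => Lint (fun om => (fid_int al om)%:E)).
Proof.
have [x0 x1 nu0] := squeezing_params.
have s0 : Num.sqrt x != 0 by rewrite gt_eqF// sqrtr_gt0.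
have g20 : 0 <= g ^+ 2 by exact: sqr_ge0.
have gn0 : g != 0 by rewrite gt_eqF.
(* The affine map is taken in two real dilations with translations: d = g alpha - g k z at fixed z,
   with Jacobian g^2, then, after exchanging the integrals, z = omega / sqrt x at fixed alpha, with
   Jacobian 1 / x. *)
pose r (al z : R[i]) : R := g ^+ 2 * sq_int x nu g k C (g%:C * al - (g * k)%:C * z) z.
have r0 al z : 0 <= r al z by rewrite mulr_ge0 ?sq_int_ge0.
have m1 z : emeasC (fun d => (sq_int x nu g k C d z)%:E).
  by apply/measurable_EFinP; exact: meas_sq_int1.
have E1 z : Lint (fun d => (sq_int x nu g k C d z)%:E) = Lint (fun al => (r al z)%:E).
  apply: (@Lint_affine_real R g (- ((g * k)%:C * z)) (fun d => sq_int x nu g k C d z) gn0).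
  - by move=> d; exact: sq_int_ge0.
  - exact: meas_sq_int1.
  apply: measurable_funM.
    apply: meas_gauss; apply: cm_sub; last exact: cm_cst.
    by apply: cm_mul; [exact: cm_cst|exact: cm_toC].
  apply: measurable_funM => //; apply: meas_sq_exp => //.
  apply: cm_add; first exact: cm_cst.
  apply: cm_sub; last exact: cm_cst.
  by apply: cm_mul; [exact: cm_cst|exact: cm_toC].
have mr d (T : measurableType d) (a z : T -> R[i]) :
    cmeas (measurable_fun [set: T]) a -> cmeas (measurable_fun [set: T]) z ->
    measurable_fun [set: T] (fun t => r (a t) (z t)).
  move=> ma mz; have mc (b : R) (u : T -> R[i]) : cmeas (measurable_fun [set: T]) u ->
      cmeas (measurable_fun [set: T]) (fun t => b%:C * u t).
    by move=> mu'; apply: cm_mul => //; exact: cm_cst.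
  apply: measurable_funM => //; apply: measurable_funM.
    by apply: meas_gauss; apply: cm_sub; exact: mc.
  apply: measurable_funM => //; apply: meas_sq_exp => //.
  by apply: cm_add; [exact: mc|apply: cm_sub; exact: mc].
rewrite /sq_total; under eq_fun do rewrite E1.
have mrz : measurable_fun [set: (RR * RR)%type] (fun t => (r (toC t.2) (toC t.1))%:E).
  by apply/measurable_EFinP; apply: mr; [exact: cm_toC2|exact: cm_toC1].
have hrz z al : (0 <= (r al z)%:E)%E by rewrite lee_fin.
rewrite (Lint_swap (F := fun z al => (r al z)%:E) mrz hrz).
congr Lint; apply/funext => al.
have mr' : measurable_fun [set: RR] (fun t => r al ((Num.sqrt x)^-1%:C * toC t)).
  by apply: mr; [exact: cm_cst|apply: cm_mul; [exact: cm_cst|exact: cm_toC]].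
have r'0 om : 0 <= r al om by exact: r0.
apply: etrans (Lint_rescale x0 r'0 mr') _.
apply: (congr1 (@Lint R)); apply/funext => om; congr (_%:E).
rewrite /r /sq_int /sq_exp /fid_int -density_match.
set z := (Num.sqrt x)^-1%:C * om.
have -> : (g * k)%:C * z + (g%:C * al - (g * k)%:C * z) = g%:C * al.
  by rewrite addrC subrK.
have -> : (Num.sqrt x)%:C * z = om.
  by rewrite /z mulrA -rmorphM divff// mul1r.
by [].
Qed.

End Fidelity.

Theorem mainTheorem5 (R : realType) (lambda mu g : R)
    (hlambda : 0 < lambda) (hmu : 0 < mu) (hg : 0 < g)
    (C : op R nat -> op R nat) (hC : channel C) :
  let x := (lambda + mu) / (lambda + mu + lambda * mu) in
  let k := mu * Num.sqrt x / (lambda + mu) in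
  let nu := (lambda + mu) / g ^+ 2 in
  let Psi := ketbra (two_mode_squeezed x) (two_mode_squeezed x) in
  let Z := weak_int (Z_integrand g k) in
  let O := ampl (noise nu) Z in
  let F := average_fidelity lambda mu g C in
  [/\ weakly_integrable (Z_integrand g k), observable Z,
      F = tr (opmul O (ampl C Psi)) &
      F = tr (opmul Z (ampl (noise nu \o C) Psi))].
Proof.
move=> x k nu Psi Z O F.
have [x0 x1 nu0] := squeezing_params hlambda hmu hg.
have E : F = (fine (sq_total x nu g k C))%:C.
  apply: etrans (average_fidelityE g hlambda hmu hC) _; congr ((fine _)%:C).
  exact: esym (sq_total_match hlambda hmu hC hg).
split.
- exact: Z_weakly_integrable.
- exact: Z_observable.
- by rewrite E -(trace_O g k x0 x1 nu0 hC).
- by rewrite E -(trace_Z_noise g k x0 x1 nu0 hC).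
Qed.
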